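(* Let $X_{11},\dots,X_{1n_1}$ and $X_{21},\dots,X_{2n_2}$ be two independent random samples from densities $g_1$ and $g_2$ satisfying the density ratio model $g_1(x)=\exp(\alpha_0+\beta_0'h(x))\,g_2(x)$ with true parameter $\theta_0=(\alpha_0,\beta_0')'$ lying in a compact set, and assume that the matrix $A$ (defined in the context) is nonsingular. Let the penalty function be $J(\beta)=\sum_{j=1}^{d}|\beta_j|^q$ with $q>1$, and suppose that the regularization parameters $\lambda_n>0$ satisfy $\lambda_n/\sqrt{n}\to\lambda_0\ge 0$, where $n=n_1+n_2\to\infty$ in such a way that $n_1/n_2\to\rho_1\in(0,\infty)$. Then the unique maximizer $\hat\theta^\lambda$ of the penalized empirical log-likelihood $l_p(\theta)=l(\theta)-\lambda_nJ(\beta)$ satisfies $$\sqrt{n}\,(\hat\theta^\lambda-\theta_0)+\lambda_0S^{-1}b\;\to\;\mathcal{N}_{d+1}(0,\Sigma)$$ in distribution as $n\to\infty$, where $\Sigma=S^{-1}VS^{-1}$ and $S$, $V$, $b$ are defined in the context. In particular, if $\lambda_0=0$, then $\sqrt{n}\,(\hat\theta^\lambda-\theta_0)\to\mathcal{N}_{d+1}(0,\Sigma)$ in distribution.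
   Context: Density ratio model: $g_1,g_2$ are unknown probability densities on $\mathbb{R}$ with cumulative distribution functions $G_1,G_2$; $h:\mathbb{R}\to\mathbb{R}^d$ is a known function; $\alpha\in\mathbb{R}$, $\beta=(\beta_1,\dots,\beta_d)'\in\mathbb{R}^d$, and $\theta=(\alpha,\beta')'\in\mathbb{R}^{d+1}$. A prime denotes transpose. $\theta_0=(\alpha_0,\beta_0')'$ denotes the true value of $\theta$. Empirical log-likelihood (profiled over $G_2$), where $x_{ij}$ are the observed values of $X_{ij}$: $$l(\theta)=-\sum_{i=1}^{2}\sum_{j=1}^{n_i}\log\Big[1+\tfrac{n_1}{n_2}\exp(\alpha+\beta'h(x_{ij}))\Big]+\sum_{j=1}^{n_1}(\alpha+\beta'h(x_{1j})).$$ Penalized empirical log-likelihood: $l_p(\theta)=l(\theta)-\lambda_nJ(\beta)$, a function of $\theta\in\mathbb{R}^{d+1}$ (the intercept $\alpha$ is not penalized). Matrices: with $\rho_1=\lim n_1/n_2$ and $w(x)=\dfrac{\exp(\alpha_0+\beta_0'h(x))}{1+\rho_1\exp(\alpha_0+\beta_0'h(x))}$, put $$A_{11}=\int_{-\infty}^{\infty}w\,dG_2,\qquad A_{21}=\int_{-\infty}^{\infty}w\,h\,dG_2\in\mathbb{R}^d,\qquad A_{22}=\int_{-\infty}^{\infty}w\,hh'\,dG_2,$$ $$A=\begin{pmatrix} A_{11} & A_{21}' \\ A_{21} & A_{22} \end{pmatrix},\qquad S=\frac{\rho_1}{1+\rho_1}A,\qquad V=\frac{\rho_1}{1+\rho_1}A-\rho_1\begin{pmatrix}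 A_{11} \\ A_{21} \end{pmatrix}\begin{pmatrix} A_{11} & A_{21}' \end{pmatrix},$$ where these integrals are assumed to be finite. The vector $b\in\mathbb{R}^{d+1}$ is the gradient of $J$ with respect to $\theta$ at the true parameter: writing $\beta_0=(\beta_{0,1},\dots,\beta_{0,d})'$, $$b=\big(0,\ \mathrm{sign}(\beta_{0,1})\,q|\beta_{0,1}|^{q-1},\dots,\mathrm{sign}(\beta_{0,d})\,q|\beta_{0,d}|^{q-1}\big)'.$$
   Formalization: The integrals defining A, and the integral of (1-rho_1 w)hh' against dG_1, are assumed finite for every theta in a compact set having theta_0 in its interior, not only at theta_0; with finiteness at theta_0 alone the claim fails for some heavy-tailed g_2. h is taken Borel measurable. *)

(* Defs.v *)
From HB Require Import structures.
From mathcomp Require Import all_boot all_order all_algebra.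
From mathcomp Require Import all_classical all_reals all_analysis.

Set Implicit Arguments.
Unset Strict Implicit.
Unset Printing Implicit Defensive.

Import Order.TTheory GRing.Theory Num.Theory.
Import numFieldNormedType.Exports.

Local Open Scope classical_set_scope.
Local Open Scope ring_scope.

(* R^m as column vectors, with its Borel sigma-algebra. *)
Definition borelV (R : realType) (m : nat) :=
  g_sigma_algebraType (@open 'cV[R]_m).

Definition mutually_independent d (T : measurableType d) (R : realType)
    (P : probability T R) (I : eqType) (X : I -> T -> R) : Prop :=
  forall (s : seq I) (B : I -> set R),
    uniq s -> (forall i, measurable (B i)) ->
    P (\bigcap_(i in [set` s]) (X i @^-1` B i)) =
      (\prod_(i <- s) P (X i @^-1` B i))%E.

Definition is_density (R : realType) (g : R -> R) : Prop :=
  [/\ measurable_fun [set: R] g,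
      (forall x, 0 <= g x) &
      (\int[lebesgue_measure]_x (g x)%:E = 1)%E].

Definition has_density d (T : measurableType d) (R : realType)
    (P : probability T R) (X : {RV P >-> R}) (g : R -> R) : Prop :=
  forall B : set R, measurable B ->
    distribution P X B = (\int[lebesgue_measure]_(x in B) (g x)%:E)%E.

(* The zero-variance case is a point mass; it has to be singled out because
   [normal_prob m 0] is, by convention, the uniform law on [0, 1]. *)
Definition normal_law (R : realType) (m v : R) (B : set R) : \bar R :=
  if v == 0 then \d_m B else normal_prob m (Num.sqrt v) B.

(* Q = N_m(mu, Sigma), Sigma possibly singular: every linear form t'x has law
   N(t' mu, t' Sigma t) under Q. *)
Definition is_multinormal (R : realType) (m : nat)
    (Q : probability (borelV R m) R) (mu : 'cV[R]_m) (Sigma : 'M[R]_m) : Prop :=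
  forall (t : 'cV[R]_m) (B : set R), measurable B ->
    Q [set x : 'cV[R]_m | B ((t^T *m x) 0 0)] =
      normal_law ((t^T *m mu) 0 0) ((t^T *m Sigma *m t) 0 0) B.

Definition cvg_in_law d (T : measurableType d) (R : realType)
    (P : probability T R) (m : nat) (Y : nat -> T -> 'cV[R]_m)
    (Q : probability (borelV R m) R) : Prop :=
  (forall k, measurable_fun [set: T] (Y k : T -> borelV R m)) /\
  forall f : 'cV[R]_m -> R,
    continuous f -> (exists M : R, forall x, `|f x| <= M) ->
    (\int[P]_w (f (Y k w))%:E)%E @[k --> \oo] --> (\int[Q]_x (f x)%:E)%E.

Definition cvg_in_law_normal d (T : measurableType d) (R : realType)
    (P : probability T R) (m : nat) (Y : nat -> T -> 'cV[R]_m)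
    (mu : 'cV[R]_m) (Sigma : 'M[R]_m) : Prop :=
  exists Q : probability (borelV R m) R,
    is_multinormal Q mu Sigma /\ cvg_in_law P Y Q.

Definition is_unique_maximizer (U : Type) (R : realType) (F : U -> R)
    (x : U) : Prop :=
  (forall y, F y <= F x) /\
  (forall z, (forall y, F y <= F z) -> z = x).

Section DensityRatioModel.
Variables (R : realType) (d : nat) (h : R -> 'cV[R]_d).
Implicit Types (alpha : R) (beta : 'cV[R]_d) (theta : 'cV[R]_(1 + d)).

Definition param alpha beta : 'cV[R]_(1 + d) := col_mx alpha%:M beta.
Definition alpha_of theta : R := usubmx theta 0 0.
Definition beta_of theta : 'cV[R]_d := dsubmx theta.

Definition predictor theta (x : R) : R :=
  alpha_of theta + ((beta_of theta)^T *m h x) 0 0.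

(* Only the first n1 entries of x1 and the first n2 entries of x2 are used. *)
Definition loglik (n1 n2 : nat) (x1 x2 : nat -> R) theta : R :=
  let c := n1%:R / n2%:R in
  - (\sum_(j < n1) ln (1 + c * expR (predictor theta (x1 j))) +
     \sum_(j < n2) ln (1 + c * expR (predictor theta (x2 j)))) +
  \sum_(j < n1) predictor theta (x1 j).

Definition penalty (q : R) beta : R := \sum_(j < d) `|beta j 0| `^ q.

Definition penalized_loglik (q lam : R) (n1 n2 : nat) (x1 x2 : nat -> R)
    theta : R :=
  loglik n1 n2 x1 x2 theta - lam * penalty q (beta_of theta).

Definition penalty_grad (q : R) beta : 'cV[R]_(1 + d) :=
  param 0 (\col_j (Num.sg (beta j 0) * q * `|beta j 0| `^ (q - 1))).

Variables (rho : R) (g2 : R -> R).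

Definition weight theta (x : R) : R :=
  expR (predictor theta x) / (1 + rho * expR (predictor theta x)).

(* The integrals against dG2 are written against g2(x)dx. *)
Definition A11 theta : R :=
  \int[lebesgue_measure]_x (weight theta x * g2 x).

Definition A21 theta : 'cV[R]_d :=
  \col_i \int[lebesgue_measure]_x (weight theta x * h x i 0 * g2 x).

Definition A22 theta : 'M[R]_d :=
  \matrix_(i, j)
    \int[lebesgue_measure]_x (weight theta x * (h x i 0 * h x j 0) * g2 x).

Definition finite_A theta : Prop :=
  [/\ lebesgue_measure.-integrable setT
        (fun x => (weight theta x * g2 x)%:E),
      (forall i, lebesgue_measure.-integrable setT
        (fun x => (weight theta x * h x i 0 * g2 x)%:E)) &
      (forall i j, lebesgue_measure.-integrable setT
        (fun x => (weight theta x * (h x i 0 * h x j 0) * g2 x)%:E))].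

(* With 1 - rho w = 1 / (1 + rho exp(alpha + beta'h)): finiteness of the
   integral of (1 - rho w) h h' against dG1.  When theta is the true parameter,
   (1 - rho w) g1 = w g2 and this is just finiteness of A22. *)
Definition finite_A22_dual (g1 : R -> R) theta : Prop :=
  forall i j, lebesgue_measure.-integrable setT
    (fun x => ((1 - rho * weight theta x) * (h x i 0 * h x j 0) * g1 x)%:E).

Definition Amx theta : 'M[R]_(1 + d) :=
  block_mx (A11 theta)%:M (A21 theta)^T (A21 theta) (A22 theta).

Definition Smx theta : 'M[R]_(1 + d) := (rho / (1 + rho)) *: Amx theta.

Definition Vmx theta : 'M[R]_(1 + d) :=
  (rho / (1 + rho)) *: Amx theta -
  rho *: (param (A11 theta) (A21 theta) *m (param (A11 theta) (A21 theta))^T).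

Definition Sigmamx theta : 'M[R]_(1 + d) :=
  invmx (Smx theta) *m Vmx theta *m invmx (Smx theta).

End DensityRatioModel.

(* Main.v *)
(* Put u = sqrt(n) (theta - theta0).  The negative penalized log-likelihood is
   strictly convex and coercive, so it has a unique, measurable minimizer.  On
   the scale of u, its increment from u = 0 is, for each fixed u,
     - u'W_n + u'Su / 2 + lambda_0 u'b + o_P(1),
   where W_n is the normalized score: the Taylor remainder is handled by an L^1
   law of large numbers, the dominating function being integrable because theta0
   is interior to the set on which the moments are finite.  By the density ratio
   identity the score is exactly centred, and E cos(t'W_n + a) converges to its
   value under N(0, V).
   For convex functions, pointwise convergence in probability to a positive
   definite quadratic form minus a tight linear form is locally uniform, so the
   rescaled minimizer is within o_P(1) of S^-1 (W_n - lambda_0 b).  Weak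
   convergence is then tested against bounded continuous functions, which are
   approximated on compact sets by trigonometric polynomials through Bernstein
   operators in the variables (1 + sin(c x_i)) / 2. *)
Require Import Defs.
From HB Require Import structures.
From mathcomp Require Import all_boot all_order all_algebra.
From mathcomp Require Import all_classical all_reals all_analysis.
From mathcomp Require Import finmap measurable_realfun ring lra.

Set Implicit Arguments.
Unset Strict Implicit.
Unset Printing Implicit Defensive.

Import Order.TTheory GRing.Theory Num.Theory.
Import numFieldNormedType.Exports.

Local Open Scope classical_set_scope.
Local Open Scope ring_scope.

(** * Real inequalities *)

Section RealInequalities.
Variable R : realType.
Implicit Types x y s t h c p q : R.

(* Two tangent lines of [expR] at [p * h], taken at [0] and at [h]. *)
Lemma expR_strict_convex p h : 0 < p < 1 -> h != 0 ->
  expR (p * h) < 1 - p + p * expR h.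
Proof.
move=> /andP[p0 p1] h0.
have e0 := expR_gt0 (p * h).
have H1 : expR (p * h) * (1 - p * h) < 1.
  have : 1 + - (p * h) < expR (- (p * h)).
    by apply: expR_gt1Dx; rewrite oppr_eq0 mulf_neq0// gt_eqF.
  rewrite -(ltr_pM2l e0) => /lt_le_trans; apply.
  by rewrite -expRD subrr expR0.
have H2 : expR (p * h) * (1 + (1 - p) * h) < expR h.
  have : 1 + ((1 - p) * h) < expR ((1 - p) * h).
    by apply: expR_gt1Dx; rewrite mulf_neq0// subr_eq0 gt_eqF.
  rewrite -(ltr_pM2l e0) => /lt_le_trans; apply.
  by rewrite -expRD; have -> : p * h + (1 - p) * h = h by ring.
nra.
Qed.

Definition logistic c s := c * expR s / (1 + c * expR s).

Definition softplus c s := ln (1 + c * expR s).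

Lemma logistic_gt0 c s : 0 < c -> 0 < logistic c s.
Proof.
by move=> c0; rewrite divr_gt0// ?addr_gt0// mulr_gt0// expR_gt0.
Qed.

Lemma logistic_compl c s : 0 < c -> 1 - logistic c s = (1 + c * expR s)^-1.
Proof.
move=> c0; rewrite /logistic; have := expR_gt0 s => e0.
have : 1 + c * expR s != 0 by rewrite gt_eqF// addr_gt0// mulr_gt0.
by move=> ?; field.
Qed.

Lemma logistic_lt1 c s : 0 < c -> logistic c s < 1.
Proof.
move=> c0; rewrite -subr_gt0 logistic_compl// invr_gt0.
by rewrite addr_gt0// mulr_gt0// expR_gt0.
Qed.

Lemma softplus_shift c s t : 0 < c ->
  softplus c (s + t) - softplus c s =
    ln (1 - logistic c s + logistic c s * expR t).
Proof.
move=> c0; rewrite /softplus -ln_div ?posrE ?addr_gt0 ?mulr_gt0 ?expR_gt0//.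
congr ln; rewrite logistic_compl// /logistic expRD.
have : 1 + c * expR s != 0 by rewrite gt_eqF// addr_gt0// mulr_gt0// expR_gt0.
by move=> ?; field.
Qed.

Lemma softplus_tangent c s t : 0 < c -> t != 0 ->
  logistic c s * t < softplus c (s + t) - softplus c s.
Proof.
move=> c0 t0; rewrite softplus_shift//.
have pl0 := logistic_gt0 s c0; have pl1 := logistic_lt1 s c0.
rewrite -[ltLHS]expRK ltr_ln ?posrE ?expR_gt0//.
  by apply: expR_strict_convex; rewrite ?pl0.
by apply: addr_gt0; [rewrite subr_gt0|rewrite mulr_gt0// expR_gt0].
Qed.

Lemma softplus_tangent_le c s t : 0 < c ->
  logistic c s * t <= softplus c (s + t) - softplus c s.
Proof.
move=> c0; have [->|t0] := eqVneq t 0; first by rewrite mulr0 addr0 subrr.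
exact/ltW/softplus_tangent.
Qed.

Lemma logistic_shift c s t : 0 < c ->
  logistic c (s + t) - logistic c s =
    logistic c (s + t) * (1 - logistic c s) * (1 - expR (- t)).
Proof.
move=> c0; rewrite logistic_compl// /logistic expRD expRN.
have : 1 + c * expR s != 0 by rewrite gt_eqF// addr_gt0// mulr_gt0// expR_gt0.
have : 1 + c * (expR s * expR t) != 0.
  by rewrite gt_eqF// addr_gt0// mulr_gt0// mulr_gt0// expR_gt0.
have : expR t != 0 by rewrite gt_eqF// expR_gt0.
by move=> ? ? ?; field; apply/and3P; split.
Qed.

Lemma softplus_rem_le c s t : 0 < c ->
  softplus c (s + t) - softplus c s - logistic c s * t <=
  t ^+ 2 * (Num.min (logistic c (s + t) + logistic c s)
               (1 - logistic c (s + t) + (1 - logistic c s))).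
Proof.
move=> c0.
have p0 := logistic_gt0 s c0; have p1 := logistic_lt1 s c0.
have q0 := logistic_gt0 (s + t) c0; have q1 := logistic_lt1 (s + t) c0.
have H : softplus c (s + t) - softplus c s <= logistic c (s + t) * t.
  have := softplus_tangent_le (s + t) (- t) c0.
  by rewrite addrK mulrN; lra.
have E1 := logistic_shift s t c0.
have E2 := logistic_shift (s + t) (- t) c0.
rewrite addrK opprK in E2.
have e1 := expR_ge1Dx (- t); have e2 := expR_ge1Dx t.
set p := logistic c s in p0 p1 E1 E2 H *.
set q := logistic c (s + t) in q0 q1 E1 E2 H *.
suff : (q - p) * t <= t ^+ 2 * Num.min (q + p) (1 - q + (1 - p)) by nra.
have [t0|t0] := leP 0 t.
  apply: (@le_trans _ _ (t ^+ 2 * (q * (1 - p)))).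
    rewrite E1; suff : 0 <= (q * (1 - p)) * (t * (t - (1 - expR (- t)))) by nra.
    by apply: mulr_ge0; apply: mulr_ge0; lra.
  rewrite ler_wpM2l// ?sqr_ge0// le_min; nra.
apply: (@le_trans _ _ (t ^+ 2 * (p * (1 - q)))).
  have -> : q - p = - (p * (1 - q) * (1 - expR t)) by rewrite -E2; ring.
  suff : 0 <= (p * (1 - q)) * ((- t) * (expR t - 1 - t)) by nra.
  by apply: mulr_ge0; apply: mulr_ge0; lra.
rewrite ler_wpM2l// ?sqr_ge0// le_min; nra.
Qed.

Lemma MVT_norm_bound (f df : R -> R) (C : R) (k : nat) (r : R) :
  f 0 = 0 -> (forall x : R, `|x| <= r -> is_derive x 1 f (df x)) ->
  (forall x, `|x| <= r -> `|df x| <= C * `|x| ^+ k) ->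
  forall x, `|x| <= r -> `|f x| <= C * `|x| ^+ k.+1.
Proof.
move=> f0 fd dfb x xr.
have r0 : 0 <= r := le_trans (normr_ge0 x) xr.
have cf a b : - r <= a -> b <= r -> {within `[a, b], continuous f}.
  move=> ra br; apply: derivable_within_continuous => y.
  rewrite in_itv/= => /andP[ay yb].
  have : is_derive y 1 f (df y) by apply: fd; rewrite ler_norml; lra.
  by move=> /@ex_derive.
have C0 : x != 0 -> 0 <= C.
  move=> x0; have := le_trans (normr_ge0 _) (dfb x xr).
  by rewrite pmulr_lge0// exprn_gt0// normr_gt0.
have [->|x0] := eqVneq x 0; first by rewrite f0 normr0 exprS mul0r mulr0.
have := ltr_norml; move: xr; rewrite ler_norml => /andP[rx xr] _.
have key c : `|c| <= `|x| -> `|df c| * `|x| <= C * `|x| ^+ k.+1.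
  move=> cx; rewrite exprSr mulrA ler_wpM2r//.
  apply: (le_trans (dfb _ _)); first by rewrite (le_trans cx)// ler_norml rx.
  by rewrite ler_wpM2l ?C0// lerXn2r ?nnegrE.
case: (ltgtP x 0) x0 => // [xn|xp] _.
- have [|| c] := @MVT R f df x 0 xn.
  + move=> y; rewrite in_itv/= => /andP[ay yb]; apply: fd.
    by rewrite ler_norml; lra.
  + by apply: cf => //; lra.
  + rewrite in_itv/= => /andP[cx c0].
    rewrite f0 !sub0r => /(congr1 Num.norm); rewrite normrN normrM normrN => ->.
    by apply: key; rewrite !ltr0_norm//; lra.
- have [|| c] := @MVT R f df 0 x xp.
  + move=> y; rewrite in_itv/= => /andP[ay yb]; apply: fd.
    by rewrite ler_norml; lra.
  + by apply: cf => //; lra.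
  + rewrite in_itv/= => /andP[c0 cx].
    rewrite f0 !subr0 => /(congr1 Num.norm); rewrite normrM => ->.
    by apply: key; rewrite !gtr0_norm//; lra.
Qed.

Lemma is_derive_sqr x : is_derive x 1 (fun x : R => x ^+ 2) (2 * x).
Proof.
have := is_deriveX 2 (is_derive_id x (1 : R)).
by move=> /is_derive_eq; apply; rewrite expr1 /GRing.scale/= mulr1.
Qed.

Lemma is_derive_softplus c s : 0 < c ->
  is_derive s 1 (softplus c) (logistic c s).
Proof.
move=> c0.
have D0 : 0 < 1 + c * expR s by rewrite addr_gt0// mulr_gt0// expR_gt0.
have H1 : is_derive s 1 (fun s => 1 + c * expR s) (c * expR s).
  have := is_deriveD (is_derive_cst (1 : R) s 1) (is_deriveZ c (is_derive_expR s)).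
  by move=> /is_derive_eq; apply; rewrite add0r.
have H2 := is_derive1_ln D0.
have -> : softplus c = (@ln R) \o (fun s => 1 + c * expR s) by [].
have /= := @is_derive1_comp R (@ln R) (fun s => 1 + c * expR s) s _ _ H2 H1.
by move=> /is_derive_eq; apply; rewrite /logistic mulrC.
Qed.

Lemma softplus_rem2 c s t : 0 < c -> `|t| <= 1 / 2 ->
  `|softplus c (s + t) - softplus c s - logistic c s * t
    - logistic c s * (1 - logistic c s) * t ^+ 2 / 2| <= 6 * `|t| ^+ 3.
Proof.
move=> c0 t12.
set p := logistic c s.
pose K u := softplus c (s + u) - softplus c s - p * u - p * (1 - p) * u ^+ 2 / 2.
pose dK u := logistic c (s + u) - p - p * (1 - p) * u.
apply: (@MVT_norm_bound K dK 6 2 (1 / 2)) => //.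
- by rewrite /K addr0 expr0n/= !mulr0 mul0r; ring.
- move=> u _.
  have H1 : is_derive u 1 (fun u => softplus c (s + u)) (logistic c (s + u)).
    have Hs : is_derive u 1 (fun u => s + u) 1.
      have := is_deriveD (is_derive_cst s u (1 : R)) (is_derive_id u (1 : R)).
      by move=> /is_derive_eq; apply; rewrite add0r.
    have /= := @is_derive1_comp R (softplus c) (fun u => s + u) u _ _ (is_derive_softplus (s + u) c0) Hs.
    by move=> /is_derive_eq; apply; rewrite mulr1.
  have := is_deriveB (is_deriveB (is_deriveB H1
    (is_derive_cst (softplus c s) u (1 : R))) (is_deriveZ p (is_derive_id u (1 : R))))
    (is_deriveZ (p * (1 - p) / 2) (is_derive_sqr u)).
  set f := (X in is_derive _ _ X _); have -> : f = K.
    apply/funext => v; rewrite /K.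
    change (softplus c (s + v) - softplus c s - p * v - p * (1 - p) / 2 * v ^+ 2 =
      softplus c (s + v) - softplus c s - p * v - p * (1 - p) * v ^+ 2 / 2).
    by field.
  move=> /is_derive_eq; apply.
  by rewrite /dK /GRing.scale /=; field.
- move=> u u12; rewrite /dK.
  have p0 := logistic_gt0 s c0; have p1 := logistic_lt1 s c0.
  have q0 := logistic_gt0 (s + u) c0; have q1 := logistic_lt1 (s + u) c0.
  have E1 := logistic_shift s u c0.
  rewrite -/p in p0 p1 E1.
  set q := logistic c (s + u) in q0 q1 E1 *.
  have e1 := expR_ge1Dx (- u); have e2 := expR_ge1Dx u.
  have e0 := expR_gt0 u.
  have eN : expR (- u) * expR u = 1 by rewrite -expRD addNr expR0.
  move: u12; rewrite ler_norml => /andP[u1 u2].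
  have B1 : expR (- u) - 1 + u <= 2 * u ^+ 2.
    have : expR (- u) * (1 + u) <= 1 by rewrite -[leRHS]eN ler_pM2l ?expR_gt0.
    set E := expR (- u) in e1 eN *; move=> H.
    have : E * (1 + u) <= (1 - u + 2 * u ^+ 2) * (1 + u).
      apply: (le_trans H).
      have : 0 <= u ^+ 2 * (1 + 2 * u) by rewrite mulr_ge0 ?sqr_ge0//; lra.
      by rewrite !expr2; nra.
    by rewrite ler_pM2r; lra.
  set F := 1 - expR (- u) in E1.
  have F1 : u - 2 * u ^+ 2 <= F by rewrite /F; lra.
  have F2 : F <= u by rewrite /F; lra.
  have -> : q - p - p * (1 - p) * u =
      (1 - p) * ((q - p) * F + p * (F - u)).
    by transitivity (q * (1 - p) * F - p * (1 - p) * u); [rewrite -E1|ring].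
  have F3 : F ^+ 2 <= 4 * u ^+ 2.
    suff : 0 <= (2 * u - F) * (2 * u + F) by rewrite !expr2; nra.
    have [u0|u0] := leP 0 u.
      by apply: mulr_ge0; first lra; move: F1; rewrite expr2; nra.
    by apply: mulr_le0; [move: F1; rewrite expr2; nra|lra].
  rewrite normrM.
  have -> : `|1 - p| = 1 - p by rewrite ger0_norm//; lra.
  have N1 : `|(q - p) * F| <= F ^+ 2.
    rewrite E1 -mulrA -expr2 normrM (ger0_norm (sqr_ge0 _)).
    rewrite ger0_norm; last by apply: mulr_ge0; lra.
    by rewrite ler_piMl ?sqr_ge0//; nra.
  have N2 : `|p * (F - u)| <= 2 * u ^+ 2.
    rewrite normrM ger0_norm; last lra.
    have : `|F - u| <= 2 * u ^+ 2 by rewrite ler_norml; apply/andP; split; lra.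
    move=> H; have := normr_ge0 (F - u); nra.
  have : `|(q - p) * F + p * (F - u)| <= 6 * u ^+ 2.
    by rewrite (le_trans (ler_normD _ _))//; lra.
  rewrite real_normK ?num_real//.
  have := normr_ge0 ((q - p) * F + p * (F - u)); nra.
Qed.

Lemma norm_sin_le x : `|sin x| <= `|x|.
Proof.
have := @MVT_norm_bound sin cos 1 0 `|x| (@sin0 R).
rewrite -[X in _ <= X]mul1r -(expr1 `|x|); apply => // y _.
by rewrite expr0 mulr1 cos_max.
Qed.

Lemma norm_cosB1_le x : `|cos x - 1| <= `|x|.
Proof.
have := @MVT_norm_bound (fun x => cos x - 1) (fun x => - sin x) 1 0 `|x|.
rewrite -[X in _ <= X]mul1r -(expr1 `|x|); apply => //.
- by rewrite cos0 subrr.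
- move=> y _; have := is_deriveB (is_derive_cos y) (is_derive_cst (1 : R) y (1 : R)).
  by move=> /is_derive_eq; apply; rewrite subr0.
- by move=> y _; rewrite normrN expr0 mulr1 sin_max.
Qed.

Lemma norm_cosB1_le2 x : `|cos x - 1| <= `|x| ^+ 2.
Proof.
have := @MVT_norm_bound (fun x => cos x - 1) (fun x => - sin x) 1 1 `|x|.
rewrite -[X in _ <= X]mul1r; apply => //.
- by rewrite cos0 subrr.
- move=> y _; have := is_deriveB (is_derive_cos y) (is_derive_cst (1 : R) y (1 : R)).
  by move=> /is_derive_eq; apply; rewrite subr0.
- by move=> y _; rewrite normrN expr1 mul1r norm_sin_le.
Qed.

Lemma norm_sinB_le k x : (k == 1%N) || (k == 2%N) ->
  `|sin x - x| <= `|x| ^+ k.+1.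
Proof.
move=> k12.
have := @MVT_norm_bound (fun x => sin x - x) (fun x => cos x - 1) 1 k `|x|.
rewrite -[X in _ <= X]mul1r; apply => //.
- by rewrite sin0 subrr.
- move=> y _; rewrite mul1r.
  by case/orP: k12 => /eqP ->; rewrite ?expr1 ?norm_cosB1_le ?norm_cosB1_le2.
Qed.

Lemma is_derive_cos_rem x :
  is_derive x 1 (fun x => cos x - 1 + x ^+ 2 / 2) (x - sin x).
Proof.
have := is_deriveD (is_deriveB (is_derive_cos x)
  (is_derive_cst (1 : R) x (1 : R))) (is_deriveZ (2^-1) (is_derive_sqr x)).
set f := (X in is_derive _ _ X _).
have -> : f = (fun x => cos x - 1 + x ^+ 2 / 2).
  by apply/funext => v; rewrite /f !fctE /GRing.scale/= mulrC.
by move=> /is_derive_eq; apply; rewrite /GRing.scale/=; field.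
Qed.

Lemma norm_cos_rem_le x : `|cos x - 1 + x ^+ 2 / 2| <= 2 * `|x| ^+ 2.
Proof.
apply: (@MVT_norm_bound (fun x => cos x - 1 + x ^+ 2 / 2)
  (fun x => x - sin x) 2 1 `|x|) => //.
- by rewrite cos0 subrr expr0n/= mul0r addr0.
- by move=> y _; exact: is_derive_cos_rem.
- move=> y _; rewrite expr1 (le_trans (ler_normB _ _))//.
  by have := norm_sin_le y; lra.
Qed.

Lemma norm_cos_rem_le4 x : `|cos x - 1 + x ^+ 2 / 2| <= `|x| ^+ 4.
Proof.
rewrite -[X in _ <= X]mul1r.
apply: (@MVT_norm_bound (fun x => cos x - 1 + x ^+ 2 / 2)
  (fun x => x - sin x) 1 3 `|x|) => //.
- by rewrite cos0 subrr expr0n/= mul0r addr0.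
- by move=> y _; exact: is_derive_cos_rem.
- by move=> y _; rewrite distrC mul1r norm_sinB_le.
Qed.

Lemma norm_cosD_le x y : `|cos x - cos y| <= `|x - y|.
Proof.
have -> : cos x - cos y = - 2 * sin ((x + y) / 2) * sin ((x - y) / 2).
  have := cosD ((x + y) / 2) ((x - y) / 2).
  have := cosB ((x + y) / 2) ((x - y) / 2).
  have -> : (x + y) / 2 + (x - y) / 2 = x by field.
  have -> : (x + y) / 2 - (x - y) / 2 = y by field.
  by move=> -> ->; ring.
have := norm_sin_le ((x - y) / 2); have := sin_max ((x + y) / 2).
rewrite !normrM normrN (ger0_norm (ler0n _ 2)) (@ger0_norm _ (2^-1)) ?invr_ge0//.
have := normr_ge0 (sin ((x + y) / 2)); have := normr_ge0 (sin ((x - y) / 2)).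
nra.
Qed.

Definition powR_slope q x := Num.sg x * q * `|x| `^ (q - 1).

Lemma bernoulli_powR q z : 1 < q -> z != 1 -> 1 + q * (z - 1) < `|z| `^ q.
Proof.
move=> q1 z1; have q0 : 0 < q by lra.
have [z0|z0] := leP z 0.
  apply: (@lt_le_trans _ _ 0); last exact: powR_ge0.
  have : 0 <= q * - z by apply: mulr_ge0; lra.
  lra.
rewrite gtr0_norm// /powR gt_eqF//.
have lz0 : ln z != 0 by rewrite ln_eq0.
have := @expR_strict_convex q^-1 (q * ln z).
rewrite invr_gt0 q0 invf_lt1// q1 mulf_neq0 ?(gt_eqF q0)// => /(_ isT isT).
rewrite mulrA mulVf ?gt_eqF// mul1r lnK ?posrE// -(ltr_pM2l q0).
set E := expR _.
have -> : q * (1 - q^-1 + q^-1 * E) = q - 1 + E by field; rewrite gt_eqF.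
lra.
Qed.

Lemma powR_slopeE q x : 0 < q -> powR_slope q x = q * `|x| `^ q / x.
Proof.
move=> q0; rewrite /powR_slope; have [->|x0] := eqVneq x 0.
  by rewrite invr0 mulr0 sgr0 !mul0r.
rewrite -(@mulr_powRB1 _ `|x| q)//.
have -> : `|x| = x * Num.sg x by rewrite mulrC [ `|x| ]normrEsg.
by field.
Qed.

Lemma norm_powR_tangent q x y : 1 < q -> y != x ->
  `|x| `^ q + powR_slope q x * (y - x) < `|y| `^ q.
Proof.
move=> q1 yx; have q0 : 0 < q by lra.
have [x0|x0] := eqVneq x 0.
  rewrite x0 /powR_slope sgr0 !mul0r normr0 powR0 ?gt_eqF// addr0.
  by rewrite powR_gt0// normr_gt0 -x0.
have xq0 : 0 < `|x| `^ q by rewrite powR_gt0// normr_gt0.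
have -> : `|y| = `|x| * `|y / x| by rewrite -normrM mulrC divfK.
rewrite powRM// powR_slopeE//.
have := @bernoulli_powR q (y / x) q1; rewrite -(ltr_pM2l xq0).
have -> : y / x != 1 by apply: contra yx => /eqP yx; rewrite -(divfK x0 y) yx mul1r.
move=> /(_ isT); congr (_ < _); field.
by rewrite x0.
Qed.

Lemma norm_powR_tangent_le q x y : 1 < q ->
  `|x| `^ q + powR_slope q x * (y - x) <= `|y| `^ q.
Proof.
move=> q1; have [->|yx] := eqVneq y x; first by rewrite subrr mulr0 addr0.
exact/ltW/norm_powR_tangent.
Qed.

Lemma norm_powR_continuous q : 0 < q -> continuous (fun x : R => `|x| `^ q).
Proof.
move=> q0 x; have [->|x0] := eqVneq x 0.
  apply/cvgrPdist_lt => /= e e0.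
  near=> y; rewrite normr0 powR0 ?gt_eqF// sub0r normrN ger0_norm ?powR_ge0//.
  have -> : e = (e `^ q^-1) `^ q by rewrite -powRrM mulVf ?gt_eqF// powRr1// ltW.
  rewrite gt0_ltr_powR ?nnegrE ?powR_ge0//.
  near: y; exists (e `^ q^-1) => /=; first exact: powR_gt0.
  by move=> z /=; rewrite sub0r normrN.
apply: (@continuous_comp _ _ _ (fun x : R => `|x|) (fun y => y `^ q)).
  exact: norm_continuous.
apply: differentiable_continuous; apply/derivable1_diffP.
by apply: derivable_powR; rewrite in_itv/= andbT normr_gt0.
Unshelve. all: by end_near. Qed.

Lemma powR_slope_continuous q : 1 < q -> continuous (powR_slope q).
Proof.
move=> q1 x; have q0 : 0 < q by lra.
have [->|x0] := eqVneq x 0.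
  apply/cvgrPdist_lt => /= e e0.
  have /= H := @norm_powR_continuous (q - 1) _ 0.
  have : 0 < e / q by rewrite divr_gt0.
  have /cvgrPdist_lt /= /[apply] : (fun x : R => `|x| `^ (q - 1)) @ 0 --> (0 : R).
    have := H; rewrite /continuous_at normr0 powR0 ?subr_eq0 ?gt_eqF//.
    by apply; rewrite subr_gt0.
  apply: filterS => y; rewrite sub0r normrN ger0_norm ?powR_ge0// ltr_pdivlMr//.
  rewrite /powR_slope sgr0 !mul0r sub0r normrN !normrM (gtr0_norm q0).
  rewrite (@ger0_norm _ (_ `^ _)) ?powR_ge0// mulrAC; apply: le_lt_trans.
  rewrite ler_pM2r//.
  by rewrite ler_piMl ?powR_ge0// normr_sg; case: (y != 0).
have -> : powR_slope q = (fun x => q * `|x| `^ q * x^-1).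
  by apply/funext => y; rewrite powR_slopeE.
apply: cvgM; last by apply: cvgV.
by apply: cvgM; [exact: cvg_cst|exact: norm_powR_continuous].
Unshelve. all: by end_near. Qed.

Lemma norm_powR_cvg_slope q x u (a : R^nat) : 1 < q ->
  a @ \oo --> +oo ->
  a k * (`|x + u / a k| `^ q - `|x| `^ q) @[k --> \oo] --> powR_slope q x * u.
Proof.
move=> q1 ay.
have ia : (a k)^-1 @[k --> \oo] --> (0 : R).
  by apply/gtr0_cvgV0 => //; near=> k; near: k; exact: cvgry_gt.
have xa : x + u / a k @[k --> \oo] --> x.
  rewrite -[X in _ --> X]addr0 -[X in _ --> x + X](mulr0 u).
  by apply: cvgD; [exact: cvg_cst|apply: cvgM => //; exact: cvg_cst].
apply: (@squeeze_cvgr _ _ _ _ (fun=> powR_slope q x * u)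
   (fun k => powR_slope q (x + u / a k) * u)).
- near=> k.
  have a0 : 0 < a k by near: k; exact: cvgry_gt.
  have E : u / a k * a k = u by rewrite divfK// gt_eqF.
  have := norm_powR_tangent_le x (x + u / a k) q1.
  have := norm_powR_tangent_le (x + u / a k) x q1.
  rewrite opprD addrA subrr sub0r (addrC x) addrK mulrN addrC.
  set y := x + u / a k; rewrite -{3 4}E; set D := u / a k => H1 H2.
  have -> : powR_slope q y * (D * a k) = a k * (powR_slope q y * D) by ring.
  have -> : powR_slope q x * (D * a k) = a k * (powR_slope q x * D) by ring.
  by rewrite !ler_pM2l//; apply/andP; split; lra.
- exact: cvg_cst.
- apply: cvgM; last exact: cvg_cst.
  by apply: (cvg_comp _ _ xa); exact: powR_slope_continuous.
Unshelve. all: by end_near. Qed.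

End RealInequalities.

Lemma norm_expRN_rem_le (R : realType) (y : R) : 0 <= y -> `|expR (- y) - 1 + y| <= y ^+ 2.
Proof.
move=> y0; have h1 := expR_ge1Dx (- y).
have h2 : expR (- y) <= (1 + y)^-1 by rewrite expRN lef_pV2 ?posrE ?expR_gt0 ?expR_ge1Dx//; lra.
have h3 : (1 + y)^-1 <= 1 - y + y ^+ 2.
  rewrite -[leLHS]mul1r ler_pdivrMr; last lra.
  have -> : (1 - y + y ^+ 2) * (1 + y) = 1 + y ^+ 3 by ring.
  by rewrite lerDl exprn_ge0.
by rewrite ger0_norm; lra.
Qed.

(** * Integration, independence and the law of large numbers *)

Section NonnegInduction.
Context d (T : measurableType d) (R : realType).
Import HBNNSimple.

Lemma measurable_nneg_ind (H : (T -> \bar R) -> Prop) :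
  (forall A, measurable A -> H (fun x => (\1_A x)%:E)) ->
  (forall (f g : T -> \bar R) (c : R), 0 <= c ->
    measurable_fun setT f -> (forall x, 0 <= f x)%E -> H f ->
    measurable_fun setT g -> (forall x, 0 <= g x)%E -> H g ->
    H (fun x => f x + c%:E * g x)%E) ->
  (forall (g : (T -> \bar R)^nat) (f : T -> \bar R), (forall n, measurable_fun setT (g n)) ->
    (forall n x, 0 <= g n x)%E -> (forall n, H (g n)) ->
    (forall x, nondecreasing_seq (g^~ x)) ->
    (forall x, g n x @[n --> \oo] --> f x) -> H f) ->
  forall f : T -> \bar R, measurable_fun setT f -> (forall x, 0 <= f x)%E -> H f.
Proof.
move=> H1 HD Hlim f mf f0.
pose g := nnsfun_approx measurableT mf.
apply: (Hlim (fun n x => (g n x)%:E)).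
- by move=> n; apply/measurable_EFinP; exact: measurable_funPT.
- by move=> n x; rewrite lee_fin.
- move=> n.
  have -> : (fun x => (g n x)%:E) = (fun x => \sum_(y <- fset_set (range (g n)))
      (y%:E * (\1_(g n @^-1` [set y]) x)%:E))%E.
    apply/funext => x; rewrite fimfunE fsbig_finite//= sumEFin.
    by [].
  have : forall y : R, y \in fset_set (range (g n)) -> 0 <= y.
    by move=> y; rewrite in_fset_set// => /set_mem[x _ <-].
  suff Hs : forall s : seq R, (forall y : R, y \in s -> 0 <= y) ->
      H (fun x => \sum_(y <- s) (y%:E * (\1_(g n @^-1` [set y]) x)%:E))%E.
    exact: Hs.
  elim=> [|y s IH] ys.
    have -> : (fun x : T => \sum_(y <- [::])
        (y%:E * (\1_(g n @^-1` [set y]) x)%:E))%E = (fun x => (\1_set0 x)%:E :> \bar R).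
      by apply/funext => x; rewrite big_nil indic0.
    exact: H1.
  have mi y' : measurable_fun setT (fun x => (\1_(g n @^-1` [set y']) x)%:E : \bar R).
    by apply/measurable_EFinP; exact: measurable_indic.
  have s0 (z : R) : z \in s -> 0 <= z.
    by move=> zs; apply: ys; rewrite in_cons zs orbT.
  have -> : (fun x : T => \sum_(y0 <- y :: s)
      (y0%:E * (\1_(g n @^-1` [set y0]) x)%:E))%E = (fun x => \sum_(y0 <- s)
      (y0%:E * (\1_(g n @^-1` [set y0]) x)%:E) + y%:E * (\1_(g n @^-1` [set y]) x)%:E)%E.
    by apply/funext => x; rewrite big_cons addeC.
  apply: HD => //.
  + by apply: ys; rewrite mem_head.
  + by apply: emeasurable_sum => z; exact: measurable_funeM.
  + move=> x; rewrite big_seq; apply: sume_ge0 => z zs.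
    by rewrite mule_ge0// lee_fin ?s0// indicE.
  + exact: IH.
  + exact: H1.
- move=> x m n mn; rewrite lee_fin.
  exact/lefP/nd_nnsfun_approx.
- by move=> x; apply: cvg_nnsfun_approx.
Qed.

End NonnegInduction.

Section Density.
Context d d' (T : measurableType d) (T' : measurableType d') (R : realType).
Variables (mu : {measure set T' -> \bar R}) (nu : {measure set T -> \bar R}).
Variables (phi : T' -> T) (g : T' -> R).
Hypothesis mphi : measurable_fun setT phi.
Hypotheses (mg : measurable_fun setT g) (g0 : forall x, 0 <= g x).
Hypothesis nuE : forall B, measurable B -> nu B = (\int[mu]_(x in phi @^-1` B) (g x)%:E)%E.

Lemma ge0_integral_density (f : T -> \bar R) :
  measurable_fun setT f -> (forall x, 0 <= f x)%E ->
  (\int[nu]_x f x = \int[mu]_x (f (phi x) * (g x)%:E))%E.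
Proof.
have mgE : measurable_fun setT (fun x => (g x)%:E) by exact/measurable_EFinP.
have gE0 x : (0 <= (g x)%:E)%E by rewrite lee_fin.
move: f; apply: measurable_nneg_ind.
- move=> A mA; rewrite integral_indic// setIT nuE// [LHS]integral_mkcond/=.
  apply: eq_integral => x _; rewrite patchE indicE.
  have -> : (phi x \in A) = (x \in phi @^-1` A) by apply/idP/idP => /set_mem H; exact/mem_set.
  by case: ifP; rewrite ?mul1e ?mul0e.
- move=> f f' c c0 mf f0 Hf mf' f'0 Hf'.
  have m1 : measurable_fun setT (fun x => f (phi x) * (g x)%:E)%E.
    by apply: emeasurable_funM => //; exact: measurableT_comp.
  have m2 : measurable_fun setT (fun x => f' (phi x) * (g x)%:E)%E.
    by apply: emeasurable_funM => //; exact: measurableT_comp.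
  have m3 : measurable_fun setT (fun x => c%:E * (f' (phi x) * (g x)%:E))%E.
    exact: measurable_funeM.
  have m4 : measurable_fun setT (fun x => c%:E * f' x)%E.
    exact: measurable_funeM.
  have n1 x : [set: T'] x -> (0 <= f (phi x) * (g x)%:E)%E by rewrite mule_ge0.
  have n2 x : [set: T'] x -> (0 <= f' (phi x) * (g x)%:E)%E by rewrite mule_ge0.
  have n3 x : [set: T'] x -> (0 <= c%:E * (f' (phi x) * (g x)%:E))%E.
    by move=> ?; rewrite !mule_ge0.
  have n4 x : [set: T] x -> (0 <= c%:E * f' x)%E by move=> ?; rewrite mule_ge0.
  rewrite ge0_integralD// ge0_integralZl// Hf Hf' -ge0_integralZl//.
  rewrite -ge0_integralD//.
  by apply: eq_integral => x _; rewrite ge0_muleDl ?mule_ge0// muleA.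
- move=> f_ f mf_ f_0 Hf_ nd cvf.
  have L : (\int[nu]_x f_ n x @[n --> \oo] --> \int[nu]_x f x)%E.
    have -> : (\int[nu]_x f x = \int[nu]_x limn (f_^~ x))%E.
      by apply: eq_integral => x _; apply/esym/cvg_lim.
    exact: cvg_monotone_convergence.
  have L' : (\int[mu]_x (f_ n (phi x) * (g x)%:E) @[n --> \oo] -->
       \int[mu]_x (f (phi x) * (g x)%:E))%E.
    have -> : (\int[mu]_x (f (phi x) * (g x)%:E) =
        \int[mu]_x limn (fun n => f_ n (phi x) * (g x)%:E))%E.
      by apply: eq_integral => x _; apply/esym/cvg_lim => //; apply: cvgeZr.
    apply: cvg_monotone_convergence => //.
    + by move=> n; apply: emeasurable_funM => //; exact: measurableT_comp.
    + by move=> n x _; rewrite mule_ge0.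
    + by move=> x _ m n mn; rewrite lee_wpmul2r// nd.
  rewrite -(cvg_lim _ L)// -(cvg_lim _ L')//.
  by congr (limn _); apply/funext => n.
Qed.

Lemma integrable_densityP (f : T -> R) : measurable_fun setT f ->
  mu.-integrable setT (fun x => (f (phi x) * g x)%:E) ->
  nu.-integrable setT (EFin \o f).
Proof.
move=> mf /integrableP[_ ifg]; apply/integrableP; split; first exact/measurable_EFinP.
rewrite ge0_integral_density//=; last first.
  by apply/measurable_EFinP; exact: measurableT_comp.
apply: le_lt_trans ifg; rewrite le_eqVlt; apply/orP; left; apply/eqP.
by apply: eq_integral => x _; rewrite /= normrM (ger0_norm (g0 x)) EFinM.
Qed.

Lemma Rintegral_density (f : T -> R) : measurable_fun setT f ->
  mu.-integrable setT (fun x => (f (phi x) * g x)%:E) ->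
  \int[nu]_x f x = \int[mu]_x (f (phi x) * g x).
Proof.
move=> mf ifg; rewrite /Rintegral; congr fine.
have mfE : measurable_fun setT (fun x => (f x)%:E) by exact/measurable_EFinP.
rewrite integralE [RHS]integralE; congr (_ - _)%E.
- rewrite ge0_integral_density//; last exact: measurable_funepos.
  apply: eq_integral => x _; rewrite !funeposE -EFin_max -EFinM.
  by rewrite maxr_pMl// mul0r EFin_max.
- rewrite ge0_integral_density//; last exact: measurable_funeneg.
  apply: eq_integral => x _; rewrite !funenegE -!EFinN -!EFin_max -EFinM -mulNr.
  by rewrite maxr_pMl// mul0r.
Qed.

End Density.

Section RealIntegral.
Context d (T : measurableType d) (R : realType).
Variable P : probability T R.
Implicit Types f F : T -> R.

Lemma integrable_bounded f (M : R) : measurable_fun setT f ->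
  (forall x, `|f x| <= M) -> P.-integrable setT (EFin \o f).
Proof.
move=> mf fM; apply: measurable_bounded_integrable => //.
  by rewrite (le_lt_trans (probability_le1 P measurableT))// ltry.
exists M; split; first exact: num_real.
by move=> y My x _; exact: le_trans (fM x) (ltW My).
Qed.

Lemma integrable_dominated f F : measurable_fun setT f ->
  P.-integrable setT (EFin \o F) ->
  (forall x, `|f x| <= F x) -> P.-integrable setT (EFin \o f).
Proof.
move=> mf iF fF; apply: le_integrable iF => //; first exact/measurable_EFinP.
by move=> x _ /=; rewrite lee_fin (le_trans (fF x))// ler_norm.
Qed.

Lemma Rintegral_const (c : R) : \int[P]_x c = c.
Proof. by rewrite Rintegral_cst// [X in fine X](probability_setT P) mulr1. Qed.

Lemma Rintegral_dominated_cvg (f : nat -> T -> R) (g F : T -> R) :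
  (forall k, measurable_fun setT (f k)) ->
  (forall x, f k x @[k --> \oo] --> g x) ->
  P.-integrable setT (EFin \o F) ->
  (\forall k \near \oo, forall x, `|f k x| <= F x) ->
  \int[P]_x f k x @[k --> \oo] --> \int[P]_x g x.
Proof.
move=> mf fg iF [N _ fF].
have mg : measurable_fun setT g.
  by apply: (measurable_fun_cvg mf) => x _; exact: fg.
have gF x : `|g x| <= F x.
  have : `|f k x| @[k --> \oo] --> `|g x| by apply: cvg_norm.
  move=> H; rewrite -(cvg_lim _ H)//; apply: limr_le; first exact: cvgP H.
  by exists N => // k Nk /=; exact: fF.
rewrite -(cvg_shiftn N).
have [|||||_ _] := @dominated_convergence _ T R P setT measurableT
  (fun k x => (f (k + N)%N x)%:E) (fun x => (g x)%:E) (EFin \o F).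
- by move=> n; exact/measurable_EFinP.
- exact/measurable_EFinP.
- apply: aeW => x _; apply: cvg_EFin; first by near=> k.
  by have := fg x; rewrite -(cvg_shiftn N).
- exact: iF.
- apply: aeW => x n _; rewrite lee_fin.
  by apply: fF => /=; rewrite leq_addl.
have ig : P.-integrable setT (EFin \o g) by exact: integrable_dominated iF _.
rewrite -(fineK (integrable_fin_num measurableT ig)) => /fine_cvg; exact.
Unshelve. all: by end_near. Qed.

Lemma markov_Rintegral f (e : R) : 0 < e ->
  P.-integrable setT (EFin \o f) ->
  (P [set x | (e <= `|f x|)%R] <= ((\int[P]_x `|f x|)%R / e)%:E)%E.
Proof.
move=> e0 If.
have mf : measurable_fun setT f by apply/measurable_EFinP; exact: measurable_int If.
have mid : measurable_fun setT (@id (\bar R)) by exact: measurable_id.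
have mfE : measurable_fun setT (EFin \o f) by exact/measurable_EFinP.
have H : (e%:E * P (setT `&` [set x | e%:E <= `|(EFin \o f) x|]) <=
    \int[P]_x `|(EFin \o f) x|)%E.
  by apply: (@le_integral_comp_abse _ T R P setT measurableT (EFin \o f) e id).
rewrite EFinM muleC -[X in (X <= _)%E]mul1e.
have <- : ((e^-1)%:E * e%:E = 1)%E by rewrite -EFinM mulVf// gt_eqF.
rewrite -muleA lee_pmul2l ?lte_fin ?invr_gt0//.
move: H; rewrite setTI => /le_trans; apply.
by rewrite /Rintegral fineK//; apply: integrable_fin_num => //; exact: integrable_norm.
Qed.

End RealIntegral.

Section Independence.
Context d (T : measurableType d) (R : realType).
Variable P : probability T R.

Lemma ge0_integral_indep_pair (X Y : T -> R) :
  measurable_fun setT X -> measurable_fun setT Y -> (forall w, 0 <= Y w) ->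
  (\int[P]_w (Y w)%:E \is a fin_num)%E ->
  (forall A : set R, measurable A ->
    (\int[P]_w ((\1_A (X w))%:E * (Y w)%:E) =
     P (X @^-1` A) * \int[P]_w (Y w)%:E)%E) ->
  forall f : R -> \bar R, measurable_fun setT f -> (forall x, 0 <= f x)%E ->
    (\int[P]_w (f (X w) * (Y w)%:E) = \int[P]_w f (X w) * \int[P]_w (Y w)%:E)%E.
Proof.
move=> mX mY Y0 finY HA.
have mYE : measurable_fun setT (fun w => (Y w)%:E) by exact/measurable_EFinP.
have YE0 w : (0 <= (Y w)%:E)%E by rewrite lee_fin.
apply: measurable_nneg_ind.
- move=> A mA; rewrite HA//; congr (_ * _)%E.
  rewrite (_ : (fun w => (\1_A (X w))%:E) = (fun w => (\1_(X @^-1` A) w)%:E))//.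
  by rewrite integral_indic ?setIT// -[X in measurable X]setTI; exact: mX.
- move=> f f' c c0 mf f0 Hf mf' f'0 Hf'.
  have mfX : measurable_fun setT (fun w => f (X w)) by exact: measurableT_comp.
  have mf'X : measurable_fun setT (fun w => f' (X w)) by exact: measurableT_comp.
  have m1 : measurable_fun setT (fun w => f (X w) * (Y w)%:E)%E.
    exact: emeasurable_funM.
  have m2 : measurable_fun setT (fun w => f' (X w) * (Y w)%:E)%E.
    exact: emeasurable_funM.
  have m3 : measurable_fun setT (fun w => c%:E * (f' (X w) * (Y w)%:E))%E.
    exact: measurable_funeM.
  have m4 : measurable_fun setT (fun w => c%:E * f' (X w))%E.
    exact: measurable_funeM.
  have n1 w : [set: T] w -> (0 <= f (X w) * (Y w)%:E)%E by rewrite mule_ge0.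
  have n2 w : [set: T] w -> (0 <= f' (X w) * (Y w)%:E)%E by rewrite mule_ge0.
  have n3 w : [set: T] w -> (0 <= c%:E * (f' (X w) * (Y w)%:E))%E.
    by move=> ?; rewrite !mule_ge0.
  have n4 w : [set: T] w -> (0 <= c%:E * f' (X w))%E.
    by move=> ?; rewrite mule_ge0.
  rewrite ge0_integralD// ge0_integralZl// ge0_muleDl; last 2 first.
  + by rewrite integral_ge0.
  + by rewrite mule_ge0// integral_ge0.
  rewrite -muleA -Hf -Hf' -ge0_integralZl// -ge0_integralD//.
  by apply: eq_integral => w _; rewrite ge0_muleDl ?mule_ge0// muleA.
- move=> f_ f mf_ f_0 Hf_ nd cvf.
  have L : (\int[P]_w f_ n (X w) @[n --> \oo] --> \int[P]_w f (X w))%E.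
    have -> : (\int[P]_w f (X w) = \int[P]_w limn (fun n => f_ n (X w)))%E.
      by apply: eq_integral => x _; apply/esym/cvg_lim => //; exact: cvf.
    apply: cvg_monotone_convergence => //.
    + by move=> n; exact: measurableT_comp.
  have L' : (\int[P]_w (f_ n (X w) * (Y w)%:E) @[n --> \oo] -->
       \int[P]_w (f (X w) * (Y w)%:E))%E.
    have -> : (\int[P]_w (f (X w) * (Y w)%:E) =
        \int[P]_w limn (fun n => f_ n (X w) * (Y w)%:E))%E.
      apply: eq_integral => w _; apply/esym/cvg_lim => //.
      by apply: cvgeZr => //; exact: cvf.
    apply: cvg_monotone_convergence => //.
    + by move=> n; apply: emeasurable_funM => //; exact: measurableT_comp.
    + by move=> n x _; rewrite mule_ge0.
    + by move=> x _ m n mn; rewrite lee_wpmul2r// nd.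
  have L'' : (\int[P]_w (f_ n (X w) * (Y w)%:E) @[n --> \oo] -->
       \int[P]_w f (X w) * \int[P]_w (Y w)%:E)%E.
    under eq_fun do rewrite Hf_.
    exact: cvgeZr.
  by rewrite -(cvg_lim _ L')// -(cvg_lim _ L'')//.
Qed.

Variables (I : eqType) (X : I -> T -> R).
Hypothesis mX : forall i, measurable_fun setT (X i).
Hypothesis indX : mutually_independent P X.

Let upd (f : I -> R -> R) j g i : R -> R := if i == j then g else f i.

Lemma upd_notin U (F : I -> (R -> R) -> U) f j g (op : U -> U -> U) idx s : j \notin s ->
  \big[op/idx]_(i <- s) F i (upd f j g i) = \big[op/idx]_(i <- s) F i (f i).
Proof.
move=> js; apply: eq_big_seq => i ins; rewrite /upd ifN//.
by apply: contra js => /eqP <-.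
Qed.

Lemma prod_indic s (B : I -> set R) w :
  \prod_(i <- s) \1_(B i) (X i w) =
    \1_(\bigcap_(i in [set` s]) (X i @^-1` B i)) w :> R.
Proof.
rewrite [RHS]indicE; have [H|] := pselect ((\bigcap_(i in [set` s]) (X i @^-1` B i)) w).
  rewrite mem_set//; apply: big1_seq => i /= ins; rewrite indicE mem_set//.
  by apply: H.
move=> H; rewrite memNset//; apply/eqP; rewrite prodf_seq_eq0; apply/hasP.
move/existsNP: H => [i] /not_implyP[/= ins nB]; exists i => //=.
by rewrite indicE memNset.
Qed.

Lemma ge0_integral_prod_indep s1 s2 (f : I -> R -> R) (B : I -> set R) (M : I -> R) :
  uniq (s1 ++ s2) ->
  (forall i, measurable_fun setT (f i)) -> (forall i x, 0 <= f i x <= M i) ->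
  (forall i, measurable (B i)) ->
  (\int[P]_w ((\prod_(i <- s1) f i (X i w)) *
               (\prod_(i <- s2) \1_(B i) (X i w)))%:E =
   \prod_(i <- s1) (\int[P]_w (f i (X i w))%:E) *
   \prod_(i <- s2) P (X i @^-1` B i))%E.
Proof.
elim: s1 s2 B => [|j s1 IH] s2 B us mf fM mB.
  rewrite big_nil mul1e -indX//.
  have E : (fun w => \prod_(i <- [::]) f i (X i w) *
      \prod_(i <- s2) \1_(B i) (X i w)) =
      \1_(\bigcap_(i in [set` s2]) (X i @^-1` B i)) :> (T -> R).
    by apply/funext => w; rewrite big_nil mul1r prod_indic.
  under eq_integral do rewrite (congr1 (@^~ _) E).
  rewrite integral_indic ?setIT//; apply/(@measurable_indicP _ T R); rewrite -E.
  apply: measurable_funM; apply: measurable_prod => i _; first exact: measurableT_comp.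
  by apply: measurableT_comp => //; exact: measurable_indic.
have j12 : j \notin s1 ++ s2 by move: us => /= /andP[].
have js1 : j \notin s1 by move: j12; rewrite mem_cat negb_or => /andP[].
have js2 : j \notin s2 by move: j12; rewrite mem_cat negb_or => /andP[].
have u12 : uniq (s1 ++ s2) by move: us => /= /andP[].
have u1j2 : uniq (s1 ++ j :: s2).
  by rewrite uniq_catC cat_cons /= mem_cat orbC -mem_cat j12 uniq_catC.
pose Y w := \prod_(i <- s1) f i (X i w) * \prod_(i <- s2) \1_(B i) (X i w).
have mY : measurable_fun setT Y.
  apply: measurable_funM; apply: measurable_prod => i _.
    exact: measurableT_comp.
  by apply: measurableT_comp => //; exact: measurable_indic.
have Y0 w : 0 <= Y w.
  apply: mulr_ge0; apply: prodr_ge0 => i _; last by rewrite indicE.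
  by have /andP[] := fM i (X i w).
have YI := IH s2 B u12 mf fM mB.
have fE i : (\int[P]_w (f i (X i w))%:E)%E \is a fin_num.
  apply: integrable_fin_num => //; apply: (@integrable_bounded _ _ _ P _ (M i)).
    exact: measurableT_comp.
  by move=> w; have /andP[? ?] := fM i (X i w); rewrite ger0_norm.
rewrite [RHS](_ : _ = \int[P]_w (f j (X j w))%:E * \int[P]_w (Y w)%:E)%E; last first.
  by rewrite YI big_cons muleA.
have finY : (\int[P]_w (Y w)%:E)%E \is a fin_num.
  rewrite YI; apply: fin_numM.
    by apply: prode_fin_num => i _.
  apply: prode_fin_num => i _; apply: fin_num_measure.
  by rewrite -[X in measurable X]setTI; exact: mX.
have HA A : measurable A -> (\int[P]_w ((\1_A (X j w))%:E * (Y w)%:E) =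
    P (X j @^-1` A) * \int[P]_w (Y w)%:E)%E.
  move=> mA; pose B' i := if i == j then A else B i.
  have mB' i : measurable (B' i) by rewrite /B'; case: ifP.
  have := IH (j :: s2) B' u1j2 mf fM mB'.
  rewrite !big_cons.
  under eq_integral do rewrite big_cons.
  have -> : B' j = A by rewrite /B' eqxx.
  have -> : (\prod_(i <- s2) P (X i @^-1` B' i) = \prod_(i <- s2) P (X i @^-1` B i))%E.
    by apply: eq_big_seq => i ins; rewrite /B' ifN//; apply: contra js2 => /eqP <-.
  move=> H; rewrite YI muleCA -H.
  apply: eq_integral => w _; rewrite -EFinM mulrCA; congr (_ * (_ * _))%:E.
  by apply: eq_big_seq => i ins; rewrite /B' ifN//; apply: contra js2 => /eqP <-.
have mfj : measurable_fun setT (fun x => (f j x)%:E) by exact/measurable_EFinP.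
have fj0 x : (0 <= (f j x)%:E)%E by rewrite lee_fin; have /andP[] := fM j x.
rewrite -(ge0_integral_indep_pair (mX j) mY Y0 finY HA mfj fj0).
by apply: eq_integral => w _; rewrite big_cons -mulrA EFinM.
Qed.

Lemma Rintegral_prod_indep s1 s2 (f : I -> R -> R) (M : I -> R) :
  uniq (s1 ++ s2) ->
  (forall i, measurable_fun setT (f i)) -> (forall i x, `|f i x| <= M i) ->
  (forall i x, i \in s2 -> 0 <= f i x) ->
  \int[P]_w (\prod_(i <- s1 ++ s2) f i (X i w)) =
   \prod_(i <- s1 ++ s2) (\int[P]_w f i (X i w)).
Proof.
elim: s1 s2 f M => [|j s1 IH] s2 f M us mf fM f0.
  rewrite cat0s in us *.
  pose f' i x := if i \in s2 then f i x else 0.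
  have mf' i : measurable_fun setT (f' i) by rewrite /f'; case: (i \in s2).
  have f'M i x : 0 <= f' i x <= `|M i|.
    rewrite /f'; case: ifPn => [ins|_]; last by rewrite lexx normr_ge0.
    apply/andP; split; first exact: f0.
    by rewrite (le_trans (ler_norm _))// (le_trans (fM i x))// ler_norm.
  have us' : uniq (s2 ++ [::]) by rewrite cats0.
  have := @ge0_integral_prod_indep s2 [::] f' (fun _ => setT) _ us' mf' f'M
    (fun _ => measurableT).
  rewrite big_nil mule1 => H.
  transitivity (\int[P]_w \prod_(i <- s2) f' i (X i w)).
    apply: eq_Rintegral => w _; apply: eq_big_seq => i ins.
    by rewrite /f' ins.
  transitivity (fine (\prod_(i <- s2) (\int[P]_w f' i (X i w))%:E)%E); last first.
    rewrite prodEFin /=; apply: eq_big_seq => i ins; apply: eq_Rintegral => w _.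
    by rewrite /f' ins.
  rewrite /Rintegral; congr fine.
  transitivity (\int[P]_w (\prod_(i <- s2) f' i (X i w) *
      \prod_(i <- [::]) \1_[set: R] (X i w))%:E)%E.
    by apply: eq_integral => w _; rewrite big_nil mulr1.
  rewrite H; apply: eq_bigr => i _; rewrite fineK//.
  apply: integrable_fin_num => //; apply: (@integrable_bounded _ _ _ P _ `|M i|).
    exact: measurableT_comp.
  by move=> w; have /andP[? ?] := f'M i (X i w); rewrite ger0_norm.
have j12 : j \notin s1 ++ s2 by move: us => /= /andP[].
have u12 : uniq (s1 ++ s2) by move: us => /= /andP[].
have u1j2 : uniq (s1 ++ j :: s2).
  by rewrite uniq_catC cat_cons /= mem_cat orbC -mem_cat j12 uniq_catC.
have key (g : R -> R) : measurable_fun setT g -> (forall x, 0 <= g x <= 2 * `|M j|) ->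
    \int[P]_w (g (X j w) * \prod_(i <- s1 ++ s2) f i (X i w)) =
    \int[P]_w g (X j w) * \prod_(i <- s1 ++ s2) (\int[P]_w f i (X i w)).
  move=> mg g0.
  have := IH (j :: s2) (upd f j g) (fun i => if i == j then 2 * `|M j| else M i) u1j2.
  have H1 i : measurable_fun setT (upd f j g i) by rewrite /upd; case: ifP.
  have H2 i x : `|upd f j g i x| <= if i == j then 2 * `|M j| else M i.
    rewrite /upd; case: ifP => // _; have /andP[? ?] := g0 x.
    by rewrite ger0_norm.
  have H3 i x : i \in j :: s2 -> 0 <= upd f j g i x.
    rewrite in_cons /upd; case: ifP => /= [_ _|_]; last exact: f0.
    by have /andP[] := g0 x.
  move=> /(_ H1 H2 H3).
  have pm F : \prod_(i <- s1 ++ j :: s2) F i = F j * \prod_(i <- s1 ++ s2) F i :> R.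
    rewrite -(big_cons 1 *%R j (s1 ++ s2) xpredT); apply: perm_big.
    by rewrite -cat1s perm_catCA.
  rewrite pm /=.
  under eq_Rintegral do rewrite pm (upd_notin (fun i f => f (X i _)) f g _ _ j12).
  rewrite (upd_notin (fun i f => \int[P]_w f (X i w)) f g _ _ j12).
  by rewrite /upd eqxx.
rewrite cat_cons big_cons; under eq_Rintegral do rewrite big_cons.
have mP : measurable_fun setT (fun w => \prod_(i <- s1 ++ s2) f i (X i w)).
  by apply: measurable_prod => i _; exact: measurableT_comp.
have bP w : `|\prod_(i <- s1 ++ s2) f i (X i w)| <= \prod_(i <- s1 ++ s2) M i.
  by rewrite normr_prod; apply: ler_prod => i _; rewrite normr_ge0 fM.
have M0 i : 0 <= M i by exact: le_trans (normr_ge0 _) (fM i 0).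
have k1 := key (fun x => f j x + M j).
have k2 := key (fun x => M j) (measurable_cst _).
have mfj : measurable_fun setT (fun w => f j (X j w)) by exact: measurableT_comp.
have ifj : P.-integrable setT (EFin \o (fun w => f j (X j w))).
  by apply: (@integrable_bounded _ _ _ P _ (M j)).
have iM : P.-integrable setT (EFin \o (fun w : T => M j)).
  by apply: (@integrable_bounded _ _ _ P _ `|M j|).
have ifjP : P.-integrable setT (EFin \o (fun w => f j (X j w) * \prod_(i <- s1 ++ s2) f i (X i w))).
  apply: (@integrable_bounded _ _ _ P _ (M j * \prod_(i <- s1 ++ s2) M i)).
    exact: measurable_funM.
  by move=> w; rewrite normrM ler_pM.
have iMP : P.-integrable setT (EFin \o (fun w => M j * \prod_(i <- s1 ++ s2) f i (X i w))).
  apply: (@integrable_bounded _ _ _ P _ (M j * \prod_(i <- s1 ++ s2) M i)).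
    exact: measurable_funM.
  by move=> w; rewrite normrM ler_pM// ger0_norm.
move: k1 k2; under eq_Rintegral do rewrite mulrDl.
rewrite !RintegralD// mulrDl => k1 k2.
apply: (addIr (\int[P]_w (M j * \prod_(i <- s1 ++ s2) f i (X i w)))).
rewrite k1.
- rewrite k2; first exact: mulrDl.
  by move=> _; rewrite M0 /= !mul1r ger0_norm// lerDl.
- by apply: measurable_funD => //; exact: measurable_cst.
- move=> x; clear k1 k2; have := fM j x; rewrite ler_norml => /andP[]; rewrite (ger0_norm (M0 j)).
  by move=> ? ?; apply/andP; split; lra.
Qed.

Variable phi : I -> R -> R.
Hypothesis mphi : forall i, measurable_fun setT (phi i).

Lemma measurable_sum_indep s (a : R) :
  measurable_fun setT (fun w => \sum_(i <- s) phi i (X i w) + a).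
Proof.
apply: measurable_funD => //; apply: measurable_sum => i.
exact: measurableT_comp.
Qed.

Let mcos (Z : T -> R) : measurable_fun setT Z -> measurable_fun setT (fun w => cos (Z w)).
Proof.
move=> mZ; apply: measurableT_comp => //.
apply: continuous_measurable_fun; exact: continuous_cos.
Qed.

Let msin (Z : T -> R) : measurable_fun setT Z -> measurable_fun setT (fun w => sin (Z w)).
Proof.
move=> mZ; apply: measurableT_comp => //.
apply: continuous_measurable_fun; exact: continuous_sin.
Qed.

Let C s a := \int[P]_w cos (\sum_(i <- s) phi i (X i w) + a).

Lemma Rintegral_prod_cos_indep s' s0 (f : I -> R -> R) (M : I -> R) a :
  uniq (s0 ++ s') ->
  (forall i, measurable_fun setT (f i)) -> (forall i x, `|f i x| <= M i) ->
  \int[P]_w (\prod_(i <- s0) f i (X i w) *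
    cos (\sum_(i <- s') phi i (X i w) + a)) =
  (\prod_(i <- s0) \int[P]_w f i (X i w)) * C s' a.
Proof.
elim: s' s0 f M a => [|j s' IH] s0 f M a us mf fM.
  rewrite /C; under eq_Rintegral do rewrite big_nil add0r.
  under [in RHS]eq_Rintegral do rewrite big_nil add0r.
  rewrite Rintegral_const RintegralZr//; last first.
    apply: (@integrable_bounded _ _ _ P _ (\prod_(i <- s0) M i)).
      by apply: measurable_prod => i _; exact: measurableT_comp.
    by move=> w; rewrite normr_prod; apply: ler_prod => i _; rewrite normr_ge0 fM.
  congr (_ * _); have := @Rintegral_prod_indep s0 [::] f M; rewrite cats0; apply => //.
  by rewrite cats0 in us.
have us' : uniq ((j :: s0) ++ s').
  by rewrite -cat1s -catA uniq_catCA.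
have j0 : j \notin s0 by move: us' => /= /andP[]; rewrite mem_cat negb_or => /andP[].
have uj : uniq (j :: s') by move: us; rewrite cat_uniq => /and3P[].
have step s1 (f1 : I -> R -> R) (M1 : I -> R) : j \notin s1 -> uniq ((j :: s1) ++ s') ->
  (forall i, measurable_fun setT (f1 i)) -> (forall i x, `|f1 i x| <= M1 i) ->
  \int[P]_w (\prod_(i <- s1) f1 i (X i w) *
    cos (\sum_(i <- j :: s') phi i (X i w) + a)) =
  (\prod_(i <- s1) \int[P]_w f1 i (X i w)) *
  (\int[P]_w cos (phi j (X j w)) * C s' a -
   \int[P]_w sin (phi j (X j w)) * C s' (a - pi / 2)).
  move=> j1 u1 mf1 fM1.
  pose M' i := if i == j then 1 else M1 i.
  have H (g : R -> R) b : measurable_fun setT g -> (forall x, `|g x| <= 1) ->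
    \int[P]_w (g (X j w) * (\prod_(i <- s1) f1 i (X i w) *
      cos (\sum_(i <- s') phi i (X i w) + b))) =
    \int[P]_w g (X j w) * (\prod_(i <- s1) \int[P]_w f1 i (X i w)) * C s' b.
    move=> mg g1.
    have := IH (j :: s1) (upd f1 j g) M' b u1.
    have H1 i : measurable_fun setT (upd f1 j g i) by rewrite /upd; case: ifP.
    have H2 i x : `|upd f1 j g i x| <= M' i by rewrite /upd /M'; case: ifP.
    move=> /(_ H1 H2); rewrite big_cons.
    rewrite (upd_notin (fun i f => \int[P]_w f (X i w)) f1 g _ _ j1).
    under eq_Rintegral do rewrite big_cons (upd_notin (fun i f => f (X i _)) f1 g _ _ j1) -mulrA.
    by rewrite /upd eqxx.
  have mS b : measurable_fun setT (fun w => \prod_(i <- s1) f1 i (X i w) *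
      cos (\sum_(i <- s') phi i (X i w) + b)).
    apply: measurable_funM.
      by apply: measurable_prod => i _; exact: measurableT_comp.
    exact/mcos/measurable_sum_indep.
  have bS b w : `|\prod_(i <- s1) f1 i (X i w) *
      cos (\sum_(i <- s') phi i (X i w) + b)| <= \prod_(i <- s1) M1 i.
    rewrite normrM -[leRHS]mulr1; apply: ler_pM => //; last exact: cos_max.
    by rewrite normr_prod; apply: ler_prod => i _; rewrite normr_ge0 fM1.
  have iS (g : R -> R) b : measurable_fun setT g -> (forall x, `|g x| <= 1) ->
      P.-integrable setT (EFin \o (fun w => g (X j w) * (\prod_(i <- s1) f1 i (X i w) *
      cos (\sum_(i <- s') phi i (X i w) + b)))).
    move=> mg g1; apply: (@integrable_bounded _ _ _ P _ (1 * \prod_(i <- s1) M1 i)).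
      by apply: measurable_funM; [exact: measurableT_comp|exact: mS].
    by move=> w; rewrite normrM ler_pM.
  have mcj : measurable_fun setT (fun x : R => cos (phi j x)).
    by apply: measurableT_comp => //; apply: continuous_measurable_fun; exact: continuous_cos.
  have msj : measurable_fun setT (fun x : R => sin (phi j x)).
    by apply: measurableT_comp => //; apply: continuous_measurable_fun; exact: continuous_sin.
  transitivity (\int[P]_w (
     cos (phi j (X j w)) * (\prod_(i <- s1) f1 i (X i w) *
       cos (\sum_(i <- s') phi i (X i w) + a)) -
     sin (phi j (X j w)) * (\prod_(i <- s1) f1 i (X i w) *
       cos (\sum_(i <- s') phi i (X i w) + (a - pi / 2))))).
    apply: eq_Rintegral => w _; rewrite big_cons -addrA cosD addrA cosBpihalf.
    ring.
  rewrite RintegralB//; last 2 first.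
  - by apply: (iS (fun x => cos (phi j x))) => // x; exact: cos_max.
  - by apply: (iS (fun x => sin (phi j x))) => // x; exact: sin_max.
  rewrite (H (fun x => cos (phi j x)))//; last by move=> x; exact: cos_max.
  rewrite (H (fun x => sin (phi j x)))//; last by move=> x; exact: sin_max.
  ring.
rewrite (step s0 f M)//; congr (_ * _).
have := step [::] (fun _ _ => 0) (fun _ => 0); rewrite !big_nil mul1r => <- //.
- by apply: eq_Rintegral => w _; rewrite mul1r.
- by move=> i x; rewrite normr0.
Qed.

Lemma Rintegral_cos_cons_indep j s a : uniq (j :: s) ->
  C (j :: s) a = \int[P]_w cos (phi j (X j w)) * C s a -
                 \int[P]_w sin (phi j (X j w)) * C s (a - pi / 2).
Proof.
move=> us; rewrite {1}/C.
have H (g : R -> R) b : measurable_fun setT g -> (forall x, `|g x| <= 1) ->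
    \int[P]_w (g (X j w) * cos (\sum_(i <- s) phi i (X i w) + b)) =
    \int[P]_w g (X j w) * C s b.
  move=> mg g1.
  have := @Rintegral_prod_cos_indep s [:: j] (fun _ => g) (fun _ => 1) b us (fun _ => mg).
  rewrite big_seq1; under eq_Rintegral do rewrite big_seq1; exact.
have mcj : measurable_fun setT (fun x : R => cos (phi j x)).
  by apply: measurableT_comp => //; apply: continuous_measurable_fun; exact: continuous_cos.
have msj : measurable_fun setT (fun x : R => sin (phi j x)).
  by apply: measurableT_comp => //; apply: continuous_measurable_fun; exact: continuous_sin.
have iS (g : R -> R) b : measurable_fun setT g -> (forall x, `|g x| <= 1) ->
    P.-integrable setT (EFin \o (fun w => g (X j w) *
      cos (\sum_(i <- s) phi i (X i w) + b))).
  move=> mg g1; apply: (@integrable_bounded _ _ _ P _ (1 * 1)).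
    apply: measurable_funM; first exact: measurableT_comp.
    exact/mcos/measurable_sum_indep.
  by move=> w; rewrite normrM ler_pM// cos_max.
rewrite -(H (fun x => cos (phi j x)))//; last by move=> x; exact: cos_max.
rewrite -(H (fun x => sin (phi j x)))//; last by move=> x; exact: sin_max.
rewrite -RintegralB//; last 2 first.
- by apply: (iS (fun x => cos (phi j x))) => // x; exact: cos_max.
- by apply: (iS (fun x => sin (phi j x))) => // x; exact: sin_max.
apply: eq_Rintegral => w _; rewrite big_cons -addrA cosD addrA cosBpihalf.
by [].
Qed.

Lemma Rintegral_cos_sum_gauss (v : I -> R) s a : uniq s -> (forall i, 0 <= v i) ->
  `|\int[P]_w cos (\sum_(i <- s) phi i (X i w) + a) -
    expR (- (\sum_(i <- s) v i) / 2) * cos a| <=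
  \sum_(i <- s) (`|\int[P]_w cos (phi i (X i w)) - expR (- v i / 2)| +
                `|\int[P]_w sin (phi i (X i w))|).
Proof.
rewrite -/(C s a) => + v0; elim: s a => [|j s IH] a us.
  rewrite /C; under eq_Rintegral do rewrite big_nil add0r.
  by rewrite Rintegral_const !big_nil oppr0 mul0r expR0 mul1r subrr normr0.
rewrite Rintegral_cos_cons_indep// !big_cons.
have us' : uniq s by move: us => /= /andP[].
have C1 b : `|C s b| <= 1.
  have mc : measurable_fun setT (fun w => cos (\sum_(i <- s) phi i (X i w) + b)).
    exact/mcos/measurable_sum_indep.
  rewrite /C; apply: (le_trans (le_normr_Rintegral measurableT _)).
    by apply: (@integrable_bounded _ _ _ P _ 1) => // w; exact: cos_max.
  rewrite -[leRHS](Rintegral_const P); apply: le_Rintegral => //.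
  - apply: (@integrable_bounded _ _ _ P _ 1); first exact: measurableT_comp.
    by move=> w; rewrite normr_id cos_max.
  - by apply: (@integrable_bounded _ _ _ P _ `|1|).
  - by move=> w _; exact: cos_max.
have e1 : expR (- v j / 2) <= 1.
  by rewrite -[leRHS]expR0 ler_expR; have := v0 j; lra.
have e0 := expR_ge0 (- v j / 2).
have -> : expR (- (v j + \sum_(i <- s) v i) / 2) =
    expR (- v j / 2) * expR (- (\sum_(i <- s) v i) / 2).
  by rewrite -expRD; congr expR; ring.
have := IH a us'.
set A := \int[P]_w cos _; set B := \int[P]_w sin _; set E := expR (- v j / 2) in e1 e0 *.
set G := expR _ * cos a => IHa.
have -> : A * C s a - B * C s (a - pi / 2) - E * expR (- (\sum_(i <- s) v i) / 2) * cos a =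
   (A - E) * C s a + E * (C s a - G) - B * C s (a - pi / 2).
  by rewrite /G; ring.
have h1 : `|(A - E) * C s a| <= `|A - E| by rewrite normrM ler_piMr.
have h2 : `|B * C s (a - pi / 2)| <= `|B| by rewrite normrM ler_piMr.
have h3 : `|E * (C s a - G)| <= `|C s a - G|.
  by rewrite normrM ler_piMl// ger0_norm.
apply: (le_trans (ler_normB _ _)).
have := ler_normD ((A - E) * C s a) (E * (C s a - G)).
lra.
Qed.

End Independence.

Section RintegralSum.
Context d (T : measurableType d) (R : realType).
Variables (P : probability T R) (I : Type) (F : I -> T -> R).
Hypothesis IF : forall i, P.-integrable setT (EFin \o F i).

Lemma integrable_Rsum s : P.-integrable setT (EFin \o (fun w => \sum_(i <- s) F i w)).
Proof.
have := @integrable_sum _ T R P setT measurableT I s xpredT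
  (fun i w => (F i w)%:E) (fun i _ => IF i).
by apply: eq_integrable => // w _ /=; rewrite sumEFin.
Qed.

Lemma Rintegral_sum s :
  \int[P]_w (\sum_(i <- s) F i w) = \sum_(i <- s) \int[P]_w F i w.
Proof.
elim: s => [|i s IHs].
  by rewrite big_nil; under eq_Rintegral do rewrite big_nil; exact: Rintegral_const.
rewrite big_cons -IHs -RintegralD//; first by apply: eq_Rintegral => w _; rewrite big_cons.
exact: integrable_Rsum.
Qed.

End RintegralSum.

Section LawTransfer.
Context d (T : measurableType d) (R : realType).
Variables (P : probability T R) (mu : probability R R) (X : T -> R).
Hypotheses (mX : measurable_fun setT X)
  (Xmu : forall B : set R, measurable B -> P (X @^-1` B) = mu B).

Lemma ge0_integral_law (f : R -> \bar R) :
  measurable_fun setT f -> (forall x, 0 <= f x)%E ->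
  (\int[P]_w f (X w) = \int[mu]_x f x)%E.
Proof.
move: f; apply: measurable_nneg_ind.
- move=> A mA; transitivity (mu A); last by rewrite integral_indic// setIT.
  transitivity (P (X @^-1` A)); last exact: Xmu.
  rewrite (_ : (fun w => (\1_A (X w))%:E) = (fun w => (\1_(X @^-1` A) w)%:E))//.
  by rewrite integral_indic ?setIT// -[X in measurable X]setTI; exact: mX.
- move=> f f' c c0 mf f0 Hf mf' f'0 Hf'.
  have mfX : measurable_fun setT (fun w => f (X w)) by exact: measurableT_comp.
  have mf'X : measurable_fun setT (fun w => f' (X w)) by exact: measurableT_comp.
  have m4 : measurable_fun setT (fun w => c%:E * f' (X w))%E.
    exact: measurable_funeM.
  have m5 : measurable_fun setT (fun x => c%:E * f' x)%E.
    exact: measurable_funeM.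
  have n4 w : [set: T] w -> (0 <= c%:E * f' (X w))%E.
    by move=> ?; rewrite mule_ge0.
  have n5 x : [set: R] x -> (0 <= c%:E * f' x)%E.
    by move=> ?; rewrite mule_ge0.
  by rewrite !ge0_integralD// !ge0_integralZl// Hf Hf'.
- move=> f_ f mf_ f_0 Hf_ nd cvf.
  have L : (\int[P]_w f_ n (X w) @[n --> \oo] --> \int[P]_w f (X w))%E.
    have -> : (\int[P]_w f (X w) = \int[P]_w limn (fun n => f_ n (X w)))%E.
      by apply: eq_integral => x _; apply/esym/cvg_lim => //; exact: cvf.
    apply: cvg_monotone_convergence => //.
    by move=> n; exact: measurableT_comp.
  have L' : (\int[mu]_w f_ n w @[n --> \oo] --> \int[mu]_w f w)%E.
    have -> : (\int[mu]_w f w = \int[mu]_w limn (fun n => f_ n w))%E.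
      by apply: eq_integral => x _; apply/esym/cvg_lim => //; exact: cvf.
    exact: cvg_monotone_convergence.
  rewrite -(cvg_lim _ L)// -(cvg_lim _ L')//.
  by congr (limn _); apply/funext => n.
Qed.

Lemma integrable_law (f : R -> R) :
  mu.-integrable setT (EFin \o f) -> P.-integrable setT (EFin \o (fun w => f (X w))).
Proof.
move=> If; have mf : measurable_fun setT f by apply/measurable_EFinP; exact: measurable_int If.
move/integrableP : If => [_ If]; apply/integrableP; split.
  by apply/measurable_EFinP; exact: measurableT_comp.
have := @ge0_integral_law (fun x => `|(f x)%:E|%E).
move=> /(_ _ _)-> //; apply/measurable_EFinP; exact: measurableT_comp.
Qed.

Lemma Rintegral_law (f : R -> R) : measurable_fun setT f ->
  \int[P]_w f (X w) = \int[mu]_x f x.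
Proof.
move=> mf; rewrite /Rintegral; congr fine.
have mfE : measurable_fun setT (fun x => (f x)%:E) by exact/measurable_EFinP.
rewrite integralE [RHS]integralE; congr (_ - _)%E.
- transitivity (\int[P]_w (fun x : R => (f x)%:E)^\+ (X w))%E.
    by apply: eq_integral => w _; rewrite !funeposE.
  apply: ge0_integral_law; last by move=> x; exact: funepos_ge0.
  exact: measurable_funepos.
- transitivity (\int[P]_w (fun x : R => (f x)%:E)^\- (X w))%E.
    by apply: eq_integral => w _; rewrite !funenegE.
  apply: ge0_integral_law; last by move=> x; exact: funeneg_ge0.
  exact: measurable_funeneg.
Qed.

End LawTransfer.

Section SecondMoment.
Context d (T : measurableType d) (R : realType).
Variable P : probability T R.
Variables (I : eqType) (X : I -> T -> R).
Hypothesis mX : forall i, measurable_fun setT (X i).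
Hypothesis indX : mutually_independent P X.
Variable phi : I -> R -> R.
Hypothesis mphi : forall i, measurable_fun setT (phi i).

Definition clip (M : R) (x : R) : R := Num.max (- M) (Num.min M x).

Lemma measurable_clip M : measurable_fun setT (clip M).
Proof.
apply: measurable_maxr => //; apply: measurable_minr => //.
Qed.

Lemma clip_bound M x : 0 <= M -> `|clip M x| <= M.
Proof.
move=> M0; rewrite ler_norml /clip ge_max le_max ge_min !lexx/=; lra.
Qed.

Lemma clip_id M x : `|x| <= M -> clip M x = x.
Proof.
rewrite ler_norml => /andP[Mx xM]; rewrite /clip min_r// max_r//.
Qed.

Lemma norm_clip_le M x : 0 <= M -> `|clip M x| <= `|x|.
Proof.
move=> M0; have [xM|xM] := leP `|x| M; first by rewrite clip_id.
by rewrite (le_trans (clip_bound _ M0))// ltW.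
Qed.

Lemma cvg_clip x : clip n%:R x @[n --> \oo] --> x.
Proof.
apply: cvg_near_cst; near=> n; apply: clip_id.
near: n; exact: nbhs_infty_ger.
Unshelve. all: by end_near. Qed.

Lemma Rintegral_mul_indep i j : i != j ->
  P.-integrable setT (EFin \o (fun w => phi i (X i w) ^+ 2)) ->
  P.-integrable setT (EFin \o (fun w => phi j (X j w) ^+ 2)) ->
  \int[P]_w (phi i (X i w) * phi j (X j w)) =
  \int[P]_w phi i (X i w) * \int[P]_w phi j (X j w).
Proof.
move=> ij Ii Ij.
have mphiX k : measurable_fun setT (fun w => phi k (X k w)) by exact: measurableT_comp.
have mc n k : measurable_fun setT (fun w => clip n%:R (phi k (X k w))).
  by apply: measurableT_comp => //; exact: measurable_clip.
have I1 k : P.-integrable setT (EFin \o (fun w => phi k (X k w) ^+ 2)) ->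
    P.-integrable setT (EFin \o (fun w => 1 + phi k (X k w) ^+ 2)).
  move=> Ik; have : P.-integrable setT (EFin \o (fun _ : T => 1 : R)).
    by apply: (@integrable_bounded _ _ _ P _ `|1|).
  by move=> /(integrableD measurableT)/(_ Ik); apply: eq_integrable.
have sq1 (x : R) : `|x| <= 1 + x ^+ 2.
  rewrite -real_normK ?num_real//; have := normr_ge0 x; nra.
have L1 k : P.-integrable setT (EFin \o (fun w => phi k (X k w) ^+ 2)) ->
    \int[P]_w clip n%:R (phi k (X k w)) @[n --> \oo] --> \int[P]_w phi k (X k w).
  move=> /I1 Ik; apply: (Rintegral_dominated_cvg _ _ Ik).
  - by move=> n; exact: mc.
  - by move=> w; exact: cvg_clip.
  - by apply: nearW => n w; rewrite (le_trans (norm_clip_le _ _)).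
have L2 : \int[P]_w (clip n%:R (phi i (X i w)) * clip n%:R (phi j (X j w)))
    @[n --> \oo] --> \int[P]_w (phi i (X i w) * phi j (X j w)).
  have Iij : P.-integrable setT (EFin \o (fun w => phi i (X i w) ^+ 2 + phi j (X j w) ^+ 2)).
    by have := integrableD measurableT Ii Ij; apply: eq_integrable.
  apply: (Rintegral_dominated_cvg _ _ Iij).
  - by move=> n; exact: measurable_funM.
  - by move=> w; apply: cvgM; exact: cvg_clip.
  - apply: nearW => n w; rewrite normrM.
    apply: (@le_trans _ _ (`|phi i (X i w)| * `|phi j (X j w)|)).
      by apply: ler_pM => //; exact: norm_clip_le.
    rewrite -(real_normK (num_real (phi i (X i w)))) -(real_normK (num_real (phi j (X j w)))).
    have := normr_ge0 (phi i (X i w)); have := normr_ge0 (phi j (X j w)); nra.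
have := cvgM (L1 _ Ii) (L1 _ Ij).
have -> : ((fun n => \int[P]_w clip n%:R (phi i (X i w))) \*
    (fun n => \int[P]_w clip n%:R (phi j (X j w)))) =
    (fun n => \int[P]_w (clip n%:R (phi i (X i w)) * clip n%:R (phi j (X j w)))).
  apply/funext => n /=.
  have := @Rintegral_prod_indep _ T R P I X mX indX [:: i; j] [::]
    (fun k x => clip n%:R (phi k x)) (fun _ => n%:R).
  rewrite /= !big_cons !big_nil mulr1 => <-//.
  - by apply: eq_Rintegral => w _; rewrite !big_cons big_nil mulr1.
  - by rewrite inE ij.
  - by move=> k; apply: measurableT_comp => //; exact: measurable_clip.
  - by move=> k x; exact: clip_bound.
by move=> L3; have {}L3 := L3 _; rewrite -(cvg_lim _ L2)// -(cvg_lim _ (L3 _))//.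
Qed.

Lemma Rintegral_sqr_sum_indep s : uniq s ->
  (forall i, P.-integrable setT (EFin \o (fun w => phi i (X i w) ^+ 2))) ->
  (forall i, \int[P]_w phi i (X i w) = 0) ->
  P.-integrable setT (EFin \o (fun w => (\sum_(i <- s) phi i (X i w)) ^+ 2)) /\
  \int[P]_w (\sum_(i <- s) phi i (X i w)) ^+ 2 =
    \sum_(i <- s) \int[P]_w (phi i (X i w) ^+ 2).
Proof.
move=> us I2 E0.
have mphiX k : measurable_fun setT (fun w => phi k (X k w)) by exact: measurableT_comp.
have Iij i j : P.-integrable setT (EFin \o (fun w => phi i (X i w) * phi j (X j w))).
  have Iij : P.-integrable setT (EFin \o (fun w => phi i (X i w) ^+ 2 + phi j (X j w) ^+ 2)).
    by have := integrableD measurableT (I2 i) (I2 j); apply: eq_integrable.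
  apply: (integrable_dominated _ Iij); first exact: measurable_funM.
  move=> w; rewrite normrM.
  rewrite -(real_normK (num_real (phi i (X i w)))) -(real_normK (num_real (phi j (X j w)))).
  have := normr_ge0 (phi i (X i w)); have := normr_ge0 (phi j (X j w)); nra.
elim: s us => [|j s IH] us.
  split; last first.
    rewrite big_nil; under eq_Rintegral do rewrite big_nil expr0n/=.
    exact: Rintegral_const.
  have : P.-integrable setT (EFin \o (fun _ : T => 0 : R)).
    apply: (@integrable_bounded _ _ _ P _ 0) => [|w]; first exact: measurable_cst.
    by rewrite normr0.
  by apply: eq_integrable => // w _ /=; rewrite big_nil expr0n.
have us' : uniq s by move: us => /= /andP[].
have js : j \notin s by move: us => /= /andP[].
have [IS ES] := IH us'.
pose c w := \sum_(i <- s) (phi j (X j w) * phi i (X i w)).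
have Ic : P.-integrable setT (EFin \o c) by exact: integrable_Rsum.
have E w : (\sum_(i <- j :: s) phi i (X i w)) ^+ 2 =
    phi j (X j w) ^+ 2 + (2 * c w + (\sum_(i <- s) phi i (X i w)) ^+ 2).
  by rewrite big_cons /c -mulr_sumr; ring.
have I2c : P.-integrable setT (EFin \o (fun w => 2 * c w)).
  by have := integrableZl measurableT 2 Ic; apply: eq_integrable.
have Ics : P.-integrable setT (EFin \o (fun w => 2 * c w + (\sum_(i <- s) phi i (X i w)) ^+ 2)).
  by have := integrableD measurableT I2c IS; apply: eq_integrable.
split.
  have := integrableD measurableT (I2 j) Ics; apply: eq_integrable => // w _ /=.
  by rewrite E.
under eq_Rintegral do rewrite E.
rewrite RintegralD// RintegralD// RintegralZl// ES big_cons.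
suff -> : \int[P]_w c w = 0 by rewrite mulr0 add0r.
transitivity (\sum_(i <- s) \int[P]_w (phi j (X j w) * phi i (X i w))).
  exact: Rintegral_sum.
apply: big1_seq => i /= ins; rewrite Rintegral_mul_indep// ?E0 ?mul0r//.
by apply: contra js => /eqP ->.
Qed.

End SecondMoment.
Section LawOfLargeNumbers.
Context d (T : measurableType d) (R : realType).
Variable P : probability T R.

Lemma mutually_independent_comp (I J : eqType) (X : I -> T -> R) (e : J -> I) :
  injective e -> mutually_independent P X ->
  mutually_independent P (fun j => X (e j)).
Proof.
move=> ie indX s B us mB.
pose B' i := if ohead [seq j <- s | e j == i] is Some j then B j else setT.
have B'e j : j \in s -> B' (e j) = B j.
  move=> js; rewrite /B'; case E : [seq j' <- s | e j' == e j] => [|j' s'] /=.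
    have : j \in [seq j' <- s | e j' == e j] by rewrite mem_filter eqxx.
    by rewrite E.
  have : j' \in [seq j' <- s | e j' == e j] by rewrite E mem_head.
  by rewrite mem_filter => /andP[/eqP /ie ->].
have mB' i : measurable (B' i).
  by rewrite /B'; case: (ohead _) => [j|]; [exact: mB|exact: measurableT].
have := indX (map e s) B'; rewrite map_inj_uniq// => /(_ us mB').
rewrite big_map => H.
transitivity (P (\bigcap_(i in [set` map e s]) (X i @^-1` B' i))).
  congr (P _); apply/seteqP; split => w H1.
    by move=> i /= /mapP[j js ->]; rewrite B'e//; exact: H1.
  move=> j /= js; have := H1 (e j); rewrite /= B'e//; apply.
  by apply/mapP; exists j.
by rewrite H; apply: eq_big_seq => j js; rewrite B'e.
Qed.

Variables (X : nat -> T -> R) (mu : probability R R).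
Hypothesis mX : forall i, measurable_fun setT (X i).
Hypothesis indX : mutually_independent P X.
Hypothesis Xmu : forall j (B : set R), measurable B -> P (X j @^-1` B) = mu B.

Lemma lln_bounded (g : R -> R) (M e : R) n :
  measurable_fun setT g -> (forall x, `|g x| <= M) -> 0 < e -> (0 < n)%N ->
  \int[P]_w `|(\sum_(j < n) g (X j w)) / n%:R - \int[mu]_x g x| <=
    e + 4 * M ^+ 2 / (n%:R * e).
Proof.
move=> mg gM e0 n0; set m := \int[mu]_x g x.
have M0 : 0 <= M by exact: le_trans (normr_ge0 _) (gM 0).
have Ig : mu.-integrable setT (EFin \o g) by exact: integrable_bounded gM.
have IgX j : P.-integrable setT (EFin \o (fun w => g (X j w))).
  by apply: (@integrable_bounded _ _ _ P _ M) => //; exact: measurableT_comp.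
have mM : `|m| <= M.
  rewrite /m; apply: (le_trans (le_normr_Rintegral measurableT _)) => //.
  rewrite -[leRHS](Rintegral_const mu); apply: le_Rintegral => //.
  - by apply: (@integrable_bounded _ _ _ mu _ M); [exact: measurableT_comp|move=> x; rewrite normr_id].
  - by apply: (@integrable_bounded _ _ _ mu _ `|M|).
pose xi x := g x - m.
have mxi : measurable_fun setT xi by exact: measurable_funB.
have xiM x : `|xi x| <= 2 * M.
  by rewrite /xi (le_trans (ler_normB _ _))//; have := gM x; lra.
have mxiX j : measurable_fun setT (fun w => xi (X j w)) by exact: measurableT_comp.
have Ixi2 j : P.-integrable setT (EFin \o (fun w => xi (X j w) ^+ 2)).
  apply: (@integrable_bounded _ _ _ P _ ((2 * M) ^+ 2)).
    exact: measurable_funX.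
  by move=> w; rewrite normrX lerXn2r ?nnegrE//; lra.
have Exi j : \int[P]_w xi (X j w) = 0.
  rewrite /xi RintegralB//; last by apply: (@integrable_bounded _ _ _ P _ `|m|).
  by rewrite (Rintegral_law (mX j) (Xmu j))// Rintegral_const /m subrr.
have [I2 E2] := @Rintegral_sqr_sum_indep _ T R P nat X mX indX (fun _ => xi)
  (fun _ => mxi) (iota 0 n) (iota_uniq 0 n) Ixi2 Exi.
have sE (F : nat -> R) : \sum_(j < n) F j = \sum_(j <- iota 0 n) F j.
  by rewrite -(big_mkord xpredT) /index_iota subn0.
pose S w := \sum_(j <- iota 0 n) xi (X j w).
have nR : 0 < n%:R :> R by rewrite ltr0n.
have SE w : (\sum_(j < n) g (X j w)) / n%:R - m = S w / n%:R.
  rewrite /S -sE /xi big_split/= sumr_const card_ord mulrDl; congr (_ + _).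
  by rewrite -mulr_natr; field; rewrite gt_eqF.
have ES : \int[P]_w (S w ^+ 2) <= n%:R * (4 * M ^+ 2).
  rewrite E2; apply: (@le_trans _ _ (\sum_(j <- iota 0 n) (4 * M ^+ 2))).
    apply: ler_sum => j _.
    rewrite -[leRHS](Rintegral_const P); apply: le_Rintegral => //.
      by apply: (@integrable_bounded _ _ _ P _ `|4 * M ^+ 2|).
    move=> w _; rewrite -(real_normK (num_real (xi _))).
    have -> : 4 * M ^+ 2 = (2 * M) ^+ 2 by ring.
    by rewrite lerXn2r ?nnegrE//; lra.
  by rewrite -sE sumr_const card_ord -[leLHS]mulr_natl.
have IS2 : P.-integrable setT (EFin \o (fun w => (n%:R ^+ 2 * e)^-1 * S w ^+ 2)).
  by have := integrableZl measurableT ((n%:R ^+ 2 * e)^-1) I2; apply: eq_integrable.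
have Ie : P.-integrable setT (EFin \o (fun _ : T => e)).
  by apply: (@integrable_bounded _ _ _ P _ `|e|).
have IeS : P.-integrable setT (EFin \o (fun w => e + (n%:R ^+ 2 * e)^-1 * S w ^+ 2)).
  by have := integrableD measurableT Ie IS2; apply: eq_integrable.
have mS : measurable_fun setT S by apply: measurable_sum => j.
apply: (@le_trans _ _ (\int[P]_w (e + (n%:R ^+ 2 * e)^-1 * S w ^+ 2))).
  have le w : `|(\sum_(j < n) g (X j w)) / n%:R - m| <= e + (n%:R ^+ 2 * e)^-1 * S w ^+ 2.
    rewrite SE; have -> : (n%:R ^+ 2 * e)^-1 * S w ^+ 2 = `|S w / n%:R| ^+ 2 / e.
      rewrite real_normK ?num_real//; field.
      by rewrite !gt_eqF.
    have z0 := normr_ge0 (S w / n%:R); move: (`|_|) z0 => z z0.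
    rewrite -(ler_pM2r e0) mulrDl divfK ?gt_eqF//; nra.
  apply: le_Rintegral => //; apply: (integrable_dominated _ IeS).
    apply: measurableT_comp => //.
    rewrite (_ : (fun w => _) = (fun w => S w / n%:R)); last exact/funext.
    exact: measurable_funM.
  by move=> w; rewrite normr_id.
rewrite RintegralD// Rintegral_const RintegralZl// lerD2l.
have -> : 4 * M ^+ 2 / (n%:R * e) = (n%:R ^+ 2 * e)^-1 * (n%:R * (4 * M ^+ 2)).
  by field; rewrite !gt_eqF.
by rewrite ler_pM2l// invr_gt0 mulr_gt0// exprn_gt0.
Qed.

Lemma Rintegral_avg_le (g : R -> R) n : (0 < n)%N ->
  mu.-integrable setT (EFin \o g) ->
  P.-integrable setT (EFin \o (fun w => (\sum_(j < n) g (X j w)) / n%:R)) /\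
  \int[P]_w `|(\sum_(j < n) g (X j w)) / n%:R| <= \int[mu]_x `|g x|.
Proof.
move=> n0 Ig.
have mg : measurable_fun setT g by apply/measurable_EFinP; exact: measurable_int Ig.
have IgX (j : 'I_n) := integrable_law (mX j) (Xmu j) Ig.
have Ign : mu.-integrable setT (EFin \o (fun x => `|g x|)) by exact: integrable_norm.
have IgnX (j : 'I_n) := integrable_law (mX j) (Xmu j) Ign.
have nR : 0 < n%:R :> R by rewrite ltr0n.
have IS (G : R -> R) : (forall j : 'I_n, P.-integrable setT (EFin \o (fun w => G (X j w)))) ->
    P.-integrable setT (EFin \o (fun w => (\sum_(j < n) G (X j w)) / n%:R)).
  move=> IG; have := integrable_Rsum IG (index_enum _).
  move=> /(integrableZl measurableT n%:R^-1); apply: eq_integrable => // w _ /=.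
  by rewrite mulrC.
split; first exact: IS.
apply: (@le_trans _ _ (\int[P]_w ((\sum_(j < n) `|g (X j w)|) / n%:R))).
  apply: le_Rintegral => //.
  - exact/integrable_norm/IS.
  - exact: (IS (fun x => `|g x|)).
  - move=> w _; rewrite normrM (ger0_norm (_ : 0 <= n%:R^-1)) ?invr_ge0 ?ler0n//.
    by rewrite ler_pM2r ?invr_gt0// ler_norm_sum.
rewrite RintegralZr//; last exact: (integrable_Rsum IgnX).
rewrite (Rintegral_sum IgnX).
rewrite (eq_bigr (fun _ => \int[mu]_x `|g x|)).
  by rewrite sumr_const card_ord -(mulr_natr (Rintegral _ _ _)) mulfK// gt_eqF.
move=> j _; rewrite (Rintegral_law (mX j) (Xmu j) (f := fun x => `|g x|))//.
exact: measurableT_comp.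
Qed.

(* Truncation reduces the triangular array to a bounded summand, for which
   pairwise orthogonality is enough. *)
Lemma lln_L1 (f : nat -> R -> R) (g F : R -> R) (N : nat -> nat) :
  (forall k, measurable_fun setT (f k)) ->
  (forall x, f k x @[k --> \oo] --> g x) ->
  mu.-integrable setT (EFin \o F) ->
  (\forall k \near \oo, forall x, `|f k x| <= F x) ->
  (forall k, (0 < N k)%N) -> ((N k)%:R : R) @[k --> \oo] --> +oo ->
  \int[P]_w `|(\sum_(j < N k) f k (X j w)) / (N k)%:R - \int[mu]_x g x|
    @[k --> \oo] --> 0.
Proof.
move=> mf fg IF fF N0 Ny.
have mg : measurable_fun setT g.
  by apply: (measurable_fun_cvg mf) => x _; exact: fg.
have gF x : `|g x| <= F x.
  have H : `|f k x| @[k --> \oo] --> `|g x| by apply: cvg_norm.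
  rewrite -(cvg_lim _ H)//; apply: limr_le; first exact: cvgP H.
  by near=> k; near: k; move: fF; apply: filterS => k; apply.
have Ig : mu.-integrable setT (EFin \o g) by exact: integrable_dominated IF _.
pose gM (M x : R) : R := if `|g x| <= M then g x else 0.
have mgM M : measurable_fun setT (gM M).
  apply: measurable_fun_ifT => //; apply: measurable_fun_ler => //.
  exact: measurableT_comp.
have gMF M x : `|gM M x| <= F x.
  by rewrite /gM; case: ifP => // _; rewrite normr0 (le_trans _ (gF x)).
have IgM M : mu.-integrable setT (EFin \o gM M) by exact: integrable_dominated IF _.
have I2F : mu.-integrable setT (EFin \o (fun x => 2 * F x)).
  by have := integrableZl measurableT 2 IF; apply: eq_integrable.
have L1 : \int[mu]_x `|f k x - g x| @[k --> \oo] --> 0.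
  rewrite -(Rintegral_const mu 0).
  apply: (Rintegral_dominated_cvg _ _ I2F).
  - by move=> k; apply: measurableT_comp => //; exact: measurable_funB.
  - move=> x; rewrite -(normr0 R) -(subrr (g x)).
    by apply: cvg_norm; apply: cvgB => //; exact: cvg_cst.
  - move: fF; apply: filterS => k fF x; rewrite normr_id.
    by rewrite (le_trans (ler_normB _ _))//; have := fF x; have := gF x; lra.
have L2 : \int[mu]_x `|g x - gM n%:R x| @[n --> \oo] --> 0.
  rewrite -(Rintegral_const mu 0).
  apply: (Rintegral_dominated_cvg _ _ I2F).
  - by move=> k; apply: measurableT_comp => //; exact: measurable_funB.
  - move=> x; apply: cvg_near_cst; near=> n; rewrite /gM ifT ?subrr ?normr0//.
    by near: n; exact: nbhs_infty_ger.
  - apply: nearW => n x; rewrite normr_id.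
    by rewrite (le_trans (ler_normB _ _))//; have := gMF n%:R x; have := gF x; lra.
apply/cvgrPdist_le => /= e e0.
have e50 : 0 < e / 5 by rewrite divr_gt0.
have [n hn] : exists n, \int[mu]_x `|g x - gM n%:R x| <= e / 5.
  move/cvgrPdist_le : L2 => /(_ _ e50)[n _ /(_ n (leqnn n))]; rewrite sub0r normrN => H.
  by exists n; rewrite (le_trans (ler_norm _)).
near=> k.
have h1 : \int[mu]_x `|f k x - g x| <= e / 5.
  apply: (le_trans (ler_norm _)); rewrite -normrN -sub0r.
  by near: k; move/cvgrPdist_le : L1; exact.
have h2 : 4 * n%:R ^+ 2 / ((N k)%:R * (e / 5)) <= e / 5.
  have N0' : 0 < (N k)%:R :> R by rewrite ltr0n.
  have : 4 * n%:R ^+ 2 / (e / 5) ^+ 2 <= (N k)%:R.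
    by near: k; move/cvgryPge : Ny; apply.
  rewrite ler_pdivrMr ?exprn_gt0// => H; rewrite ler_pdivrMr ?mulr_gt0//.
  by rewrite (le_trans H)// le_eqVlt; apply/orP; left; apply/eqP; ring.
have fFk x : `|f k x| <= F x.
  by move: x; near: k.
rewrite sub0r normrN.
have If : mu.-integrable setT (EFin \o f k) by exact: integrable_dominated IF _.
have Ifg : mu.-integrable setT (EFin \o (fun x => f k x - g x)).
  by have := integrableB measurableT If Ig; apply: eq_integrable.
have IggM : mu.-integrable setT (EFin \o (fun x => g x - gM n%:R x)).
  by have := integrableB measurableT Ig (IgM n%:R); apply: eq_integrable.
have [Ia1 a1] := Rintegral_avg_le (N0 k) Ifg.
have [Ia2 a2] := Rintegral_avg_le (N0 k) IggM.
have [Ia3 _] := Rintegral_avg_le (N0 k) (IgM n%:R).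
have a3 : \int[P]_w `|(\sum_(j < N k) gM n%:R (X j w)) / (N k)%:R -
     \int[mu]_x gM n%:R x| <= e / 5 + 4 * n%:R ^+ 2 / ((N k)%:R * (e / 5)).
  apply: lln_bounded => // x; rewrite /gM; case: ifP => // _.
  by rewrite normr0.
have Ic c : P.-integrable setT (EFin \o (fun _ : T => c : R)).
  by apply: (@integrable_bounded _ _ _ P _ `|c|).
have Ia3' : P.-integrable setT (EFin \o (fun w => (\sum_(j < N k) gM n%:R (X j w)) / (N k)%:R -
     \int[mu]_x gM n%:R x)).
  by have := integrableB measurableT Ia3 (Ic (\int[mu]_x gM n%:R x)); apply: eq_integrable.
set D := \int[mu]_x gM n%:R x - \int[mu]_x g x.
have D5 : `|D| <= e / 5.
  rewrite /D distrC -RintegralB//.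
  exact: (le_trans (le_normr_Rintegral measurableT IggM)).
pose a w := (\sum_(j < N k) (f k (X j w) - g (X j w))) / (N k)%:R.
pose b w := (\sum_(j < N k) (g (X j w) - gM n%:R (X j w))) / (N k)%:R.
pose c w := (\sum_(j < N k) gM n%:R (X j w)) / (N k)%:R - \int[mu]_x gM n%:R x.
have E w : (\sum_(j < N k) f k (X j w)) / (N k)%:R - \int[mu]_x g x =
    a w + b w + c w + D.
  by rewrite /a /b /c /D !sumrB; ring.
have Ina : P.-integrable setT (EFin \o (fun w => `|a w|)) by exact: integrable_norm.
have Inb : P.-integrable setT (EFin \o (fun w => `|b w|)) by exact: integrable_norm.
have Inc : P.-integrable setT (EFin \o (fun w => `|c w|)) by exact: integrable_norm.
have Iab : P.-integrable setT (EFin \o (fun w => `|a w| + `|b w|)).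
  by have := integrableD measurableT Ina Inb; apply: eq_integrable.
have Iabc : P.-integrable setT (EFin \o (fun w => `|a w| + `|b w| + `|c w|)).
  by have := integrableD measurableT Iab Inc; apply: eq_integrable.
have IabcD : P.-integrable setT (EFin \o (fun w => `|a w| + `|b w| + `|c w| + `|D|)).
  by have := integrableD measurableT Iabc (Ic `|D|); apply: eq_integrable.
rewrite ger0_norm; last exact: Rintegral_ge0.
apply: (@le_trans _ _ (\int[P]_w (`|a w| + `|b w| + `|c w| + `|D|))).
  apply: le_Rintegral => //; last first.
    move=> w _; rewrite E !(le_trans (ler_normD _ _))// lerD2r.
    by rewrite (le_trans (ler_normD _ _))// lerD2r ler_normD.
  apply: (integrable_dominated _ IabcD).
    apply: measurableT_comp => //; apply: measurable_funB => //.
    apply: measurable_funM => //; apply: measurable_sum => j.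
    exact: measurableT_comp.
  move=> w; rewrite normr_id E !(le_trans (ler_normD _ _))// lerD2r.
  by rewrite (le_trans (ler_normD _ _))// lerD2r ler_normD.
rewrite !RintegralD// Rintegral_const.
rewrite -/a -/b -/c in a1 a2 a3.
lra.
Unshelve. all: by end_near. Qed.

End LawOfLargeNumbers.

(** * Weak convergence and trigonometric polynomials *)

Section ColumnVectors.
Variable R : realType.

Lemma cV_normP m (x : 'cV[R]_m) (r : R) : 0 <= r ->
  (`|x| <= r) <-> (forall i, `|x i 0| <= r).
Proof.
move=> r0; split.
  move=> xr i; apply: le_trans xr.
  rewrite [leRHS]/Num.norm/= mx_normrE; apply/bigmax_geP; right => /=.
  by exists (i, ord0).
move=> H; rewrite [leLHS]/Num.norm/= mx_normrE; apply/bigmax_leP; split => //= -[i j] _.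
by rewrite /= (ord1 j).
Qed.

Lemma cV_coord_le m (x : 'cV[R]_m) i : `|x i 0| <= `|x|.
Proof. by move: i; apply/(cV_normP _ (normr_ge0 _)). Qed.

Lemma cV_norm_ltP m (x : 'cV[R]_m) (r : R) : 0 < r ->
  (`|x| < r) <-> (forall i, `|x i 0| < r).
Proof.
move=> r0; split; first by move=> xr i; exact: le_lt_trans (cV_coord_le _ _) xr.
move=> H; have [->|x0] := eqVneq x 0; first by rewrite normr0.
have /= := @mx_norm_neq0 R m 1 x; rewrite -[mx_norm x]/(`|x|) normr_eq0 => /(_ x0)[[i j]] ->.
by rewrite /= (ord1 j).
Qed.

Lemma cV_box_compact m (L : R) : compact [set x : 'cV[R]_m | `|x| <= L].
Proof.
have [L0|L0] := leP 0 L; last first.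
  rewrite (_ : [set _ | _] = set0); first exact: compact0.
  apply/seteqP; split => // x /= xL; have := normr_ge0 x.
  by rewrite leNgt (le_lt_trans xL L0).
have rVc : compact [set v : 'rV[R]_m | forall i, `[(- L), L]%classic (v ord0 i)].
  by apply: (@rV_compact _ _ (fun=> `[(- L), L]%classic)) => _; exact: segment_compact.
have tc : continuous (fun v : 'rV[R]_m => v^T : 'cV[R]_m).
  move=> v s /= /(nbhs_ballP (v^T)) [e e0 es].
  apply/nbhs_ballP; exists e => //= N [_ vN]; apply: es; split => // i j.
  by rewrite !mxE; exact: vN.
have := @continuous_compact _ _ (fun v : 'rV[R]_m => v^T : 'cV[R]_m) _
  (continuous_subspaceT tc) rVc.
congr compact; apply/seteqP; split => x /=.
  move=> [v vL <-]; apply/cV_normP => // i; rewrite mxE.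
  by have := vL i; rewrite in_itv/= ler_norml.
move=> /(cV_normP _ L0) xL; exists (x^T); last by rewrite trmxK.
by move=> i; rewrite in_itv/= mxE -ler_norml.
Qed.

Lemma unif_continuous_box m (f : 'cV[R]_m -> R) (L e : R) : continuous f -> 0 < e ->
  exists2 r : R, 0 < r & forall x y, `|x| <= L -> `|y - x| <= r -> `|f x - f y| <= e.
Proof.
move=> cf e0.
have /compact_near_coveringP := @cV_box_compact m L.
move=> /(_ R (0 : R)^'+ (fun r x => forall y, `|y - x| <= r -> `|f x - f y| <= e) _).
case.
  move=> x _.
  have /cvgrPdist_lt/(_ (e / 2)) := cf x; rewrite divr_gt0// => /(_ isT).
  move/nbhs_normP => [r /= r0 xr].
  exists (ball x (r / 2), [set s | s < r / 2]); first split => /=.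
  - by apply: nbhsx_ballx; rewrite divr_gt0.
  - by apply: nbhs_right_lt; rewrite divr_gt0.
  move=> [x' s] /= [xx' sr] y yx'.
  rewrite -ball_normE /= in xx'.
  have H1 := xr x'; have H2 := xr y; rewrite /= in H1 H2.
  have {}H1 : `|f x - f x'| < e / 2 by apply: H1; rewrite (lt_trans xx')//; lra.
  have {}H2 : `|f x - f y| < e / 2.
    apply: H2; rewrite -(subrK x' x) -addrA (le_lt_trans (ler_normD _ _))//.
    by rewrite (distrC x' y); lra.
  have -> : f x' - f y = (f x - f y) - (f x - f x') by ring.
  by rewrite (le_trans (ler_normB _ _))//; lra.
move=> r /= r0 H; exists (r / 2); first by rewrite divr_gt0.
move=> x y xL yx; apply: (H (r / 2)) => //=.
  by rewrite sub0r normrN ger0_norm ?divr_ge0 ?ltW//; lra.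
by rewrite divr_gt0.
Qed.

End ColumnVectors.

Section BorelColumnVectors.
Context (R : realType).

Lemma measurable_set_lt d (T : measurableType d) (f g : T -> R) :
  measurable_fun setT f -> measurable_fun setT g -> measurable [set w | f w < g w].
Proof.
move=> mf mg; rewrite -[X in measurable X]setTI.
by have /(_ measurableT [set true] _) := measurable_fun_ltr mf mg; exact.
Qed.

Lemma ball_cV_bigcap m (c : 'cV[R]_m) (r : R) : 0 < r ->
  [set x | `|x - c| < r] = \bigcap_(i in [set: 'I_m]) [set x | `|x i 0 - c i 0| < r].
Proof.
move=> r0; apply/seteqP; split => x /=.
  by move=> /(cV_norm_ltP _ r0) H i _ /=; have := H i; rewrite !mxE.
by move=> H; apply/cV_norm_ltP => // i; have := H i I; rewrite /= !mxE.
Qed.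

Lemma cV_rat_approx m (x : 'cV[R]_m) (e : R) : 0 < e ->
  exists q : 'cV[rat]_m, `|x - map_mx (@ratr R) q| < e.
Proof.
move=> e0.
have H i : exists q : rat, `|x i 0 - ratr q| < e.
  have [||y []] := @dense_rat R (ball (x i 0) e).
  - by exists (x i 0); exact: ballxx.
  - exact: ball_open.
  - by rewrite -ball_normE/= => xy [q _ qy]; exists q; rewrite qy.
have [q qP] := choice H.
by exists (\col_i q i); apply/cV_norm_ltP => // i; rewrite !mxE.
Qed.

Lemma open_cV_bigcup m (U : set 'cV[R]_m) : open U ->
  U = \bigcup_(p in [set p : 'cV[rat]_m * nat |
        [set x | `|x - map_mx (@ratr R) p.1| < p.2.+1%:R^-1] `<=` U])
      [set x | `|x - map_mx (@ratr R) p.1| < p.2.+1%:R^-1].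
Proof.
move=> oU; apply/seteqP; split; last first.
  by move=> x [p /= pU xp]; exact: pU.
move=> x Ux.
have : nbhs x U by exact: open_nbhs_nbhs.
move/nbhs_normP => [e /= e0 xU].
have [n ne] : exists n, n.+1%:R^-1 < e / 2.
  have : 0 < e / 2 by rewrite divr_gt0.
  move=> /ltr_add_invr[n]; rewrite add0r => ?.
  by exists n.
have n0 : 0 < n.+1%:R^-1 :> R by rewrite invr_gt0.
have [q xq] := cV_rat_approx x n0.
exists (q, n) => //= y yq; apply: xU => /=.
rewrite -(subrK (map_mx (@ratr R) q) x) -addrA.
rewrite (le_lt_trans (ler_normD _ _))//.
rewrite [ltRHS]splitr; apply: ltrD; first exact: lt_trans xq ne.
by rewrite distrC; exact: lt_trans yq ne.
Qed.

Lemma measurable_fun_cV d (T : measurableType d) m (f : T -> 'cV[R]_m) :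
  (forall i, measurable_fun setT (fun w => f w i 0)) ->
  measurable_fun setT (f : T -> borelV R m).
Proof.
move=> mf; apply: (@measurability _ _ T (borelV R m) setT f (@open 'cV[R]_m)) => //.
move=> _ [U oU <-]; rewrite setTI (open_cV_bigcup oU) preimage_bigcup.
rewrite bigcup_mkcond; apply: countable_bigcupT_measurable; first exact: countableP.
move=> [q n]; case: ifP => // _ /=.
have n0 : 0 < n.+1%:R^-1 :> R by rewrite invr_gt0.
rewrite ball_cV_bigcap// preimage_bigcap.
apply: fin_bigcap_measurable; first exact: finite_finset.
move=> i _; apply: measurable_set_lt => //; apply: measurableT_comp => //.
exact: measurable_funB.
Qed.

Lemma continuous_measurable_borelV m (f : 'cV[R]_m -> R) : continuous f ->
  measurable_fun setT (f : borelV R m -> R).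
Proof.
move=> /continuousP cf; apply: (measurability _ (RGenOpens.measurableE R)).
move=> _ [_ [a [b ->] <-]]; rewrite setTI; apply: sub_sigma_algebra.
exact/cf/interval_open.
Qed.

Lemma measurable_fun_continuous_cV d (T : measurableType d) m (Y : T -> 'cV[R]_m)
    (f : 'cV[R]_m -> R) : measurable_fun setT (Y : T -> borelV R m) ->
  continuous f -> measurable_fun setT (fun w => f (Y w)).
Proof.
by move=> mY /continuous_measurable_borelV cf; exact: (measurableT_comp cf mY).
Qed.

End BorelColumnVectors.

Lemma cvg_Rsum (R : realType) (T I : Type) (F : set_system T) (r : seq I)
    (f : I -> T -> R) (l : I -> R) {FF : Filter F} :
  (forall i, f i x @[x --> F] --> l i) ->
  \sum_(i <- r) f i x @[x --> F] --> \sum_(i <- r) l i.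
Proof.
move=> fl; elim: r => [|i r IH].
  by rewrite big_nil; under eq_fun do rewrite big_nil; exact: cvg_cst.
by rewrite big_cons; under eq_fun do rewrite big_cons; exact: cvgD.
Qed.

Section TrigPolynomials.
Variables (R : realType) (m : nat).

Inductive trigpoly : ('cV[R]_m -> R) -> Prop :=
| trigpoly_cos (t : 'cV[R]_m) (a : R) :
    trigpoly (fun x => cos ((t^T *m x) 0 0 + a))
| trigpoly_lin (c : R) p q : trigpoly p -> trigpoly q ->
    trigpoly (fun x => c * p x + q x).

Lemma trigpoly_ext p q : p =1 q -> trigpoly p -> trigpoly q.
Proof. by move=> /funext ->. Qed.

Lemma trigpoly_const c : trigpoly (fun=> c).
Proof.
apply: (@trigpoly_ext (fun x => (c - 1) * cos (((0 : 'cV[R]_m)^T *m x) 0 0 + 0) +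
  cos (((0 : 'cV[R]_m)^T *m x) 0 0 + 0))).
  by move=> x; rewrite trmx0 mul0mx mxE addr0 cos0; ring.
by apply: trigpoly_lin; exact: trigpoly_cos.
Qed.

Lemma trigpolyZ c p : trigpoly p -> trigpoly (fun x => c * p x).
Proof.
move=> tp; apply: (@trigpoly_ext (fun x => c * p x + 0)); first by move=> x; rewrite addr0.
by apply: trigpoly_lin => //; exact: trigpoly_const.
Qed.

Lemma trigpolyD p q : trigpoly p -> trigpoly q -> trigpoly (fun x => p x + q x).
Proof.
move=> tp tq; apply: (@trigpoly_ext (fun x => 1 * p x + q x)).
  by move=> x; rewrite mul1r.
exact: trigpoly_lin.
Qed.

Lemma trigpolyM p q : trigpoly p -> trigpoly q -> trigpoly (fun x => p x * q x).
Proof.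
move=> tp; elim: tp q => [t a|c p1 p2 _ IH1 _ IH2] q tq; last first.
  apply: (@trigpoly_ext (fun x => c * (p1 x * q x) + p2 x * q x)).
    by move=> x; ring.
  by apply: trigpoly_lin; [exact: IH1|exact: IH2].
elim: tq => [s b|c p1 p2 _ IH1 _ IH2]; last first.
  apply: (@trigpoly_ext (fun x => c * (cos ((t^T *m x) 0 0 + a) * p1 x) +
    cos ((t^T *m x) 0 0 + a) * p2 x)); first by move=> x; ring.
  exact: trigpoly_lin.
apply: (@trigpoly_ext (fun x => 2^-1 * cos (((t + s)^T *m x) 0 0 + (a + b)) +
  2^-1 * cos (((t - s)^T *m x) 0 0 + (a - b)))); last first.
  by apply: trigpoly_lin; [|apply: trigpolyZ]; exact: trigpoly_cos.
move=> x; rewrite !linearD/= linearN/= !mulmxDl mulNmx !mxE.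
set A := \sum_j _; set B := \sum_j _.
have -> : A + B + (a + b) = (A + a) + (B + b) by ring.
have -> : A - B + (a - b) = (A + a) - (B + b) by ring.
by rewrite cosD cosB; field.
Qed.

Lemma linform_continuous (t : 'cV[R]_m) :
  continuous (fun x : 'cV[R]_m => (t^T *m x) 0 0).
Proof.
have -> : (fun x : 'cV[R]_m => (t^T *m x) 0 0) = (fun x => \sum_i t i 0 * x i 0).
  by apply/funext => x; rewrite mxE; apply: eq_bigr => i _; rewrite mxE.
move=> x; apply: (@cvg_Rsum R _ _ (nbhs x)) => i; apply: cvgM; first exact: cvg_cst.
exact: coord_continuous.
Qed.

Lemma trigpoly_continuous p : trigpoly p -> continuous p.
Proof.
elim=> [t a|c p1 p2 _ IH1 _ IH2] x.
  apply: (@continuous_comp _ _ _ (fun x => (t^T *m x) 0 0 + a) cos); last exact: continuous_cos.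
  apply: (@cvgD _ _ _ (nbhs x)); [exact: linform_continuous|exact: cvg_cst].
apply: (@cvgD _ _ _ (nbhs x)); last exact: IH2.
by apply: (@cvgM _ _ (nbhs x)); [exact: cvg_cst|exact: IH1].
Qed.

Lemma trigpoly_bounded p : trigpoly p -> exists M : R, forall x, `|p x| <= M.
Proof.
elim=> [t a|c p1 p2 _ [M1 H1] _ [M2 H2]]; first by exists 1 => x; exact: cos_max.
exists (`|c| * M1 + M2) => x; rewrite (le_trans (ler_normD _ _))// normrM.
by rewrite lerD// ler_wpM2l.
Qed.

Lemma trigpoly_sin_coord (c : R) i : trigpoly (fun x => sin (c * x i 0)).
Proof.
apply: (@trigpoly_ext (fun x => cos (((c *: delta_mx i 0 : 'cV[R]_m)^T *m x) 0 0 + - (pi / 2)))).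
  move=> x; rewrite cosBpihalf linearZ/= trmx_delta -scalemxAl mxE; congr (sin (_ * _)).
  by rewrite -rowE mxE.
exact: trigpoly_cos.
Qed.

End TrigPolynomials.

(* The n-th Bernstein operator evaluated at [u], in the form of the expectation
   of [phi] under the Binomial(n, u) law built by tossing one coin at a time. *)
Section Bernstein.
Variable R : realType.

Fixpoint bernstein (n : nat) (u : R) (phi : nat -> R) : R :=
  if n is n'.+1 then
    u * bernstein n' u (fun j => phi j.+1) + (1 - u) * bernstein n' u phi
  else phi 0%N.

Lemma bernstein_cst n u c : bernstein n u (fun=> c) = c.
Proof. by elim: n => //= n ->; ring. Qed.

Lemma bernstein_le n u phi psi : 0 <= u <= 1 -> (forall j, phi j <= psi j) ->
  bernstein n u phi <= bernstein n u psi.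
Proof.
move=> /andP[u0 u1]; elim: n phi psi => //= n IH phi psi le.
by apply: lerD; apply: ler_wpM2l; rewrite ?subr_ge0//; apply: IH.
Qed.

Lemma bernstein_lin n u c phi psi :
  bernstein n u (fun j => c * phi j + psi j) =
  c * bernstein n u phi + bernstein n u psi.
Proof. by elim: n phi psi => //= n IH phi psi; rewrite !IH; ring. Qed.

Lemma bernstein_variance n u b : bernstein n u (fun j => (j%:R + b) ^+ 2) =
  n%:R * u * (1 - u) + (n%:R * u + b) ^+ 2.
Proof.
elim: n b => [|n IH] b /=; first by rewrite !mul0r; ring.
rewrite -[in X in u * X](_ : (fun j => (j%:R + (1 + b)) ^+ 2) =
  (fun j => (j.+1%:R + b) ^+ 2)); last first.
  by apply/funext => j; rewrite -natr1; ring.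
by rewrite !IH -natr1; ring.
Qed.

Lemma bernstein_dev n u : (0 < n)%N ->
  bernstein n u (fun j => (u - j%:R / n%:R) ^+ 2) = u * (1 - u) / n%:R.
Proof.
move=> n0; have nR : n%:R != 0 :> R by rewrite pnatr_eq0 -lt0n.
have -> : (fun j => (u - j%:R / n%:R) ^+ 2) =
    (fun j : nat => (n%:R ^- 2) * (j%:R + (- (n%:R * u))) ^+ 2 + 0) :> (nat -> R).
  by apply/funext => j; field.
rewrite bernstein_lin bernstein_variance bernstein_cst subrr.
by field.
Qed.

Variables (m n : nat).

Definition updf (k : 'I_m -> nat) i j : 'I_m -> nat :=
  fun i' => if i' == i then j else k i'.

Fixpoint mbernstein (s : seq 'I_m) (u : 'I_m -> R) (Phi : ('I_m -> nat) -> R) : R :=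
  if s is i :: s' then
    mbernstein s' u (fun k => bernstein n (u i) (fun j => Phi (updf k i j)))
  else Phi (fun=> 0%N).

Lemma mbernstein_cst s u c : mbernstein s u (fun=> c) = c.
Proof.
elim: s => //= i s IH; rewrite -[RHS]IH; congr mbernstein.
by apply/funext => k; rewrite bernstein_cst.
Qed.

Lemma mbernstein_le s u Phi Psi : (forall i, 0 <= u i <= 1) ->
  (forall k, Phi k <= Psi k) -> mbernstein s u Phi <= mbernstein s u Psi.
Proof.
move=> u01; elim: s Phi Psi => //= i s IH Phi Psi le.
by apply: IH => k; exact: bernstein_le.
Qed.

Lemma mbernstein_lin s u c Phi Psi :
  mbernstein s u (fun k => c * Phi k + Psi k) =
  c * mbernstein s u Phi + mbernstein s u Psi.
Proof.
elim: s Phi Psi => //= i s IH Phi Psi; rewrite -IH; congr mbernstein.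
by apply/funext => k; rewrite bernstein_lin.
Qed.

Lemma mbernstein_sum s u (I : Type) (r : seq I) (F : I -> ('I_m -> nat) -> R) :
  mbernstein s u (fun k => \sum_(i <- r) F i k) = \sum_(i <- r) mbernstein s u (F i).
Proof.
elim: r => [|i r IH].
  by under eq_fun do rewrite big_nil; rewrite mbernstein_cst big_nil.
rewrite big_cons -IH -[X in X + _]mul1r -mbernstein_lin; congr mbernstein.
by apply/funext => k; rewrite big_cons mul1r.
Qed.

Lemma mbernstein_coord s u i (g : nat -> R) : uniq s -> i \in s ->
  mbernstein s u (fun k => g (k i)) = bernstein n (u i) g.
Proof.
elim: s => //= j s IH /andP[js us]; rewrite in_cons.
have [-> _|ij /= ins] := eqVneq i j.
  rewrite -[RHS](mbernstein_cst s u); congr mbernstein; apply/funext => k.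
  by congr bernstein; apply/funext => l; rewrite /updf eqxx.
rewrite -IH//; congr mbernstein; apply/funext => k.
rewrite -[RHS](bernstein_cst n (u j)); congr bernstein; apply/funext => l.
by rewrite /updf (negPf ij).
Qed.

Lemma trigpoly_bernstein l (v : 'cV[R]_m -> R) (phi : nat -> 'cV[R]_m -> R) :
  trigpoly v -> (forall j, trigpoly (phi j)) ->
  trigpoly (fun x => bernstein l (v x) (fun j => phi j x)).
Proof.
move=> tv; elim: l phi => /= [|l IH] phi tphi; first exact: tphi.
apply: trigpolyD; apply: trigpolyM => //.
- by apply: (IH (fun j => phi j.+1)).
- apply: (@trigpoly_ext _ _ (fun x => (-1) * v x + 1)); first by move=> x; ring.
  by apply: trigpoly_lin => //; exact: trigpoly_const.
- exact: IH.
Qed.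

Lemma trigpoly_mbernstein s (v : 'I_m -> 'cV[R]_m -> R)
    (Phi : ('I_m -> nat) -> 'cV[R]_m -> R) :
  (forall i, trigpoly (v i)) -> (forall k, trigpoly (Phi k)) ->
  trigpoly (fun x => mbernstein s (fun i => v i x) (fun k => Phi k x)).
Proof.
move=> tv; elim: s Phi => /= [|i s IH] Phi tPhi; first exact: tPhi.
apply: (IH (fun k x => bernstein n (v i x) (fun j => Phi (updf k i j) x))) => k.
by apply: (trigpoly_bernstein _ _ (phi := fun j => Phi (updf k i j))).
Qed.

End Bernstein.

Section TrigApproximation.
Variables (R : realType) (m : nat).

Lemma sin_modulus (a b h : R) : 0 <= h <= pi / 2 ->
  - (pi / 2) <= a <= pi / 2 -> - (pi / 2) <= b <= pi / 2 ->
  2 * h <= `|a - b| -> 2 * sin h ^+ 2 <= `|sin a - sin b|.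
Proof.
wlog ba : a b / b <= a.
  move=> W hh ha hb; have [ba|ab] := leP b a; first exact: W.
  by rewrite distrC (distrC (sin a)); apply: W => //; exact: ltW.
move=> /andP[h0 h1] /andP[a0 a1] /andP[b0 b1].
rewrite ger0_norm ?subr_ge0// => hab.
have pi0 := pi_gt0 R.
pose g := (a - b) / 2; pose s := (a + b) / 2.
have gh : h <= g by rewrite /g; lra.
have g2 : g <= pi / 2 by rewrite /g; lra.
have -> : sin a - sin b = 2 * cos s * sin g.
  have -> : a = s + g by rewrite /s /g; field.
  have -> : b = s - g by rewrite /s /g; field.
  by rewrite sinD sinB; ring.
have sh : sin h <= sin g.
  have [->//|hg] := eqVneq h g.
  apply: ltW; rewrite ltr_sin ?in_itv/=; [by rewrite lt_neqAle hg|lra|lra].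
have sh0 : 0 <= sin h by apply: sin_ge0_pi; lra.
have cg : sin g <= cos s.
  rewrite -cosBpihalf -cosN opprB -(cos_norm s).
  have : `|s| <= pi / 2 - g by rewrite ler_norml /s /g; lra.
  rewrite le_eqVlt => /predU1P[->//|lt].
  by apply: ltW; rewrite ltr_cos ?in_itv/=//; have := normr_ge0 s; lra.
rewrite expr2 ger0_norm; last by apply: mulr_ge0; lra.
rewrite mulrA; apply: ler_pM => //; lra.
Qed.

Lemma trig_approx (f : 'cV[R]_m -> R) (M L e : R) : continuous f ->
  (forall x, `|f x| <= M) -> 0 < L -> 0 < e ->
  exists p, [/\ trigpoly p, forall x, `|p x| <= M &
    forall x, `|x| <= L -> `|f x - p x| <= e].
Proof.
move=> cf fM L0 e0.
have M0 : 0 <= M by exact: le_trans (fM 0).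
have pi0 := pi_gt0 R.
have [r r0 fr] := @unif_continuous_box R m f L (e / 2) cf ltac:(by rewrite divr_gt0).
pose c : R := pi / (2 * L).
have c0 : 0 < c by rewrite divr_gt0// mulr_gt0.
pose h := Num.min (c * r / 2) (pi / 2).
have h0 : 0 < h by rewrite lt_min !divr_gt0// mulr_gt0.
have hp : h <= pi / 2 by rewrite ge_min lexx orbT.
have hr : 2 * h <= c * r.
  have : h <= c * r / 2 by rewrite ge_min lexx.
  lra.
pose eta := sin h ^+ 2.
have eta0 : 0 < eta.
  rewrite exprn_gt0// sin_gt0_pi//; lra.
pose D := 2 * M / eta ^+ 2.
have D0 : 0 <= D by apply: divr_ge0; [exact: mulr_ge0|exact/exprn_ge0/ltW].
have [n' n'P] : exists n', D * m%:R / n'.+1%:R <= e / 2.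
  pose z := D * m%:R / (e / 2).
  have z0 : 0 <= z by apply: divr_ge0; [exact: mulr_ge0|lra].
  exists (Num.truncn z); rewrite ler_pdivrMr// [leRHS]mulrC -ler_pdivrMr ?divr_gt0//.
  by apply/ltW; exact: truncnS_gt.
pose n := n'.+1.
have nR : 0 < n%:R :> R by rewrite ltr0n.
pose v (j : nat) : R := (minn j n)%:R / n%:R.
pose node (j : nat) : R := asin (2 * v j - 1) / c.
have nodearg j : -1 <= 2 * v j - 1 <= 1.
  have h1 : 0 <= v j by rewrite divr_ge0.
  have h2 : v j <= 1 by rewrite ler_pdivrMr// mul1r ler_nat geq_minr.
  by apply/andP; split; lra.
pose u i (x : 'cV[R]_m) : R := 2^-1 * sin (c * x i 0) + 2^-1.
have u01 i x : 0 <= u i x <= 1.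
  by rewrite /u; have := sin_geN1 (c * x i 0); have := sin_le1 (c * x i 0); lra.
pose s := enum 'I_m.
pose y (k : 'I_m -> nat) : 'cV[R]_m := \col_i node (k i).
pose p x := mbernstein n s (fun i => u i x) (fun k => f (y k)).
exists p; split.
- apply: (@trigpoly_mbernstein R m n s u (fun k _ => f (y k))) => [i|k]; last exact: trigpoly_const.
  by apply: trigpoly_lin; [exact: trigpoly_sin_coord|exact: trigpoly_const].
- move=> x; rewrite ler_norml; apply/andP; split.
    rewrite -[leLHS](mbernstein_cst n s (fun i => u i x)).
    by apply: mbernstein_le => // k; have := fM (y k); rewrite ler_norml => /andP[].
  rewrite -[leRHS](mbernstein_cst n s (fun i => u i x)).
  by apply: mbernstein_le => // k; have := fM (y k); rewrite ler_norml => /andP[].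
move=> x xL.
pose q k := e / 2 + D * \sum_(i <- s) (u i x - (k i)%:R / n%:R) ^+ 2.
have key k : `|f x - f (y k)| <= q k.
  rewrite /q; have S0 : 0 <= \sum_(i <- s) (u i x - (k i)%:R / n%:R) ^+ 2.
    by apply: sumr_ge0 => i _; exact: sqr_ge0.
  have [yx|yx] := leP `|y k - x| r.
    by apply: (le_trans (fr _ _ xL yx)); rewrite lerDl mulr_ge0.
  have [i xi] : exists i, r < `|y k i 0 - x i 0|.
    apply: contrapT => /forallNP H; move: yx; rewrite ltNge => /negP; apply.
    by apply/cV_normP; [exact: ltW|move=> i; rewrite !mxE leNgt; apply/negP; have := H i; rewrite mxE].
  have xiL : `|x i 0| <= L := le_trans (cV_coord_le _ _) xL.
  have a1 : - (pi / 2) <= c * x i 0 <= pi / 2.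
    have -> : pi / 2 = c * L by rewrite /c; field; rewrite gt_eqF.
    by rewrite -mulrN !ler_pM2l// -ler_norml.
  have cy : c * y k i 0 = asin (2 * v (k i) - 1).
    by rewrite mxE /node; field; rewrite gt_eqF.
  have a2 : - (pi / 2) <= c * y k i 0 <= pi / 2.
    by rewrite cy asin_geNpi2// asin_lepi2.
  have sy : sin (c * y k i 0) = 2 * v (k i) - 1.
    by rewrite cy asinK// in_itv/= nodearg.
  have h01 : 0 <= h <= pi / 2 by rewrite ltW.
  have sd : 2 * h <= `|c * y k i 0 - c * x i 0|.
    by rewrite -mulrBr normrM gtr0_norm// (le_trans hr)// ler_pM2l// ltW.
  have := sin_modulus h01 a2 a1 sd.
  rewrite sy -/eta => mod.
  have {}mod : eta <= `|u i x - v (k i)|.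
    rewrite -(@ler_pM2l _ 2)// (le_trans mod)//.
    rewrite -[X in X * `|_|](@ger0_norm _ 2)// -normrM -normrN.
    by rewrite le_eqVlt; apply/orP; left; apply/eqP; congr Num.norm; rewrite /u; field.
  have {}mod : eta <= `|u i x - (k i)%:R / n%:R|.
    apply: (le_trans mod); rewrite /v /minn; case: ltnP => // nk.
    rewrite divff ?gt_eqF//.
    have /andP[_ ui1] := u01 i x.
    have kn : 1 <= (k i)%:R / n%:R :> R by rewrite ler_pdivlMr// mul1r ler_nat.
    by rewrite !ler0_norm; clear - ui1 kn; lra.
  have t1 : eta ^+ 2 <= \sum_(i <- s) (u i x - (k i)%:R / n%:R) ^+ 2.
    apply: (@le_trans _ _ ((u i x - (k i)%:R / n%:R) ^+ 2)).
      by rewrite -(real_normK (num_real (u i x - _))) lerXn2r ?nnegrE// ltW.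
    rewrite (bigD1_seq i) ?mem_enum ?enum_uniq//= lerDl.
    by apply: sumr_ge0 => ? _; exact: sqr_ge0.
  apply: (@le_trans _ _ (D * eta ^+ 2)).
    have -> : D * eta ^+ 2 = 2 * M by rewrite /D divfK// gt_eqF// exprn_gt0.
    apply: (le_trans (ler_normB _ _)).
    by have := fM x; have := fM (y k); lra.
  by rewrite (le_trans (ler_wpM2l D0 t1))// lerDr divr_ge0// ltW.
have Eq : mbernstein n s (fun i => u i x) q <= e.
  have -> : q = (fun k => D * (\sum_(i <- s) (u i x - (k i)%:R / n%:R) ^+ 2) + e / 2).
    by apply/funext => k; rewrite /q addrC.
  rewrite mbernstein_lin mbernstein_cst mbernstein_sum.
  apply: (@le_trans _ _ (D * (\sum_(i <- s) n%:R^-1) + e / 2)).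
    rewrite lerD2r ler_wpM2l// big_seq [leRHS]big_seq; apply: ler_sum => i ins.
    rewrite (mbernstein_coord n (fun i => u i x) (fun j => (u i x - j%:R / n%:R) ^+ 2) (enum_uniq _) ins).
    rewrite bernstein_dev// ler_piMl ?invr_ge0//.
    by have /andP[? ?] := u01 i x; nra.
  have -> : \sum_(i <- s) n%:R^-1 = m%:R / n%:R :> R.
    by rewrite big_const_seq count_predT size_enum_ord iter_addr_0 -[LHS]mulr_natl.
  by rewrite mulrA -/n in n'P *; clear - n'P; lra.
have pE : f x - p x = mbernstein n s (fun i => u i x) (fun k => (-1) * f (y k) + f x).
  by rewrite mbernstein_lin mbernstein_cst /p; ring.
have pN : - (f x - p x) = mbernstein n s (fun i => u i x) (fun k => 1 * f (y k) + - f x).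
  by rewrite mbernstein_lin mbernstein_cst /p; ring.
rewrite ler_norml lerNl pN pE; apply/andP; split; apply: le_trans Eq;
  apply: mbernstein_le => // k; have := key k; rewrite ler_norml => /andP[];
  by rewrite ?mul1r ?mulN1r => k1 k2; clear - k1 k2; lra.
Qed.

End TrigApproximation.

Section WeakConvergence.
Context d (T : measurableType d) (R : realType).
Variable P : probability T R.

Lemma Rintegral_indic (A : set T) : measurable A -> \int[P]_w \1_A w = fine (P A).
Proof. by move=> mA; rewrite /Rintegral integral_indic// setIT. Qed.

Lemma Rintegral_dist_le (F G : T -> R) (A : set T) (e M : R) :
  measurable_fun setT F -> measurable_fun setT G -> measurable A ->
  (forall w, `|F w| <= M) -> (forall w, `|G w| <= M) -> 0 <= e ->
  (forall w, ~ A w -> `|F w - G w| <= e) ->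
  `|\int[P]_w F w - \int[P]_w G w| <= e + 2 * M * fine (P A).
Proof.
move=> mF mG mA FM GM e0 FG.
have IF : P.-integrable setT (EFin \o F) by exact: integrable_bounded FM.
have IG : P.-integrable setT (EFin \o G) by exact: integrable_bounded GM.
have IFG : P.-integrable setT (EFin \o (fun w => F w - G w)).
  by have := integrableB measurableT IF IG; apply: eq_integrable.
have IA : P.-integrable setT (EFin \o (\1_A : T -> R)).
  by apply: (@integrable_bounded _ _ _ P _ 1) => // w; rewrite indicE ger0_norm// lern1 leq_b1.
have IMA : P.-integrable setT (EFin \o (fun w => 2 * M * \1_A w)).
  by have := integrableZl measurableT (2 * M) IA; apply: eq_integrable.
have Ie : P.-integrable setT (EFin \o (fun _ : T => e)).
  by apply: (@integrable_bounded _ _ _ P _ `|e|).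
have IeMA : P.-integrable setT (EFin \o (fun w => e + 2 * M * \1_A w)).
  by have := integrableD measurableT Ie IMA; apply: eq_integrable.
rewrite -RintegralB// (le_trans (le_normr_Rintegral measurableT IFG))//.
rewrite -(Rintegral_indic mA) -RintegralZl// -[X in X + _](Rintegral_const P) -RintegralD//.
apply: le_Rintegral => //; first exact: integrable_norm.
move=> w _; have [Aw|Aw] := pselect (A w).
  rewrite indicE mem_set// mulr1 (le_trans (ler_normB _ _))//.
  by have := FM w; have := GM w; lra.
by rewrite indicE memNset// mulr0 addr0 FG.
Qed.

Lemma measurable_norm_gt m (Y : T -> 'cV[R]_m) (L : R) :
  measurable_fun setT (Y : T -> borelV R m) -> measurable [set w | L < `|Y w|].
Proof.
move=> mY; apply: measurable_set_lt => //.
by apply: (measurable_fun_continuous_cV mY); exact: norm_continuous.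
Qed.

End WeakConvergence.

Lemma borelV_tight (R : realType) m (Q : probability (borelV R m) R) (e : R) : 0 < e ->
  exists L : R, (Q [set x | (L < `|x : 'cV[R]_m|)%R] <= e%:E)%E.
Proof.
move=> e0.
have mid : measurable_fun setT (id : borelV R m -> borelV R m) by exact: measurable_id.
pose A (n : nat) : set (borelV R m) := [set x | n%:R < `|x : 'cV[R]_m|].
have mA n : measurable (A n) by exact: (measurable_norm_gt n%:R mid).
have A0 : \bigcap_n A n = set0.
  apply/seteqP; split => // x Ax.
  have := Ax (Num.truncn `|x : 'cV[R]_m|).+1 I; rewrite /A/= => /(lt_trans (truncnS_gt _)).
  by rewrite ltxx.
have := @nonincreasing_cvg_mu _ _ _ Q A.
move=> /(_ _ mA _ _).
rewrite A0 measure0 => cA.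
have {}cA : Q (A n) @[n --> \oo] --> 0%E.
  apply: cA => //.
  - by rewrite (le_lt_trans (probability_le1 Q (mA 0%N)))// ltry.
  - move=> n m' nm; apply/subsetPset => x /=; rewrite /A/=; apply: le_lt_trans.
    by rewrite ler_nat.
have [n _ /(_ n (leqnn n))] : \forall n \near \oo, (Q (A n) <= e%:E)%E.
  have /fine_cvgP[_ /cvgrPdist_le /(_ e e0)] := cA.
  apply: filterS => n; rewrite sub0r normrN ger0_norm ?fine_ge0// => H.
  rewrite -[leLHS]fineK ?lee_fin//; exact: fin_num_measure.
by move=> H; exists n%:R.
Qed.

Section WeakConvergenceCriterion.
Context d (T : measurableType d) (R : realType) (m : nat).
Variables (P : probability T R) (Q : probability (borelV R m) R).
Variable Y : nat -> T -> 'cV[R]_m.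
Hypothesis mY : forall k, measurable_fun setT (Y k : T -> borelV R m).
Hypothesis tightY : forall e : R, 0 < e -> exists L : R,
  \forall k \near \oo, (P [set w | (L < `|Y k w|)%R] <= e%:E)%E.
Hypothesis cosY : forall (t : 'cV[R]_m) (a : R),
  \int[P]_w cos ((t^T *m Y k w) 0 0 + a) @[k --> \oo] -->
  \int[Q]_x cos ((t^T *m (x : 'cV[R]_m)) 0 0 + a).

Let mid : measurable_fun setT (id : borelV R m -> borelV R m) := @measurable_id _ _ _.

Let Iq (f : 'cV[R]_m -> R) (M : R) : continuous f -> (forall x, `|f x| <= M) ->
  Q.-integrable setT (EFin \o (f : borelV R m -> R)).
Proof.
by move=> cf fM; apply: (@integrable_bounded _ _ _ Q f M) => //; exact: continuous_measurable_borelV.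
Qed.

Let Ip (f : 'cV[R]_m -> R) (M : R) k : continuous f -> (forall x, `|f x| <= M) ->
  P.-integrable setT (EFin \o (fun w => f (Y k w))).
Proof.
move=> cf fM; apply: (@integrable_bounded _ _ _ P _ M) => //.
exact: (measurable_fun_continuous_cV (mY k)).
Qed.

Lemma trigpoly_cvg (p : 'cV[R]_m -> R) : trigpoly p ->
  \int[P]_w p (Y k w) @[k --> \oo] --> \int[Q]_x (p : borelV R m -> R) x.
Proof.
elim=> [t a|c p1 p2 t1 IH1 t2 IH2]; first exact: cosY.
have [M1 b1] := trigpoly_bounded t1; have [M2 b2] := trigpoly_bounded t2.
have c1 := trigpoly_continuous t1; have c2 := trigpoly_continuous t2.
have Iq1 := Iq c1 b1; have Iq2 := Iq c2 b2.
have Iqc1 : Q.-integrable setT (EFin \o (fun x : borelV R m => c * p1 x)).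
  by have := integrableZl measurableT c Iq1; apply: eq_integrable.
rewrite RintegralD// RintegralZl//.
have -> : (fun k => \int[P]_w (c * p1 (Y k w) + p2 (Y k w))) =
    (fun k => c * \int[P]_w p1 (Y k w) + \int[P]_w p2 (Y k w)).
  apply/funext => k; have Ip1 := Ip k c1 b1; have Ip2 := Ip k c2 b2.
  have Ipc1 : P.-integrable setT (EFin \o (fun w => c * p1 (Y k w))).
    by have := integrableZl measurableT c Ip1; apply: eq_integrable.
  by rewrite RintegralD// RintegralZl.
by apply: cvgD => //; apply: cvgM => //; exact: cvg_cst.
Qed.

Lemma cvg_in_law_criterion : cvg_in_law P Y Q.
Proof.
split=> // f cf [M0 fM0].
pose M : R := `|M0| + 1.
have M1 : 0 < M by rewrite ltr_wpDl.
have fM x : `|f x| <= M by rewrite (le_trans (fM0 x))// (le_trans (ler_norm _))// lerDl.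
suff cR : \int[P]_w f (Y k w) @[k --> \oo] --> \int[Q]_x (f : borelV R m -> R) x.
  have -> : (fun k => \int[P]_w (f (Y k w))%:E)%E = (fun k => (\int[P]_w f (Y k w))%:E).
    apply/funext => k; rewrite /Rintegral fineK//; apply: integrable_fin_num => //.
    exact: Ip cf fM.
  rewrite -[X in _ --> X]fineK; last by apply: integrable_fin_num => //; exact: Iq cf fM.
  by apply: cvg_EFin; [exact: nearW|exact: cR].
apply/cvgrPdist_le => /= e e0.
pose e' := e / (3 + 4 * M).
have e'0 : 0 < e' by rewrite divr_gt0//; lra.
have [L1 PL] := tightY e'0.
have [L2 QL] := borelV_tight Q e'0.
pose L := Num.max (Num.max L1 L2) 1.
have L0 : 0 < L by rewrite lt_max ltr01 orbT.
have [p [tp pM fp]] := trig_approx cf fM L0 e'0.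
have cp := trigpoly_continuous tp.
have Q1 : `|\int[Q]_x (f : borelV R m -> R) x - \int[Q]_x (p : borelV R m -> R) x| <= e' + 2 * M * e'.
  have mA : measurable [set x : borelV R m | L < `|x : 'cV[R]_m|].
    exact: (measurable_norm_gt L mid).
  apply: (@le_trans _ _ (e' + 2 * M * fine (Q [set x | L < `|x : 'cV[R]_m|]))).
    apply: Rintegral_dist_le => //; [exact: continuous_measurable_borelV..|exact: ltW|].
    by move=> x /= /negP; rewrite -leNgt => /fp.
  rewrite lerD2l ler_wpM2l//; first lra.
  rewrite -lee_fin fineK ?fin_num_measure//; apply: le_trans QL.
  have mB : measurable [set x : borelV R m | L2 < `|x : 'cV[R]_m|].
    exact: (measurable_norm_gt L2 mid).
  apply: le_measure; [exact: mem_set|exact: mem_set|].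
  by move=> x /=; apply: le_lt_trans; rewrite /L !le_max lexx orbT.
near=> k.
have P1 : `|\int[P]_w f (Y k w) - \int[P]_w p (Y k w)| <= e' + 2 * M * e'.
  have mA : measurable [set w | L < `|Y k w|] by exact: measurable_norm_gt.
  apply: (@le_trans _ _ (e' + 2 * M * fine (P [set w | L < `|Y k w|]))).
    apply: Rintegral_dist_le => //; [exact: (measurable_fun_continuous_cV (mY k))..|exact: ltW|].
    by move=> x /= /negP; rewrite -leNgt => /fp.
  rewrite lerD2l ler_wpM2l//; first lra.
  rewrite -lee_fin fineK ?fin_num_measure//.
  apply: (@le_trans _ _ (P [set w | L1 < `|Y k w|])); last by near: k.
  have mB : measurable [set w | L1 < `|Y k w|] by exact: measurable_norm_gt.
  apply: le_measure; [exact: mem_set|exact: mem_set|].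
  by move=> x /=; apply: le_lt_trans; rewrite /L !le_max lexx.
have PQ : `|\int[Q]_x (p : borelV R m -> R) x - \int[P]_w p (Y k w)| <= e'.
  by near: k; have /cvgrPdist_le := trigpoly_cvg tp; exact.
set a := \int[Q]_x _ in Q1 PQ *; set b := \int[Q]_x (p : borelV R m -> R) x in Q1 PQ.
set c := \int[P]_w p _ in P1 PQ; set g := \int[P]_w f _ in P1 *.
have -> : a - g = (a - b) + (b - c) - (g - c) by ring.
have eE : e = 3 * e' + 4 * M * e' by rewrite /e'; field; rewrite gt_eqF//; lra.
rewrite (le_trans (ler_normB _ _))//; have := ler_normD (a - b) (b - c).
move: P1 PQ Q1; rewrite eE.
move: `|_| `|_| `|_| `|_| => x1 x2 x3 x4; lra.
Unshelve. all: by end_near. Qed.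

End WeakConvergenceCriterion.

(** * Gaussian laws *)

Section LebesgueAffine.
Variable R : realType.
Notation mu := (@lebesgue_measure R).

Lemma lebesgue_measure_affine (a b : R) (A : set R) : 0 < a -> measurable A ->
  mu A = (a%:E * mu ((fun x : R => (a * x + b)%R) @^-1` A))%E.
Proof.
move=> a0 mA.
have ma : measurable_fun setT (fun x : R => a * x + b).
  by apply: measurable_funD => //; exact: measurable_funM.
have a0' : 0 <= a by exact: ltW.
pose f : measurableTypeR R -> measurableTypeR R := fun x => a * x + b.
pose nu : {measure set (measurableTypeR R) -> \bar R} := mscale (NngNum a0') (pushforward mu f).
suff -> : mu A = nu ma A by [].
apply: (@lebesgue_measure_unique R (nu ma)) => // _ [[x y]] _ <-.
rewrite /nu /= /mscale/= /pushforward.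
have -> : f @^-1` `]x, y] = `](x - b) / a, (y - b) / a]%classic.
  apply/seteqP; split => z /=; rewrite !in_itv/= /f.
    by move=> /andP[xz zy]; rewrite ltr_pdivrMr// ler_pdivlMr//; lra.
  by rewrite ltr_pdivrMr// ler_pdivlMr//; lra.
rewrite !lebesgue_measure_itv/= !lte_fin ltr_pM2r ?invr_gt0// ltrD2r.
case: ifPn => _; last by rewrite mule0.
rewrite -!EFinB -EFinM; congr EFin; field.
by rewrite gt_eqF.
Qed.

Lemma ge0_integral_affine (a b : R) (f : R -> \bar R) : 0 < a ->
  measurable_fun setT f -> (forall x, 0 <= f x)%E ->
  (\int[mu]_x f x = a%:E * \int[mu]_x f (a * x + b)%R)%E.
Proof.
move=> a0; have a0' : (0 <= a%:E)%E by rewrite lee_fin ltW.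
have ma : measurable_fun setT (fun x : R => a * x + b).
  by apply: measurable_funD => //; exact: measurable_funM.
move: f; apply: measurable_nneg_ind.
- move=> A mA; transitivity (mu A); first by rewrite integral_indic ?setIT.
  rewrite (lebesgue_measure_affine b a0 mA); congr (_ * _)%E.
  rewrite (_ : (fun x : R => (\1_A (a * x + b))%R%:E) =
    (fun x : R => (\1_((fun x : R => a * x + b) @^-1` A) x)%R%:E))//.
  by rewrite integral_indic ?setIT// -[X in measurable X]setTI; exact: ma.
- move=> f f' c c0 mf f0 Hf mf' f'0 Hf'.
  have mfa : measurable_fun setT (fun x => f (a * x + b)%R) by exact: measurableT_comp.
  have mf'a : measurable_fun setT (fun x => f' (a * x + b)%R) by exact: measurableT_comp.
  have m1 : measurable_fun setT (fun x => c%:E * f' (a * x + b)%R)%E by exact: measurable_funeM.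
  have m2 : measurable_fun setT (fun x => c%:E * f' x)%E by exact: measurable_funeM.
  have n1 x : [set: R] x -> (0 <= c%:E * f' (a * x + b)%R)%E by move=> ?; rewrite mule_ge0.
  have n2 x : [set: R] x -> (0 <= c%:E * f' x)%E by move=> ?; rewrite mule_ge0.
  rewrite !ge0_integralD// !ge0_integralZl// Hf Hf' [RHS]ge0_muleDr ?mule_ge0 ?integral_ge0//.
  by rewrite muleCA.
- move=> f_ f mf_ f_0 Hf_ nd cvf.
  have L : (\int[mu]_x f_ n (a * x + b)%R @[n --> \oo] --> \int[mu]_x f (a * x + b)%R)%E.
    have -> : (\int[mu]_x f (a * x + b)%R = \int[mu]_x limn (fun n => f_ n (a * x + b)%R))%E.
      by apply: eq_integral => x _; apply/esym/cvg_lim => //; exact: cvf.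
    apply: cvg_monotone_convergence => //.
    by move=> n; exact: measurableT_comp.
  have L' : (\int[mu]_x f_ n x @[n --> \oo] --> \int[mu]_x f x)%E.
    have -> : (\int[mu]_x f x = \int[mu]_x limn (fun n => f_ n x))%E.
      by apply: eq_integral => x _; apply/esym/cvg_lim => //; exact: cvf.
    exact: cvg_monotone_convergence.
  have L'' := cvgeZl (isT : a%:E \is a fin_num) L.
  rewrite -(cvg_lim _ L')// -(cvg_lim _ L'')//.
  by congr (limn _); apply/funext => n.
Qed.

End LebesgueAffine.

Section NormalLaw.
Variable R : realType.
Notation mu := (@lebesgue_measure R).
Notation N s := (normal_prob (0 : R) s).
Implicit Types a b s t v : R.

Lemma ge0_integral_normal s (f : R -> \bar R) : measurable_fun setT f ->
  (forall x, 0 <= f x)%E ->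
  (\int[N s]_x f x = \int[mu]_x (f x * (normal_pdf 0 s x)%:E))%E.
Proof.
move=> mf f0; apply: (@ge0_integral_density _ _ _ _ _ mu (N s) idfun (normal_pdf 0 s)) => //.
- exact: measurable_id.
- exact: measurable_normal_pdf.
- exact: normal_pdf_ge0.
Qed.

Lemma normal_pdf_expE m s x : 0 < s ->
  normal_pdf m s x = (s * Num.sqrt (pi *+ 2))^-1 * expR (- (x - m) ^+ 2 / (s ^+ 2 *+ 2)).
Proof.
move=> s0; rewrite normal_pdfE ?gt_eqF// /normal_peak /normal_fun.
by rewrite -mulrnAr sqrtrM ?sqr_ge0// sqrtr_sqr gtr0_norm.
Qed.

Lemma normal_pdf_scale s x : 0 < s ->
  s * normal_pdf 0 s (s * x) = normal_pdf 0 1 x.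
Proof.
move=> s0; rewrite !normal_pdf_expE//.
have -> : - (s * x - 0) ^+ 2 / (s ^+ 2 *+ 2) = - (x - 0) ^+ 2 / (1 ^+ 2 *+ 2).
  by field; rewrite gt_eqF.
have q0 : Num.sqrt (pi *+ 2) != 0 :> R by rewrite gt_eqF// sqrtr_gt0 pmulrn_lgt0 ?pi_gt0.
by field; rewrite q0 gt_eqF.
Qed.

Lemma ge0_integral_normal_scale s (f : R -> \bar R) : 0 < s ->
  measurable_fun setT f -> (forall x, 0 <= f x)%E ->
  (\int[N s]_x f x = \int[N 1]_x f (s * x)%R)%E.
Proof.
move=> s0 mf f0.
have ms : measurable_fun setT (fun x => f (s * x)%R).
  by apply: (measurableT_comp mf); exact: measurable_funM.
rewrite (ge0_integral_normal s mf f0) (ge0_integral_normal 1 ms (fun x => f0 _)).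
have mp r : measurable_fun setT (fun x => (normal_pdf 0 r x)%:E : \bar R).
  by apply/measurable_EFinP; exact: measurable_normal_pdf.
rewrite (ge0_integral_affine 0 s0); last 2 first.
- exact: emeasurable_funM.
- by move=> x; rewrite mule_ge0// lee_fin normal_pdf_ge0.
rewrite -ge0_integralZl//; last 3 first.
- apply: (@measurableT_comp _ _ _ _ _ _ (fun x => f x * (normal_pdf 0 s x)%:E)%E).
    exact: emeasurable_funM.
  by apply: measurable_funD => //; exact: measurable_funM.
- by move=> x _; rewrite mule_ge0// lee_fin normal_pdf_ge0.
- by rewrite lee_fin ltW.
by apply: eq_integral => x _; rewrite addr0 muleCA -EFinM normal_pdf_scale.
Qed.

Lemma normal_pdfN (x : R) : normal_pdf 0 1 x = normal_pdf 0 1 (- x).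
Proof. by rewrite !normal_pdf_expE// !subr0 sqrrN. Qed.

Lemma ge0_integral_normalN (f : R -> \bar R) :
  measurable_fun setT f -> (forall x, 0 <= f x)%E ->
  (\int[N 1]_x f x = \int[N 1]_x f (- x)%R)%E.
Proof.
move=> mf f0.
have mN : measurable_fun setT (fun x : R => f (- x)%R) by exact: measurableT_comp.
rewrite (ge0_integral_normal 1 mf f0) (ge0_integral_normal 1 mN (fun x => f0 _)).
have mp r : measurable_fun setT (fun x => (normal_pdf 0 r x)%:E : \bar R).
  by apply/measurable_EFinP; exact: measurable_normal_pdf.
pose F x := (f x * (normal_pdf 0 1 x)%:E)%E.
have mF : measurable_fun setT F by exact: emeasurable_funM.
pose o := (-%R : measurableTypeR R -> measurableTypeR R).
have mo : measurable_fun setT o by exact: oppr_measurable.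
have F0 : {in [set: measurableTypeR R], forall x, (0 <= F x)%E}.
  by move=> x _; rewrite mule_ge0// lee_fin normal_pdf_ge0.
have H := ge0_integral_pushforward mo mu (@measurableT _ _) mF F0.
transitivity (\int[pushforward mu o]_x F x)%E.
  by apply: eq_measure_integral => //= A mA _; exact/esym/lebesgue_measureN.
rewrite H.
by rewrite preimage_setT; apply: eq_integral => x _; rewrite /F /= -normal_pdfN.
Qed.

(* Completing the square: the y-section of the joint density of (X, Z), where
   X ~ N(0, a^2) and Z = X + Y, is the density of Z times a normal density. *)
Lemma normal_pdf_conv a b y z : 0 < a -> 0 < b ->
  let c := Num.sqrt (a ^+ 2 + b ^+ 2) in
  normal_pdf 0 a (z - y) * normal_pdf 0 b y =
    normal_pdf 0 c z * normal_pdf (b ^+ 2 * z / c ^+ 2) (a * b / c) y.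
Proof.
move=> a0 b0 c.
have c2 : c ^+ 2 = a ^+ 2 + b ^+ 2 by rewrite sqr_sqrtr// addr_ge0 ?sqr_ge0.
have c0 : 0 < c by rewrite sqrtr_gt0 addr_gt0// exprn_gt0.
rewrite !normal_pdf_expE ?divr_gt0 ?mulr_gt0//.
set q := Num.sqrt (pi *+ 2).
have q0 : q != 0 by rewrite gt_eqF// sqrtr_gt0 pmulrn_lgt0 ?pi_gt0.
rewrite mulrACA -expRD [RHS]mulrACA -expRD; congr (_ * expR _).
  by field; rewrite q0 !gt_eqF.
have d0 : a ^+ 2 + b ^+ 2 != 0 by rewrite -c2 gt_eqF// exprn_gt0.
have -> : (a * b / c) ^+ 2 = a ^+ 2 * b ^+ 2 / (a ^+ 2 + b ^+ 2).
  by rewrite -c2; field; rewrite gt_eqF.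
rewrite c2; field.
by rewrite d0 !gt_eqF.
Qed.

Lemma normal_conv a b (f : R -> \bar R) : 0 < a -> 0 < b ->
  measurable_fun setT f -> (forall x, 0 <= f x)%E ->
  (\int[N b]_y \int[N a]_x f (x + y)%R = \int[N (Num.sqrt (a ^+ 2 + b ^+ 2))]_z f z)%E.
Proof.
move=> a0 b0 mf f0; set c := Num.sqrt _.
have c0 : 0 < c by rewrite sqrtr_gt0 addr_gt0// exprn_gt0.
have mp r : measurable_fun setT (fun x => (normal_pdf 0 r x)%:E : \bar R).
  by apply/measurable_EFinP; exact: measurable_normal_pdf.
have mfD (y : R) : measurable_fun setT (fun x : R => f (x + y)%R).
  by apply: (measurableT_comp mf); exact: measurable_funD.
pose G (p : R * R) := (f p.2 * (normal_pdf 0 a (p.2 - p.1) * normal_pdf 0 b p.1)%:E)%E.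
have mG : measurable_fun setT G.
  apply: emeasurable_funM.
    by apply: (measurableT_comp mf); exact: measurable_snd.
  apply/measurable_EFinP; apply: measurable_funM.
    apply: (measurableT_comp (measurable_normal_pdf 0 a)).
    by apply: measurable_funB; [exact: measurable_snd|exact: measurable_fst].
  by apply: (measurableT_comp (measurable_normal_pdf 0 b)); exact: measurable_fst.
have G0 p : (0 <= G p)%E by rewrite mule_ge0// lee_fin mulr_ge0// normal_pdf_ge0.
have inner y : (\int[N a]_x f (x + y)%R * (normal_pdf 0 b y)%:E = \int[mu]_z G (y, z))%E.
  rewrite (ge0_integral_normal a (mfD y) (fun x => f0 _)) -ge0_integralZr//; last 3 first.
  - exact: (emeasurable_funM (mfD y) (mp a)).
  - by move=> x _; rewrite mule_ge0// lee_fin normal_pdf_ge0.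
  - by rewrite lee_fin normal_pdf_ge0.
  rewrite [LHS](ge0_integral_affine (- y) ltr01); last 2 first.
  - exact: (emeasurable_funM (emeasurable_funM (mfD y) (mp a)) (measurable_cst _)).
  - by move=> x; rewrite !mule_ge0// lee_fin normal_pdf_ge0.
  rewrite mul1e; apply: eq_integral => z _.
  by rewrite mul1r subrK -muleA -EFinM.
have mI : measurable_fun setT (fun y => \int[N a]_x f (x + y)%R)%E.
  have mfxy : measurable_fun setT (fun p : R * R => f (p.2 + p.1)%R).
    apply: (measurableT_comp mf).
    by apply: measurable_funD; [exact: measurable_snd|exact: measurable_fst].
  have := measurable_fun_fubini_tonelli_F (m2 := N a) _ mfxy (fun _ => f0 _).
  by [].
rewrite (ge0_integral_normal b mI); last by move=> y; rewrite integral_ge0.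
transitivity (\int[mu]_y \int[mu]_z G (y, z))%E.
  by apply: eq_integral => y _; exact: inner.
rewrite (fubini_tonelli (m1 := mu) (m2 := mu) G mG G0) (ge0_integral_normal c mf f0).
apply: eq_integral => z _; rewrite /G/=.
transitivity (\int[mu]_y ((f z * (normal_pdf 0 c z)%:E) *
   (normal_pdf (b ^+ 2 * z / c ^+ 2) (a * b / c) y)%:E))%E.
  by apply: eq_integral => y _; rewrite normal_pdf_conv// EFinM muleA.
rewrite ge0_integralZl//; last 3 first.
- by apply/measurable_EFinP; exact: measurable_normal_pdf.
- by move=> y _; rewrite lee_fin normal_pdf_ge0.
- by rewrite mule_ge0// lee_fin normal_pdf_ge0.
by rewrite integral_normal_pdf mule1.
Qed.

End NormalLaw.

Section NormalCombinations.
Variable R : realType.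
Notation Z := (normal_prob (0 : R) 1).
Implicit Types a b v x y : R.

Lemma ge0_integral_normal_abs a (f : R -> \bar R) :
  measurable_fun setT f -> (forall x, 0 <= f x)%E ->
  (\int[Z]_x f (a * x)%R = \int[Z]_x f (`|a| * x)%R)%E.
Proof.
move=> mf f0; case: (lerP 0 a) => a0; first by rewrite ger0_norm.
have ma : measurable_fun setT (fun x => f (a * x)%R).
  by apply: (measurableT_comp mf); exact: measurable_funM.
rewrite (ge0_integral_normalN ma (fun x => f0 _)) ltr0_norm//.
by apply: eq_integral => x _; rewrite mulrN mulNr.
Qed.

Lemma ge0_integral_normal_comb a b (f : R -> \bar R) :
  measurable_fun setT f -> (forall x, 0 <= f x)%E ->
  (\int[Z]_y \int[Z]_x f (a * x + b * y)%R =
   \int[Z]_z f (Num.sqrt (a ^+ 2 + b ^+ 2) * z)%R)%E.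
Proof.
move=> mf f0.
have mfD (y : R) : measurable_fun setT (fun x : R => f (x + y)%R).
  by apply: (measurableT_comp mf); exact: measurable_funD.
pose G (y : R) : \bar R := (\int[Z]_x f (`|a| * x + y)%R)%E.
have G0 y : (0 <= G y)%E by rewrite integral_ge0.
have mG : measurable_fun setT G.
  have mfxy : measurable_fun setT (fun p : R * R => f (`|a| * p.2 + p.1)%R).
    apply: (measurableT_comp mf); apply: measurable_funD; last exact: measurable_fst.
    by apply: measurable_funM => //; exact: measurable_snd.
  have := measurable_fun_fubini_tonelli_F (m2 := Z) _ mfxy (fun _ => f0 _).
  by [].
transitivity (\int[Z]_y G (b * y)%R)%E.
  apply: eq_integral => y _.
  exact: (ge0_integral_normal_abs a (mfD (b * y)) (fun x => f0 _)).
rewrite (ge0_integral_normal_abs b mG G0).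
have cst (g : \bar R) : (\int[Z]__ g = g)%E.
  rewrite integral_cst// -[RHS]mule1; congr (_ * _)%E; exact: probability_setT.
have [a0|a0] := eqVneq a 0.
  rewrite a0 expr0n/= add0r sqrtr_sqr; apply: eq_integral => y _.
  by rewrite /G a0 normr0; under eq_integral do rewrite mul0r add0r; exact: cst.
have [->|b0] := eqVneq b 0.
  rewrite expr0n/= addr0 sqrtr_sqr normr0; under eq_integral do rewrite mul0r.
  by rewrite cst /G; apply: eq_integral => x _; rewrite addr0.
have a0' : 0 < `|a| by rewrite normr_gt0.
have b0' : 0 < `|b| by rewrite normr_gt0.
rewrite -(ge0_integral_normal_scale b0' mG G0).
have c0 : 0 < Num.sqrt (a ^+ 2 + b ^+ 2).
  by rewrite sqrtr_gt0 addr_gt0// exprn_even_gt0.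
rewrite -(ge0_integral_normal_scale c0 mf f0).
have E : `|a| ^+ 2 + `|b| ^+ 2 = a ^+ 2 + b ^+ 2 by rewrite !real_normK ?num_real.
have := normal_conv a0' b0' mf f0; rewrite E => H; apply: etrans H.
by apply: eq_integral => y _; rewrite (ge0_integral_normal_scale a0' (mfD y) (fun x => f0 _)).
Qed.

Lemma normal_lawE v (B : set R) : 0 <= v -> measurable B ->
  normal_law 0 v B = Z [set x | B (Num.sqrt v * x)].
Proof.
move=> v0 mB; have mB' : measurable [set x : R | B (Num.sqrt v * x)].
  have /(_ measurableT _ mB) : measurable_fun setT (fun x : R => Num.sqrt v * x).
    exact: measurable_funM.
  by rewrite setTI.
rewrite /normal_law; case: eqVneq => [->|vn0].
  rewrite diracE sqrtr0.
  have [B0|B0] := pselect (B 0).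
    rewrite mem_set// (_ : [set x : R | B (0 * x)] = setT); first exact/esym/probability_setT.
    by apply/seteqP; split => x //= _; rewrite mul0r.
  rewrite memNset// (_ : [set x : R | B (0 * x)] = set0) ?measure0//.
  by apply/seteqP; split => x //=; rewrite mul0r.
have s0 : 0 < Num.sqrt v by rewrite sqrtr_gt0 lt_neqAle eq_sym vn0.
have mI (A : set R) : measurable A -> measurable_fun setT (fun x : R => (\1_A x)%:E : \bar R).
  by move=> mA; apply/measurable_EFinP; exact: measurable_indic.
transitivity (\int[normal_prob 0 (Num.sqrt v)]_x (\1_B x)%:E)%E.
  by rewrite integral_indic// setIT.
rewrite (ge0_integral_normal_scale s0 (mI _ mB)); last by move=> x; rewrite lee_fin.
transitivity (\int[Z]_x (\1_[set x : R | B (Num.sqrt v * x)] x)%:E)%E; last first.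
  by rewrite integral_indic// setIT.
by apply: eq_integral => x _.
Qed.

End NormalCombinations.

Section NormalMoments.
Variable R : realType.
Notation Z := (normal_prob (0 : R) 1).
Implicit Types a b t v x y : R.

Lemma integral_normal_expR t : (\int[Z]_x (expR (t * x))%:E = (expR (t ^+ 2 / 2))%:E)%E.
Proof.
have me : measurable_fun setT (fun x => (expR (t * x))%:E : \bar R).
  by apply/measurable_EFinP/measurableT_comp => //; exact: measurable_funM.
rewrite (ge0_integral_normal 1 me); last by move=> x; rewrite lee_fin expR_ge0.
transitivity (\int[lebesgue_measure]_x ((expR (t ^+ 2 / 2))%:E * (normal_pdf t 1 x)%:E))%E.
  apply: eq_integral => x _; rewrite -!EFinM !normal_pdf_expE//; congr EFin.
  by rewrite mulrCA -expRD [RHS]mulrCA -expRD; congr (_ * expR _); field.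
rewrite ge0_integralZl//.
- by rewrite integral_normal_pdf mule1.
- by apply/measurable_EFinP; exact: measurable_normal_pdf.
- by move=> x _; rewrite lee_fin normal_pdf_ge0.
Qed.

Lemma integrable_normal_expR t : Z.-integrable setT (EFin \o (fun x => expR (t * x))).
Proof.
apply/integrableP; split.
  by apply/measurable_EFinP/measurableT_comp => //; exact: measurable_funM.
under eq_integral do rewrite /= ger0_norm ?expR_ge0//.
by rewrite integral_normal_expR ltry.
Qed.

Lemma Rintegral_normal_expR t : \int[Z]_x expR (t * x) = expR (t ^+ 2 / 2).
Proof. by rewrite /Rintegral integral_normal_expR. Qed.

Lemma expR_norm_le x : expR `|x| <= expR x + expR (- x).
Proof.
by case: (ger0P x) => _; rewrite ?lerDl ?lerDr expR_ge0.
Qed.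

Lemma norm_le_expR x : `|x| <= expR `|x|.
Proof. by apply: le_trans (expR_ge1Dx _); rewrite lerDr. Qed.

Lemma sqr_le_expR x : x ^+ 2 <= 4 * expR `|x|.
Proof.
have := norm_le_expR (x / 2); rewrite normrM (ger0_norm (_ : 0 <= 2^-1 :> R))// => H.
have -> : expR `|x| = expR (`|x| / 2) ^+ 2 by rewrite -expRM_natl; congr expR; field.
rewrite -real_normK ?num_real//.
have : (`|x| / 2) ^+ 2 <= expR (`|x| / 2) ^+ 2 by rewrite lerXn2r// nnegrE ?expR_ge0// divr_ge0.
by rewrite expr_div_n; lra.
Qed.

Lemma pow4_le_expR x : x ^+ 4 <= 256 * expR `|x|.
Proof.
have := sqr_le_expR (x / 2); rewrite normrM (ger0_norm (_ : 0 <= 2^-1 :> R))// => H.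
have -> : expR `|x| = expR (`|x| / 2) ^+ 2 by rewrite -expRM_natl; congr expR; field.
have : ((x / 2) ^+ 2) ^+ 2 <= (4 * expR (`|x| / 2)) ^+ 2.
  by rewrite lerXn2r// nnegrE ?sqr_ge0// mulr_ge0// expR_ge0.
by rewrite -exprM expr_div_n exprMn; lra.
Qed.

(* [4 sinh(y/2)^2] is squeezed between [y^2 exp(-|y|)] and [y^2 exp |y|]. *)
Lemma cosh_bounds y :
  y ^+ 2 * expR (- `|y|) <= expR y + expR (- y) - 2 <= y ^+ 2 * expR `|y|.
Proof.
wlog y0 : y / 0 <= y.
  move=> H; case: (lerP 0 y) => y0; first exact: H.
  have := H (- y); rewrite normrN sqrrN opprK oppr_ge0 => /(_ (ltW y0)).
  by rewrite (addrC (expR (- y))).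
rewrite ger0_norm//.
set u := expR (y / 2); set w := expR (- (y / 2)).
have u0 : 0 < u by exact: expR_gt0.
have w0 : 0 < w by exact: expR_gt0.
have uw : u * w = 1 by rewrite -expRD subrr expR0.
have -> : expR y = u ^+ 2 by rewrite -expRM_natl; congr expR; field.
have -> : expR (- y) = w ^+ 2 by rewrite -expRM_natl; congr expR; field.
have -> : u ^+ 2 + w ^+ 2 - 2 = (u - w) ^+ 2 by rewrite sqrrB uw; ring.
have h1 : y * w <= u - w.
  have : y + 1 <= u * u by rewrite -expRD addrC (le_trans (expR_ge1Dx _))// ler_expR; lra.
  move=> /(ler_wpM2r (ltW w0)); rewrite -mulrA uw mulr1 mulrDl mul1r; lra.
have h2 : u - w <= y * u.
  have : 1 - y <= w * w by rewrite -expRD (le_trans (expR_ge1Dx _))// ler_expR; lra.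
  move=> /(ler_wpM2r (ltW u0)); rewrite -mulrA (mulrC w u) uw mulr1 mulrBl mul1r; lra.
have yw0 : 0 <= y * w by rewrite mulr_ge0// ltW.
have uw0 := le_trans yw0 h1; have yu0 := le_trans uw0 h2.
by rewrite -!exprMn; apply/andP; split; rewrite lerXn2r.
Qed.

Lemma integrable_normal_expR_norm (c t : R) : 0 <= t ->
  Z.-integrable setT (EFin \o (fun x => c * expR (t * `|x|))).
Proof.
move=> t0; have I1 := integrable_normal_expR t; have I2 := integrable_normal_expR (- t).
have I3 : Z.-integrable setT (EFin \o (fun x => `|c| * (expR (t * x) + expR (- t * x)))).
  have := integrableD measurableT I1 I2 => /(integrableZl measurableT `|c|).
  by apply: eq_integrable => // x _.
apply: integrable_dominated I3 _.
  apply: measurable_funM => //; apply: measurableT_comp => //.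
  by apply: measurable_funM => //; exact: measurableT_comp.
move=> x; rewrite normrM (ger0_norm (expR_ge0 _)) ler_wpM2l//.
have -> : t * `|x| = `|t * x| by rewrite normrM (ger0_norm t0).
by rewrite mulNr expR_norm_le.
Qed.

Lemma integrable_normal_pow4 : Z.-integrable setT (EFin \o (fun x => x ^+ 4)).
Proof.
apply: (integrable_dominated _ (integrable_normal_expR_norm 256 ler01)).
  exact: measurable_funX.
by move=> x; rewrite mul1r ger0_norm ?exprn_even_ge0// pow4_le_expR.
Qed.

Lemma integrable_normal_sqr : Z.-integrable setT (EFin \o (fun x => x ^+ 2)).
Proof.
apply: (integrable_dominated _ (integrable_normal_expR_norm 4 ler01)).
  exact: measurable_funX.
by move=> x; rewrite mul1r ger0_norm ?sqr_ge0// sqr_le_expR.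
Qed.

Lemma invS_cvg0 (c : R) : c / k.+1%:R @[k --> \oo] --> 0.
Proof.
by rewrite -(mulr0 c); apply: cvgM; [exact: cvg_cst|exact: cvg_harmonic].
Qed.

Lemma expR_invS_cvg1 (c : R) : expR (c / k.+1%:R) @[k --> \oo] --> (1 : R).
Proof.
rewrite -[X in _ --> X]expR0; apply: continuous_cvg; first exact: continuous_expR.
exact: invS_cvg0.
Qed.

Lemma Rintegral_normal_sqr : \int[Z]_x x ^+ 2 = 1.
Proof.
pose f (k : nat) x := k.+1%:R ^+ 2 * (expR (k.+1%:R^-1 * x) + expR (- k.+1%:R^-1 * x) - 2).
have k0 k : 0 < k.+1%:R :> R by rewrite ltr0n.
have fb k x : x ^+ 2 * expR (- (`|x| / k.+1%:R)) <= f k x <= x ^+ 2 * expR (`|x| / k.+1%:R).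
  have := cosh_bounds (k.+1%:R^-1 * x).
  have -> : `|k.+1%:R^-1 * x| = `|x| / k.+1%:R by rewrite normrM gtr0_norm ?invr_gt0// mulrC.
  move=> /andP[h1 h2].
  have -> : x ^+ 2 = k.+1%:R ^+ 2 * (k.+1%:R^-1 * x) ^+ 2 by field; rewrite gt_eqF.
  have K : 0 <= k.+1%:R ^+ 2 :> R by exact: sqr_ge0.
  have := ler_wpM2l K h1; have := ler_wpM2l K h2; rewrite /f mulNr.
  by rewrite [in X in X -> _]mulrA [in X in _ -> X -> _]mulrA => -> ->.
have L1 : \int[Z]_x f k x @[k --> \oo] --> \int[Z]_x x ^+ 2.
  apply: (Rintegral_dominated_cvg _ _ (integrable_normal_expR_norm 4 (ler0n R 2))).
  - move=> k; apply: measurable_funM => //; apply: measurable_funB => //.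
    by apply: measurable_funD; apply: measurableT_comp => //; exact: measurable_funM.
  - move=> x; apply: (@squeeze_cvgr _ _ _ _ (fun k => x ^+ 2 * expR (- (`|x| / k.+1%:R)))
      (fun k => x ^+ 2 * expR (`|x| / k.+1%:R))).
    + by apply: nearW => k; exact: fb.
    + rewrite -[X in _ --> X]mulr1; apply: cvgM; first exact: cvg_cst.
      by under eq_fun do rewrite -mulNr; exact: expR_invS_cvg1.
    + rewrite -[X in _ --> X]mulr1; apply: cvgM; first exact: cvg_cst.
      exact: expR_invS_cvg1.
  - apply: nearW => k x; have /andP[h1 h2] := fb k x.
    have f0 : 0 <= f k x by rewrite (le_trans _ h1)// mulr_ge0 ?sqr_ge0 ?expR_ge0.
    rewrite ger0_norm// (le_trans h2)//.
    have -> : 4 * expR (2 * `|x|) = 4 * expR `|x| * expR `|x| :> R.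
      by rewrite -mulrA -expRD; congr (_ * expR _); ring.
    apply: ler_pM; rewrite ?sqr_ge0 ?expR_ge0 ?sqr_le_expR//.
    by rewrite ler_expR ler_pdivrMr// ler_peMr// ler1n.
have L2 : \int[Z]_x f k x @[k --> \oo] --> (1 : R).
  have fE k : \int[Z]_x f k x = k.+1%:R ^+ 2 * (2 * expR (k.+1%:R^-1 ^+ 2 / 2) - 2).
    have I1 := integrable_normal_expR (k.+1%:R^-1).
    have I2 := integrable_normal_expR (- k.+1%:R^-1).
    have I3 : Z.-integrable setT (EFin \o (fun=> 2)).
      by apply: (@integrable_bounded _ _ _ _ _ 2) => // x; rewrite ger0_norm.
    have I12 : Z.-integrable setT
        (EFin \o (fun x => expR (k.+1%:R^-1 * x) + expR (- k.+1%:R^-1 * x))).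
      by have := integrableD measurableT I1 I2; apply: eq_integrable => // x _.
    have I123 : Z.-integrable setT
        (EFin \o (fun x => expR (k.+1%:R^-1 * x) + expR (- k.+1%:R^-1 * x) - 2)).
      by have := integrableB measurableT I12 I3; apply: eq_integrable => // x _.
    rewrite /f RintegralZl// RintegralB// RintegralD// !Rintegral_normal_expR Rintegral_const.
    by rewrite sqrrN; congr (_ * (_ - _)); ring.
  under eq_fun do rewrite fE.
  apply: (@squeeze_cvgr _ _ _ _ (fun=> 1) (fun k => expR (1 / k.+1%:R))).
  - apply: nearW => k.
    set s := k.+1%:R^-1 ^+ 2 / 2.
    have s0 : 0 < s by rewrite divr_gt0// exprn_gt0// invr_gt0.
    have -> : k.+1%:R ^+ 2 * (2 * expR s - 2) = (expR s - 1) / s.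
      by rewrite /s; field; rewrite gt_eqF.
    have h1 : 1 <= (expR s - 1) / s.
      by rewrite ler_pdivlMr// mul1r lerBrDl expR_ge1Dx.
    rewrite h1/= ler_pdivrMr//.
    have h2 : expR s - 1 <= s * expR s.
      have := expR_ge1Dx (- s) => /(ler_wpM2r (expR_ge0 s)).
      by rewrite -expRD addNr expR0 mulrDl mul1r mulNr; lra.
    apply: (le_trans h2); rewrite mulrC ler_pM2r// ler_expR mul1r /s.
    rewrite ler_pdivrMr// expr2 ler_pM2l ?invr_gt0//.
    by rewrite (@le_trans _ _ 1)// ?invf_le1// ?ler1n.
  - exact: cvg_cst.
  - exact: expR_invS_cvg1.
exact: (cvg_unique _ L1 L2).
Qed.

Lemma integral_1D d (T : measurableType d) (Q : probability T R) (g : T -> R) :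
  measurable_fun setT g -> (forall w, `|g w| <= 1) ->
  (\int[Q]_w (1 + g w)%:E = (1 + \int[Q]_w g w)%:E)%E.
Proof.
move=> mg g1.
have I1 : Q.-integrable setT (EFin \o g) by exact: (integrable_bounded Q mg g1).
have I2 : Q.-integrable setT (EFin \o (fun=> 1)).
  by apply: (@integrable_bounded _ _ _ _ _ 1) => // x; rewrite normr1.
have I3 : Q.-integrable setT (EFin \o (fun w => 1 + g w)).
  by have := integrableD measurableT I2 I1; apply: eq_integrable => // x _.
have <- : \int[Q]_w (1 + g w) = 1 + \int[Q]_w g w by rewrite RintegralD// Rintegral_const.
by rewrite /Rintegral fineK// (integrable_fin_num measurableT I3).
Qed.

Let norm1D_ge0 y : `|y| <= 1 -> 0 <= 1 + y.
Proof. by rewrite ler_norml => /andP[]; lra. Qed.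

Lemma measurable_cosM a b : measurable_fun setT (fun x : R => cos (a * x + b)).
Proof.
apply: (@measurableT_comp _ _ _ _ _ _ (@cos R)).
  exact: continuous_measurable_fun (@continuous_cos R).
by apply: measurable_funD => //; exact: measurable_funM.
Qed.

Lemma measurable_sinM a : measurable_fun setT (fun x : R => sin (a * x)).
Proof.
apply: (@measurableT_comp _ _ _ _ _ _ (@sin R)).
  exact: continuous_measurable_fun (@continuous_sin R).
exact: measurable_funM.
Qed.

Lemma Rintegral_normal_sin a : \int[Z]_x sin (a * x) = 0.
Proof.
have s1 (t x : R) : `|sin (t * x)| <= 1 by rewrite ler_norml sin_geN1 sin_le1.
have m1 : measurable_fun setT (fun x : R => (1 + sin (a * x))%:E).
  by apply/measurable_EFinP/measurable_funD => //; exact: measurable_sinM.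
have E1 := integral_1D Z (measurable_sinM a) (s1 a).
have E2 := integral_1D Z (measurable_sinM (- a)) (s1 (- a)).
have : (1 + \int[Z]_x sin (a * x))%:E = (1 + \int[Z]_x sin (- a * x))%:E :> \bar R.
  apply: (etrans (esym E1)); apply: etrans E2.
  have m10 x : (0 <= (1 + sin (a * x))%:E)%E by rewrite lee_fin norm1D_ge0.
  apply: (etrans (ge0_integral_normalN m1 m10)).
  by apply: eq_integral => x _; rewrite mulrN mulNr.
move=> -[].
have -> : \int[Z]_x sin (- a * x) = - \int[Z]_x sin (a * x).
  transitivity (\int[Z]_x (-1 * sin (a * x))).
    by apply: eq_Rintegral => x _; rewrite mulN1r mulNr sinN.
  rewrite RintegralZl ?mulN1r//.
  exact: (integrable_bounded Z (measurable_sinM a) (s1 a)).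
by lra.
Qed.

Lemma Rintegral_normal_cosDl a t :
  \int[Z]_x cos (a * x + t) = \int[Z]_x cos (a * x) * cos t.
Proof.
have s1 (x : R) : `|sin (a * x)| <= 1 by rewrite ler_norml sin_geN1 sin_le1.
have c1 (x : R) : `|cos (a * x)| <= 1 by rewrite ler_norml cos_geN1 cos_le1.
have mc : measurable_fun setT (fun x : R => cos (a * x)).
  by have := measurable_cosM a 0; under eq_fun do rewrite addr0.
have Ic := integrable_bounded Z mc c1.
have Is := integrable_bounded Z (measurable_sinM a) s1.
have Ic' : Z.-integrable setT (EFin \o (fun x => cos (a * x) * cos t)).
  by have := integrableZr measurableT (cos t) Ic; apply: eq_integrable => // x _.
have Is' : Z.-integrable setT (EFin \o (fun x => sin (a * x) * sin t)).
  by have := integrableZr measurableT (sin t) Is; apply: eq_integrable => // x _.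
under eq_Rintegral do rewrite cosD.
by rewrite RintegralB// !RintegralZr// Rintegral_normal_sin mul0r subr0.
Qed.

Lemma norm_Rintegral_normal_cos a : `|\int[Z]_x cos (a * x)| <= 1.
Proof.
have c1 (x : R) : `|cos (a * x)| <= 1 by rewrite ler_norml cos_geN1 cos_le1.
have mc : measurable_fun setT (fun x : R => cos (a * x)).
  by have := measurable_cosM a 0; under eq_fun do rewrite addr0.
have Ic := integrable_bounded Z mc c1.
apply: le_trans (le_normr_Rintegral measurableT Ic) _.
rewrite -[leRHS](Rintegral_const Z 1); apply: le_Rintegral => //.
- apply: (@integrable_bounded _ _ _ _ _ 1) => //; first exact: measurableT_comp.
  by move=> x; rewrite normr_id.
- by apply: (@integrable_bounded _ _ _ _ _ 1) => // x; rewrite normr1.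
Qed.

Lemma Rintegral_normal_cos_comb a b :
  \int[Z]_x cos (Num.sqrt (a ^+ 2 + b ^+ 2) * x) =
  \int[Z]_x cos (a * x) * \int[Z]_x cos (b * x).
Proof.
have c1 (u t x : R) : `|cos (u * x + t)| <= 1 by rewrite ler_norml cos_geN1 cos_le1.
have mc : measurable_fun setT (fun x : R => (1 + cos x)%:E).
  apply/measurable_EFinP/measurable_funD => //.
  exact: continuous_measurable_fun (@continuous_cos R).
have m0 (x : R) : (0 <= (1 + cos x)%:E)%E by rewrite lee_fin norm1D_ge0// ler_norml cos_geN1 cos_le1.
have H := ge0_integral_normal_comb a b mc m0.
pose C (u : R) := \int[Z]_x cos (u * x).
have E u t : (\int[Z]_x (1 + cos (u * x + t))%:E = (1 + C u * cos t)%:E)%E.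
  apply: (etrans (integral_1D Z (measurable_cosM u t) (c1 u t))).
  by rewrite Rintegral_normal_cosDl.
have mg : measurable_fun setT (fun x : R => C a * cos (b * x)).
  apply: measurable_funM => //.
  by have := measurable_cosM b 0; under eq_fun do rewrite addr0.
have g1 (x : R) : `|C a * cos (b * x)| <= 1.
  rewrite normrM mulr_ile1 ?norm_Rintegral_normal_cos//.
  by rewrite ler_norml cos_geN1 cos_le1.
have L : (\int[Z]_y \int[Z]_x (1 + cos (a * x + b * y))%:E = (1 + C a * C b)%:E)%E.
  transitivity (\int[Z]_y (1 + C a * cos (b * y))%:E)%E.
    by apply: eq_integral => y _; exact: E.
  apply: (etrans (integral_1D Z mg g1)); rewrite RintegralZl//.
  apply: (integrable_bounded Z (M := 1)) => [|x]; last by rewrite ler_norml cos_geN1 cos_le1.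
  by have := measurable_cosM b 0; under eq_fun do rewrite addr0.
have : (1 + C a * C b)%:E = (1 + C (Num.sqrt (a ^+ 2 + b ^+ 2)))%:E :> \bar R.
  apply: (etrans (esym L)); apply: (etrans H).
  have := E (Num.sqrt (a ^+ 2 + b ^+ 2)) 0; rewrite cos0 mulr1 => <-.
  by apply: eq_integral => x _; rewrite addr0.
by move=> -[] /addrI.
Qed.

Lemma norm_subX (a b : R) n : `|a| <= 1 -> `|b| <= 1 ->
  `|a ^+ n - b ^+ n| <= n%:R * `|a - b|.
Proof.
move=> a1 b1; elim: n => [|n IH]; first by rewrite subrr normr0 mul0r.
have -> : a ^+ n.+1 - b ^+ n.+1 = a * (a ^+ n - b ^+ n) + (a - b) * b ^+ n.
  by rewrite !exprS; ring.
apply: (le_trans (ler_normD _ _)); rewrite !normrM -natr1 mulrDl mul1r normrX.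
apply: lerD; last by rewrite ler_piMr// exprn_ile1.
by apply: le_trans IH; rewrite ler_piMl.
Qed.

Lemma Rintegral_normal_cos_sqrtn (a : R) n :
  \int[Z]_x cos (Num.sqrt n%:R * a * x) = (\int[Z]_x cos (a * x)) ^+ n.
Proof.
elim: n => [|n IH].
  rewrite expr0 sqrtr0; under eq_Rintegral do rewrite !mul0r cos0.
  exact: Rintegral_const.
have C_abs (c : R) : \int[Z]_x cos (`|c| * x) = \int[Z]_x cos (c * x).
  case: (ger0P c) => // _; apply: eq_Rintegral => x _.
  by rewrite mulNr cosN.
rewrite exprSr -IH -Rintegral_normal_cos_comb -C_abs normrM ger0_norm ?sqrtr_ge0//.
apply: eq_Rintegral => x _; congr (cos (_ * _)).
rewrite exprMn sqr_sqrtr ?ler0n// -[X in _ + X]mul1r -mulrDl natr1.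
by rewrite sqrtrM ?ler0n// sqrtr_sqr.
Qed.

Lemma Rintegral_normal_cos (a : R) : \int[Z]_x cos (a * x) = expR (- (a ^+ 2 / 2)).
Proof.
pose m4 := \int[Z]_x x ^+ 4.
have c1 (u x : R) : `|cos (u * x)| <= 1 by rewrite ler_norml cos_geN1 cos_le1.
have mc (u : R) : measurable_fun setT (fun x : R => cos (u * x)).
  by have := measurable_cosM u 0; under eq_fun do rewrite addr0.
have C4 (u : R) : `|\int[Z]_x cos (u * x) - 1 + u ^+ 2 / 2| <= m4 * u ^+ 4.
  have I1 := integrable_bounded Z (mc u) (c1 u).
  have I0 : Z.-integrable setT (EFin \o (fun=> 1)).
    by apply: (@integrable_bounded _ _ _ _ _ 1) => // x; rewrite normr1.
  have I2 : Z.-integrable setT (EFin \o (fun x => x ^+ 2 * (u ^+ 2 / 2))).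
    by have := integrableZr measurableT (u ^+ 2 / 2) integrable_normal_sqr;
       apply: eq_integrable => // x _.
  have I3 : Z.-integrable setT (EFin \o (fun x => x ^+ 4 * u ^+ 4)).
    by have := integrableZr measurableT (u ^+ 4) integrable_normal_pow4;
       apply: eq_integrable => // x _.
  have I10 : Z.-integrable setT (EFin \o (fun x => cos (u * x) - 1)).
    by have := integrableB measurableT I1 I0; apply: eq_integrable => // x _.
  have I102 : Z.-integrable setT (EFin \o (fun x => cos (u * x) - 1 + x ^+ 2 * (u ^+ 2 / 2))).
    by have := integrableD measurableT I10 I2; apply: eq_integrable => // x _.
  have -> : \int[Z]_x cos (u * x) - 1 + u ^+ 2 / 2 =
      \int[Z]_x (cos (u * x) - 1 + x ^+ 2 * (u ^+ 2 / 2)).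
    rewrite RintegralD// RintegralB// Rintegral_const RintegralZr//.
      by rewrite Rintegral_normal_sqr mul1r.
    exact: integrable_normal_sqr.
  apply: (le_trans (le_normr_Rintegral measurableT I102)).
  rewrite /m4 -RintegralZr//; last exact: integrable_normal_pow4.
  apply: le_Rintegral => //.
    by have := integrable_norm I102; apply: eq_integrable => // x _.
  move=> x _.
  have -> : x ^+ 4 * u ^+ 4 = `|u * x| ^+ 4.
    by rewrite -normrX ger0_norm ?exprn_even_ge0// exprMn mulrC.
  have -> : x ^+ 2 * (u ^+ 2 / 2) = (u * x) ^+ 2 / 2 by rewrite exprMn mulrCA mulrA.
  exact: norm_cos_rem_le4.
apply/eqP; rewrite -subr_eq0 -normr_le0; apply/ler_addgt0Pr => e e0; rewrite add0r.
pose K := m4 * a ^+ 4 + (a ^+ 2 / 2) ^+ 2.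
have bnd n : `|\int[Z]_x cos (a * x) - expR (- (a ^+ 2 / 2))| <= K / n.+1%:R.
  pose u := a / Num.sqrt n.+1%:R.
  have n0 : 0 < n.+1%:R :> R by rewrite ltr0n.
  have s0 : 0 < Num.sqrt n.+1%:R :> R by rewrite sqrtr_gt0.
  have au : a = Num.sqrt n.+1%:R * u by rewrite /u mulrCA divff ?mulr1// gt_eqF.
  have s2 : Num.sqrt n.+1%:R ^+ 2 = n.+1%:R :> R by rewrite sqr_sqrtr ?ltW.
  have u2 : u ^+ 2 = a ^+ 2 / n.+1%:R by rewrite /u expr_div_n s2.
  have -> : expR (- (a ^+ 2 / 2)) = expR (- (u ^+ 2 / 2)) ^+ n.+1.
    rewrite -expRM_natl u2; congr expR; field.
    by rewrite gt_eqF.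
  rewrite [in X in `|X - _|]au Rintegral_normal_cos_sqrtn.
  apply: (le_trans (norm_subX _ (norm_Rintegral_normal_cos _) _)).
    by rewrite ger0_norm ?expR_ge0// -[leRHS]expR0 ler_expR oppr_le0 divr_ge0 ?sqr_ge0.
  have := C4 u; have := norm_expRN_rem_le (divr_ge0 (sqr_ge0 u) (ler0n R 2)).
  set A := \int[Z]_x _; set B := expR _ => hB hA.
  have hAB : `|A - B| <= m4 * u ^+ 4 + (u ^+ 2 / 2) ^+ 2.
    have -> : A - B = (A - 1 + u ^+ 2 / 2) - (B - 1 + u ^+ 2 / 2) by ring.
    by apply: (le_trans (ler_normB _ _)); exact: lerD.
  apply: (le_trans (ler_wpM2l (ltW n0) hAB)).
  have -> : u ^+ 4 = a ^+ 4 / n.+1%:R ^+ 2 by rewrite (exprM u 2 2) u2 expr_div_n -exprM.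
  rewrite u2 le_eqVlt; apply/orP; left; apply/eqP; rewrite /K; field.
  by rewrite gt_eqF.
have /cvgrPdist_lt/(_ e e0) [N _ /(_ N (leqnn N))] := @invS_cvg0 K.
rewrite /= sub0r normrN => hN.
by rewrite (le_trans (bnd N))// ltW// (le_lt_trans (ler_norm _) hN).
Qed.

Lemma Rintegral_normal_cosD s t :
  \int[Z]_x cos (s * x + t) = expR (- (s ^+ 2 / 2)) * cos t.
Proof. by rewrite Rintegral_normal_cosDl Rintegral_normal_cos. Qed.

End NormalMoments.

Section Cholesky.
Variable R : realType.

Let quad_block n (a : R) (v : 'cV[R]_n) (B : 'M[R]_n) (x : R) (y : 'cV[R]_n) :
  ((col_mx x%:M y)^T *m block_mx (a%:M : 'M[R]_1) v^T v B *m col_mx x%:M y) 0 0 =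
  a * x ^+ 2 + 2 * x * (y^T *m v) 0 0 + (y^T *m B *m y) 0 0.
Proof.
rewrite tr_col_mx mul_row_block mul_row_col !mulmxDl tr_scalar_mx.
have -> : x%:M *m v^T *m y = x *: (y^T *m v)^T by rewrite trmx_mul trmxK mul_scalar_mx scalemxAl.
rewrite -!scalar_mxM mul_mx_scalar !mxE !mulr1n.
move: (\sum_j y^T 0 j * v j 0) (\sum_j (y^T *m B) 0 j * y j 0) => s r; ring.
Qed.

Lemma psd_factor n (M : 'M[R]_n) : M^T = M ->
  (forall t : 'cV[R]_n, 0 <= (t^T *m M *m t) 0 0) ->
  exists L : 'M[R]_n, M = L *m L^T.
Proof.
elim: n M => [|n IH] M; first by exists 0; apply/matrixP => -[].
rewrite -[n.+1]/(1 + n)%N in M *; move=> sM pM.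
pose a := ulsubmx M 0 0; pose v : 'cV[R]_n := dlsubmx M; pose B := drsubmx M.
have eM : M = block_mx (a%:M : 'M[R]_1) v^T v B.
  have -> : v^T = ursubmx M by rewrite /v -[in RHS]sM trmx_dlsub.
  by rewrite -mx11_scalar submxK.
have sB : B^T = B by rewrite /B trmx_drsub sM.
have q x (y : 'cV[R]_n) : 0 <= a * x ^+ 2 + 2 * x * (y^T *m v) 0 0 + (y^T *m B *m y) 0 0.
  by rewrite -quad_block -eM.
have a0 : 0 <= a by have := q 1 0; rewrite trmx0 !mul0mx mxE expr1n; lra.
have [az|an0] := eqVneq a 0.
  have v0 : v = 0.
    apply/matrixP => i j; rewrite ord1 [RHS]mxE.
    have := q ; rewrite az => /(_ _ (delta_mx i 0)).
    rewrite trmx_delta -rowE mxE; set s := v i 0; set c := (_ *m _ *m _) 0 0 => H.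
    apply/eqP; apply: contraT => s0; have := H (- (c + 1) / (2 * s)).
    have -> : 0 * (- (c + 1) / (2 * s)) ^+ 2 + 2 * (- (c + 1) / (2 * s)) * s + c = -1.
      by field; rewrite s0.
    by rewrite oppr_ge0 ler10.
  have [L BL] : exists L : 'M[R]_n, B = L *m L^T.
    by apply: (IH _ sB) => y; have := q 0 y; rewrite expr0n/= !mulr0 mul0r !add0r.
  exists (block_mx 0 0 0 L); rewrite eM az v0 tr_block_mx mulmx_block !trmx0 !mulmx0 !mul0mx !add0r BL.
  by rewrite raddf0.
have a1 : 0 < a by rewrite lt_neqAle eq_sym an0.
have sa : 0 < Num.sqrt a by rewrite sqrtr_gt0.
have [L BL] : exists L : 'M[R]_n, B - a^-1 *: (v *m v^T) = L *m L^T.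
  apply: IH => [|y].
    by rewrite linearB/= linearZ/= trmx_mul trmxK sB.
  rewrite mulmxBr mulmxBl -scalemxAr -scalemxAl !mulmxA.
  have -> : y^T *m v *m v^T *m y = (y^T *m v) *m (y^T *m v)^T.
    by rewrite trmx_mul trmxK !mulmxA.
  have := q (- ((y^T *m v) 0 0) / a) y.
  rewrite [((_ - _) : 'M[R]_1) 0 0]mxE [(- _ : 'M[R]_1) 0 0]mxE [(_ *: _ : 'M[R]_1) 0 0]mxE.
  rewrite [((_ *m _) *m _^T) 0 0]mxE big_ord1 [(_^T : 'M[R]_1) 0 0]mxE.
  set s := (y^T *m v) 0 0 => H; apply: le_trans H _.
  by rewrite le_eqVlt; apply/orP; left; apply/eqP; field.
exists (block_mx (Num.sqrt a)%:M 0 ((Num.sqrt a)^-1 *: v) L).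
rewrite eM tr_block_mx mulmx_block !trmx0 !mulmx0 !mul0mx !addr0 tr_scalar_mx.
rewrite -scalar_mxM -expr2 sqr_sqrtr// mul_scalar_mx mul_mx_scalar linearZ/=.
rewrite !scalerA divff ?gt_eqF// !scale1r -BL -scalemxAl -scalemxAr scalerA.
by rewrite -invfM -expr2 sqr_sqrtr// addrCA subrr addr0.
Qed.

End Cholesky.

Section ExistsMultinormal.
Variable R : realType.
Notation Z := (normal_prob (0 : R) 1).

Lemma exists_normal_family m : exists d (T : measurableType d) (P : probability T R)
    (Y : 'I_m -> T -> R), (forall i, measurable_fun setT (Y i)) /\
  forall (c : 'I_m -> R) (B : set R), measurable B ->
    P [set w | B (\sum_i c i * Y i w)] =
    Z [set x | B (Num.sqrt (\sum_i c i ^+ 2) * x)].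
Proof.
elim: m => [|m [d [T [P [Y [mY HY]]]]]].
  exists _, (measurableTypeR R), Z, (fun i _ => 0); split => [i|c B mB]; first exact: measurable_cst.
  congr (Z _); apply/seteqP.
  by split => x /=; rewrite !big_ord0 sqrtr0 mul0r.
pose Y' (i : 'I_m.+1) (p : T * R) : R := if unlift ord0 i is Some j then Y j p.1 else p.2.
exists _, (T * measurableTypeR R)%type, (P \x^ Z)%E, Y'; split.
  move=> i; rewrite /Y'; case: (unlift ord0 i) => [j|].
    by apply: (measurableT_comp (mY j)); exact: measurable_fst.
  exact: measurable_snd.
move=> c B mB.
have mI (A : set R) : measurable A -> measurable_fun setT (fun x : R => (\1_A x)%:E : \bar R).
  by move=> mA; apply/measurable_EFinP; exact: measurable_indic.
pose c' i := c (lift ord0 i).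
transitivity (\int[Z]_y P [set w | B (c ord0 * y + \sum_i c' i * Y i w)%R])%E.
  rewrite /product_measure2; apply: eq_integral => y _; congr (P _).
  have E w : \sum_i c i * Y' i (w, y) = c ord0 * y + \sum_i c' i * Y i w.
    rewrite big_ord_recl /Y' unlift_none; congr (_ + _).
    by apply: eq_bigr => i _; rewrite liftK.
  apply/seteqP; split => w /=.
    by move/mem_set; rewrite mem_ysection => /set_mem /=; rewrite E.
  by move=> Bw; apply/set_mem; rewrite mem_ysection; apply/mem_set; rewrite /= E.
set s := Num.sqrt (\sum_i c' i ^+ 2).
transitivity (\int[Z]_y \int[Z]_x (\1_B (s * x + c ord0 * y)%R)%:E)%E.
  apply: eq_integral => y _.
  have mBy : measurable [set u : R | B (c ord0 * y + u)].
    have /(_ measurableT _ mB) : measurable_fun setT (fun u : R => c ord0 * y + u).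
      exact: measurable_funD.
    by rewrite setTI.
  apply: (etrans (HY c' _ mBy)).
  have mBs : measurable [set x : R | B (c ord0 * y + s * x)].
    have /(_ measurableT _ mBy) : measurable_fun setT (fun x : R => s * x).
      exact: measurable_funM.
    by rewrite setTI.
  transitivity (\int[Z]_x (\1_[set x : R | B (c ord0 * y + s * x)%R] x)%:E)%E.
    by rewrite integral_indic// setIT.
  by apply: eq_integral => x _; rewrite addrC !indicE.
rewrite (ge0_integral_normal_comb s (c ord0) (mI _ mB)); last by move=> x; rewrite lee_fin.
rewrite big_ord_recl sqr_sqrtr ?sumr_ge0// => [|i _]; last exact: sqr_ge0.
rewrite addrC; set r := Num.sqrt _.
have mBr : measurable [set x : R | B (r * x)].
  have /(_ measurableT _ mB) : measurable_fun setT (fun x : R => r * x).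
    exact: measurable_funM.
  by rewrite setTI.
transitivity (\int[Z]_x (\1_[set x : R | B (r * x)%R] x)%:E)%E.
  by apply: eq_integral => x _; rewrite !indicE.
by rewrite integral_indic// setIT.
Qed.

Lemma exists_multinormal m (M : 'M[R]_m) : M^T = M ->
  (forall t : 'cV[R]_m, 0 <= (t^T *m M *m t) 0 0) ->
  exists Q : probability (borelV R m) R, is_multinormal Q 0 M.
Proof.
move=> sM pM; have [L eM] := psd_factor sM pM.
have [d [T [P [Y [mY HY]]]]] := exists_normal_family m.
pose G w : borelV R m := L *m \col_i Y i w.
have mG : measurable_fun setT G.
  apply: measurable_fun_cV => i; rewrite /G; under eq_fun do rewrite mxE.
  apply: measurable_sum => j; under eq_fun do rewrite mxE.
  by apply: measurable_funM.
pose Gm := isMeasurableFun.Build _ _ _ _ _ mG.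
pose Gp : {RV P >-> borelV R m} := HB.pack G Gm.
exists (distribution P Gp) => t B mB.
transitivity (P [set w | B (\sum_i (L^T *m t) i 0 * Y i w)]).
  congr (P _); apply/seteqP.
  have E w : (t^T *m (G w : 'cV[R]_m)) 0 0 = \sum_i (L^T *m t) i 0 * Y i w.
    rewrite /G mulmxA -[t^T *m L]trmxK trmx_mul trmxK mxE.
    by apply: eq_bigr => i _; rewrite !mxE.
  by split => w /=; rewrite E.
rewrite HY// mulmx0 [(0 : 'M[R]_1) 0 0]mxE.
have -> : (t^T *m M *m t) 0 0 = \sum_i ((L^T *m t) i 0) ^+ 2.
  rewrite eM mulmxA -mulmxA -[t^T *m L]trmxK trmx_mul trmxK mxE.
  by apply: eq_bigr => i _; rewrite mxE expr2.
by rewrite normal_lawE ?sumr_ge0// => i _; exact: sqr_ge0.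
Qed.

Lemma multinormal_cos m (Q : probability (borelV R m) R) (M : 'M[R]_m) (t : 'cV[R]_m) a :
  is_multinormal Q 0 M -> 0 <= (t^T *m M *m t) 0 0 ->
  \int[Q]_x cos ((t^T *m (x : 'cV[R]_m)) 0 0 + a) =
    expR (- ((t^T *m M *m t) 0 0 / 2)) * cos a.
Proof.
move=> nQ; set v := (_ *m _ *m _) 0 0 => v0.
pose X (x : borelV R m) : R := (t^T *m (x : 'cV[R]_m)) 0 0.
have mX : measurable_fun setT X.
  exact: continuous_measurable_borelV (@linform_continuous R m t).
pose G (x : measurableTypeR R) : R := Num.sqrt v * x.
have mG : measurable_fun setT G by exact: measurable_funM.
pose Gm := isMeasurableFun.Build _ _ _ _ _ mG.
pose Gp : {RV Z >-> R} := HB.pack G Gm.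
have mc : measurable_fun setT (fun x : R => cos (x + a)).
  by have := measurable_cosM 1 a; under eq_fun do rewrite mul1r.
have XG (B : set R) : measurable B -> Q (X @^-1` B) = distribution Z Gp B.
  by move=> mB; rewrite [LHS]nQ// mulmx0 [(0 : 'M[R]_1) 0 0]mxE normal_lawE.
rewrite (Rintegral_law mX XG mc) -(@Rintegral_law _ _ _ Z _ G mG _ _ mc)//.
by rewrite Rintegral_normal_cosD sqr_sqrtr.
Qed.

End ExistsMultinormal.

(** * Minimizers of random convex functions *)

Section ConvexFunctions.
Variable R : realType.
Implicit Types m : nat.

Definition convex_cV m (f : 'cV[R]_m -> R) := forall (x y : 'cV[R]_m) (s : R),
  0 <= s <= 1 -> f (s *: x + (1 - s) *: y) <= s * f x + (1 - s) * f y.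

Lemma convex_cV_vertices m (f : 'cV[R]_m -> R) (lo hi x : 'cV[R]_m) (C : R) :
  convex_cV f -> (forall i, lo i 0 <= x i 0 <= hi i 0) ->
  (forall v : 'cV[R]_m, (forall i, v i 0 = lo i 0 \/ v i 0 = hi i 0) -> f v <= C) ->
  f x <= C.
Proof.
move=> cf xb fv.
have lohi i : lo i 0 <= hi i 0 by have /andP[h1 h2] := xb i; exact: le_trans h1 h2.
suff H j : (j <= m)%N -> forall v : 'cV[R]_m,
    (forall i : 'I_m, (i < j)%N -> lo i 0 <= v i 0 <= hi i 0) ->
    (forall i : 'I_m, (j <= i)%N -> v i 0 = lo i 0 \/ v i 0 = hi i 0) -> f v <= C.
  by apply: (H m (leqnn m)) => [i _|i]; [exact: xb|rewrite leqNgt ltn_ord].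
elim: j => [|j IH] jm v v1 v2; first by apply: fv => i; exact: v2.
pose jo := Ordinal jm.
pose w (c : R) : 'cV[R]_m := \col_i (if i == jo then c else v i 0).
have fw c : c = lo jo 0 \/ c = hi jo 0 -> f (w c) <= C.
  move=> hc; apply: (IH (ltnW jm)) => i ij; rewrite mxE.
    case: eqP => [E|_]; first by move: ij; rewrite E ltnn.
    by apply: v1; rewrite ltnS ltnW.
  case: eqP => [->//|/eqP E]; apply: v2; rewrite ltn_neqAle ij andbT.
  by apply: contra E => /eqP E; apply/eqP/val_inj.
have /andP[l1 l2] := v1 jo (ltnSn j).
have [E|lh] := eqVneq (lo jo 0) (hi jo 0).
  have -> : v = w (lo jo 0).
    apply/colP => i; rewrite mxE; case: eqP => [->|//].
    by apply/eqP; rewrite eq_le l1 [in X in X && _]E l2.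
  by apply: fw; left.
have hl : 0 < hi jo 0 - lo jo 0 by rewrite subr_gt0 lt_neqAle lh lohi.
pose s := (v jo 0 - lo jo 0) / (hi jo 0 - lo jo 0).
have s0 : 0 <= s by rewrite divr_ge0 ?subr_ge0.
have s1 : s <= 1 by rewrite ler_pdivrMr// mul1r lerB.
have -> : v = s *: w (hi jo 0) + (1 - s) *: w (lo jo 0).
  apply/colP => i; rewrite !mxE; case: eqP => [->|_]; last by ring.
  by rewrite /s; field; rewrite gt_eqF.
apply: le_trans (cf _ _ _ _) _; first by rewrite s0.
have -> : C = s * C + (1 - s) * C by ring.
by apply: lerD; apply: ler_wpM2l; rewrite ?subr_ge0//; apply: fw; [right|left].
Qed.

(* The upper bound at x comes from the vertices of a small grid cube around x;
   reflecting x in a grid point turns it into a lower bound. *)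
Lemma convex_cV_grid m (D : 'cV[R]_m -> R) (L e : R) : continuous D -> 0 <= L -> 0 < e ->
  exists (I : finType) (g : I -> 'cV[R]_m), forall f, convex_cV f ->
    (forall i, `|f (g i) - D (g i)| <= e / 8) ->
    forall x, `|x| <= L -> `|f x - D x| <= e.
Proof.
move=> cD L0 e0; have e8 : 0 < e / 8 by rewrite divr_gt0.
have [r r0 Dr] := unif_continuous_box (L + 2) cD e8.
have [h [h0 h1 hr]] : exists h : R, [/\ 0 < h, h <= 2^-1 & h + h <= r].
  exists (Num.min 2^-1 (r / 2)); split; first by rewrite lt_min invr_gt0 ltr0n divr_gt0.
    by rewrite ge_min lexx.
  by rewrite [leRHS]splitr lerD// ge_min lexx orbT.
pose K := (Num.trunc ((L + 2) / h)).+1.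
have LK : L + 2 <= h * K%:R.
  rewrite mulrC -ler_pdivrMr//; apply/ltW; exact: truncnS_gt.
pose g (phi : {ffun 'I_m -> 'I_(K + K).+1}) : 'cV[R]_m := \col_i (h * ((phi i)%:R - K%:R)).
have gP (z : 'I_m -> int) : (forall i, `|h * (z i)%:~R| <= L + 2) ->
    exists phi, g phi = \col_i (h * (z i)%:~R).
  move=> zb.
  have zK i : (`|z i| <= K%:Z)%R.
    rewrite -(ler_int R) intr_norm -(ler_pM2l h0); apply: le_trans LK.
    by rewrite -[X in X * _](gtr0_norm h0) -normrM; exact: zb.
  have H i : exists n : 'I_(K + K).+1, (n%:R - K%:R = (z i)%:~R :> R).
    have := zK i; rewrite ler_norml => /andP[z1 z2].
    have zn : 0 <= z i + K%:Z by lra.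
    have nK : (absz (z i + K%:Z)%R < (K + K).+1)%N.
      by rewrite ltnS -lez_nat gez0_abs// PoszD lerD2r.
    exists (Ordinal nK) => /=.
    rewrite (_ : (absz (z i + K%:Z))%:R = (z i + K%:Z)%:~R :> R); last first.
      by rewrite -{2}(gez0_abs zn).
    by rewrite rmorphD/= addrK.
  have [n nP] := choice H.
  exists [ffun i => n i]; apply/colP => i; rewrite !mxE ffunE nP//.
exists {ffun 'I_m -> 'I_(K + K).+1}, g => f cf fg.
have near (z : 'I_m -> int) : (forall i, `|h * (z i)%:~R| <= L + 2) ->
    `|f (\col_i (h * (z i)%:~R)) - D (\col_i (h * (z i)%:~R))| <= e / 8.
  by move=> /gP[phi <-]; exact: fg.
pose fl (x : 'cV[R]_m) i := Num.floor (x i 0 / h).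
have flP x i : h * (fl x i)%:~R <= x i 0 <= h * (fl x i)%:~R + h.
  have : (fl x i)%:~R <= x i 0 / h by exact: floor_le_tmp.
  have : x i 0 / h < (fl x i + 1)%:~R by exact: floorD1_gt.
  by rewrite ltr_pdivrMr// ler_pdivlMr// rmorphD/= mulrDl mul1r !(mulrC h) => /ltW -> ->.
have up x : `|x| <= L + 1 -> f x <= D x + e / 8 + e / 8.
  move=> xL; apply: (convex_cV_vertices cf (lo := \col_i (h * (fl x i)%:~R))
     (hi := \col_i (h * (fl x i)%:~R + h))).
    by move=> i; rewrite !mxE; exact: flP.
  move=> v vP.
  have vx : `|v - x| <= r.
    apply/cV_normP; first exact: ltW.
    move=> i; rewrite !mxE; have /andP[x1 x2] := flP x i.
    by have := vP i; rewrite !mxE ler_norml => -[]->; apply/andP; split; lra.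
  have [z vz] : exists z : 'I_m -> int, v = \col_i (h * (z i)%:~R).
    have H i : exists z : int, v i 0 = h * z%:~R.
      have := vP i; rewrite !mxE => -[]->; first by exists (fl x i).
      by exists (fl x i + 1); rewrite rmorphD/= mulrDr mulr1.
    by have [z zP] := choice H; exists z; apply/colP => i; rewrite mxE.
  have vb : `|v| <= L + 2.
    apply/cV_normP; first lra.
    move=> i; have := cV_coord_le x i; have /andP[x1 x2] := flP x i.
    rewrite !ler_norml => /andP[x3 x4].
    by have := vP i; rewrite !mxE => -[]->; apply/andP; split; lra.
  have h2 : `|f v - D v| <= e / 8.
    by rewrite vz; apply: near => i; have := cV_coord_le v i; rewrite vz mxE => /le_trans; apply; rewrite -vz.
  have h3 := Dr x v (le_trans xL (lerD (lexx L) (ler1n R 2))) vx.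
  by move: h2 h3; rewrite !ler_norml => /andP[? ?] /andP[? ?]; lra.
move=> x xL.
have xL1 : `|x| <= L + 1 by lra.
have xL2 : `|x| <= L + 2 by lra.
pose p : 'cV[R]_m := \col_i (h * (fl x i)%:~R).
have px : `|p - x| <= h.
  apply/cV_normP; first exact: ltW.
  by move=> i; rewrite !mxE; have /andP[x1 x2] := flP x i; rewrite ler_norml; apply/andP; split; lra.
have h2 : `|f p - D p| <= e / 8.
  apply: near => i; have := cV_coord_le p i; rewrite mxE => /le_trans; apply.
  by rewrite -(subrK x p) (le_trans (ler_normD _ _))//; lra.
pose y := 2 *: p - x.
have yx : `|y - x| <= r.
  have -> : y - x = (p - x) + (p - x) by apply/colP => i; rewrite !mxE; ring.
  by rewrite (le_trans (ler_normD _ _))//; lra.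
have yL : `|y| <= L + 1.
  have -> : y = x + ((p - x) + (p - x)) by apply/colP => i; rewrite !mxE; ring.
  apply: (le_trans (ler_normD _ _)); have := ler_normD (p - x) (p - x); lra.
have fp : f p <= 2^-1 * f x + 2^-1 * f y.
  have := cf x y 2^-1; have -> : 1 - 2^-1 = 2^-1 :> R by field.
  have -> : 2^-1 *: x + 2^-1 *: y = p.
    by rewrite /y scalerBr scalerA mulVf// scale1r addrCA subrr addr0.
  by apply; lra.
have fy := up y yL.
have fx := up x xL1.
have Dp := Dr x p xL2 (le_trans px (le_trans _ hr)).
have Dy := Dr x y xL2 yx.
move: h2 Dp Dy; rewrite !ler_norml => /andP[? ?] /(_ _)/andP[|? ?]; first lra.
by move=> /andP[? ?]; lra.
Qed.

End ConvexFunctions.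

Section Argmin.
Variable R : realType.
Implicit Types m : nat.

Lemma norm_mulmx_cV n m (A : 'M[R]_(n, m)) (v : 'cV[R]_m) :
  `|A *m v| <= (\sum_i \sum_j `|A i j|) * `|v|.
Proof.
have s0 : 0 <= \sum_i \sum_j `|A i j| by apply: sumr_ge0 => i _; exact: sumr_ge0.
apply/cV_normP; first exact: mulr_ge0.
move=> i; rewrite mxE; apply: (le_trans (ler_norm_sum _ _ _)).
apply: (@le_trans _ _ ((\sum_j `|A i j|) * `|v|)).
  rewrite mulr_suml; apply: ler_sum => j _.
  by rewrite normrM ler_wpM2l// cV_coord_le.
rewrite ler_wpM2r// (bigD1 i)//= lerDl.
by apply: sumr_ge0 => k _; exact: sumr_ge0.
Qed.

Lemma pd_lower_bound m (S : 'M[R]_m) : S^T = S ->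
  (forall t : 'cV[R]_m, 0 <= (t^T *m S *m t) 0 0) -> S \in unitmx ->
  exists2 k : R, 0 < k & forall v : 'cV[R]_m, k * `|v| ^+ 2 <= (v^T *m S *m v) 0 0.
Proof.
move=> sS pS uS; have [L eS] := psd_factor sS pS.
have uL : L^T \in unitmx by move: uS; rewrite eS unitmx_mul => /andP[].
pose C := 1 + \sum_i \sum_j `|invmx L^T i j|.
have C0 : 0 < C.
  by rewrite ltr_pwDl//; apply: sumr_ge0 => i _; exact: sumr_ge0.
exists (C ^- 2); first by rewrite invr_gt0 exprn_gt0.
move=> v; pose w := L^T *m v.
have vw : `|v| <= C * `|w|.
  have -> : v = invmx L^T *m w by rewrite mulKmx.
  by apply: (le_trans (norm_mulmx_cV _ _)); rewrite ler_wpM2r// lerDr.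
have -> : (v^T *m S *m v) 0 0 = \sum_i w i 0 ^+ 2.
  rewrite eS mulmxA -mulmxA -[v^T *m L]trmxK trmx_mul trmxK mxE.
  by apply: eq_bigr => i _; rewrite mxE expr2.
have s0 : 0 <= \sum_i w i 0 ^+ 2 by apply: sumr_ge0 => i _; exact: sqr_ge0.
have w2 : `|w| ^+ 2 <= \sum_i w i 0 ^+ 2.
  rewrite -(sqr_sqrtr s0) lerXn2r ?nnegrE ?sqrtr_ge0//.
  apply/cV_normP; first exact: sqrtr_ge0.
  move=> i; rewrite -sqrtr_sqr ler_wsqrtr// (bigD1 i)//= lerDl.
  by apply: sumr_ge0 => j _; exact: sqr_ge0.
apply: le_trans w2; rewrite mulrC ler_pdivrMr ?exprn_gt0// mulrC -exprMn.
apply: lerXn2r => //; rewrite nnegrE//; exact: (le_trans (normr_ge0 v) vw).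
Qed.

(* The closeness hypothesis bears on f with its random linear part removed, so
   that the finite set of test points does not depend on W. *)
Lemma argmin_close m (S : 'M[R]_m) (b : 'cV[R]_m) (L e : R) : S^T = S ->
  (forall t : 'cV[R]_m, 0 <= (t^T *m S *m t) 0 0) -> S \in unitmx -> 0 < e ->
  exists (I : finType) (g : I -> 'cV[R]_m) (dl : R), 0 < dl /\
    forall f (W u : 'cV[R]_m), convex_cV f -> (forall x, f u <= f x) -> `|W| <= L ->
    (forall i, `|f (g i) + ((g i)^T *m W) 0 0 -
      (((g i)^T *m S *m g i) 0 0 / 2 + ((g i)^T *m b) 0 0)| <= dl) ->
    `|u - invmx S *m (W - b)| <= e.
Proof.
move=> sS pS uS e0; have [k k0 Sk] := pd_lower_bound sS pS uS.
pose D (x : 'cV[R]_m) := (x^T *m S *m x) 0 0 / 2 + (x^T *m b) 0 0.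
have cD : continuous D.
  move=> x.
  have -> : D = fun x => (\sum_i (\sum_j x j 0 * S j i) * x i 0) * 2^-1 + \sum_i x i 0 * b i 0.
    apply/funext => y; rewrite /D mxE; congr (_ * _ + _).
      by apply: eq_bigr => i _; rewrite mxE; congr (_ * _); apply: eq_bigr => j _; rewrite mxE.
    by rewrite mxE; apply: eq_bigr => j _; rewrite mxE.
  have cc (i : 'I_m) : (fun y : 'cV[R]_m => y i 0) y @[y --> x] --> x i 0.
    exact: coord_continuous.
  apply: (@cvgD _ _ _ (nbhs x)).
    apply: (@cvgM _ _ (nbhs x)); last exact: cvg_cst.
    apply: (@cvg_Rsum R _ _ (nbhs x)) => i.
    apply: (@cvgM _ _ (nbhs x)); last exact: cc.
    apply: (@cvg_Rsum R _ _ (nbhs x)) => j.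
    by apply: (@cvgM _ _ (nbhs x)); [exact: cc|exact: cvg_cst].
  apply: (@cvg_Rsum R _ _ (nbhs x)) => j.
  by apply: (@cvgM _ _ (nbhs x)); [exact: cc|exact: cvg_cst].
pose C := \sum_i \sum_j `|invmx S i j|.
have C0 : 0 <= C by apply: sumr_ge0 => i _; exact: sumr_ge0.
pose L' := C * (`|L| + `|b|) + e.
have L'0 : 0 <= L' by rewrite addr_ge0 ?mulr_ge0 ?addr_ge0// ltW.
have eta0 : 0 < k * e ^+ 2 / 5 by rewrite divr_gt0// mulr_gt0// exprn_gt0.
have [I [g gP]] := convex_cV_grid cD L'0 eta0.
exists I, g, (k * e ^+ 2 / 5 / 8); split; first by rewrite divr_gt0.
move=> f W u cf fu WL fg.
pose N (x : 'cV[R]_m) := f x + (x^T *m W) 0 0.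
have cN : convex_cV N.
  move=> x y s s01; have := cf x y s s01; rewrite /N => H.
  rewrite linearD/= !linearZ/= mulmxDl -!scalemxAl !mxE.
  set p := \sum_j _; set q := \sum_j _; lra.
have HN := gP N cN fg.
pose us := invmx S *m (W - b).
have usL : `|us| <= C * (`|L| + `|b|).
  apply: (le_trans (norm_mulmx_cV _ _)); rewrite ler_wpM2l//.
  by apply: (le_trans (ler_normB _ _)); rewrite lerD2r (le_trans WL)// ler_norm.
rewrite leNgt; apply/negP => ue.
pose nu := `|u - us|; have nu0 : 0 < nu by exact: lt_trans e0 ue.
pose s := e / nu.
have s0 : 0 <= s by rewrite divr_ge0// ltW.
have s1 : s <= 1 by rewrite ler_pdivrMr// mul1r ltW.
pose t : 'cV[R]_m := s *: (u - us).
have tn : `|t| = e.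
  by rewrite /t normrZ ger0_norm// /s -/nu divfK// gt_eqF.
pose v : 'cV[R]_m := us + t.
have vE : v = s *: u + (1 - s) *: us.
  by rewrite /v /t; apply/colP => i; rewrite !mxE; ring.
have fv : f v <= f us.
  rewrite vE; apply: (le_trans (cf _ _ _ _)); first by rewrite s0.
  have := ler_wpM2l s0 (fu us).
  move: (f u) (f us) => A B; rewrite !(mulrBl, mul1r); lra.
have vL : `|v| <= L'.
  by apply: (le_trans (ler_normD _ _)); rewrite tn /L' lerD2r.
have usL' : `|us| <= L' by apply: (le_trans usL); rewrite /L' lerDl ltW.
have h1 := HN v vL; have h2 := HN us usL'.
have Sus : S *m us = W - b by rewrite mulKVmx.
have DD : D v - D us = (t^T *m S *m t) 0 0 / 2 + (t^T *m W) 0 0.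
  have vT : v^T = us^T + t^T by rewrite linearD.
  rewrite /D vT /v !mulmxDl !mulmxDr -!mulmxA Sus.
  have -> : us^T *m (S *m t) = (t^T *m (S *m us))^T.
    by rewrite !trmx_mul trmxK sS mulmxA.
  have e1 (A B : 'M[R]_1) : (A + B) 0 0 = A 0 0 + B 0 0 by rewrite mxE.
  have e2 (A : 'M[R]_1) : A^T 0 0 = A 0 0 by rewrite mxE.
  have e3 (A : 'M[R]_1) : (- A) 0 0 = - A 0 0 by rewrite mxE.
  rewrite Sus !mulmxBr !(e1, e2, e3).
  lra.
have tW : (v^T *m W) 0 0 = (us^T *m W) 0 0 + (t^T *m W) 0 0.
  have vT : v^T = us^T + t^T by rewrite linearD.
  by rewrite vT mulmxDl mxE.
have St := Sk t; rewrite tn in St.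
move: h1 h2; rewrite /N tW !ler_norml => /andP[a1 a2] /andP[b1 b2].
have K0 : 0 < k * e ^+ 2 by rewrite mulr_gt0// exprn_gt0.
move: (k * e ^+ 2) (f v) (f us) (D v) (D us) ((t^T *m S *m t) 0 0) ((us^T *m W) 0 0)
  ((t^T *m W) 0 0) K0 fv a1 a2 b1 b2 DD St => K A B E F Q x y.
lra.
Qed.

End Argmin.

Section ConvergenceInProbability.
Context d (T : measurableType d) (R : realType) (P : probability T R).

Definition cvg_prob0 (f : nat -> T -> R) := forall c e : R, 0 < c -> 0 < e ->
  \forall k \near \oo, (P [set w | (c < `|f k w|)%R] <= e%:E)%E.

Definition tight m (W : nat -> T -> 'cV[R]_m) := forall e : R, 0 < e ->
  exists L : R, \forall k \near \oo, (P [set w | (L < `|W k w|)%R] <= e%:E)%E.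

Lemma measurable_abs_gt (f : T -> R) (c : R) : measurable_fun setT f ->
  measurable [set w | c < `|f w|].
Proof. by move=> mf; apply: measurable_set_lt => //; exact: measurableT_comp. Qed.

Lemma cvg_prob0D (f g : nat -> T -> R) :
  (forall k, measurable_fun setT (f k)) -> (forall k, measurable_fun setT (g k)) ->
  cvg_prob0 f -> cvg_prob0 g -> cvg_prob0 (fun k w => f k w + g k w).
Proof.
move=> mf mg f0 g0 c e c0 e0.
have c2 : 0 < c / 2 by rewrite divr_gt0.
have e2 : 0 < e / 2 by rewrite divr_gt0.
near=> k.
have F : (P [set w | (c / 2 < `|f k w|)%R] <= (e / 2)%:E)%E by near: k; exact: f0.
have G : (P [set w | (c / 2 < `|g k w|)%R] <= (e / 2)%:E)%E by near: k; exact: g0.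
have mF := measurable_abs_gt (c / 2) (mf k); have mG := measurable_abs_gt (c / 2) (mg k).
rewrite [in leRHS](splitr e) EFinD; apply: le_trans (leeD F G).
apply: le_trans (measureU2 _ mF mG); apply: le_measure.
- by apply/mem_set/measurable_abs_gt; exact: measurable_funD.
- by apply/mem_set; exact: measurableU.
move=> w /= fg; have [H|H] := ltrP (c / 2) `|f k w|; first by left.
right => /=; rewrite ltNge; apply/negP => H'.
by have := lt_le_trans fg (ler_normD _ _); lra.
Unshelve. all: by end_near.
Qed.

Lemma cvg_prob0_cst (r : nat -> R) : r k @[k --> \oo] --> 0 -> cvg_prob0 (fun k _ => r k).
Proof.
move=> /cvgrPdist_lt r0 c e c0 e0; near=> k.
have H : `|0 - r k| < c by near: k; exact: r0.
rewrite (_ : [set w | _] = set0) ?measure0 ?lee_fin ?ltW//.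
by apply/seteqP; split => // w /=; move: H; rewrite sub0r normrN => /lt_trans H /H; rewrite ltxx.
Unshelve. all: by end_near.
Qed.

Lemma cvg_prob0_L1 (f : nat -> T -> R) :
  (\forall k \near \oo, P.-integrable setT (EFin \o f k)) ->
  \int[P]_w `|f k w| @[k --> \oo] --> 0 -> cvg_prob0 f.
Proof.
move=> If /cvgrPdist_lt f0 c e c0 e0; near=> k.
have Ifk : P.-integrable setT (EFin \o f k) by near: k.
have H : `|0 - \int[P]_w `|f k w| | < e * c by near: k; apply: f0; exact: mulr_gt0.
have mf : measurable_fun setT (f k) by apply/measurable_EFinP; exact: measurable_int Ifk.
apply: (@le_trans _ _ (P [set w | (c <= `|f k w|)%R])).
  apply: le_measure; [exact/mem_set/measurable_abs_gt| |by move=> w /= /ltW].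
  apply/mem_set; rewrite (_ : [set w | _] = ~` [set w | `|f k w| < c]).
    by apply: measurableC; apply: measurable_set_lt => //; exact: measurableT_comp.
  by apply/seteqP; split => w /=; rewrite leNgt => /negP.
apply: le_trans (markov_Rintegral c0 Ifk) _.
rewrite lee_fin ler_pdivrMr// ltW//.
by move: H; rewrite sub0r normrN; apply: le_lt_trans; exact: ler_norm.
Unshelve. all: by end_near.
Qed.

Lemma measurable_bigsetU_seq (I : Type) (s : seq I) (A : I -> set T) :
  (forall i, measurable (A i)) -> measurable (\big[setU/set0]_(i <- s) A i).
Proof. by move=> mA; elim/big_ind : _ => // B C; exact: measurableU. Qed.

Lemma measure_bigsetU_le (I : Type) (s : seq I) (A : I -> set T) (r : R) :
  (forall i, measurable (A i)) -> (forall i, (P (A i) <= r%:E)%E) ->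
  (P (\big[setU/set0]_(i <- s) A i) <= ((size s)%:R * r)%:E)%E.
Proof.
move=> mA Ar; elim: s => [|i s IH]; first by rewrite big_nil measure0 mul0r.
rewrite big_cons/= -natr1 mulrDl mul1r addrC EFinD.
apply: le_trans (measureU2 _ (mA i) (measurable_bigsetU_seq s mA)) _.
exact: leeD (Ar i) IH.
Qed.

Lemma argmin_cvg_prob m (S : 'M[R]_m) (b : 'cV[R]_m)
    (M : nat -> T -> 'cV[R]_m -> R) (W u : nat -> T -> 'cV[R]_m) :
  S^T = S -> (forall t : 'cV[R]_m, 0 <= (t^T *m S *m t) 0 0) -> S \in unitmx ->
  (forall k x, measurable_fun setT (fun w => M k w x)) ->
  (forall k, measurable_fun setT (W k : T -> borelV R m)) ->
  (forall k, measurable_fun setT (u k : T -> borelV R m)) ->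
  (forall k w, convex_cV (M k w)) -> (forall k w x, M k w (u k w) <= M k w x) ->
  tight W ->
  (forall x : 'cV[R]_m, cvg_prob0 (fun k w => M k w x + (x^T *m W k w) 0 0 -
      ((x^T *m S *m x) 0 0 / 2 + (x^T *m b) 0 0))) ->
  cvg_prob0 (fun k w => `|u k w - invmx S *m (W k w - b)|).
Proof.
move=> sS pS uS mM mW mu cM Mu tW MD c e c0 e0.
have e2 : 0 < e / 2 by rewrite divr_gt0.
have [L WL] := tW _ e2.
have [I [g [dl [dl0 gP]]]] := argmin_close b L sS pS uS c0.
pose n := (size (enum I)).+1.
have n0 : 0 < n%:R :> R by rewrite ltr0n.
have e2n : 0 < e / 2 / n%:R by rewrite divr_gt0.
pose F k i w := M k w (g i) + ((g i)^T *m W k w) 0 0 -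
  (((g i)^T *m S *m g i) 0 0 / 2 + ((g i)^T *m b) 0 0).
have mlin k (x : 'cV[R]_m) : measurable_fun setT (fun w => (x^T *m W k w) 0 0).
  exact: (measurable_fun_continuous_cV (mW k) (@linform_continuous R m x)).
have mF k i : measurable_fun setT (F k i).
  by apply: measurable_funB => //; apply: measurable_funD.
have FI : \forall k \near \oo, forall i : I,
    (P [set w | (dl < `|F k i w|)%R] <= (e / 2 / n%:R)%:E)%E.
  by apply: filter_forall => i; exact: MD.
near=> k.
have HW : (P [set w | (L < `|W k w|)%R] <= (e / 2)%:E)%E by near: k.
have HF i : (P [set w | (dl < `|F k i w|)%R] <= (e / 2 / n%:R)%:E)%E.
  by move: i; near: k.
pose A i := [set w | dl < `|F k i w|].
have mA i : measurable (A i) by exact: measurable_abs_gt.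
have mWL : measurable [set w | L < `|W k w|] by exact: measurable_norm_gt (mW k).
have mU := measurable_bigsetU_seq (enum I) mA.
apply: (@le_trans _ _ (P ([set w | L < `|W k w|] `|` \big[setU/set0]_(i <- enum I) A i))).
  apply: le_measure.
  - apply/mem_set; rewrite (_ : [set w | _] =
        [set w | c < `|u k w - invmx S *m (W k w - b)|]); last first.
      by apply/seteqP; split => w /=; rewrite normr_id.
    apply: measurable_norm_gt; apply: measurable_fun_cV => i.
    have -> : (fun w => (u k w - invmx S *m (W k w - b)) i 0) =
        (fun w => ((delta_mx i 0 : 'cV[R]_m)^T *m u k w) 0 0 -
          (((row i (invmx S))^T^T *m W k w) 0 0 - (invmx S *m b) i 0)).
      apply/funext => w; rewrite trmxK trmx_delta -rowE mulmxBr !mxE.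
      by congr (_ - (_ - _)); apply: eq_bigr => j _; rewrite mxE.
    apply: measurable_funB; last by apply: measurable_funB.
    exact: (measurable_fun_continuous_cV (mu k) (@linform_continuous R m _)).
  - by apply/mem_set; exact: measurableU.
  move=> w /=; rewrite normr_id => H.
  have [H1|H1] := ltrP L `|W k w|; first by left.
  right; rewrite -bigcup_seq/=; apply: contrapT => H2.
  suff : `|u k w - invmx S *m (W k w - b)| <= c by rewrite leNgt H.
  apply: (gP (M k w)) => // i; rewrite leNgt; apply/negP => H3.
  by apply: H2; exists i => //=; rewrite mem_enum.
apply: le_trans (measureU2 _ mWL mU) _.
rewrite [in leRHS](splitr e) EFinD; apply: leeD => //.
apply: le_trans (measure_bigsetU_le (enum I) mA HF) _.
rewrite lee_fin mulrCA ler_piMr// ?ltW//.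
by rewrite ltr_pdivrMr// mul1r ltr_nat.
Unshelve. all: by end_near.
Qed.

Lemma tight_near m (Y W : nat -> T -> 'cV[R]_m) :
  (forall k, measurable_fun setT (W k : T -> borelV R m)) ->
  (forall k, measurable_fun setT (Y k : T -> borelV R m)) ->
  (forall k, measurable_fun setT (fun w => `|Y k w - W k w|)) ->
  tight W -> cvg_prob0 (fun k w => `|Y k w - W k w|) -> tight Y.
Proof.
move=> mW mY mYW tW YW e e0.
have e2 : 0 < e / 2 by rewrite divr_gt0.
have [L WL] := tW _ e2; exists (L + 1); near=> k.
have H1 : (P [set w | (L < `|W k w|)%R] <= (e / 2)%:E)%E by near: k.
have H2 : (P [set w | (1 < `| `|Y k w - W k w| |)%R] <= (e / 2)%:E)%E.
  by near: k; exact: YW.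
have m1 := measurable_norm_gt L (mW k); have m2 := measurable_abs_gt 1 (mYW k).
rewrite [in leRHS](splitr e) EFinD; apply: le_trans (leeD H1 H2).
apply: le_trans (measureU2 _ m1 m2); apply: le_measure.
- by apply/mem_set; exact: measurable_norm_gt.
- by apply/mem_set; exact: measurableU.
move=> w /= H; have [H3|H3] := ltrP L `|W k w|; first by left.
right; rewrite /= normr_id ltNge; apply/negP => H4.
have := ler_normD (Y k w - W k w) (W k w); rewrite subrK => H5.
by have := lt_le_trans H H5; lra.
Unshelve. all: by end_near.
Qed.

End ConvergenceInProbability.

Section ArgminLaw.
Context d (T : measurableType d) (R : realType) (P : probability T R).

Lemma norm_Rintegral_bounded (f : T -> R) (M : R) : measurable_fun setT f ->
  (forall w, `|f w| <= M) -> `|\int[P]_w f w| <= M.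
Proof.
move=> mf fM; have If := integrable_bounded P mf fM.
apply: le_trans (le_normr_Rintegral measurableT If) _.
rewrite -[leRHS](Rintegral_const P M); apply: le_Rintegral => //.
  by have := integrable_norm If; apply: eq_integrable => // w _.
by apply: (@integrable_bounded _ _ _ _ _ `|M|).
Qed.

Lemma argmin_cvg_in_law m (S V : 'M[R]_m) (b : 'cV[R]_m)
    (M : nat -> T -> 'cV[R]_m -> R) (W u : nat -> T -> 'cV[R]_m) :
  S^T = S -> (forall t : 'cV[R]_m, 0 <= (t^T *m S *m t) 0 0) -> S \in unitmx ->
  V^T = V ->
  (forall k x, measurable_fun setT (fun w => M k w x)) ->
  (forall k, measurable_fun setT (W k : T -> borelV R m)) ->
  (forall k, measurable_fun setT (u k : T -> borelV R m)) ->
  (forall k w, convex_cV (M k w)) -> (forall k w x, M k w (u k w) <= M k w x) ->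
  tight P W ->
  (forall x : 'cV[R]_m, cvg_prob0 P (fun k w => M k w x + (x^T *m W k w) 0 0 -
      ((x^T *m S *m x) 0 0 / 2 + (x^T *m b) 0 0))) ->
  (forall (t : 'cV[R]_m) a, \int[P]_w cos ((t^T *m W k w) 0 0 + a) @[k --> \oo] -->
      expR (- ((t^T *m V *m t) 0 0 / 2)) * cos a) ->
  cvg_in_law_normal P (fun k w => u k w + invmx S *m b) 0 (invmx S *m V *m invmx S).
Proof.
move=> sS pS uS sV mM mW mu cM Mu tW MD cosW.
pose B := invmx S; have sB : B^T = B by rewrite trmx_inv sS.
have mlin k (Y : nat -> T -> 'cV[R]_m) (x : 'cV[R]_m) :
    measurable_fun setT (Y k : T -> borelV R m) ->
    measurable_fun setT (fun w => (x^T *m Y k w) 0 0).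
  by move=> mY; exact: (measurable_fun_continuous_cV mY (@linform_continuous R m x)).
have mcos (f : T -> R) : measurable_fun setT f -> measurable_fun setT (fun w => cos (f w)).
  by move=> mf; apply: measurableT_comp mf; exact: continuous_measurable_fun (@continuous_cos R).
have cos1 (x : R) : `|cos x| <= 1 by rewrite ler_norml cos_geN1 cos_le1.
have pV (t : 'cV[R]_m) : 0 <= (t^T *m V *m t) 0 0.
  have := cosW t 0; rewrite cos0 mulr1 => cW.
  have : expR (- ((t^T *m V *m t) 0 0 / 2)) <= 1.
    apply: (cvgr_to_le cW); apply: nearW => k; apply: (le_trans (ler_norm _)).
    apply: norm_Rintegral_bounded => //; apply: mcos.
    by apply: measurable_funD => //; exact: mlin.
  by rewrite -[leRHS]expR0 ler_expR oppr_le0 pmulr_lge0.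
pose Sg := B *m V *m B.
have SgE (t : 'cV[R]_m) : (t^T *m Sg *m t) 0 0 = ((B *m t)^T *m V *m (B *m t)) 0 0.
  by rewrite trmx_mul sB /Sg !mulmxA.
have [Q nQ] : exists Q : probability (borelV R m) R, is_multinormal Q 0 Sg.
  apply: exists_multinormal => [|t]; last by rewrite SgE.
  by rewrite /Sg !trmx_mul sB sV mulmxA.
exists Q; split => //.
pose Y k w : 'cV[R]_m := u k w + B *m b; pose Z k w : 'cV[R]_m := B *m W k w.
have mcoord (A : 'M[R]_m) (c : 'cV[R]_m) (X : T -> 'cV[R]_m) :
    measurable_fun setT (X : T -> borelV R m) ->
    measurable_fun setT ((fun w => A *m X w + c) : T -> borelV R m).
  move=> mX; apply: measurable_fun_cV => i.
  have -> : (fun w => (A *m X w + c) i 0) = (fun w => ((row i A)^T^T *m X w) 0 0 + c i 0).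
    apply/funext => w; rewrite trmxK !mxE; congr (_ + _).
    by apply: eq_bigr => j _; rewrite mxE.
  by apply: measurable_funD => //; exact: (mlin 0%N (fun=> X)).
have mY k : measurable_fun setT (Y k : T -> borelV R m).
  have := mcoord 1%:M (B *m b) (u k) (mu k).
  by under eq_fun do rewrite mul1mx.
have mZ k : measurable_fun setT (Z k : T -> borelV R m).
  have := mcoord B 0 (W k) (mW k).
  by under eq_fun do rewrite addr0.
have mYZ k : measurable_fun setT (fun w => `|Y k w - Z k w|).
  have mD : measurable_fun setT ((fun w => Y k w - Z k w) : T -> borelV R m).
    apply: measurable_fun_cV => i.
    have -> : (fun w => (Y k w - Z k w) i 0) = (fun w => ((delta_mx i 0 : 'cV[R]_m)^T *m Y k w) 0 0
        - ((delta_mx i 0 : 'cV[R]_m)^T *m Z k w) 0 0).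
      by apply/funext => w; rewrite trmx_delta -!rowE !mxE.
    by apply: measurable_funB; exact: mlin.
  by apply: (measurable_fun_continuous_cV mD); exact: norm_continuous.
have YZ : cvg_prob0 P (fun k w => `|Y k w - Z k w|).
  have := argmin_cvg_prob sS pS uS mM mW mu cM Mu tW MD.
  congr cvg_prob0; apply/funext => k; apply/funext => w; congr `|_|.
  by rewrite /Y /Z mulmxBr opprB addrA addrAC.
have tZ : tight P Z.
  pose C := 1 + \sum_i \sum_j `|B i j|.
  have C0 : 0 < C by rewrite ltr_pwDl//; apply: sumr_ge0 => i _; exact: sumr_ge0.
  move=> e e0; have [L WL] := tW _ e0; exists (C * L); near=> k.
  apply: le_trans (_ : P [set w | (L < `|W k w|)%R] <= _)%E; last by near: k.
  apply: le_measure.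
  - by apply/mem_set; exact: measurable_norm_gt.
  - by apply/mem_set; exact: measurable_norm_gt.
  move=> w /= H; rewrite -(ltr_pM2l C0); apply: lt_le_trans H _.
  by apply: (le_trans (norm_mulmx_cV _ _)); rewrite ler_wpM2r// lerDr.
have tY := tight_near mZ mY mYZ tZ YZ.
apply: cvg_in_law_criterion => // t a.
have vt0 : 0 <= (t^T *m Sg *m t) 0 0 by rewrite SgE.
rewrite (multinormal_cos a nQ vt0) SgE.
have ZW : \int[P]_w cos ((t^T *m Z k w) 0 0 + a) @[k --> \oo] -->
    expR (- (((B *m t)^T *m V *m (B *m t)) 0 0 / 2)) * cos a.
  have -> : (fun k => \int[P]_w cos ((t^T *m Z k w) 0 0 + a)) =
      (fun k => \int[P]_w cos (((B *m t)^T *m W k w) 0 0 + a)); last exact: cosW.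
  apply/funext => k.
  by apply: eq_Rintegral => w _; rewrite trmx_mul sB mulmxA.
rewrite -[X in _ --> X]add0r.
have -> : (fun k => \int[P]_w cos ((t^T *m Y k w) 0 0 + a)) =
   (fun k => (\int[P]_w cos ((t^T *m Y k w) 0 0 + a) - \int[P]_w cos ((t^T *m Z k w) 0 0 + a)) +
     \int[P]_w cos ((t^T *m Z k w) 0 0 + a)).
  by apply/funext => k; rewrite subrK.
apply: cvgD ZW; apply/cvgrPdist_le => e e0; rewrite /=.
pose Ct := 1 + \sum_i \sum_j `|t^T i j|.
have Ct0 : 0 < Ct by rewrite ltr_pwDl//; apply: sumr_ge0 => i _; exact: sumr_ge0.
have c0 : 0 < e / 2 / Ct by rewrite !divr_gt0.
have e4 : 0 < e / 4 by rewrite divr_gt0.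
near=> k.
have HA : (P [set w | (e / 2 / Ct < `| `|Y k w - Z k w| |)%R] <= (e / 4)%:E)%E.
  by near: k; exact: YZ.
rewrite sub0r normrN.
have mc (X : nat -> T -> 'cV[R]_m) : measurable_fun setT (X k : T -> borelV R m) ->
    measurable_fun setT (fun w => cos ((t^T *m X k w) 0 0 + a)).
  by move=> mX; apply: mcos; apply: measurable_funD => //; exact: mlin.
have mA := measurable_abs_gt (e / 2 / Ct) (mYZ k).
have e20 : 0 <= e / 2 by rewrite divr_ge0// ltW.
have PA : fine (P [set w | (e / 2 / Ct < `| `|Y k w - Z k w| |)%R]) <= e / 4.
  rewrite -lee_fin fineK//; apply: fin_num_measure => //.
have H := Rintegral_dist_le P (mc Y (mY k)) (mc Z (mZ k)) mA (fun w => cos1 _) (fun w => cos1 _) e20.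
apply: le_trans (H _) _; last by lra.
move=> w /=; rewrite normr_id => /negP; rewrite -leNgt => YZw.
apply: (le_trans (norm_cosD_le _ _)).
have -> : (t^T *m Y k w) 0 0 + a - ((t^T *m Z k w) 0 0 + a) = (t^T *m (Y k w - Z k w)) 0 0.
  by rewrite mulmxBr [in RHS]mxE [(- _ : 'M[R]_1) 0 0]mxE; ring.
apply: (le_trans (cV_coord_le _ _)); apply: (le_trans (norm_mulmx_cV _ _)).
apply: (@le_trans _ _ (Ct * `|Y k w - Z k w|)); first by rewrite ler_wpM2r// lerDr.
by rewrite mulrC -ler_pdivlMr.
Unshelve. all: by end_near.
Qed.

End ArgminLaw.

Section StrictlyConvex.
Variables (R : realType) (m : nat).
Implicit Types (F : 'cV[R]_m -> R) (x y : 'cV[R]_m).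

Definition strict_support F := forall x, exists2 g : 'cV[R]_m -> R,
  (forall s v, g (s *: v) = s * g v) & (forall y, y != x -> F x + g (y - x) < F y).

Lemma strict_support_convex F : strict_support F -> convex_cV F.
Proof.
move=> sF x y s /andP[s0 s1].
set z := s *: x + (1 - s) *: y; have [g gZ gF] := sF z.
have gF' v : F z + g (v - z) <= F v.
  have [->|/gF/ltW//] := eqVneq v z.
  by rewrite subrr -(scale0r z) gZ mul0r addr0.
have h1 := ler_wpM2l s0 (gF' x).
have s1' : 0 <= 1 - s by rewrite subr_ge0.
have h2 := ler_wpM2l s1' (gF' y).
have e1 : x - z = (1 - s) *: (x - y) by apply/colP => i; rewrite !mxE; ring.
have e2 : y - z = (- s) *: (x - y) by apply/colP => i; rewrite !mxE; ring.
move: h1 h2; rewrite e1 e2 !gZ.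
move: (F x) (F y) (F z) (g _) => a b c t h1 h2.
have -> : c = s * (c + (1 - s) * t) + (1 - s) * (c + - s * t) by ring.
exact: lerD.
Qed.

Lemma strict_support_uniq F x y : strict_support F ->
  (forall v, F x <= F v) -> (forall v, F y <= F v) -> x = y.
Proof.
move=> sF Fx Fy; apply/eqP; apply: contraT => xy.
pose z := 2^-1 *: (x + y); have [g gZ gF] := sF z.
have e1 : x - z = 2^-1 *: (x - y) by apply/colP => i; rewrite !mxE; field.
have e2 : y - z = (- 2^-1) *: (x - y) by apply/colP => i; rewrite !mxE; field.
have n1 : x != z.
  by rewrite -subr_eq0 e1 scaler_eq0 subr_eq0 (negbTE xy) orbF.
have n2 : y != z.
  by rewrite -subr_eq0 e2 scaler_eq0 subr_eq0 (negbTE xy) orbF.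
have := gF x n1; have := gF y n2; rewrite e1 e2 !gZ.
have := Fx z; have := Fy z.
move: (F x) (F y) (F z) (g _) => a b c t; lra.
Qed.

Lemma continuous_min_exists F (L : R) : continuous F -> 0 <= L ->
  (forall x, F x <= F 0 -> `|x| <= L) -> exists x, forall y, F x <= F y.
Proof.
move=> cF L0 FL.
pose A := [set x : 'cV[R]_m | `|x| <= L].
have A0 : A !=set0 by exists 0; rewrite /A/= normr0.
have [x /set_mem xL xmin] := compact_EVT_min A0 (@cV_box_compact R m L) (continuous_subspaceT cF).
exists x => y; have [yL|yL] := lerP `|y| L; first exact/xmin/mem_set.
apply: le_trans (xmin 0 _) _; first by apply/mem_set; rewrite /A/= normr0.
by apply/ltW; rewrite ltNge; apply/negP => /FL; rewrite leNgt yL.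
Qed.

Lemma strict_min_gap F u (r : R) : continuous F -> strict_support F ->
  (forall v, F u <= F v) -> 0 < r ->
  exists2 e : R, 0 < e & forall v, r <= `|v - u| -> F u + e <= F v.
Proof.
move=> cF sF Fu r0.
pose A := [set v : 'cV[R]_m | `|v - u| = r].
have onA v : r <= `|v - u| -> exists s, [/\ 0 < s, s <= 1 & A (s *: v + (1 - s) *: u)].
  move=> vr; have vu : 0 < `|v - u| by exact: lt_le_trans vr.
  exists (r / `|v - u|); split; first exact: divr_gt0.
    by rewrite ler_pdivrMr// mul1r.
  rewrite /A/=; set s := r / _.
  have -> : s *: v + (1 - s) *: u - u = s *: (v - u) by apply/colP => i; rewrite !mxE; ring.
  by rewrite normrZ ger0_norm ?divr_ge0 ?ltW// divfK// gt_eqF.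
have [A0|A0] := pselect (A !=set0); last first.
  by exists 1 => // v /onA[s [_ _ As]]; exfalso; apply: A0; exists (s *: v + (1 - s) *: u).
have cA : compact A.
  apply: (subclosed_compact _ (@cV_box_compact R m (`|u| + r))).
    have cd : continuous (fun v : 'cV[R]_m => `|v - u|).
      move=> v; apply: (@cvg_norm _ _ _ (nbhs v)).
      by apply: (@cvgB _ _ _ (nbhs v)); [exact: cvg_id|exact: cvg_cst].
    by have /continuous_closedP/(_ [set r]) := cd; apply; exact: closed_eq.
  move=> v /= vr; rewrite -(subrK u v) addrC (le_trans (ler_normD _ _))//.
  by rewrite lerD2l vr.
have [c /set_mem cAc cmin] := compact_EVT_min A0 cA (continuous_subspaceT cF).
have cu : F u < F c.
  rewrite lt_neqAle Fu andbT; apply/eqP => E.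
  have uc : u = c by apply: (strict_support_uniq sF Fu) => v; rewrite -E.
  by move: cAc; rewrite /A/= -uc subrr normr0 => r00; move: r0; rewrite -r00 ltxx.
exists (F c - F u); first by rewrite subr_gt0.
move=> v /onA[s [s0 s1 As]]; rewrite addrC subrK.
have h1 := cmin _ (mem_set As).
have s01 : 0 <= s <= 1 by rewrite ltW.
have h2 := strict_support_convex sF v u s01.
have h3 := le_trans h1 h2; have h4 := Fu v.
have h5 : 0 <= (1 - s) * (F v - F u) by rewrite mulr_ge0 ?subr_ge0.
move: h3 h5; move: (F v) (F u) (F c) => a b x; nra.
Qed.

End StrictlyConvex.

Lemma measurable_argmin d (T : measurableType d) (R : realType) m
    (F : T -> 'cV[R]_m -> R) (u : T -> 'cV[R]_m) :
  (forall x, measurable_fun setT (F ^~ x)) -> (forall w, continuous (F w)) ->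
  (forall w, strict_support (F w)) -> (forall w v, F w (u w) <= F w v) ->
  measurable_fun setT (u : T -> borelV R m).
Proof.
move=> mF cF sF Fu; apply: measurable_fun_cV => i.
pose rv (q : 'cV[rat]_m) : 'cV[R]_m := map_mx (@ratr R) q.
have approx w (x : 'cV[R]_m) (e r : R) : 0 < e -> 0 < r ->
    exists q, `|F w x - F w (rv q)| < e /\ `|x - rv q| < r.
  move=> e0 r0; have /cvgrPdist_lt/(_ e e0) := cF w x.
  move/nbhs_normP => [s /= s0 xs].
  have rs0 : 0 < Num.min r s by rewrite lt_min r0.
  have [q] := cV_rat_approx x rs0; rewrite lt_min => /andP[xr xs'].
  by exists q; split => //; exact: xs.
apply: (measurability _ (RGenInftyO.measurableE R)) => //.
move=> _ [_ [a ->] <-]; rewrite setTI.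
have -> : (fun w => u w i 0) @^-1` `]-oo, a[ =
    \bigcup_(p in [set p | (rv p) i 0 < a]) \bigcap_(q in [set q | a < (rv q) i 0])
      [set w | F w (rv p) <= F w (rv q)].
  apply/seteqP; split => w /=; rewrite in_itv/=.
    move=> ua; have r0 : 0 < a - u w i 0 by rewrite subr_gt0.
    have [e e0 gap] := strict_min_gap (cF w) (sF w) (Fu w) r0.
    have [p [p1 p2]] := approx w (u w) e (a - u w i 0) e0 r0.
    exists p => /=.
      have := le_lt_trans (cV_coord_le (u w - rv p) i) p2; rewrite !mxE.
      by rewrite distrC => /(le_lt_trans (ler_norm _)); lra.
    move=> q /= aq; apply: le_trans (gap _ _); last first.
      have := cV_coord_le (rv q - u w) i; rewrite mxE [(- _ : 'cV[R]_m) i 0]mxE => /(le_trans (ler_norm _)).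
      by lra.
    by move: p1; rewrite ltr_norml => /andP[]; lra.
  move=> [p /= pa pq]; rewrite ltNge; apply/negP => au.
  have pu : F w (rv p) <= F w (u w).
    apply/ler_addgt0Pr => e e0.
    have e2 : 0 < e / 2 by rewrite divr_gt0.
    have /cvgrPdist_lt/(_ _ e2) := cF w (u w).
    move/nbhs_normP => [s /= s0 us].
    have s2 : 0 < s / 2 by rewrite divr_gt0.
    have dn : `|(delta_mx i 0 : 'cV[R]_m)| <= 1.
      apply/cV_normP => // j; rewrite mxE.
      by case: (_ && _); rewrite ?normr1 ?normr0.
    pose x : 'cV[R]_m := u w + (s / 2) *: delta_mx i 0.
    have ux : `|F w (u w) - F w x| < e / 2.
      apply: us => /=; rewrite /x opprD addNKr normrN normrZ ger0_norm ?ltW//.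
      apply: (@le_lt_trans _ _ (s / 2)); last by lra.
      by apply: ler_piMr => //; exact: ltW.
    have [q [q1 q2]] := approx w x (e / 2) (s / 2) e2 s2.
    have aq : a < rv q i 0.
      have := le_lt_trans (cV_coord_le (x - rv q) i) q2.
      rewrite /x !mxE !eqxx mulr1 => /(le_lt_trans (ler_norm _)); lra.
    have /= := pq q aq; move: ux q1; rewrite !ltr_norml => /andP[? ?] /andP[? ?] ?; lra.
  have E : rv p = u w.
    apply: (strict_support_uniq (sF w)) => // v; exact: le_trans pu (Fu w v).
  by move: pa; rewrite E ltNge au.
rewrite bigcup_mkcond; apply: countable_bigcupT_measurable; first exact: countableP.
move=> p; case: ifP => // _.
rewrite -[X in measurable X]setCK setC_bigcap; apply: measurableC.
rewrite bigcup_mkcond; apply: countable_bigcupT_measurable; first exact: countableP.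
move=> q; case: ifP => // _; apply: measurableC.
rewrite -[X in measurable X]setTI.
have /(_ measurableT [set true] _) := measurable_fun_ler (mF (rv p)) (mF (rv q)); exact.
Qed.

(** * The penalized objective *)

Section Objective.
Variables (R : realType) (d : nat) (h : R -> 'cV[R]_d).
Implicit Types (theta v : 'cV[R]_(1 + d)) (x : R).

Definition covariate x : 'cV[R]_(1 + d) := param 1 (h x).

Definition dotz x v : R := ((covariate x)^T *m v) 0 0.

Lemma dotzE x v : dotz x v = v ord0 0 + ((h x)^T *m dsubmx v) 0 0.
Proof.
rewrite /dotz /covariate /param -[v in LHS]vsubmxK tr_col_mx mul_row_col mxE.
rewrite tr_scalar_mx mul1mx mxE; congr (v _ _ + _).
by apply/val_inj.
Qed.

Lemma predictorE theta x : predictor h theta x = dotz x theta.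
Proof.
rewrite dotzE /predictor /alpha_of /beta_of mxE; congr (theta _ _ + _).
  by apply/val_inj.
by rewrite !mxE; apply: eq_bigr => j _; rewrite !mxE mulrC.
Qed.

Lemma dotzD x v w : dotz x (v + w) = dotz x v + dotz x w.
Proof. by rewrite /dotz mulmxDr mxE. Qed.

Lemma dotzZ x s v : dotz x (s *: v) = s * dotz x v.
Proof. by rewrite /dotz -scalemxAr mxE. Qed.

Lemma dotz_continuous x : continuous (dotz x).
Proof. exact: linform_continuous. Qed.

Variables (q lam : R) (n1 n2 : nat) (x1 x2 : nat -> R).
Hypotheses (q1 : 1 < q) (lam0 : 0 < lam) (n10 : (0 < n1)%N) (n20 : (0 < n2)%N).

Let c : R := n1%:R / n2%:R.
Let c0 : 0 < c. Proof. by rewrite divr_gt0// ltr0n. Qed.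

Definition objective theta := - penalized_loglik h q lam n1 n2 x1 x2 theta.

Lemma objectiveE theta : objective theta =
  \sum_(j < n1) (softplus c (dotz (x1 j) theta) - dotz (x1 j) theta) +
  \sum_(j < n2) softplus c (dotz (x2 j) theta) +
  lam * \sum_(i < d) `|theta (rshift 1 i) 0| `^ q.
Proof.
rewrite /objective /penalized_loglik /loglik /penalty /= opprB opprD opprK.
rewrite addrC; congr (_ + _); last first.
  by congr (_ * _); apply: eq_bigr => i _; rewrite mxE.
rewrite sumrB [RHS]addrAC; congr (_ + _ - _); apply: eq_bigr => j _.
- by rewrite predictorE.
- by rewrite predictorE.
- by rewrite predictorE.
Qed.

Lemma softplus_continuous s : {for s, continuous (softplus c)}.
Proof.
by have [D _] := is_derive_softplus s c0; exact/differentiable_continuous/derivable1_diffP.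
Qed.

Lemma objective_continuous : continuous objective.
Proof.
rewrite (funext objectiveE) => theta.
have cd x : dotz x v @[v --> theta] --> dotz x theta by exact: dotz_continuous.
have cs x : softplus c (dotz x v) @[v --> theta] --> softplus c (dotz x theta).
  by apply: (@continuous_cvg _ _ _ (nbhs theta)); [exact: softplus_continuous|exact: cd].
apply: (@cvgD _ _ _ (nbhs theta)).
  apply: (@cvgD _ _ _ (nbhs theta)).
    apply: (@cvg_Rsum R _ _ (nbhs theta)) => j.
    by apply: (@cvgB _ _ _ (nbhs theta)); [exact: cs|exact: cd].
  by apply: (@cvg_Rsum R _ _ (nbhs theta)) => j; exact: cs.
apply: (@cvgM _ _ (nbhs theta)); first exact: cvg_cst.
apply: (@cvg_Rsum R _ _ (nbhs theta)) => i.
have q0 : 0 < q by exact: lt_trans q1.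
apply: (@continuous_cvg _ _ _ (nbhs theta) _ (fun v : 'cV[R]_(1 + d) => v (rshift 1 i) 0)
  (fun t : R => `|t| `^ q)).
  exact: norm_powR_continuous.
exact: coord_continuous.
Qed.

Lemma objective_strict_support : strict_support objective.
Proof.
move=> theta; pose p x := logistic c (dotz x theta).
pose g v := \sum_(j < n1) (p (x1 j) - 1) * dotz (x1 j) v +
  \sum_(j < n2) p (x2 j) * dotz (x2 j) v +
  lam * \sum_(i < d) powR_slope q (theta (rshift 1 i) 0) * v (rshift 1 i) 0.
exists g.
  move=> s v; rewrite /g.
  have E n (f : 'I_n -> R) (x : 'I_n -> R) :
      \sum_j f j * dotz (x j) (s *: v) = s * \sum_j f j * dotz (x j) v.
    by rewrite mulr_sumr; apply: eq_bigr => j _; rewrite dotzZ mulrCA.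
  have -> : \sum_(i < d) powR_slope q (theta (rshift 1 i) 0) * (s *: v) (rshift 1 i) 0 =
      s * \sum_(i < d) powR_slope q (theta (rshift 1 i) 0) * v (rshift 1 i) 0.
    by rewrite mulr_sumr; apply: eq_bigr => j _; rewrite mxE mulrCA.
  by rewrite !E; ring.
move=> y yth; set v := y - theta.
pose e x := softplus c (dotz x y) - softplus c (dotz x theta) - p x * dotz x v.
pose k i := `|y (rshift 1 i) 0| `^ q -
  (`|theta (rshift 1 i) 0| `^ q + powR_slope q (theta (rshift 1 i) 0) * v (rshift 1 i) 0).
have yE x : dotz x y = dotz x theta + dotz x v by rewrite -dotzD addrC subrK.
have e0 x : 0 <= e x.
  by rewrite subr_ge0 yE; exact: softplus_tangent_le.
have vE i : v i 0 = y i 0 - theta i 0 by rewrite !mxE.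
have k0 i : 0 <= k i by rewrite subr_ge0 vE; exact: norm_powR_tangent_le.
have FE : objective y = objective theta + g v +
    (\sum_(j < n1) e (x1 j) + \sum_(j < n2) e (x2 j) + lam * \sum_(i < d) k i).
  rewrite !objectiveE /g.
  have -> : \sum_(i < d) k i = \sum_(i < d) `|y (rshift 1 i) 0| `^ q -
     (\sum_(i < d) `|theta (rshift 1 i) 0| `^ q +
      \sum_(i < d) powR_slope q (theta (rshift 1 i) 0) * v (rshift 1 i) 0).
    by rewrite -big_split -sumrB.
  have -> : \sum_(j < n1) e (x1 j) = \sum_(j < n1) (softplus c (dotz (x1 j) y) - dotz (x1 j) y)
     - (\sum_(j < n1) (softplus c (dotz (x1 j) theta) - dotz (x1 j) theta) +
        \sum_(j < n1) (p (x1 j) - 1) * dotz (x1 j) v).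
    by rewrite -big_split -sumrB; apply: eq_bigr => j _; rewrite /e yE/=; ring.
  have -> : \sum_(j < n2) e (x2 j) = \sum_(j < n2) softplus c (dotz (x2 j) y)
     - (\sum_(j < n2) softplus c (dotz (x2 j) theta) +
        \sum_(j < n2) p (x2 j) * dotz (x2 j) v).
    by rewrite -big_split -sumrB; apply: eq_bigr => j _; rewrite /e/=; ring.
  ring.
rewrite FE ltrDl.
have s1 : 0 <= \sum_(j < n1) e (x1 j) by exact: sumr_ge0.
have s2 : 0 <= \sum_(j < n2) e (x2 j) by exact: sumr_ge0.
have s30 : 0 <= \sum_(i < d) k i by exact: sumr_ge0.
have s3 : 0 <= lam * \sum_(i < d) k i by rewrite mulr_ge0// ltW.
have [/existsP[i yi]|/existsPn H] := boolP [exists i : 'I_d, y (rshift 1 i) 0 != theta (rshift 1 i) 0].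
  suff : 0 < lam * \sum_(i < d) k i by lra.
  rewrite pmulr_rgt0// (bigD1 i)//= ltr_wpDr ?sumr_ge0//.
  by rewrite subr_gt0 vE; exact: norm_powR_tangent.
suff : 0 < \sum_(j < n1) e (x1 j) by lra.
have vr i : v (rshift 1 i) 0 = 0 by rewrite vE; apply/eqP; rewrite subr_eq0; have /negPn := H i.
rewrite (bigD1 (Ordinal n10))//= ltr_wpDr ?sumr_ge0//.
rewrite subr_gt0 yE; apply: softplus_tangent => //.
have dv : dsubmx v = 0 by apply/colP => i; rewrite !mxE -[RHS](vr i).
rewrite dotzE dv mulmx0 [X in _ + X]mxE addr0.
apply: contra yth => /eqP v0; rewrite -subr_eq0 -/v; apply/eqP/colP => i; rewrite [RHS]mxE.
case: (split_ordP i) => j ->; last exact: vr.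
by rewrite -[RHS]v0; congr (v _ _); apply/val_inj; rewrite /= (ord1 j).
Qed.

Lemma objective_sublevel_bounded : exists2 L : R, 0 <= L &
  forall theta, objective theta <= objective 0 -> `|theta| <= L.
Proof.
set f0 := objective 0.
pose a : R := n1%:R * `|ln c|.
pose B : R := 1 + (`|f0| + a) / lam.
pose H x : R := \sum_(i < d) `|h x i 0| * B.
have a0 : 0 <= a by rewrite mulr_ge0.
have B1 : 1 <= B by rewrite lerDl divr_ge0 ?addr_ge0// ltW.
have H0 x : 0 <= H x by apply: sumr_ge0 => i _; rewrite mulr_ge0// (le_trans ler01).
pose L := B + `|f0| + a + `|ln c| + H (x1 0%N) + H (x2 0%N).
have lnc0 := normr_ge0 (ln c); have f00 := normr_ge0 f0.
have H1 := H0 (x1 0%N); have H2 := H0 (x2 0%N).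
exists L; first by rewrite /L; lra.
move=> theta; rewrite objectiveE => Ff0.
have sp_ge0 s : 0 <= softplus c s.
  by rewrite ln_ge0// lerDl mulr_ge0 ?expR_ge0// ltW.
have sp_ge s : ln c + s <= softplus c s.
  have ce : 0 < c * expR s by rewrite mulr_gt0// expR_gt0.
  rewrite -[X in _ + X]expRK -lnM ?posrE ?expR_gt0// ler_ln ?posrE//; lra.
have lc : - `|ln c| <= ln c by rewrite lerNl (le_trans (ler_norm _))// normrN.
pose s1 := \sum_(j < n1) (softplus c (dotz (x1 j) theta) - dotz (x1 j) theta).
pose s2 := \sum_(j < n2) softplus c (dotz (x2 j) theta).
pose s3 := \sum_(i < d) `|theta (rshift 1 i) 0| `^ q.
have t1 j : - `|ln c| <= softplus c (dotz (x1 j) theta) - dotz (x1 j) theta.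
  by have := sp_ge (dotz (x1 j) theta); lra.
have bnd1 j0 : softplus c (dotz (x1 (j0 : 'I_n1)) theta) - dotz (x1 j0) theta - a <= s1.
  rewrite /s1 (bigD1 j0)//= lerD2l /a.
  apply: (@le_trans _ _ (\sum_(j < n1 | j != j0) - `|ln c|)); last by apply: ler_sum => j _.
  rewrite sumr_const mulNrn -[X in _ <= - X]mulr_natl lerN2.
  by rewrite ler_wpM2r// ler_nat -[X in (_ <= X)%N]card_ord max_card.
have s1a : - a <= s1.
  apply: (@le_trans _ _ (\sum_(j < n1) - `|ln c|)); last by apply: ler_sum => j _.
  by rewrite sumr_const card_ord mulNrn -[X in _ <= - X]mulr_natl.
have s20 : 0 <= s2 by exact: sumr_ge0.
have s30 : 0 <= s3 by apply: sumr_ge0 => i _; exact: powR_ge0.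
have ls3 : 0 <= lam * s3 by rewrite mulr_ge0// ltW.
rewrite -/s1 -/s2 -/s3 in Ff0.
have f0n := ler_norm f0.
have bB i : `|theta (rshift 1 i) 0| <= B.
  set t := `|_|; have t0 : 0 <= t by exact: normr_ge0.
  have [t1'|t1'] := lerP t 1; first exact: le_trans B1.
  have tq : t <= t `^ q by rewrite -[leLHS]powRr1// ler_powR ?ltW.
  have ts3 : t `^ q <= s3.
    rewrite /s3 (bigD1 i)//= lerDl; apply: sumr_ge0 => j _; exact: powR_ge0.
  apply: (le_trans tq); apply: (le_trans ts3).
  apply: (@le_trans _ _ ((`|f0| + a) / lam)); last by rewrite /B lerDr.
  by rewrite ler_pdivlMr// mulrC; lra.
have dH x : `|dotz x theta - theta ord0 0| <= H x.
  rewrite dotzE addrAC subrr add0r mxE; apply: (le_trans (ler_norm_sum _ _ _)).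
  by apply: ler_sum => i _; rewrite normrM !mxE ler_wpM2l.
have L0 : 0 <= L by rewrite /L; lra.
apply/cV_normP => // i; case: (split_ordP i) => j ->; last first.
  by apply: (le_trans (bB j)); rewrite /L; lra.
rewrite (_ : lshift d j = ord0); last by apply/val_inj; rewrite /= (ord1 j).
have := dH (x1 0%N); have := dH (x2 0%N); rewrite !ler_norml => /andP[u1 u2] /andP[u3 u4].
have u5 := bnd1 (Ordinal n10); rewrite /= in u5.
have u6 := sp_ge0 (dotz (x1 0%N) theta).
have u7 : softplus c (dotz (x2 0%N) theta) <= s2.
  by rewrite /s2 (bigD1 (Ordinal n20))//= lerDl sumr_ge0.
have u8 := sp_ge (dotz (x2 0%N) theta).
move: (theta ord0 0) (dotz (x1 0%N) theta) (dotz (x2 0%N) theta) (softplus c _) (softplus c _)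
  u1 u2 u3 u4 u5 u6 u7 u8 => tt z1 z2 sp1 sp2 u1 u2 u3 u4 u5 u6 u7 u8.
by rewrite /L; apply/andP; split; lra.
Qed.

Lemma objective_min_exists : exists theta, forall y, objective theta <= objective y.
Proof.
have [L L0 H] := objective_sublevel_bounded.
exact: continuous_min_exists objective_continuous L0 H.
Qed.

End Objective.

(** * Triangular arrays of independent summands *)

Lemma cvg0_dominated (R : realType) (u v : nat -> R) :
  (\forall k \near \oo, `|u k| <= v k) -> v k @[k --> \oo] --> 0 -> u k @[k --> \oo] --> 0.
Proof.
move=> uv v0; apply: norm_cvg0; apply: (@squeeze_cvgr _ _ _ _ (fun=> 0) v) => //.
  by near=> k; rewrite normr_ge0/=; near: k.
exact: cvg_cst.
Unshelve. all: by end_near. Qed.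

Lemma cvg_exprn (R : realType) (u : nat -> R) (l : R) n :
  u k @[k --> \oo] --> l -> u k ^+ n @[k --> \oo] --> l ^+ n.
Proof.
move=> ul; elim: n => [|n IH]; first by under eq_fun do rewrite expr0; exact: cvg_cst.
by under eq_fun do rewrite exprS; rewrite exprS; exact: cvgM.
Qed.

Section TriangularArrays.
Context d (S : measurableType d) (R : realType) (mu : probability S R).
Variables (f : nat -> S -> R) (g F : S -> R) (r : nat -> R).
Hypotheses (mf : forall k, measurable_fun setT (f k))
  (fg : forall x, f k x @[k --> \oo] --> g x)
  (F2 : mu.-integrable setT (EFin \o (fun x => F x ^+ 2)))
  (fF : \forall k \near \oo, forall x, `|f k x| <= F x)
  (r0 : forall k, 0 < r k) (ry : r k @[k --> \oo] --> +oo).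

Let ir : (r k)^-1 @[k --> \oo] --> (0 : R).
Proof. by apply/gtr0_cvgV0 => //; exact: nearW. Qed.

Let ir2 (C : R) : C / r k ^+ 2 @[k --> \oo] --> 0.
Proof.
rewrite -(mulr0 C); apply: cvgM; first exact: cvg_cst.
rewrite -(mulr0 (0 : R)); under eq_fun do rewrite expr2 invfM; exact: cvgM.
Qed.

Let sqr_dom k : (forall x, `|f k x| <= F x) -> forall x, f k x ^+ 2 <= F x ^+ 2.
Proof.
move=> H x; rewrite -(real_normK (num_real (f k x))).
by rewrite lerXn2r ?nnegrE//; exact: le_trans (normr_ge0 _) (H x).
Qed.

Lemma triangular_sqr_integrable : \forall k \near \oo,
  mu.-integrable setT (EFin \o (fun x => f k x ^+ 2)).
Proof.
near=> k; have H : forall x, `|f k x| <= F x by near: k.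
apply: (integrable_dominated _ F2); first exact: measurable_funX.
by move=> x; rewrite ger0_norm ?sqr_ge0//; exact: sqr_dom.
Unshelve. all: by end_near. Qed.

Lemma triangular_sqr_cvg : \int[mu]_x f k x ^+ 2 @[k --> \oo] --> \int[mu]_x g x ^+ 2.
Proof.
apply: (Rintegral_dominated_cvg _ _ F2).
- by move=> k; exact: measurable_funX.
- by move=> x; under eq_fun do rewrite expr2; rewrite expr2; exact: cvgM.
near=> k => x; have H : forall x, `|f k x| <= F x by near: k.
by rewrite ger0_norm ?sqr_ge0//; exact: sqr_dom.
Unshelve. all: by end_near. Qed.

Lemma triangular_cos : r k ^+ 2 * `|\int[mu]_x cos (f k x / r k) -
    expR (- (\int[mu]_x f k x ^+ 2 / r k ^+ 2) / 2)| @[k --> \oo] --> 0.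
Proof.
have I2F : mu.-integrable setT (EFin \o (fun x => 2 * F x ^+ 2)).
  by have := integrableZl measurableT 2 F2; apply: eq_integrable => // x _.
pose psi k x := r k ^+ 2 * (cos (f k x / r k) - 1 + (f k x / r k) ^+ 2 / 2).
have mfr k : measurable_fun setT (fun x => f k x / r k) by exact: measurable_funM.
have mcos k : measurable_fun setT (fun x => cos (f k x / r k)).
  by apply: measurableT_comp (mfr k); exact: continuous_measurable_fun (@continuous_cos R).
have mpsi k : measurable_fun setT (psi k).
  apply: measurable_funM => //; apply: measurable_funD.
    exact: measurable_funB.
  by apply: measurable_funM => //; exact: measurable_funX.
have psi_le k x : `|psi k x| <= 2 * f k x ^+ 2.
  rewrite /psi normrM ger0_norm ?sqr_ge0//.
  apply: (le_trans (ler_wpM2l (sqr_ge0 _) (norm_cos_rem_le _))).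
  rewrite real_normK ?num_real// expr_div_n le_eqVlt; apply/orP; left; apply/eqP; field.
  by rewrite gt_eqF.
have psi_le4 k x : `|psi k x| <= f k x ^+ 4 / r k ^+ 2.
  rewrite /psi normrM ger0_norm ?sqr_ge0//.
  apply: (le_trans (ler_wpM2l (sqr_ge0 _) (norm_cos_rem_le4 _))).
  rewrite -normrX ger0_norm ?exprn_even_ge0// expr_div_n le_eqVlt; apply/orP; left; apply/eqP; field.
  by rewrite gt_eqF.
have psi0 : \int[mu]_x psi k x @[k --> \oo] --> 0.
  have -> : 0 = \int[mu]_x (0 : R) by rewrite Rintegral_const.
  apply: (Rintegral_dominated_cvg mpsi _ I2F).
    move=> x; apply: (@cvg0_dominated _ _ (fun k => f k x ^+ 4 / r k ^+ 2)).
      by apply: nearW => k; exact: psi_le4.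
    rewrite -(mulr0 (g x ^+ 4)); apply: cvgM; first exact: cvg_exprn.
    by have := ir2 1; under eq_fun do rewrite mul1r.
  near=> k => x; have H : forall x, `|f k x| <= F x by near: k.
  by apply: (le_trans (psi_le k x)); rewrite ler_pM2l//; exact: sqr_dom.
pose s k := \int[mu]_x f k x ^+ 2.
have rem0 : (s k) ^+ 2 / 4 / r k ^+ 2 @[k --> \oo] --> 0.
  pose s0 := \int[mu]_x g x ^+ 2.
  have -> : 0 = (s0 * s0) * (4^-1 * 0) :> R by rewrite !mulr0.
  under eq_fun do rewrite expr2 -mulrA.
  apply: cvgM; first by apply: cvgM; exact: triangular_sqr_cvg.
  by rewrite mulr0; exact: (ir2 4^-1).
have E : \forall k \near \oo, r k ^+ 2 * `|\int[mu]_x cos (f k x / r k) -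
    expR (- (s k / r k ^+ 2) / 2)| <= `|\int[mu]_x psi k x| + (s k) ^+ 2 / 4 / r k ^+ 2.
  near=> k.
  have If2 : mu.-integrable setT (EFin \o (fun x => f k x ^+ 2)).
    by near: k; exact: triangular_sqr_integrable.
  have Ic : mu.-integrable setT (EFin \o (fun x => cos (f k x / r k))).
    by apply: (integrable_bounded mu (M := 1)) => // x; rewrite ler_norml cos_geN1 cos_le1.
  have I1 : mu.-integrable setT (EFin \o (fun=> 1)).
    by apply: (@integrable_bounded _ _ _ _ _ 1) => // x; rewrite normr1.
  have I2 : mu.-integrable setT (EFin \o (fun x => f k x ^+ 2 * (r k ^- 2 / 2))).
    by have := integrableZr measurableT (r k ^- 2 / 2) If2; apply: eq_integrable => // x _.
  have Ic1 : mu.-integrable setT (EFin \o (fun x => cos (f k x / r k) - 1)).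
    by have := integrableB measurableT Ic I1; apply: eq_integrable => // x _.
  have Ic12 : mu.-integrable setT (EFin \o (fun x => cos (f k x / r k) - 1 + f k x ^+ 2 * (r k ^- 2 / 2))).
    by have := integrableD measurableT Ic1 I2; apply: eq_integrable => // x _.
  have psiE : \int[mu]_x psi k x =
      r k ^+ 2 * (\int[mu]_x cos (f k x / r k) - 1 + s k * (r k ^- 2 / 2)).
    transitivity (\int[mu]_x (r k ^+ 2 * (cos (f k x / r k) - 1 + f k x ^+ 2 * (r k ^- 2 / 2)))).
      by apply: eq_Rintegral => x _; rewrite /psi expr_div_n mulrA.
    by rewrite RintegralZl// RintegralD// RintegralB// RintegralZr// Rintegral_const.
  set C := \int[mu]_x cos _ in psiE *; set y := s k / r k ^+ 2 / 2.
  have sk0 : 0 <= s k by apply: Rintegral_ge0 => x _; exact: sqr_ge0.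
  have y0 : 0 <= y by rewrite !divr_ge0 ?sqr_ge0.
  rewrite (mulNr (s k / r k ^+ 2)) -/y.
  have -> : C - expR (- y) = (C - 1 + y) - (expR (- y) - 1 + y) by ring.
  apply: (le_trans (ler_wpM2l (sqr_ge0 _) (ler_normB _ _))).
  rewrite mulrDr; apply: lerD.
    by rewrite psiE normrM (ger0_norm (sqr_ge0 _)) /y -mulrA.
  apply: (le_trans (ler_wpM2l (sqr_ge0 _) (norm_expRN_rem_le y0))).
  rewrite /y le_eqVlt; apply/orP; left; apply/eqP; field.
  by rewrite gt_eqF.
apply: (@cvg0_dominated _ _ (fun k => `|\int[mu]_x psi k x| + (s k) ^+ 2 / 4 / r k ^+ 2)).
- move: E; apply: filterS => k Ek.
  by rewrite (ger0_norm (mulr_ge0 (sqr_ge0 (r k)) (normr_ge0 _))).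
- rewrite -[X in _ --> X]addr0; apply: cvgD => //.
  by rewrite -(normr0 R); exact: cvg_norm.
Unshelve. all: by end_near. Qed.

Lemma triangular_sin : (\forall k \near \oo, \int[mu]_x f k x = 0) ->
  r k ^+ 2 * `|\int[mu]_x sin (f k x / r k)| @[k --> \oo] --> 0.
Proof.
move=> f0.
pose psi k x := r k ^+ 2 * (sin (f k x / r k) - f k x / r k).
have mfr k : measurable_fun setT (fun x => f k x / r k) by exact: measurable_funM.
have msin k : measurable_fun setT (fun x => sin (f k x / r k)).
  by apply: measurableT_comp (mfr k); exact: continuous_measurable_fun (@continuous_sin R).
have mpsi k : measurable_fun setT (psi k).
  by apply: measurable_funM => //; exact: measurable_funB.
have psi_le k x : `|psi k x| <= f k x ^+ 2.
  rewrite /psi normrM ger0_norm ?sqr_ge0//.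
  apply: (le_trans (ler_wpM2l (sqr_ge0 _) (norm_sinB_le (k := 1%N) _ isT))).
  rewrite real_normK ?num_real// expr_div_n le_eqVlt; apply/orP; left; apply/eqP; field.
  by rewrite gt_eqF.
have psi_le3 k x : `|psi k x| <= `|f k x| ^+ 3 / r k.
  rewrite /psi normrM ger0_norm ?sqr_ge0//.
  apply: (le_trans (ler_wpM2l (sqr_ge0 _) (norm_sinB_le (k := 2%N) _ isT))).
  rewrite normrM normfV (gtr0_norm (r0 k)) le_eqVlt; apply/orP; left; apply/eqP; field.
  by rewrite gt_eqF.
have psi0 : \int[mu]_x psi k x @[k --> \oo] --> 0.
  have -> : 0 = \int[mu]_x (0 : R) by rewrite Rintegral_const.
  apply: (Rintegral_dominated_cvg mpsi _ F2).
    move=> x; apply: (@cvg0_dominated _ _ (fun k => `|f k x| ^+ 3 / r k)).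
      by apply: nearW => k; exact: psi_le3.
    rewrite -(mulr0 (`|g x| ^+ 3)); apply: cvgM; last exact: ir.
    by apply: cvg_exprn; apply: cvg_norm; exact: fg.
  near=> k => x; have H : forall x, `|f k x| <= F x by near: k.
  by apply: (le_trans (psi_le k x)); exact: sqr_dom.
have psin0 : `|\int[mu]_x psi k x| @[k --> \oo] --> 0.
  by rewrite -(normr0 R); exact: cvg_norm.
apply: cvg0_dominated psin0; near=> k.
have f00 : \int[mu]_x f k x = 0 by near: k.
have I1 : mu.-integrable setT (EFin \o (fun=> 1)).
  by apply: (@integrable_bounded _ _ _ _ _ 1) => // x; rewrite normr1.
have If2 : mu.-integrable setT (EFin \o (fun x => f k x ^+ 2)).
  by near: k; exact: triangular_sqr_integrable.
have I1f : mu.-integrable setT (EFin \o (fun x => 1 + f k x ^+ 2)).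
  by have := integrableD measurableT I1 If2; apply: eq_integrable => // x _.
have If : mu.-integrable setT (EFin \o f k).
  apply: (integrable_dominated (mf k) I1f) => x.
  have := sqr_ge0 (1 - `|f k x|); rewrite sqrrB expr1n mul1r real_normK ?num_real//.
  by have := sqr_ge0 (f k x); lra.
have Ifr : mu.-integrable setT (EFin \o (fun x => f k x / r k)).
  by have := integrableZr measurableT (r k)^-1 If; apply: eq_integrable => // x _.
have Is : mu.-integrable setT (EFin \o (fun x => sin (f k x / r k))).
  by apply: (integrable_bounded mu (M := 1)) => // x; rewrite ler_norml sin_geN1 sin_le1.
have Isf : mu.-integrable setT (EFin \o (fun x => sin (f k x / r k) - f k x / r k)).
  by have := integrableB measurableT Is Ifr; apply: eq_integrable => // x _.
rewrite /psi RintegralZl// RintegralB// RintegralZr// f00 mul0r subr0.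
by rewrite !normrM !normr_id.
Unshelve. all: by end_near. Qed.

End TriangularArrays.

Lemma integrable_of_sqr d (S : measurableType d) (R : realType) (mu : probability S R)
    (f : S -> R) : measurable_fun setT f ->
  mu.-integrable setT (EFin \o (fun x => f x ^+ 2)) -> mu.-integrable setT (EFin \o f).
Proof.
move=> mf If2.
have I1 : mu.-integrable setT (EFin \o (fun=> 1)).
  by apply: (@integrable_bounded _ _ _ _ _ 1) => // x; rewrite normr1.
have I1f : mu.-integrable setT (EFin \o (fun x => 1 + f x ^+ 2)).
  by have := integrableD measurableT I1 If2; apply: eq_integrable => // x _.
apply: (integrable_dominated mf I1f) => x.
have := sqr_ge0 (1 - `|f x|); rewrite sqrrB expr1n mul1r real_normK ?num_real//.
by have := sqr_ge0 (f x); lra.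
Qed.

Section TwoSamples.
Context d (T : measurableType d) (R : realType) (P : probability T R).
Variables (X : nat + nat -> T -> R) (mu1 mu2 : probability R R).
Hypotheses (mX : forall i, measurable_fun setT (X i))
  (indX : mutually_independent P X)
  (X1mu : forall j (B : set R), measurable B -> P (X (inl j) @^-1` B) = mu1 B)
  (X2mu : forall j (B : set R), measurable B -> P (X (inr j) @^-1` B) = mu2 B).
Variables (f1 f2 : nat -> R -> R) (g1 g2 F1 F2 : R -> R) (N1 N2 : nat -> nat)
  (r : nat -> R) (tau1 tau2 : R).
Hypotheses (mf1 : forall k, measurable_fun setT (f1 k))
  (mf2 : forall k, measurable_fun setT (f2 k))
  (fg1 : forall x, f1 k x @[k --> \oo] --> g1 x)
  (fg2 : forall x, f2 k x @[k --> \oo] --> g2 x)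
  (IF1 : mu1.-integrable setT (EFin \o (fun x => F1 x ^+ 2)))
  (IF2 : mu2.-integrable setT (EFin \o (fun x => F2 x ^+ 2)))
  (fF1 : \forall k \near \oo, forall x, `|f1 k x| <= F1 x)
  (fF2 : \forall k \near \oo, forall x, `|f2 k x| <= F2 x)
  (f10 : \forall k \near \oo, \int[mu1]_x f1 k x = 0)
  (f20 : \forall k \near \oo, \int[mu2]_x f2 k x = 0)
  (r0 : forall k, 0 < r k) (ry : r k @[k --> \oo] --> +oo)
  (N1tau : (N1 k)%:R / r k ^+ 2 @[k --> \oo] --> tau1)
  (N2tau : (N2 k)%:R / r k ^+ 2 @[k --> \oo] --> tau2).

Definition sample_sum k w : R :=
  (\sum_(j < N1 k) f1 k (X (inl (j : nat)) w) + \sum_(j < N2 k) f2 k (X (inr (j : nat)) w)) / r k.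

Let phi k (i : nat + nat) (x : R) : R :=
  (match i with inl _ => f1 k x | inr _ => f2 k x end) / r k.

Let idx k : seq (nat + nat) :=
  [seq inl j | j <- iota 0 (N1 k)] ++ [seq inr j | j <- iota 0 (N2 k)].

Let sum_idx k (G : nat + nat -> R) :
  \sum_(i <- idx k) G i = \sum_(j < N1 k) G (inl (j : nat)) + \sum_(j < N2 k) G (inr (j : nat)).
Proof.
rewrite /idx big_cat !big_map/=; congr (_ + _).
- by rewrite -(big_mkord xpredT (fun j => G (inl j))) /index_iota subn0.
- by rewrite -(big_mkord xpredT (fun j => G (inr j))) /index_iota subn0.
Qed.

Let idx_uniq k : uniq (idx k).
Proof.
rewrite cat_uniq !map_inj_uniq ?iota_uniq/= ?andbT; [|by move=> ? ? []..].
by apply/hasPn => i /mapP[j _ ->]; apply/negP => /mapP[].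
Qed.

Let mphi k i : measurable_fun setT (phi k i).
Proof. by case: i => j; exact: measurable_funM. Qed.

Lemma sample_sumE k w : sample_sum k w = \sum_(i <- idx k) phi k i (X i w).
Proof. by rewrite sum_idx /phi -!mulr_suml -mulrDl. Qed.

Lemma sample_sum_cos a : \int[P]_w cos (sample_sum k w + a) @[k --> \oo] -->
  expR (- ((tau1 * \int[mu1]_x g1 x ^+ 2 + tau2 * \int[mu2]_x g2 x ^+ 2) / 2)) * cos a.
Proof.
pose v k : R := (N1 k)%:R / r k ^+ 2 * \int[mu1]_x f1 k x ^+ 2 +
  (N2 k)%:R / r k ^+ 2 * \int[mu2]_x f2 k x ^+ 2.
have vcvg : v k @[k --> \oo] --> tau1 * \int[mu1]_x g1 x ^+ 2 + tau2 * \int[mu2]_x g2 x ^+ 2.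
  apply: cvgD; (apply: cvgM; first by []).
    exact: triangular_sqr_cvg mf1 fg1 IF1 fF1.
  exact: triangular_sqr_cvg mf2 fg2 IF2 fF2.
have ecvg : expR (- (v k / 2)) * cos a @[k --> \oo] -->
    expR (- ((tau1 * \int[mu1]_x g1 x ^+ 2 + tau2 * \int[mu2]_x g2 x ^+ 2) / 2)) * cos a.
  apply: cvgM; last exact: cvg_cst.
  apply: continuous_cvg; first exact: continuous_expR.
  by apply: cvgN; apply: cvgM => //; exact: cvg_cst.
pose vi k (i : nat + nat) : R := (match i with inl _ => \int[mu1]_x f1 k x ^+ 2
  | inr _ => \int[mu2]_x f2 k x ^+ 2 end) / r k ^+ 2.
have vi0 k i : 0 <= vi k i.
  by case: i => j; rewrite divr_ge0 ?sqr_ge0//; apply: Rintegral_ge0 => x _; exact: sqr_ge0.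
have sumvi k : \sum_(i <- idx k) vi k i = v k.
  rewrite sum_idx /vi !sumr_const !card_ord -(mulr_natl _ (N1 k)) -(mulr_natl _ (N2 k)) /v; ring.
pose e1 k := `|\int[mu1]_x cos (f1 k x / r k) -
    expR (- (\int[mu1]_x f1 k x ^+ 2 / r k ^+ 2) / 2)| + `|\int[mu1]_x sin (f1 k x / r k)|.
pose e2 k := `|\int[mu2]_x cos (f2 k x / r k) -
    expR (- (\int[mu2]_x f2 k x ^+ 2 / r k ^+ 2) / 2)| + `|\int[mu2]_x sin (f2 k x / r k)|.
have mcos (u : R -> R) : measurable_fun setT u -> measurable_fun setT (fun x => cos (u x)).
  by move=> mu'; apply: measurableT_comp mu'; exact: continuous_measurable_fun (@continuous_cos R).
have msin (u : R -> R) : measurable_fun setT u -> measurable_fun setT (fun x => sin (u x)).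
  by move=> mu'; apply: measurableT_comp mu'; exact: continuous_measurable_fun (@continuous_sin R).
have bnd k : `|\int[P]_w cos (sample_sum k w + a) - expR (- (v k / 2)) * cos a| <=
    (N1 k)%:R * e1 k + (N2 k)%:R * e2 k.
  have := Rintegral_cos_sum_gauss mX indX (mphi k) a (idx_uniq k) (vi0 k).
  rewrite sumvi mulNr => H; under eq_Rintegral do rewrite sample_sumE.
  apply: (le_trans H); rewrite sum_idx.
  have E1 j : \int[P]_w cos (phi k (inl j) (X (inl j) w)) = \int[mu1]_x cos (f1 k x / r k).
    exact: (Rintegral_law (mX _) (X1mu j) (mcos _ (mphi k (inl j)))).
  have E2 j : \int[P]_w sin (phi k (inl j) (X (inl j) w)) = \int[mu1]_x sin (f1 k x / r k).
    exact: (Rintegral_law (mX _) (X1mu j) (msin _ (mphi k (inl j)))).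
  have E3 j : \int[P]_w cos (phi k (inr j) (X (inr j) w)) = \int[mu2]_x cos (f2 k x / r k).
    exact: (Rintegral_law (mX _) (X2mu j) (mcos _ (mphi k (inr j)))).
  have E4 j : \int[P]_w sin (phi k (inr j) (X (inr j) w)) = \int[mu2]_x sin (f2 k x / r k).
    exact: (Rintegral_law (mX _) (X2mu j) (msin _ (mphi k (inr j)))).
  under eq_bigr do rewrite E1 E2.
  under [X in _ + X]eq_bigr do rewrite E3 E4.
  rewrite /vi le_eqVlt; apply/orP; left; apply/eqP.
  by congr (_ + _); rewrite sumr_const card_ord -[LHS]mulr_natl.
have e10 : (N1 k)%:R * e1 k @[k --> \oo] --> 0.
  have -> : (fun k => (N1 k)%:R * e1 k) = (fun k => (N1 k)%:R / r k ^+ 2 * (r k ^+ 2 * e1 k)).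
    by apply/funext => k; rewrite mulrA divfK// gt_eqF// exprn_gt0.
  have S : r k ^+ 2 * e1 k @[k --> \oo] --> 0.
    rewrite -[X in _ --> X]addr0; under eq_fun do rewrite mulrDr; apply: cvgD.
      exact: triangular_cos mf1 fg1 IF1 fF1 r0 ry.
    exact: triangular_sin mf1 fg1 IF1 fF1 r0 ry f10.
  by rewrite -(mulr0 tau1); exact: cvgM N1tau S.
have e20 : (N2 k)%:R * e2 k @[k --> \oo] --> 0.
  have -> : (fun k => (N2 k)%:R * e2 k) = (fun k => (N2 k)%:R / r k ^+ 2 * (r k ^+ 2 * e2 k)).
    by apply/funext => k; rewrite mulrA divfK// gt_eqF// exprn_gt0.
  have S : r k ^+ 2 * e2 k @[k --> \oo] --> 0.
    rewrite -[X in _ --> X]addr0; under eq_fun do rewrite mulrDr; apply: cvgD.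
      exact: triangular_cos mf2 fg2 IF2 fF2 r0 ry.
    exact: triangular_sin mf2 fg2 IF2 fF2 r0 ry f20.
  by rewrite -(mulr0 tau2); exact: cvgM N2tau S.
have D0 : \int[P]_w cos (sample_sum k w + a) - expR (- (v k / 2)) * cos a @[k --> \oo] --> 0.
  apply: (cvg0_dominated (v := fun k => (N1 k)%:R * e1 k + (N2 k)%:R * e2 k)).
    by apply: nearW => k; exact: bnd.
  by rewrite -[X in _ --> X]addr0; exact: cvgD.
rewrite -[X in _ --> X]add0r.
have -> : (fun k => \int[P]_w cos (sample_sum k w + a)) =
    (fun k => (\int[P]_w cos (sample_sum k w + a) - expR (- (v k / 2)) * cos a) +
      expR (- (v k / 2)) * cos a).
  by apply/funext => k; rewrite subrK.
exact: cvgD.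
Qed.

Lemma sample_sum_sqr_bounded : exists C : R, \forall k \near \oo,
  P.-integrable setT (EFin \o (fun w => sample_sum k w ^+ 2)) /\
  \int[P]_w sample_sum k w ^+ 2 <= C.
Proof.
pose v k : R := (N1 k)%:R / r k ^+ 2 * \int[mu1]_x f1 k x ^+ 2 +
  (N2 k)%:R / r k ^+ 2 * \int[mu2]_x f2 k x ^+ 2.
pose V := tau1 * \int[mu1]_x g1 x ^+ 2 + tau2 * \int[mu2]_x g2 x ^+ 2.
have vcvg : v k @[k --> \oo] --> V.
  apply: cvgD; (apply: cvgM; first by []).
    exact: triangular_sqr_cvg mf1 fg1 IF1 fF1.
  exact: triangular_sqr_cvg mf2 fg2 IF2 fF2.
exists (V + 1); near=> k.
have I1 : mu1.-integrable setT (EFin \o (fun x => f1 k x ^+ 2)).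
  by near: k; exact: triangular_sqr_integrable mf1 IF1 fF1.
have I2 : mu2.-integrable setT (EFin \o (fun x => f2 k x ^+ 2)).
  by near: k; exact: triangular_sqr_integrable mf2 IF2 fF2.
have z1 : \int[mu1]_x f1 k x = 0 by near: k.
have z2 : \int[mu2]_x f2 k x = 0 by near: k.
have J1 : mu1.-integrable setT (EFin \o (fun x => (f1 k x / r k) ^+ 2)).
  have := integrableZr measurableT (r k ^- 2) I1; apply: eq_integrable => // x _ /=.
  by rewrite expr_div_n EFinM.
have J2 : mu2.-integrable setT (EFin \o (fun x => (f2 k x / r k) ^+ 2)).
  have := integrableZr measurableT (r k ^- 2) I2; apply: eq_integrable => // x _ /=.
  by rewrite expr_div_n EFinM.
have Iphi i : P.-integrable setT (EFin \o (fun w => phi k i (X i w) ^+ 2)).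
  case: i => j.
    exact: (integrable_law (mX _) (X1mu j) (f := fun x => (f1 k x / r k) ^+ 2)).
  exact: (integrable_law (mX _) (X2mu j) (f := fun x => (f2 k x / r k) ^+ 2)).
have m2 i : measurable_fun setT (fun x => phi k i x ^+ 2) by exact: measurable_funX.
have zphi i : \int[P]_w phi k i (X i w) = 0.
  case: i => j.
    rewrite (Rintegral_law (mX _) (X1mu j) (mphi k (inl j))) /phi RintegralZr//.
      by rewrite z1 mul0r.
    exact: integrable_of_sqr.
  rewrite (Rintegral_law (mX _) (X2mu j) (mphi k (inr j))) /phi RintegralZr//.
    by rewrite z2 mul0r.
  exact: integrable_of_sqr.
have [I E] := Rintegral_sqr_sum_indep mX indX (mphi k) (idx_uniq k) Iphi zphi.
split; first by apply: eq_integrable I => // w _ /=; rewrite sample_sumE.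
under eq_Rintegral do rewrite sample_sumE.
rewrite E sum_idx.
have E1 j : \int[P]_w phi k (inl j) (X (inl j) w) ^+ 2 = \int[mu1]_x f1 k x ^+ 2 * r k ^- 2.
  rewrite (Rintegral_law (mX _) (X1mu j) (m2 (inl j))) -RintegralZr//.
  by apply: eq_Rintegral => x _; rewrite /phi expr_div_n.
have E2 j : \int[P]_w phi k (inr j) (X (inr j) w) ^+ 2 = \int[mu2]_x f2 k x ^+ 2 * r k ^- 2.
  rewrite (Rintegral_law (mX _) (X2mu j) (m2 (inr j))) -RintegralZr//.
  by apply: eq_Rintegral => x _; rewrite /phi expr_div_n.
under eq_bigr do rewrite E1.
under [X in _ + X]eq_bigr do rewrite E2.
rewrite !sumr_const !card_ord -(mulr_natl _ (N1 k)) -(mulr_natl _ (N2 k)).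
have -> : (N1 k)%:R * (\int[mu1]_x f1 k x ^+ 2 * r k ^- 2) +
    (N2 k)%:R * (\int[mu2]_x f2 k x ^+ 2 * r k ^- 2) = v k.
  by rewrite /v; ring.
near: k; move/cvgrPdist_le : vcvg => /(_ 1 ltr01); apply: filterS => k.
by rewrite ler_norml => /andP[]; lra.
Unshelve. all: by end_near. Qed.

End TwoSamples.

(** * Score and quadratic expansion *)

Section LogisticBounds.
Variable R : realType.
Implicit Types c rho s t : R.

Let onep c s : 0 < c -> 0 < 1 + c * expR s.
Proof. by move=> c0; rewrite addr_gt0// mulr_gt0// expR_gt0. Qed.

Lemma logistic_le2 c rho s : 0 < c -> 0 < rho -> c <= 2 * rho ->
  logistic c s <= 2 * logistic rho s.
Proof.
move=> c0 r0 cr; have e0 := expR_gt0 s; have h1 := onep s c0; have h2 := onep s r0.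
rewrite /logistic mulrA ler_pdivrMr// mulrAC ler_pdivlMr//.
have h3 : c * expR s <= 2 * rho * expR s by rewrite ler_pM2r.
have h4 : 0 <= (c * expR s) * (rho * expR s) by rewrite !mulr_ge0// ltW.
move: (expR s) e0 h1 h2 h3 h4 => e e0 h1 h2 h3 h4; nra.
Qed.

Lemma logistic_compl_le2 c rho s : 0 < c -> 0 < rho -> rho <= 2 * c ->
  1 - logistic c s <= 2 * (1 - logistic rho s).
Proof.
move=> c0 r0 cr; rewrite !logistic_compl//.
have e0 := expR_gt0 s; have h1 := onep s c0; have h2 := onep s r0.
rewrite -[leLHS]mul1r ler_pdivrMr// mulrAC ler_pdivlMr// mul1r.
have h3 : rho * expR s <= 2 * c * expR s by rewrite ler_pM2r.
lra.
Qed.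

Lemma logistic_le c s t : 0 < c -> s <= t -> logistic c s <= logistic c t.
Proof.
move=> c0 st; rewrite -lerN2 -(lerD2l 1) !logistic_compl//.
by rewrite lef_pV2 ?posrE ?onep// lerD2l ler_pM2l// ler_expR.
Qed.

Lemma logistic_segment c s t a b : 0 < c -> 0 <= a <= b ->
  logistic c (s + a * t) <= logistic c s + logistic c (s + b * t).
Proof.
move=> c0 /andP[a0 ab].
have p1 := ltW (logistic_gt0 s c0); have p2 := ltW (logistic_gt0 (s + b * t) c0).
have [t0|t0] := leP 0 t.
  have : logistic c (s + a * t) <= logistic c (s + b * t).
    by apply: logistic_le => //; rewrite lerD2l ler_wpM2r.
  lra.
have : logistic c (s + a * t) <= logistic c s.
  by apply: logistic_le => //; rewrite gerDl mulr_ge0_le0// ltW.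
lra.
Qed.

Lemma logistic_compl_segment c s t a b : 0 < c -> 0 <= a <= b ->
  1 - logistic c (s + a * t) <= (1 - logistic c s) + (1 - logistic c (s + b * t)).
Proof.
move=> c0 /andP[a0 ab].
have p1 := ltW (logistic_lt1 s c0); have p2 := ltW (logistic_lt1 (s + b * t) c0).
have [t0|t0] := leP 0 t.
  have : logistic c s <= logistic c (s + a * t).
    by apply: logistic_le => //; rewrite lerDl mulr_ge0.
  lra.
have : logistic c (s + b * t) <= logistic c (s + a * t).
  by apply: logistic_le => //; rewrite lerD2l ler_wnM2r// ltW.
lra.
Qed.

Lemma logistic_cvg (c : nat -> R) rho s : 0 < rho -> c k @[k --> \oo] --> rho ->
  logistic (c k) s @[k --> \oo] --> logistic rho s.
Proof.
move=> r0 cr; rewrite /logistic.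
have ce : c k * expR s @[k --> \oo] --> rho * expR s by apply: cvgM => //; exact: cvg_cst.
apply: cvgM => //; apply: cvgV; first by rewrite gt_eqF// onep.
by apply: cvgD => //; exact: cvg_cst.
Qed.

Lemma logistic_density c s : 0 < c -> (1 - logistic c s) * expR s = logistic c s / c.
Proof.
move=> c0; rewrite logistic_compl// /logistic; have h := onep s c0.
by field; rewrite !gt_eqF.
Qed.

End LogisticBounds.

Section ModelIntegrals.
Variables (R : realType) (d : nat) (h : R -> 'cV[R]_d).
Hypothesis mh : forall i, measurable_fun setT (fun x => h x i 0).
Variables (mu1 mu2 : probability R R) (theta0 : 'cV[R]_(1 + d)) (rho : R).
Hypotheses (rho0 : 0 < rho)
  (mu12 : forall B : set R, measurable B ->
     mu1 B = (\int[mu2]_(x in B) (expR (dotz h x theta0))%:E)%E).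

Let p c x := logistic c (dotz h x theta0).

Lemma measurable_dotz v : measurable_fun setT (fun x => dotz h x v).
Proof.
under eq_fun do rewrite dotzE; apply: measurable_funD => //.
under eq_fun do rewrite mxE; apply: measurable_sum => i.
apply: measurable_funM => //; under eq_fun do rewrite mxE; exact: mh.
Qed.

Lemma measurable_logistic_dotz c v : 0 < c ->
  measurable_fun setT (fun x => logistic c (dotz h x v)).
Proof.
move=> c0; apply: (measurableT_comp _ (measurable_dotz v)).
apply: continuous_measurable_fun => s.
apply: (@cvgM _ _ (nbhs s)).
  by apply: (@cvgM _ _ (nbhs s)); [exact: cvg_cst|exact: continuous_expR].
apply: (@cvgV _ _ (nbhs s)); first by rewrite gt_eqF// addr_gt0// mulr_gt0// expR_gt0.
apply: (@cvgD _ _ _ (nbhs s)); first exact: cvg_cst.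
by apply: (@cvgM _ _ (nbhs s)); [exact: cvg_cst|exact: continuous_expR].
Qed.

Lemma Rintegral_mu1 (f : R -> R) : measurable_fun setT f ->
  mu2.-integrable setT (EFin \o (fun x => f x * expR (dotz h x theta0))) ->
  \int[mu1]_x f x = \int[mu2]_x (f x * expR (dotz h x theta0)).
Proof.
move=> mf If; apply: (@Rintegral_density _ _ _ _ _ mu2 mu1 idfun (fun x => expR (dotz h x theta0))) => //.
  exact: measurable_id.
by apply: measurableT_comp => //; exact: measurable_dotz.
Qed.

Lemma p_ge0 c x : 0 < c -> 0 <= p c x. Proof. by move=> c0; exact/ltW/logistic_gt0. Qed.
Lemma p_le1 c x : 0 < c -> p c x <= 1. Proof. by move=> c0; exact/ltW/logistic_lt1. Qed.

Hypotheses (I1 : forall u, mu1.-integrable setT (EFin \o (fun x => (1 - p rho x) * dotz h x u ^+ 2)))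
  (I2 : forall u, mu2.-integrable setT (EFin \o (fun x => p rho x * dotz h x u ^+ 2))).

Let mp c : 0 < c -> measurable_fun setT (p c).
Proof. exact: measurable_logistic_dotz. Qed.

(* |x| <= 1 + x^2 turns weighted second moments into first moments. *)
Let abs_le (x : R) : `|x| <= 1 + x ^+ 2.
Proof.
have := sqr_ge0 (1 - `|x|); rewrite sqrrB expr1n mul1r real_normK ?num_real//.
by have := sqr_ge0 x; lra.
Qed.

Lemma integrable_pz c u : 0 < c -> c <= 2 * rho ->
  mu2.-integrable setT (EFin \o (fun x => p c x * dotz h x u)).
Proof.
move=> c0 cr.
have J : mu2.-integrable setT (EFin \o (fun x => 1 + 2 * (p rho x * dotz h x u ^+ 2))).
  have J1 : mu2.-integrable setT (EFin \o (fun=> 1)).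
    by apply: (@integrable_bounded _ _ _ _ _ 1) => // x; rewrite normr1.
  have := integrableD measurableT J1 (integrableZl measurableT 2 (I2 u)).
  by apply: eq_integrable => // x _ /=.
apply: integrable_dominated J _.
  by apply: measurable_funM; [exact: mp|exact: measurable_dotz].
move=> x; rewrite normrM (ger0_norm (p_ge0 x c0)).
have h1 := logistic_le2 (dotz h x theta0) c0 rho0 cr; rewrite -/(p c x) -/(p rho x) in h1.
have h2 := p_le1 x c0; have h3 := p_ge0 x c0.
apply: (le_trans (ler_wpM2l h3 (abs_le _))); rewrite mulrDr mulr1 mulrA.
by apply: lerD => //; rewrite ler_wpM2r ?sqr_ge0.
Qed.

Lemma integrable_qz c u : 0 < c -> rho <= 2 * c ->
  mu1.-integrable setT (EFin \o (fun x => (1 - p c x) * dotz h x u)).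
Proof.
move=> c0 cr.
have J : mu1.-integrable setT (EFin \o (fun x => 1 + 2 * ((1 - p rho x) * dotz h x u ^+ 2))).
  have J1 : mu1.-integrable setT (EFin \o (fun=> 1)).
    by apply: (@integrable_bounded _ _ _ _ _ 1) => // x; rewrite normr1.
  have := integrableD measurableT J1 (integrableZl measurableT 2 (I1 u)).
  by apply: eq_integrable => // x _ /=.
apply: integrable_dominated J _.
  by apply: measurable_funM; [apply: measurable_funB => //; exact: mp|exact: measurable_dotz].
have h0 x : 0 <= 1 - p c x by rewrite subr_ge0 p_le1.
move=> x; rewrite normrM (ger0_norm (h0 x)).
have h1 := logistic_compl_le2 (dotz h x theta0) c0 rho0 cr; rewrite -/(p c x) -/(p rho x) in h1.
have h2 := p_ge0 x c0; have h3 := h0 x.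
apply: (le_trans (ler_wpM2l h3 (abs_le _))); rewrite mulrDr mulr1 mulrA.
by apply: lerD; [lra|rewrite ler_wpM2r ?sqr_ge0].
Qed.

Lemma Rintegral_qz c u : 0 < c -> c <= 2 * rho ->
  \int[mu1]_x ((1 - p c x) * dotz h x u) = (\int[mu2]_x (p c x * dotz h x u)) / c.
Proof.
move=> c0 cr.
have E x : (1 - p c x) * dotz h x u * expR (dotz h x theta0) = p c x * dotz h x u / c.
  by rewrite mulrAC logistic_density// mulrAC.
have I := integrable_pz u c0 cr.
rewrite Rintegral_mu1; first by rewrite -RintegralZr//; apply: eq_Rintegral => x _; exact: E.
  by apply: measurable_funM; [apply: measurable_funB => //; exact: mp|exact: measurable_dotz].
have := integrableZr measurableT c^-1 I; apply: eq_integrable => // x _ /=.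
by rewrite E.
Qed.

Lemma Rintegral_pqzz u :
  \int[mu1]_x (p rho x * (1 - p rho x) * dotz h x u ^+ 2) =
    (\int[mu2]_x (p rho x ^+ 2 * dotz h x u ^+ 2)) / rho.
Proof.
have E x : p rho x * (1 - p rho x) * dotz h x u ^+ 2 * expR (dotz h x theta0) =
    p rho x ^+ 2 * dotz h x u ^+ 2 / rho.
  have := logistic_density (dotz h x theta0) rho0; rewrite -/(p rho x) => D.
  have -> : p rho x * (1 - p rho x) * dotz h x u ^+ 2 * expR (dotz h x theta0) =
    p rho x * dotz h x u ^+ 2 * ((1 - p rho x) * expR (dotz h x theta0)) by ring.
  by rewrite D; ring.
have I : mu2.-integrable setT (EFin \o (fun x => p rho x ^+ 2 * dotz h x u ^+ 2)).
  apply: integrable_dominated (I2 u) _.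
    by apply: measurable_funM; apply: measurable_funX; [exact: mp|exact: measurable_dotz].
  move=> x; rewrite (ger0_norm (mulr_ge0 (sqr_ge0 _) (sqr_ge0 _))).
  apply: ler_wpM2r; first exact: sqr_ge0.
  by rewrite expr2; apply: ler_piMl; [exact: p_ge0|exact: p_le1].
rewrite Rintegral_mu1; first by rewrite -RintegralZr//; apply: eq_Rintegral => x _; exact: E.
  apply: measurable_funM; last by apply: measurable_funX; exact: measurable_dotz.
  by apply: measurable_funM; [exact: mp|apply: measurable_funB => //; exact: mp].
have := integrableZr measurableT rho^-1 I; apply: eq_integrable => // x _ /=.
by rewrite E.
Qed.

Lemma integrable_ppzz u :
  mu2.-integrable setT (EFin \o (fun x => p rho x ^+ 2 * dotz h x u ^+ 2)).
Proof.
apply: integrable_dominated (I2 u) _.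
  by apply: measurable_funM; apply: measurable_funX; [exact: mp|exact: measurable_dotz].
move=> x; rewrite (ger0_norm (mulr_ge0 (sqr_ge0 _) (sqr_ge0 _))).
apply: ler_wpM2r; first exact: sqr_ge0.
by rewrite expr2; apply: ler_piMl; [exact: p_ge0|exact: p_le1].
Qed.

Lemma Rintegral_qqzz u :
  \int[mu1]_x ((1 - p rho x) ^+ 2 * dotz h x u ^+ 2) =
    (\int[mu2]_x (p rho x * dotz h x u ^+ 2) -
     \int[mu2]_x (p rho x ^+ 2 * dotz h x u ^+ 2)) / rho.
Proof.
have I := integrable_ppzz u.
have E x : (1 - p rho x) ^+ 2 * dotz h x u ^+ 2 * expR (dotz h x theta0) =
    (p rho x * dotz h x u ^+ 2 - p rho x ^+ 2 * dotz h x u ^+ 2) / rho.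
  have := logistic_density (dotz h x theta0) rho0; rewrite -/(p rho x) => D.
  have -> : (1 - p rho x) ^+ 2 * dotz h x u ^+ 2 * expR (dotz h x theta0) =
    (1 - p rho x) * dotz h x u ^+ 2 * ((1 - p rho x) * expR (dotz h x theta0)) by ring.
  by rewrite D; ring.
have J : mu2.-integrable setT (EFin \o (fun x =>
    p rho x * dotz h x u ^+ 2 - p rho x ^+ 2 * dotz h x u ^+ 2)).
  by have := integrableB measurableT (I2 u) I; apply: eq_integrable => // x _.
rewrite Rintegral_mu1.
- by rewrite -RintegralB// -RintegralZr//; apply: eq_Rintegral => x _; exact: E.
- apply: measurable_funM; last by apply: measurable_funX; exact: measurable_dotz.
  by apply: measurable_funX; apply: measurable_funB => //; exact: mp.
- have := integrableZr measurableT rho^-1 J; apply: eq_integrable => // x _ /=.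
  by rewrite E.
Qed.

End ModelIntegrals.

Section WeightedMoments.
Context d (S : measurableType d) (R : realType) (mu : probability S R).
Variables (W z : S -> R).
Hypotheses (mW : measurable_fun setT W) (mz : measurable_fun setT z)
  (W0 : forall x, 0 <= W x) (W1 : forall x, W x <= 1)
  (I : mu.-integrable setT (EFin \o (fun x => W x * z x ^+ 2))).

Lemma integrable_weight_norm_sqr (M : R) :
  mu.-integrable setT (EFin \o (fun x => (2 * W x * `|z x| + M) ^+ 2)).
Proof.
have J : mu.-integrable setT (EFin \o (fun x => 8 * (W x * z x ^+ 2) + 2 * M ^+ 2)).
  have J1 : mu.-integrable setT (EFin \o (fun=> 2 * M ^+ 2)).
    by apply: (@integrable_bounded _ _ _ _ _ `|2 * M ^+ 2|).
  have := integrableD measurableT (integrableZl measurableT 8 I) J1.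
  by apply: eq_integrable => // x _.
apply: integrable_dominated J _.
  apply: measurable_funX; apply: measurable_funD => //; apply: measurable_funM.
    exact: measurable_funM.
  exact: measurableT_comp.
move=> x; rewrite ger0_norm ?sqr_ge0//.
have h1 : W x ^+ 2 * z x ^+ 2 <= W x * z x ^+ 2.
  by apply: ler_wpM2r; [exact: sqr_ge0|rewrite expr2 ler_piMl].
have := sqr_ge0 (2 * W x * `|z x| - M).
have -> : (2 * W x * `|z x| - M) ^+ 2 =
    8 * (W x ^+ 2 * `|z x| ^+ 2) + 2 * M ^+ 2 - (2 * W x * `|z x| + M) ^+ 2 by ring.
by rewrite real_normK ?num_real//; lra.
Qed.

Lemma integrable_weight_norm : mu.-integrable setT (EFin \o (fun x => 2 * W x * `|z x|)).
Proof.
apply: integrable_of_sqr.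
  apply: measurable_funM; last exact: measurableT_comp.
  exact: measurable_funM.
by have := integrable_weight_norm_sqr 0; under eq_fun do rewrite addr0.
Qed.

End WeightedMoments.

Lemma Rintegral_sqrB d (S : measurableType d) (R : realType) (mu : probability S R)
    (f : S -> R) (a : R) : measurable_fun setT f ->
  mu.-integrable setT (EFin \o (fun x => f x ^+ 2)) ->
  \int[mu]_x (f x - a) ^+ 2 = \int[mu]_x f x ^+ 2 - 2 * a * \int[mu]_x f x + a ^+ 2.
Proof.
move=> mf I2; have I1 := integrable_of_sqr mf I2.
have J1 : mu.-integrable setT (EFin \o (fun x => 2 * a * f x)).
  by have := integrableZl measurableT (2 * a) I1; apply: eq_integrable => // x _.
have J2 : mu.-integrable setT (EFin \o (fun=> a ^+ 2)).
  by apply: (@integrable_bounded _ _ _ _ _ `|a ^+ 2|).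
have J3 : mu.-integrable setT (EFin \o (fun x => f x ^+ 2 - 2 * a * f x)).
  by have := integrableB measurableT I2 J1; apply: eq_integrable => // x _.
rewrite -(Rintegral_const mu (a ^+ 2)) -RintegralZl// -RintegralB// -RintegralD//.
by apply: eq_Rintegral => x _; ring.
Qed.

Section Score.
Context disp (T : measurableType disp) (R : realType) (P : probability T R).
Variables (d : nat) (h : R -> 'cV[R]_d).
Hypothesis mh : forall i, measurable_fun setT (fun x => h x i 0).
Variables (X : nat + nat -> T -> R) (mu1 mu2 : probability R R).
Hypotheses (mX : forall i, measurable_fun setT (X i))
  (indX : mutually_independent P X)
  (X1mu : forall j (B : set R), measurable B -> P (X (inl j) @^-1` B) = mu1 B)
  (X2mu : forall j (B : set R), measurable B -> P (X (inr j) @^-1` B) = mu2 B).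
Variables (theta0 : 'cV[R]_(1 + d)) (rho : R) (n1 n2 : nat -> nat).
Hypotheses (rho0 : 0 < rho)
  (mu12 : forall B : set R, measurable B ->
     mu1 B = (\int[mu2]_(x in B) (expR (dotz h x theta0))%:E)%E)
  (n10 : forall k, (0 < n1 k)%N) (n20 : forall k, (0 < n2 k)%N)
  (ninf : (n1 k + n2 k)%N @[k --> \oo] --> \oo)
  (nrho : (n1 k)%:R / (n2 k)%:R @[k --> \oo] --> rho).
Let p c x := logistic c (dotz h x theta0).
Hypotheses (I1 : forall u, mu1.-integrable setT (EFin \o (fun x => (1 - p rho x) * dotz h x u ^+ 2)))
  (I2 : forall u, mu2.-integrable setT (EFin \o (fun x => p rho x * dotz h x u ^+ 2))).

Let c k : R := (n1 k)%:R / (n2 k)%:R.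
Let c0 k : 0 < c k. Proof. by rewrite divr_gt0// ltr0n. Qed.
Definition root_size k : R := Num.sqrt (n1 k + n2 k)%:R.
Let r := root_size.

Lemma root_size_gt0 k : 0 < r k.
Proof. by rewrite sqrtr_gt0 ltr0n addn_gt0 n10. Qed.

Lemma root_size_sqr k : r k ^+ 2 = (n1 k)%:R + (n2 k)%:R.
Proof. by rewrite sqr_sqrtr ?ler0n// natrD. Qed.

Lemma root_size_cvgy : r k @[k --> \oo] --> +oo.
Proof.
apply/cvgryPge => A.
pose N := (Num.truncn (A ^+ 2)).+1.
have : \forall k \near \oo, (N <= n1 k + n2 k)%N.
  by move/cvgnyPge : ninf; exact.
apply: filterS => k nk; apply: (le_trans (ler_norm A)); rewrite -sqrtr_sqr.
apply: ler_wsqrtr; apply/ltW; apply: lt_le_trans (truncnS_gt _) _.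
by rewrite ler_nat.
Qed.

Lemma size_ratio1 : (n1 k)%:R / r k ^+ 2 @[k --> \oo] --> rho / (1 + rho).
Proof.
have -> : (fun k => (n1 k)%:R / r k ^+ 2) = (fun k => c k / (1 + c k)).
  apply/funext => k; rewrite root_size_sqr /c; field.
  have a : 0 < (n1 k)%:R :> R by rewrite ltr0n.
  have b : 0 < (n2 k)%:R :> R by rewrite ltr0n.
  by rewrite !gt_eqF// addr_gt0.
apply: cvgM => //; apply: cvgV; first by rewrite gt_eqF// addr_gt0.
by apply: cvgD => //; exact: cvg_cst.
Qed.

Lemma size_ratio2 : (n2 k)%:R / r k ^+ 2 @[k --> \oo] --> 1 / (1 + rho).
Proof.
have -> : (fun k => (n2 k)%:R / r k ^+ 2) = (fun k => 1 / (1 + c k)).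
  apply/funext => k; rewrite root_size_sqr /c; field.
  have a : 0 < (n1 k)%:R :> R by rewrite ltr0n.
  have b : 0 < (n2 k)%:R :> R by rewrite ltr0n.
  by rewrite !gt_eqF// addr_gt0.
apply: cvgM; first exact: cvg_cst.
apply: cvgV; first by rewrite gt_eqF// addr_gt0.
by apply: cvgD => //; exact: cvg_cst.
Qed.

Lemma ratio_near : \forall k \near \oo, c k <= 2 * rho /\ rho <= 2 * c k.
Proof.
have /cvgrPdist_lt/(_ (rho / 2)) := nrho; rewrite divr_gt0// => /(_ isT).
by apply: filterS => k; rewrite ltr_norml /c => /andP[]; split; lra.
Qed.

Definition score k w : 'cV[R]_(1 + d) := (r k)^-1 *:
  (\sum_(j < n1 k) (1 - p (c k) (X (inl (j : nat)) w)) *: covariate h (X (inl (j : nat)) w) -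
   \sum_(j < n2 k) p (c k) (X (inr (j : nat)) w) *: covariate h (X (inr (j : nat)) w)).

Lemma dot_covariate (t : 'cV[R]_(1 + d)) x : (t^T *m covariate h x) 0 0 = dotz h x t.
Proof. by rewrite /dotz !mxE; apply: eq_bigr => i _; rewrite !mxE mulrC. Qed.

Lemma dot_score k w (t : 'cV[R]_(1 + d)) : (t^T *m score k w) 0 0 =
  (\sum_(j < n1 k) (1 - p (c k) (X (inl (j : nat)) w)) * dotz h (X (inl (j : nat)) w) t -
   \sum_(j < n2 k) p (c k) (X (inr (j : nat)) w) * dotz h (X (inr (j : nat)) w) t) / r k.
Proof.
rewrite /score -scalemxAr mxE mulrC mulmxBr !mulmx_sumr; congr (_ * _).
rewrite mxE [(- _ : 'M[R]_1) 0 0]mxE !summxE.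
by congr (_ - _); apply: eq_bigr => j _; rewrite -scalemxAr mxE dot_covariate.
Qed.

Section OneDirection.
Variable t : 'cV[R]_(1 + d).
Let z x := dotz h x t.
Let m k := \int[mu1]_x ((1 - p (c k) x) * z x).
Let m0 := \int[mu1]_x ((1 - p rho x) * z x).
Let f1 k x := (1 - p (c k) x) * z x - m k.
Let f2 k x := c k * m k - p (c k) x * z x.
Let mz : measurable_fun setT z. Proof. exact: measurable_dotz. Qed.
Let mp b : 0 < b -> measurable_fun setT (p b).
Proof. exact: measurable_logistic_dotz. Qed.
Let mq b : 0 < b -> measurable_fun setT (fun x => 1 - p b x).
Proof. by move=> b0; apply: measurable_funB => //; exact: mp. Qed.
Let p0 x : 0 <= p rho x. Proof. exact/ltW/logistic_gt0. Qed.
Let p1 x : p rho x <= 1. Proof. exact/ltW/logistic_lt1. Qed.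
Let q0 x : 0 <= 1 - p rho x. Proof. by rewrite subr_ge0. Qed.
Let q1 x : 1 - p rho x <= 1. Proof. by rewrite gerBl. Qed.
Let M := \int[mu1]_x (2 * (1 - p rho x) * `|z x|).

Let qz_dom k x : rho <= 2 * c k -> `|(1 - p (c k) x) * z x| <= 2 * (1 - p rho x) * `|z x|.
Proof.
move=> ck; rewrite normrM ger0_norm; last by rewrite subr_ge0; exact/ltW/logistic_lt1.
by rewrite ler_wpM2r//; exact: logistic_compl_le2.
Qed.

Let pz_dom k x : c k <= 2 * rho -> `|p (c k) x * z x| <= 2 * p rho x * `|z x|.
Proof.
move=> ck; rewrite normrM ger0_norm; last exact/ltW/logistic_gt0.
by rewrite ler_wpM2r//; exact: logistic_le2.
Qed.

Let Iqz : mu1.-integrable setT (EFin \o (fun x => 2 * (1 - p rho x) * `|z x|)).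
Proof. exact: (integrable_weight_norm (mq rho0) mz q0 q1 (I1 t)). Qed.

Let m_le k : rho <= 2 * c k -> `|m k| <= M.
Proof.
move=> ck; have I : mu1.-integrable setT (EFin \o (fun x => (1 - p (c k) x) * z x)).
  exact: (integrable_qz mh rho0 I1).
apply: (le_trans (le_normr_Rintegral measurableT I)).
apply: le_Rintegral => //; last by move=> x _; exact: qz_dom.
by have := integrable_norm I; apply: eq_integrable => // x _.
Qed.

Let m_cvg : m k @[k --> \oo] --> m0.
Proof.
apply: (Rintegral_dominated_cvg _ _ Iqz).
- by move=> k; apply: measurable_funM => //; exact: mq.
- move=> x; apply: cvgM; last exact: cvg_cst.
  by apply: cvgB; [exact: cvg_cst|exact: logistic_cvg].
- by apply: filterS ratio_near => k [_ ck] x; exact: qz_dom.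
Qed.

Let score_sample_sum k w : (t^T *m score k w) 0 0 = sample_sum X f1 f2 n1 n2 r k w.
Proof.
rewrite dot_score /sample_sum; congr (_ / _).
rewrite /f1 /f2 sumrB sumrB !sumr_const !card_ord.
have -> : c k * m k *+ n2 k = m k *+ n1 k.
  rewrite -(mulr_natl _ (n2 k)) -(mulr_natl _ (n1 k)) mulrA /c mulrCA divff ?mulr1//.
  by rewrite gt_eqF// ltr0n.
by rewrite addrA subrK.
Qed.

Let mf1 k : measurable_fun setT (f1 k).
Proof. by apply: measurable_funB => //; apply: measurable_funM => //; exact: mq. Qed.
Let mf2 k : measurable_fun setT (f2 k).
Proof. by apply: measurable_funB => //; apply: measurable_funM => //; exact: mp. Qed.

Let g1 x := (1 - p rho x) * z x - m0.
Let g2 x := rho * m0 - p rho x * z x.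

Let fg1 x : f1 k x @[k --> \oo] --> g1 x.
Proof.
apply: cvgB => //; apply: cvgM; last exact: cvg_cst.
by apply: cvgB; [exact: cvg_cst|exact: logistic_cvg].
Qed.

Let fg2 x : f2 k x @[k --> \oo] --> g2 x.
Proof.
apply: cvgB; first exact: cvgM.
by apply: cvgM; [exact: logistic_cvg|exact: cvg_cst].
Qed.

Let fF1 : \forall k \near \oo, forall x, `|f1 k x| <= 2 * (1 - p rho x) * `|z x| + M.
Proof.
apply: filterS ratio_near => k [_ ck] x; apply: (le_trans (ler_normB _ _)).
by apply: lerD; [exact: qz_dom|exact: m_le].
Qed.

Let fF2 : \forall k \near \oo, forall x, `|f2 k x| <= 2 * p rho x * `|z x| + 2 * rho * M.
Proof.
apply: filterS ratio_near => k [ck ck'] x; apply: (le_trans (ler_normB _ _)).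
rewrite addrC; apply: lerD; first exact: pz_dom.
rewrite normrM (gtr0_norm (c0 k)).
exact: ler_pM (ltW (c0 k)) (normr_ge0 _) ck (m_le ck').
Qed.

Let IF1 := integrable_weight_norm_sqr (mq rho0) mz q0 q1 (I1 t) M.
Let IF2 := integrable_weight_norm_sqr (mp rho0) mz p0 p1 (I2 t) (2 * rho * M).

Let f10 : \forall k \near \oo, \int[mu1]_x f1 k x = 0.
Proof.
apply: filterS ratio_near => k [_ ck]; rewrite /f1 RintegralB//.
- by rewrite Rintegral_const subrr.
- exact: (integrable_qz mh rho0 I1).
- by apply: (@integrable_bounded _ _ _ _ _ `|m k|).
Qed.

Let f20 : \forall k \near \oo, \int[mu2]_x f2 k x = 0.
Proof.
apply: filterS ratio_near => k [ck _]; rewrite /f2 RintegralB//.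
- rewrite Rintegral_const /m (Rintegral_qz mh rho0 mu12 I2)// mulrCA divff ?mulr1 ?subrr//.
  by rewrite gt_eqF.
- by apply: (@integrable_bounded _ _ _ _ _ `|c k * m k|).
- exact: (integrable_pz mh rho0 I2).
Qed.

Definition score_var := (\int[mu2]_x (p rho x * z x ^+ 2)) / (1 + rho) -
  (\int[mu2]_x (p rho x * z x)) ^+ 2 / rho.

Let varE : rho / (1 + rho) * \int[mu1]_x g1 x ^+ 2 + 1 / (1 + rho) * \int[mu2]_x g2 x ^+ 2
  = score_var.
Proof.
have Ipp := integrable_ppzz mh rho0 I2 t.
have Iqq : mu1.-integrable setT (EFin \o (fun x => ((1 - p rho x) * z x) ^+ 2)).
  apply: (integrable_dominated _ (I1 t)).
    by apply: measurable_funX; apply: measurable_funM => //; exact: mq.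
  move=> x; rewrite ger0_norm ?sqr_ge0// exprMn; apply: ler_wpM2r; first exact: sqr_ge0.
  by rewrite expr2; apply: ler_piMl.
have Ipp' : mu2.-integrable setT (EFin \o (fun x => (p rho x * z x) ^+ 2)).
  by under eq_fun do rewrite exprMn; exact: Ipp.
have m0E : m0 = (\int[mu2]_x (p rho x * z x)) / rho.
  have rr : rho <= 2 * rho by rewrite mulr_natl mulr2n lerDl ltW.
  exact: (Rintegral_qz mh rho0 mu12 I2 t rho0 rr).
have E1 : \int[mu1]_x g1 x ^+ 2 = \int[mu1]_x ((1 - p rho x) ^+ 2 * z x ^+ 2) - m0 ^+ 2.
  rewrite /g1 Rintegral_sqrB//; last by apply: measurable_funM => //; exact: mq.
  rewrite -/m0; have -> : \int[mu1]_x ((1 - p rho x) * z x) ^+ 2 =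
      \int[mu1]_x ((1 - p rho x) ^+ 2 * z x ^+ 2).
    by apply: eq_Rintegral => x _; rewrite exprMn.
  ring.
have E2 : \int[mu2]_x g2 x ^+ 2 = \int[mu2]_x (p rho x ^+ 2 * z x ^+ 2) - (rho * m0) ^+ 2.
  transitivity (\int[mu2]_x (p rho x * z x - rho * m0) ^+ 2).
    by apply: eq_Rintegral => x _; rewrite /g2 -sqrrN opprB.
  rewrite Rintegral_sqrB//; last by apply: measurable_funM => //; exact: mp.
  have -> : \int[mu2]_x (p rho x * z x) = rho * m0 by rewrite m0E mulrC divfK// gt_eqF.
  have -> : \int[mu2]_x (p rho x * z x) ^+ 2 = \int[mu2]_x (p rho x ^+ 2 * z x ^+ 2).
    by apply: eq_Rintegral => x _; rewrite exprMn.
  ring.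
rewrite E1 E2 (Rintegral_qqzz mh rho0 mu12 I2) m0E /score_var; field.
by rewrite !gt_eqF// addr_gt0.
Qed.

Lemma score_cos a : \int[P]_w cos ((t^T *m score k w) 0 0 + a) @[k --> \oo] -->
  expR (- (score_var / 2)) * cos a.
Proof.
have H := sample_sum_cos mX indX X1mu X2mu mf1 mf2 fg1 fg2 IF1 IF2 fF1 fF2 f10 f20
  root_size_gt0 root_size_cvgy size_ratio1 size_ratio2 (a := a).
rewrite varE in H; have -> : (fun k => \int[P]_w cos ((t^T *m score k w) 0 0 + a)) =
    (fun k => \int[P]_w cos (sample_sum X f1 f2 n1 n2 r k w + a)); last exact: H.
by apply/funext => k; apply: eq_Rintegral => w _; rewrite score_sample_sum.
Qed.

Lemma score_sqr_bounded : exists C : R, \forall k \near \oo,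
  P.-integrable setT (EFin \o (fun w => (t^T *m score k w) 0 0 ^+ 2)) /\
  \int[P]_w (t^T *m score k w) 0 0 ^+ 2 <= C.
Proof.
have [C HC] := sample_sum_sqr_bounded mX indX X1mu X2mu mf1 mf2 fg1 fg2 IF1 IF2 fF1 fF2 f10 f20
  size_ratio1 size_ratio2.
exists C; apply: filterS HC => k [I H]; split.
  by apply: eq_integrable I => // w _ /=; rewrite score_sample_sum.
by apply: le_trans H; rewrite le_eqVlt; apply/orP; left; apply/eqP;
   apply: eq_Rintegral => w _; rewrite score_sample_sum.
Qed.

End OneDirection.

Lemma measurable_score k : measurable_fun setT (score k : T -> borelV R (1 + d)).
Proof.
apply: measurable_fun_cV => i.
have -> : (fun w => score k w i 0) = (fun w => ((delta_mx i 0 : 'cV[R]_(1 + d))^T *m score k w) 0 0).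
  by apply/funext => w; rewrite trmx_delta -rowE [RHS]mxE.
under eq_fun do rewrite dot_score.
have md := measurable_dotz mh (delta_mx i 0).
have mp := measurable_logistic_dotz mh theta0 (c0 k).
apply: measurable_funM => //; apply: measurable_funB; apply: measurable_sum => j.
- apply: (measurableT_comp (f := fun x => (1 - p (c k) x) * dotz h x (delta_mx i 0))) => //.
  by apply: measurable_funM => //; exact: measurable_funB.
- apply: (measurableT_comp (f := fun x => p (c k) x * dotz h x (delta_mx i 0))) => //.
  exact: measurable_funM.
Qed.

Lemma tight_score : tight P score.
Proof.
move=> e e0.
have [C HC] := choice (fun i : 'I_(1 + d) => score_sqr_bounded (delta_mx i 0)).
pose s k w := \sum_i ((delta_mx i 0 : 'cV[R]_(1 + d))^T *m score k w) 0 0 ^+ 2.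
pose D : R := \sum_i `|C i|.
have D0 : 0 <= D by exact: sumr_ge0.
pose L2 : R := D / e + 1.
have L20 : 0 < L2 by rewrite ltr_wpDl// divr_ge0// ltW.
exists (Num.sqrt L2).
near=> k.
have Hk : forall i, P.-integrable setT (EFin \o (fun w =>
    ((delta_mx i 0 : 'cV[R]_(1 + d))^T *m score k w) 0 0 ^+ 2)) /\
  \int[P]_w ((delta_mx i 0 : 'cV[R]_(1 + d))^T *m score k w) 0 0 ^+ 2 <= C i.
  by near: k; apply: filter_forall => i; exact: HC.
have Is : P.-integrable setT (EFin \o s k).
  exact: (integrable_Rsum (fun i => (Hk i).1)).
have ss w : `|s k w| = s k w by rewrite ger0_norm// sumr_ge0// => i _; exact: sqr_ge0.
have sD : \int[P]_w `|s k w| <= D.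
  under eq_Rintegral do rewrite ss.
  rewrite /s (Rintegral_sum (fun i => (Hk i).1)); apply: ler_sum => i _.
  exact: le_trans (Hk i).2 (ler_norm _).
have ms : measurable_fun setT (s k) by apply/measurable_EFinP; exact: measurable_int Is.
apply: (@le_trans _ _ (P [set w | (L2 <= `|s k w|)%R])); last first.
  apply: (le_trans (markov_Rintegral L20 Is)); rewrite lee_fin ler_pdivrMr//.
  apply: (le_trans sD); rewrite /L2 mulrDr mulrCA divff ?gt_eqF// !mulr1.
  by rewrite lerDl ltW.
apply: le_measure.
- by apply/mem_set; exact: measurable_norm_gt (measurable_score k).
- apply/mem_set; rewrite (_ : [set w | _] = ~` [set w | `|s k w| < L2]).
    by apply: measurableC; apply: measurable_set_lt => //; exact: measurableT_comp.
  by apply/seteqP; split => w /=; rewrite leNgt => /negP.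
move=> w /= H; rewrite ss leNgt; apply/negP => sL; move: H; apply/negP; rewrite -leNgt.
apply/cV_normP; first exact: sqrtr_ge0.
move=> i; rewrite -sqrtr_sqr; apply: ler_wsqrtr; apply: (le_trans _ (ltW sL)).
rewrite /s (bigD1 i)//= trmx_delta -rowE [row _ _ _ _]mxE lerDl.
by apply: sumr_ge0 => j _; exact: sqr_ge0.
Unshelve. all: by end_near. Qed.

End Score.

Section Increment.
Context disp (T : measurableType disp) (R : realType) (P : probability T R).
Variables (d : nat) (h : R -> 'cV[R]_d).
Hypothesis mh : forall i, measurable_fun setT (fun x => h x i 0).
Variables (X : nat + nat -> T -> R) (mu1 mu2 : probability R R).
Hypotheses (mX : forall i, measurable_fun setT (X i))
  (indX : mutually_independent P X)
  (X1mu : forall j (B : set R), measurable B -> P (X (inl j) @^-1` B) = mu1 B)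
  (X2mu : forall j (B : set R), measurable B -> P (X (inr j) @^-1` B) = mu2 B).
Variables (theta0 : 'cV[R]_(1 + d)) (rho : R) (n1 n2 : nat -> nat).
Hypotheses (rho0 : 0 < rho)
  (mu12 : forall B : set R, measurable B ->
     mu1 B = (\int[mu2]_(x in B) (expR (dotz h x theta0))%:E)%E)
  (n10 : forall k, (0 < n1 k)%N) (n20 : forall k, (0 < n2 k)%N)
  (ninf : (n1 k + n2 k)%N @[k --> \oo] --> \oo)
  (nrho : (n1 k)%:R / (n2 k)%:R @[k --> \oo] --> rho).
Variables (u : 'cV[R]_(1 + d)) (b : R).
Hypothesis b0 : 0 < b.
Let p c x := logistic c (dotz h x theta0).
Let z x := dotz h x u.
Let pb c x := logistic c (dotz h x theta0 + b * z x).
Hypotheses (I1 : forall u, mu1.-integrable setT (EFin \o (fun x => (1 - p rho x) * dotz h x u ^+ 2)))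
  (I2 : forall u, mu2.-integrable setT (EFin \o (fun x => p rho x * dotz h x u ^+ 2)))
  (J1 : mu1.-integrable setT (EFin \o (fun x => (1 - pb rho x) * z x ^+ 2)))
  (J2 : mu2.-integrable setT (EFin \o (fun x => pb rho x * z x ^+ 2))).

Let c k : R := (n1 k)%:R / (n2 k)%:R.
Let c0 k : 0 < c k. Proof. by rewrite divr_gt0// ltr0n. Qed.
Let r := root_size R n1 n2.
Let r0 k : 0 < r k := root_size_gt0 R n2 n10 k.
Let rnear := ratio_near rho0 nrho.
Let ir : (r k)^-1 @[k --> \oo] --> (0 : R).
Proof. by apply/gtr0_cvgV0; [exact: nearW|exact: root_size_cvgy]. Qed.

Let rem k x := r k ^+ 2 * (softplus (c k) (dotz h x theta0 + (r k)^-1 * z x) -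
  softplus (c k) (dotz h x theta0) - p (c k) x * ((r k)^-1 * z x)).

Let mz : measurable_fun setT z. Proof. exact: measurable_dotz. Qed.
Let mp k : measurable_fun setT (p (c k)). Proof. exact: measurable_logistic_dotz. Qed.

Let mrem k : measurable_fun setT (rem k).
Proof.
have msp : measurable_fun setT (softplus (c k)).
  by apply: continuous_measurable_fun => s; exact: (softplus_continuous (n10 k) (n20 k)).
have mirz : measurable_fun setT (fun x => (r k)^-1 * z x) by exact: measurable_funM.
have md := measurable_dotz mh theta0.
apply: measurable_funM => //; apply: measurable_funB; last exact: measurable_funM.
apply: measurable_funB; first by apply: measurableT_comp => //; exact: measurable_funD.
exact: measurableT_comp.
Qed.

Let rem_ge0 k x : 0 <= rem k x.
Proof. by rewrite mulr_ge0 ?sqr_ge0// subr_ge0; exact: softplus_tangent_le. Qed.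

Let rem_le k x : rem k x <= z x ^+ 2 *
  Num.min (logistic (c k) (dotz h x theta0 + (r k)^-1 * z x) + p (c k) x)
    (1 - logistic (c k) (dotz h x theta0 + (r k)^-1 * z x) + (1 - p (c k) x)).
Proof.
apply: (le_trans (ler_wpM2l (sqr_ge0 _) (softplus_rem_le _ _ (c0 k)))).
rewrite mulrA exprMn exprVn mulrA divff ?mul1r//.
by rewrite gt_eqF// exprn_gt0.
Qed.

Let rem_cvg x : rem k x @[k --> \oo] --> p rho x * (1 - p rho x) * z x ^+ 2 / 2.
Proof.
pose A k := p (c k) x * (1 - p (c k) x) * z x ^+ 2 / 2.
have Ac : A k @[k --> \oo] --> p rho x * (1 - p rho x) * z x ^+ 2 / 2.
  have pc : p (c k) x @[k --> \oo] --> p rho x by exact: logistic_cvg.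
  apply: cvgM; last exact: cvg_cst.
  apply: cvgM; last exact: cvg_cst.
  by apply: cvgM => //; apply: cvgB => //; exact: cvg_cst.
have RA : rem k x - A k @[k --> \oo] --> 0.
  apply: (cvg0_dominated (v := fun k => 6 * `|z x| ^+ 3 * (r k)^-1)).
    have tz : (r k)^-1 * z x @[k --> \oo] --> 0.
      by rewrite -(mul0r (z x)); apply: cvgM => //; exact: cvg_cst.
    move/cvgr0Pnorm_lt : tz => /(_ (1 / 2)); rewrite divr_gt0// => /(_ isT).
    apply: filterS => k /ltW t12.
    have := softplus_rem2 (dotz h x theta0) (c0 k) t12.
    set D := softplus _ _ - _ - _ - _ => HD.
    have -> : rem k x - A k = r k ^+ 2 * D.
      rewrite /rem /A /D -/(p (c k) x) exprMn; field; rewrite gt_eqF//.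
    rewrite normrM ger0_norm ?sqr_ge0//; apply: (le_trans (ler_wpM2l (sqr_ge0 _) HD)).
    rewrite normrM gtr0_norm ?invr_gt0// exprMn le_eqVlt; apply/orP; left; apply/eqP; field.
    by rewrite gt_eqF.
  by rewrite -(mulr0 (6 * `|z x| ^+ 3)); apply: cvgM => //; exact: cvg_cst.
rewrite -[X in _ --> X]add0r.
have -> : rem^~ x = (fun k => (rem k x - A k) + A k) by apply/funext => k; rewrite subrK.
exact: cvgD.
Qed.

Let irb : \forall k \near \oo, 0 <= (r k)^-1 <= b.
Proof.
move/cvgr0Pnorm_lt : ir => /(_ _ b0); apply: filterS => k.
by move=> /(le_lt_trans (ler_norm _))/ltW ->; rewrite invr_ge0 ltW.
Qed.

Let G1 x := 4 * ((1 - p rho x) * z x ^+ 2) + 2 * ((1 - pb rho x) * z x ^+ 2).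
Let G2 x := 4 * (p rho x * z x ^+ 2) + 2 * (pb rho x * z x ^+ 2).

Let IG1 : mu1.-integrable setT (EFin \o G1).
Proof.
have := integrableD measurableT (integrableZl measurableT 4 (I1 u)) (integrableZl measurableT 2 J1).
by apply: eq_integrable => // x _.
Qed.

Let IG2 : mu2.-integrable setT (EFin \o G2).
Proof.
have := integrableD measurableT (integrableZl measurableT 4 (I2 u)) (integrableZl measurableT 2 J2).
by apply: eq_integrable => // x _.
Qed.

Let rem_dom1 : \forall k \near \oo, forall x, `|rem k x| <= G1 x.
Proof.
near=> k => x.
have [ck1 ck2] : c k <= 2 * rho /\ rho <= 2 * c k by near: k; exact: rnear.
have rb : 0 <= (r k)^-1 <= b by near: k; exact: irb.
rewrite ger0_norm//; apply: (le_trans (rem_le k x)).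
have -> : G1 x = z x ^+ 2 * (4 * (1 - p rho x) + 2 * (1 - pb rho x)) by rewrite /G1; ring.
apply: ler_wpM2l; first exact: sqr_ge0.
rewrite ge_min; apply/orP; right.
have := logistic_compl_segment (dotz h x theta0) (z x) (c0 k) rb.
have := logistic_compl_le2 (dotz h x theta0) (c0 k) rho0 ck2.
have := logistic_compl_le2 (dotz h x theta0 + b * z x) (c0 k) rho0 ck2.
rewrite -/(p (c k) x) -/(p rho x) -/(pb rho x) -/(pb (c k) x); lra.
Unshelve. all: by end_near. Qed.

Let rem_dom2 : \forall k \near \oo, forall x, `|rem k x| <= G2 x.
Proof.
near=> k => x.
have [ck1 ck2] : c k <= 2 * rho /\ rho <= 2 * c k by near: k; exact: rnear.
have rb : 0 <= (r k)^-1 <= b by near: k; exact: irb.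
rewrite ger0_norm//; apply: (le_trans (rem_le k x)).
have -> : G2 x = z x ^+ 2 * (4 * p rho x + 2 * pb rho x) by rewrite /G2; ring.
apply: ler_wpM2l; first exact: sqr_ge0.
rewrite ge_min; apply/orP; left.
have := logistic_segment (dotz h x theta0) (z x) (c0 k) rb.
have := logistic_le2 (dotz h x theta0) (c0 k) rho0 ck1.
have := logistic_le2 (dotz h x theta0 + b * z x) (c0 k) rho0 ck1.
rewrite -/(p (c k) x) -/(p rho x) -/(pb rho x) -/(pb (c k) x); lra.
Unshelve. all: by end_near. Qed.

Let ir2 (C : R) : C / r k ^+ 2 @[k --> \oo] --> 0.
Proof.
rewrite -(mulr0 C); apply: cvgM; first exact: cvg_cst.
rewrite -(mulr0 (0 : R)); under eq_fun do rewrite expr2 invfM; exact: cvgM.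
Qed.

Let size_cvgy (n : nat -> nat) (tau : R) : (forall k, (0 < n k)%N) -> 0 < tau ->
  (n k)%:R / r k ^+ 2 @[k --> \oo] --> tau -> ((n k)%:R : R) @[k --> \oo] --> +oo.
Proof.
move=> n0 tau0 ntau; apply/gtr0_cvgV0; first by apply: nearW => k; rewrite ltr0n.
have H : ((n k)%:R / r k ^+ 2)^-1 @[k --> \oo] --> tau^-1 by apply: cvgV => //; rewrite gt_eqF.
have H2 : ((n k)%:R / r k ^+ 2)^-1 * (1 / r k ^+ 2) @[k --> \oo] --> 0.
  by rewrite -(mulr0 tau^-1); exact: cvgM H (ir2 1).
have E k : ((n k)%:R / r k ^+ 2)^-1 * (1 / r k ^+ 2) = (n k)%:R^-1.
  by field; rewrite !gt_eqF ?ltr0n.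
by move: H2; under eq_fun do rewrite E.
Qed.

Let rem_sum (Y : nat -> T -> R) (mu : probability R R) (G : R -> R) (n : nat -> nat) (tau : R) :
  (forall j, measurable_fun setT (Y j)) -> mutually_independent P Y ->
  (forall j (B : set R), measurable B -> P (Y j @^-1` B) = mu B) ->
  mu.-integrable setT (EFin \o G) -> (\forall k \near \oo, forall x, `|rem k x| <= G x) ->
  (forall k, (0 < n k)%N) -> 0 < tau -> (n k)%:R / r k ^+ 2 @[k --> \oo] --> tau ->
  cvg_prob0 P (fun k w => (\sum_(j < n k) rem k (Y j w)) / r k ^+ 2 -
     tau * \int[mu]_x (p rho x * (1 - p rho x) * z x ^+ 2 / 2)) /\
  forall k, measurable_fun setT (fun w => (\sum_(j < n k) rem k (Y j w)) / r k ^+ 2 -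
     tau * \int[mu]_x (p rho x * (1 - p rho x) * z x ^+ 2 / 2)).
Proof.
move=> mY indY Ymu IG remG n0 tau0 ntau.
set I := \int[mu]_x _.
have L := lln_L1 mY indY Ymu mrem rem_cvg IG remG n0 (size_cvgy n0 tau0 ntau).
have msum k : measurable_fun setT (fun w => \sum_(j < n k) rem k (Y j w)).
  by apply: measurable_sum => j; exact: measurableT_comp.
have mA k : measurable_fun setT (fun w => (n k)%:R / r k ^+ 2 * ((\sum_(j < n k) rem k (Y j w)) / (n k)%:R - I)).
  by apply: measurable_funM => //; apply: measurable_funB => //; exact: measurable_funM.
split; last by move=> k; apply: measurable_funB => //; exact: measurable_funM.
have -> : (fun k w => (\sum_(j < n k) rem k (Y j w)) / r k ^+ 2 - tau * I) =
    (fun k w => (n k)%:R / r k ^+ 2 * ((\sum_(j < n k) rem k (Y j w)) / (n k)%:R - I) +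
       ((n k)%:R / r k ^+ 2 - tau) * I).
  apply/funext => k; apply/funext => w; field.
  by rewrite !gt_eqF ?ltr0n.
apply: cvg_prob0D => //; last first.
  apply: cvg_prob0_cst; rewrite -(mul0r I); apply: cvgM; last exact: cvg_cst.
  by rewrite -(subrr tau); apply: cvgB => //; exact: cvg_cst.
have IA : \forall k \near \oo, P.-integrable setT
    (EFin \o (fun w => (\sum_(j < n k) rem k (Y j w)) / (n k)%:R - I)).
  apply: filterS remG => k remGk.
  have Irem : mu.-integrable setT (EFin \o rem k) by exact: integrable_dominated IG _.
  have IS := integrable_Rsum (fun j : 'I_(n k) => integrable_law (mY j) (Ymu j) Irem) (index_enum 'I_(n k)).
  have IC : P.-integrable setT (EFin \o (fun=> I)).
    by apply: (@integrable_bounded _ _ _ _ _ `|I|).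
  have := integrableB measurableT (integrableZr measurableT (n k)%:R^-1 IS) IC.
  by apply: eq_integrable => // w _.
apply: cvg_prob0_L1.
  apply: filterS IA => k IAk.
  by have := integrableZl measurableT ((n k)%:R / r k ^+ 2) IAk; apply: eq_integrable => // w _.
have H : (n k)%:R / r k ^+ 2 * \int[P]_w `|(\sum_(j < n k) rem k (Y j w)) / (n k)%:R - I|
    @[k --> \oo] --> 0.
  rewrite -[X in _ --> X](mulr0 tau).
  by apply: cvgM; [exact: ntau|exact: L].
apply: cvg0_dominated H; apply: filterS IA => k IAk.
have tk0 : 0 <= (n k)%:R / r k ^+ 2 by rewrite divr_ge0// sqr_ge0.
rewrite ger0_norm; last by apply: Rintegral_ge0.
under eq_Rintegral do rewrite normrM (ger0_norm tk0).
rewrite RintegralZl//.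
by have := integrable_norm IAk; apply: eq_integrable => // w _.
Qed.

Variables (q lam0 : R) (lam : nat -> R).
Hypotheses (q1 : 1 < q) (lamcvg : lam k / r k @[k --> \oo] --> lam0).

Let obj k w := objective h q (lam k) (n1 k) (n2 k)
  (fun j => X (inl j) w) (fun j => X (inr j) w).

Let pen k := lam k * \sum_(i < d) (`|theta0 (rshift 1 i) 0 + (r k)^-1 * u (rshift 1 i) 0| `^ q -
  `|theta0 (rshift 1 i) 0| `^ q).

Let pen_cvg : pen k @[k --> \oo] -->
  lam0 * \sum_(i < d) powR_slope q (theta0 (rshift 1 i) 0) * u (rshift 1 i) 0.
Proof.
have -> : pen = (fun k => lam k / r k * \sum_(i < d) (r k *
    (`|theta0 (rshift 1 i) 0 + u (rshift 1 i) 0 / r k| `^ q - `|theta0 (rshift 1 i) 0| `^ q))).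
  apply/funext => k; rewrite /pen -mulr_sumr mulrA divfK ?gt_eqF//.
  by congr (_ * _); apply: eq_bigr => i _; rewrite (mulrC (r k)^-1).
apply: cvgM => //; apply: (@cvg_Rsum R _ _ \oo) => i.
by apply: norm_powR_cvg_slope => //; exact: root_size_cvgy.
Qed.

Let incrementE k w : obj k w (theta0 + (r k)^-1 *: u) - obj k w theta0 +
    (u^T *m score h X theta0 n1 n2 k w) 0 0 =
  (\sum_(j < n1 k) rem k (X (inl (j : nat)) w)) / r k ^+ 2 +
  (\sum_(j < n2 k) rem k (X (inr (j : nat)) w)) / r k ^+ 2 + pen k.
Proof.
rewrite /obj !objectiveE dot_score -/c.
have E x : dotz h x (theta0 + (r k)^-1 *: u) = dotz h x theta0 + (r k)^-1 * z x.
  by rewrite dotzD dotzZ.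
have R2 : r k ^+ 2 != 0 by rewrite gt_eqF// exprn_gt0.
have E1 : (\sum_(j < n1 k) rem k (X (inl (j : nat)) w)) / r k ^+ 2 =
    \sum_(j < n1 k) (softplus (c k) (dotz h (X (inl (j : nat)) w) (theta0 + (r k)^-1 *: u)) -
      dotz h (X (inl (j : nat)) w) (theta0 + (r k)^-1 *: u)) -
    \sum_(j < n1 k) (softplus (c k) (dotz h (X (inl (j : nat)) w) theta0) -
      dotz h (X (inl (j : nat)) w) theta0) +
    (\sum_(j < n1 k) (1 - p (c k) (X (inl (j : nat)) w)) * z (X (inl (j : nat)) w)) / r k.
  rewrite !mulr_suml -sumrB -big_split; apply: eq_bigr => j _ /=.
  by rewrite /rem mulrC mulKf// E; ring.
have E2 : (\sum_(j < n2 k) rem k (X (inr (j : nat)) w)) / r k ^+ 2 =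
    \sum_(j < n2 k) softplus (c k) (dotz h (X (inr (j : nat)) w) (theta0 + (r k)^-1 *: u)) -
    \sum_(j < n2 k) softplus (c k) (dotz h (X (inr (j : nat)) w) theta0) -
    (\sum_(j < n2 k) p (c k) (X (inr (j : nat)) w) * z (X (inr (j : nat)) w)) / r k.
  rewrite !mulr_suml -!sumrB; apply: eq_bigr => j _ /=.
  by rewrite /rem mulrC mulKf// E; ring.
have E3 : pen k = lam k * \sum_(i < d) `|(theta0 + (r k)^-1 *: u) (rshift 1 i) 0| `^ q -
    lam k * \sum_(i < d) `|theta0 (rshift 1 i) 0| `^ q.
  rewrite -mulrBr -sumrB; congr (_ * _); apply: eq_bigr => i _.
  by rewrite !mxE.
rewrite E1 E2 E3 -/c -/r /c; ring.
Qed.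

Lemma objective_increment :
  cvg_prob0 P (fun k w => obj k w (theta0 + (r k)^-1 *: u) - obj k w theta0 +
    (u^T *m score h X theta0 n1 n2 k w) 0 0 -
    ((\int[mu2]_x (p rho x * z x ^+ 2)) / (1 + rho) / 2 +
     lam0 * \sum_(i < d) powR_slope q (theta0 (rshift 1 i) 0) * u (rshift 1 i) 0)).
Proof.
have rho1 : 0 < 1 + rho by rewrite addr_gt0.
have t10 : 0 < rho / (1 + rho) by rewrite divr_gt0.
have t20 : 0 < 1 / (1 + rho) by rewrite divr_gt0.
have ind1 : mutually_independent P (fun j => X (inl j)).
  by apply: mutually_independent_comp indX => i j [].
have ind2 : mutually_independent P (fun j => X (inr j)).
  by apply: mutually_independent_comp indX => i j [].
have s1 := @size_ratio1 R rho n1 n2 rho0 n10 n20 nrho.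
have s2 := @size_ratio2 R rho n1 n2 rho0 n10 n20 nrho.
have [H1 m1] := rem_sum (fun j => mX (inl j)) ind1 X1mu IG1 rem_dom1 n10 t10 s1.
have [H2 m2] := rem_sum (fun j => mX (inr j)) ind2 X2mu IG2 rem_dom2 n20 t20 s2.
set a1 := \int[mu1]_x _ in H1 m1; set a2 := \int[mu2]_x _ in H2 m2.
set L0 := lam0 * _; set Q := \int[mu2]_x _.
have mpr : measurable_fun setT (p rho) by exact: measurable_logistic_dotz.
have Ipp := integrable_ppzz mh rho0 I2 u.
have I12 : mu1.-integrable setT (EFin \o (fun x => p rho x * (1 - p rho x) * z x ^+ 2)).
  apply: (integrable_dominated _ (I1 u)).
    apply: measurable_funM; last exact: measurable_funX.
    by apply: measurable_funM => //; exact: measurable_funB.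
  have p0 x := ltW (logistic_gt0 (dotz h x theta0) rho0).
  have p1 x := ltW (logistic_lt1 (dotz h x theta0) rho0).
  have q0 x : 0 <= 1 - p rho x by rewrite subr_ge0; exact: p1.
  move=> x; rewrite (ger0_norm (mulr_ge0 (mulr_ge0 (p0 x) (q0 x)) (sqr_ge0 _))).
  by apply: ler_wpM2r; [exact: sqr_ge0|apply: ler_piMl => //; exact: p1].
have a1E : a1 = (\int[mu2]_x (p rho x ^+ 2 * z x ^+ 2)) / rho / 2.
  by rewrite /a1 RintegralZr// (Rintegral_pqzz mh rho0 mu12 I2).
have a2E : a2 = (Q - \int[mu2]_x (p rho x ^+ 2 * z x ^+ 2)) / 2.
  have ID : mu2.-integrable setT (EFin \o (fun x => p rho x * z x ^+ 2 - p rho x ^+ 2 * z x ^+ 2)).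
    by have := integrableB measurableT (I2 u) Ipp; apply: eq_integrable => // x _.
  have -> : Q - \int[mu2]_x (p rho x ^+ 2 * z x ^+ 2) =
      \int[mu2]_x (p rho x * z x ^+ 2 - p rho x ^+ 2 * z x ^+ 2).
    by rewrite (RintegralB _ (I2 u) Ipp).
  transitivity (\int[mu2]_x ((p rho x * z x ^+ 2 - p rho x ^+ 2 * z x ^+ 2) / 2)); last first.
    exact: RintegralZr.
  by apply: eq_Rintegral => x _; congr (_ / 2); ring.
have -> : (fun k w => obj k w (theta0 + (r k)^-1 *: u) - obj k w theta0 +
    (u^T *m score h X theta0 n1 n2 k w) 0 0 - (Q / (1 + rho) / 2 + L0)) =
  (fun k w => (((\sum_(j < n1 k) rem k (X (inl (j : nat)) w)) / r k ^+ 2 - rho / (1 + rho) * a1) +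
    ((\sum_(j < n2 k) rem k (X (inr (j : nat)) w)) / r k ^+ 2 - 1 / (1 + rho) * a2)) +
    (pen k - L0)).
  apply/funext => k; apply/funext => w; rewrite incrementE a1E a2E; field.
  by rewrite !gt_eqF.
apply: cvg_prob0D.
- by move=> k; exact: measurable_funD.
- by move=> k; exact: measurable_cst.
- exact: cvg_prob0D.
- apply: cvg_prob0_cst; rewrite -(subrr L0); apply: cvgB; [exact: pen_cvg|exact: cvg_cst].
Qed.

End Increment.

(** * Moments of the density ratio model *)

Section Moments.
Variables (R : realType) (d : nat) (h : R -> 'cV[R]_d) (mu : probability R R).
Local Notation z x i := (covariate h x i 0).

Lemma dotz_sum x (v : 'cV[R]_(1 + d)) : dotz h x v = \sum_i z x i * v i 0.
Proof. by rewrite /dotz mxE; apply: eq_bigr => i _; rewrite !mxE. Qed.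

Lemma covariate_lshift x i : z x (lshift d i) = 1.
Proof. by rewrite /covariate /param col_mxEu mxE (ord1 i) eqxx. Qed.

Lemma covariate_rshift x i : z x (rshift 1 i) = h x i 0.
Proof. by rewrite /covariate /param col_mxEd. Qed.

Variable f : R -> R.
Hypothesis If : forall i j, mu.-integrable setT (EFin \o (fun x => f x * (z x i * z x j))).

Lemma weighted_dotz_sqr x (v : 'cV[R]_(1 + d)) : f x * dotz h x v ^+ 2 =
  \sum_i \sum_j f x * (z x i * z x j) * (v i 0 * v j 0).
Proof.
rewrite dotz_sum expr2 mulr_suml mulr_sumr; apply: eq_bigr => i _.
by rewrite mulr_sumr mulr_sumr; apply: eq_bigr => j _; ring.
Qed.

Let Iterm (v : 'cV[R]_(1 + d)) i j : mu.-integrable setT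
  (EFin \o (fun x => f x * (z x i * z x j) * (v i 0 * v j 0))).
Proof.
have := integrableZr measurableT (v i 0 * v j 0 : R) (If i j).
by apply: eq_integrable => // x _.
Qed.

Lemma integrable_weighted_dotz_sqr v :
  mu.-integrable setT (EFin \o (fun x => f x * dotz h x v ^+ 2)).
Proof.
under [X in EFin \o X]eq_fun do rewrite weighted_dotz_sqr.
by apply: integrable_Rsum => i; apply: integrable_Rsum => j; exact: Iterm.
Qed.

Lemma Rintegral_weighted_dotz_sqr (M : 'M[R]_(1 + d)) v :
  (forall i j, \int[mu]_x (f x * (z x i * z x j)) = M i j) ->
  \int[mu]_x (f x * dotz h x v ^+ 2) = (v^T *m M *m v) 0 0.
Proof.
move=> ME; under eq_Rintegral do rewrite weighted_dotz_sqr.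
rewrite Rintegral_sum; last by move=> i; apply: integrable_Rsum => j; exact: Iterm.
rewrite -mulmxA [RHS]mxE; apply: eq_bigr => i _.
rewrite Rintegral_sum; last by move=> j; exact: Iterm.
rewrite !mxE mulr_sumr; apply: eq_bigr => j _.
by rewrite RintegralZr// ME; ring.
Qed.

Lemma Rintegral_weighted_dotz (a : 'cV[R]_(1 + d)) v :
  (forall i, \int[mu]_x (f x * z x i) = a i 0) ->
  \int[mu]_x (f x * dotz h x v) = (v^T *m a) 0 0.
Proof.
move=> aE.
have I1 i : mu.-integrable setT (EFin \o (fun x => f x * z x i)).
  have := If i (lshift d ord0); apply: eq_integrable => // x _ /=.
  by rewrite covariate_lshift mulr1.
have -> : (fun x => f x * dotz h x v) = (fun x => \sum_i f x * z x i * v i 0).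
  by apply/funext => x; rewrite dotz_sum mulr_sumr; apply: eq_bigr => i _; rewrite mulrA.
rewrite Rintegral_sum; last first.
  move=> i; have := integrableZr measurableT (v i 0 : R) (I1 i).
  by apply: eq_integrable => // x _.
by rewrite [RHS]mxE; apply: eq_bigr => i _; rewrite RintegralZr// aE mxE mulrC.
Qed.

End Moments.

Section ModelMoments.
Variables (R : realType) (d : nat) (h : R -> 'cV[R]_d).
Hypothesis mh : forall i, measurable_fun setT (fun x => h x i 0).
Variables (mu1 mu2 : probability R R) (g1 g2 : R -> R) (rho : R).
Hypotheses (mg1 : measurable_fun setT g1) (mg2 : measurable_fun setT g2)
  (g10 : forall x, 0 <= g1 x) (g20 : forall x, 0 <= g2 x)
  (mu1E : forall B : set R, measurable B -> mu1 B = (\int[lebesgue_measure]_(x in B) (g1 x)%:E)%E)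
  (mu2E : forall B : set R, measurable B -> mu2 B = (\int[lebesgue_measure]_(x in B) (g2 x)%:E)%E)
  (rho0 : 0 < rho).
Local Notation z x i := (covariate h x i 0).
Let p theta x := logistic rho (dotz h x theta).

Lemma logistic_weight theta x : p theta x = rho * weight h rho theta x.
Proof. by rewrite /p /logistic /weight predictorE mulrA. Qed.

(* [R] and the carrier [measurableTypeR R] of [lebesgue_measure] are distinct
   measurable types with the same measurable sets. *)
Let mid : measurable_fun setT (idfun : measurableTypeR R -> R).
Proof. by move=> _ B mB; rewrite setTI. Qed.

Let mz i : measurable_fun setT (fun x => z x i).
Proof.
case: (split_ordP i) => j ->.
  by rewrite (_ : (fun x => _) = cst 1)//; apply/funext => x; rewrite covariate_lshift.
rewrite (_ : (fun x => _) = (fun x => h x j 0)); first exact: mh.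
by apply/funext => x; rewrite covariate_rshift.
Qed.

Let mp theta : measurable_fun setT (p theta). Proof. exact: measurable_logistic_dotz. Qed.

Let mw theta : measurable_fun setT (weight h rho theta).
Proof.
have -> : weight h rho theta = (fun x => rho^-1 * p theta x).
  by apply/funext => x; rewrite logistic_weight mulKf// gt_eqF.
exact: measurable_funM.
Qed.

Section Finite.
Variable theta : 'cV[R]_(1 + d).
Hypothesis fA : finite_A h rho g2 theta.

Let IA i j : lebesgue_measure.-integrable setT
  (fun x => (weight h rho theta x * (z x i * z x j) * g2 x)%:E).
Proof.
have [F1 F2 F3] := fA; case: (split_ordP i) => i' ->; case: (split_ordP j) => j' ->.
- by apply: eq_integrable F1 => // x _; rewrite !covariate_lshift !mulr1.
- by apply: eq_integrable (F2 j') => // x _; rewrite covariate_lshift covariate_rshift mul1r.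
- by apply: eq_integrable (F2 i') => // x _; rewrite covariate_lshift covariate_rshift mulr1.
- by apply: eq_integrable (F3 i' j') => // x _; rewrite !covariate_rshift.
Qed.

Let mwzz i j : measurable_fun setT (fun x => weight h rho theta x * (z x i * z x j)).
Proof. by apply: measurable_funM => //; exact: measurable_funM. Qed.

Lemma integrable_weight_covariate i j :
  mu2.-integrable setT (EFin \o (fun x => weight h rho theta x * (z x i * z x j))).
Proof. exact: (integrable_densityP mid mg2 g20 mu2E (mwzz i j) (IA i j)). Qed.

Lemma Rintegral_weight_covariate i j :
  \int[mu2]_x (weight h rho theta x * (z x i * z x j)) = Amx h rho g2 theta i j.
Proof.
rewrite (Rintegral_density mid mg2 g20 mu2E (mwzz i j) (IA i j)) /Amx.
case: (split_ordP i) => i' ->; case: (split_ordP j) => j' ->.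
- rewrite block_mxEul mxE !ord1 eqxx mulr1n /A11.
  by apply: eq_Rintegral => x _; rewrite !covariate_lshift !mulr1.
- rewrite block_mxEur !mxE.
  by apply: eq_Rintegral => x _; rewrite covariate_lshift covariate_rshift mul1r.
- rewrite block_mxEdl !mxE.
  by apply: eq_Rintegral => x _; rewrite covariate_lshift covariate_rshift mulr1.
- rewrite block_mxEdr !mxE.
  by apply: eq_Rintegral => x _; rewrite !covariate_rshift.
Qed.

Lemma integrable_logistic_dotz_sqr u :
  mu2.-integrable setT (EFin \o (fun x => p theta x * dotz h x u ^+ 2)).
Proof.
have := integrableZl measurableT rho (integrable_weighted_dotz_sqr integrable_weight_covariate u).
by apply: eq_integrable => // x _ /=; rewrite logistic_weight -mulrA.
Qed.

Lemma Rintegral_logistic_dotz_sqr u : \int[mu2]_x (p theta x * dotz h x u ^+ 2) =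
  rho * (u^T *m Amx h rho g2 theta *m u) 0 0.
Proof.
rewrite -(Rintegral_weighted_dotz_sqr integrable_weight_covariate u Rintegral_weight_covariate).
rewrite -RintegralZl//; last exact: integrable_weighted_dotz_sqr integrable_weight_covariate u.
by apply: eq_Rintegral => x _; rewrite logistic_weight -mulrA.
Qed.

Lemma Rintegral_logistic_dotz u : \int[mu2]_x (p theta x * dotz h x u) =
  rho * (u^T *m param (A11 h rho g2 theta) (A21 h rho g2 theta)) 0 0.
Proof.
have E i : \int[mu2]_x (weight h rho theta x * z x i) =
    param (A11 h rho g2 theta) (A21 h rho g2 theta) i 0.
  transitivity (Amx h rho g2 theta i (lshift d ord0)).
    rewrite -Rintegral_weight_covariate.
    by apply: eq_Rintegral => x _; rewrite covariate_lshift mulr1.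
  rewrite /Amx /param; case: (split_ordP i) => i' ->.
    by rewrite block_mxEul col_mxEu.
  by rewrite block_mxEdl col_mxEd.
have Iw : mu2.-integrable setT (EFin \o (fun x => weight h rho theta x * dotz h x u)).
  have -> : (fun x => weight h rho theta x * dotz h x u) =
      (fun x => \sum_i weight h rho theta x * (z x i * z x (lshift d ord0)) * u i 0).
    apply/funext => x; rewrite dotz_sum mulr_sumr; apply: eq_bigr => i _.
    by rewrite covariate_lshift mulr1 mulrA.
  apply: integrable_Rsum => i.
  have := integrableZr measurableT (u i 0 : R) (integrable_weight_covariate i (lshift d ord0)).
  by apply: eq_integrable => // x _.
rewrite -(Rintegral_weighted_dotz integrable_weight_covariate u E).
rewrite -RintegralZl//.
by apply: eq_Rintegral => x _; rewrite logistic_weight -mulrA.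
Qed.

End Finite.

Lemma integrable_logistic_compl_dotz_sqr theta u : finite_A22_dual h rho g1 theta ->
  mu1.-integrable setT (EFin \o (fun x => (1 - p theta x) * dotz h x u ^+ 2)).
Proof.
move=> fA; apply: integrable_weighted_dotz_sqr => i j.
have q0 x : 0 <= 1 - p theta x by rewrite subr_ge0; exact/ltW/logistic_lt1.
have q1 x : 1 - p theta x <= 1 by rewrite lerBlDr lerDl; exact/ltW/logistic_gt0.
have mq : measurable_fun setT (fun x => 1 - p theta x) by exact: measurable_funB.
have mqzz k l : measurable_fun setT (fun x => (1 - p theta x) * (z x k * z x l)).
  by apply: measurable_funM => //; exact: measurable_funM.
have I11 k l : mu1.-integrable setT
    (EFin \o (fun x => (1 - p theta x) * (z x (rshift 1 k) * z x (rshift 1 l)))).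
  apply: (integrable_densityP mid mg1 g10 mu1E (mqzz _ _)).
  by apply: eq_integrable (fA k l) => // x _; rewrite logistic_weight !covariate_rshift.
have Iq : mu1.-integrable setT (EFin \o (fun x => 1 - p theta x)).
  by apply: (@integrable_bounded _ _ _ _ _ 1) => // x; rewrite ger0_norm.
have I10 k : mu1.-integrable setT (EFin \o (fun x => (1 - p theta x) * z x (rshift 1 k))).
  apply: (@integrable_dominated _ _ _ _ _ (fun x =>
      (1 - p theta x) + (1 - p theta x) * (z x (rshift 1 k) * z x (rshift 1 k)))).
  - exact: measurable_funM.
  - by have := integrableD measurableT Iq (I11 k k); apply: eq_integrable => // x _.
  - move=> x; rewrite normrM ger0_norm// -[X in _ <= X + _]mulr1 -mulrDr ler_wpM2l//.
    have := sqr_ge0 (1 - `|z x (rshift 1 k)|).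
    rewrite sqrrB expr1n mul1r real_normK ?num_real// expr2.
    by have := sqr_ge0 (z x (rshift 1 k)); rewrite expr2; lra.
case: (split_ordP i) => i' ->; case: (split_ordP j) => j' ->.
- by apply: eq_integrable Iq => // x _ /=; rewrite !covariate_lshift !mulr1.
- by apply: eq_integrable (I10 j') => // x _ /=; rewrite covariate_lshift mul1r.
- by apply: eq_integrable (I10 i') => // x _ /=; rewrite covariate_lshift mulr1.
- exact: I11.
Qed.

Lemma density_ratio (f : R -> R) : measurable_fun setT f -> (forall x, 0 <= f x) ->
  (forall x, g1 x = f x * g2 x) -> forall B : set R, measurable B ->
  mu1 B = (\int[mu2]_(x in B) (f x)%:E)%E.
Proof.
move=> mf f0 g12 B mB.
have mfE : measurable_fun setT (fun x => (f x)%:E) by exact/measurable_EFinP.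
rewrite mu1E// [LHS]integral_mkcond [RHS]integral_mkcond (ge0_integral_density mid mg2 g20 mu2E).
- apply: eq_integral => x _; rewrite !patchE; case: ifP => _; last by rewrite mul0e.
  by rewrite g12 EFinM.
- by apply/(measurable_restrictT _ mB); exact: measurable_funTS.
- by move=> x; rewrite patchE; case: ifP => _; rewrite ?lee_fin.
Qed.

End ModelMoments.

Section QuadraticForms.
Variables (R : realType) (d : nat) (h : R -> 'cV[R]_d) (rho : R) (g2 : R -> R).
Implicit Type theta : 'cV[R]_(1 + d).

Lemma quad_scale m (c : R) (M : 'M[R]_m) (t : 'cV[R]_m) :
  (t^T *m (c *: M) *m t) 0 0 = c * (t^T *m M *m t) 0 0.
Proof. by rewrite -scalemxAr -scalemxAl mxE. Qed.

Lemma quad_outer m (v t : 'cV[R]_m) : (t^T *m (v *m v^T) *m t) 0 0 = (t^T *m v) 0 0 ^+ 2.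
Proof.
rewrite -!mulmxA mulmxA mxE big_ord_recl big_ord0 addr0 expr2; congr (_ * _).
by rewrite -[v^T *m t]trmxK trmx_mul trmxK mxE.
Qed.

Lemma Amx_sym theta : (Amx h rho g2 theta)^T = Amx h rho g2 theta.
Proof.
rewrite /Amx tr_block_mx tr_scalar_mx trmxK; congr block_mx.
by apply/matrixP => i j; rewrite !mxE; apply: eq_Rintegral => x _; rewrite (mulrC (h x j 0)).
Qed.

Lemma Vmx_sym theta : (Vmx h rho g2 theta)^T = Vmx h rho g2 theta.
Proof. by rewrite /Vmx linearB/= !linearZ/= Amx_sym trmx_mul trmxK. Qed.

Lemma quad_Vmx theta (t : 'cV[R]_(1 + d)) : (t^T *m Vmx h rho g2 theta *m t) 0 0 =
  rho / (1 + rho) * (t^T *m Amx h rho g2 theta *m t) 0 0 -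
  rho * (t^T *m param (A11 h rho g2 theta) (A21 h rho g2 theta)) 0 0 ^+ 2.
Proof.
rewrite /Vmx mulmxBr mulmxBl mxE [X in _ + X]mxE quad_scale; congr (_ - _).
by rewrite quad_scale quad_outer.
Qed.

End QuadraticForms.

Lemma convex_cV_rescale (R : realType) m (f : 'cV[R]_m -> R) theta (c : R) :
  convex_cV f -> convex_cV (fun u => f (theta + c *: u) - f theta).
Proof.
move=> cf x y s s01.
have -> : theta + c *: (s *: x + (1 - s) *: y) =
    s *: (theta + c *: x) + (1 - s) *: (theta + c *: y).
  by apply/colP => i; rewrite !mxE; ring.
by have := cf (theta + c *: x) (theta + c *: y) s s01; lra.
Qed.

Lemma rescaleK (R : realType) m (theta t : 'cV[R]_m) (c : R) : c != 0 ->
  theta + c^-1 *: (c *: (t - theta)) = t.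
Proof. by move=> c0; rewrite scalerA mulVf// scale1r addrC subrK. Qed.

Lemma measurable_rescale disp (T : measurableType disp) (R : realType) m
    (u : T -> 'cV[R]_m) (theta : 'cV[R]_m) (c : R) :
  measurable_fun setT (u : T -> borelV R m) ->
  measurable_fun setT ((fun w => c *: (u w - theta)) : T -> borelV R m).
Proof.
move=> mu; apply: measurable_fun_cV => i.
apply: (measurable_fun_continuous_cV (f := fun t => (c *: (t - theta)) i 0)) => //.
have -> : (fun t => (c *: (t - theta)) i 0) = (fun t => c * (t i 0 - theta i 0)).
  by apply/funext => t; rewrite !mxE.
move=> t; apply: (@cvgM _ _ (nbhs t)); first exact: cvg_cst.
by apply: (@cvgB _ _ _ (nbhs t)); [exact: coord_continuous|exact: cvg_cst].
Qed.

Lemma penalty_grad_dot (R : realType) d q (beta : 'cV[R]_d) (t : 'cV[R]_(1 + d)) :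
  (t^T *m penalty_grad q beta) 0 0 =
  \sum_(i < d) powR_slope q (beta i 0) * t (rshift 1 i) 0.
Proof.
rewrite mxE big_split_ord/= big_ord_recl big_ord0 addr0 /penalty_grad /param col_mxEu.
rewrite [_%:M _ _]mxE eqxx mulr0 add0r; apply: eq_bigr => i _.
by rewrite col_mxEd !mxE mulrC.
Qed.

Lemma dotz_param (R : realType) d (h : R -> 'cV[R]_d) x a (b : 'cV[R]_d) :
  dotz h x (param a b) = a + (b^T *m h x) 0 0.
Proof.
by rewrite -predictorE /predictor /alpha_of /beta_of /param col_mxKu col_mxKd mxE eqxx.
Qed.

Lemma measurable_objective disp (T : measurableType disp) (R : realType) d
    (h : R -> 'cV[R]_d) (mh : forall i, measurable_fun setT (fun x => h x i 0))
    (X1 X2 : nat -> T -> R) (mX1 : forall j, measurable_fun setT (X1 j))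
    (mX2 : forall j, measurable_fun setT (X2 j)) q lam n1 n2 theta :
  (0 < n1)%N -> (0 < n2)%N ->
  measurable_fun setT (fun w => objective h q lam n1 n2 (X1 ^~ w) (X2 ^~ w) theta).
Proof.
move=> n10 n20; under eq_fun do rewrite objectiveE.
have md := measurable_dotz mh theta.
have ms : measurable_fun setT (fun x => softplus (n1%:R / n2%:R) (dotz h x theta)).
  apply: (measurableT_comp _ md); apply: continuous_measurable_fun => s.
  exact: (softplus_continuous n10 n20).
apply: measurable_funD => //; apply: measurable_funD; apply: measurable_sum => j.
- apply: (measurableT_comp (f := fun x => softplus (n1%:R / n2%:R) (dotz h x theta) - dotz h x theta)) => //.
  exact: measurable_funB.
- exact: (measurableT_comp (f := fun x => softplus (n1%:R / n2%:R) (dotz h x theta))).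
Qed.

Unset Implicit Arguments.

Theorem theorem3p2 (R : realType) (disp : measure_display)
  (T : measurableType disp) (P : probability T R)
  (d : nat) (h : R -> 'cV[R]_d)
  (h_meas : forall i : 'I_d, measurable_fun [set: R] (fun x => h x i 0))
  (* density ratio model *)
  (g1 g2 : R -> R) (g1_density : is_density g1) (g2_density : is_density g2)
  (alpha0 : R) (beta0 : 'cV[R]_d)
  (ratio : forall x, g1 x = expR (alpha0 + (beta0^T *m h x) 0 0) * g2 x)
  (* two independent random samples *)
  (X1 X2 : nat -> {RV P >-> R})
  (X1_density : forall j, has_density (X1 j) g1)
  (X2_density : forall j, has_density (X2 j) g2)
  (X_indep : mutually_independent P
     (fun i : nat + nat =>
        match i with inl j => (X1 j : T -> R) | inr j => (X2 j : T -> R) end))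
  (* sampling regime *)
  (n1 n2 : nat -> nat)
  (n1_gt0 : forall k, (0 < n1 k)%N) (n2_gt0 : forall k, (0 < n2 k)%N)
  (n_infty : (n1 k + n2 k)%N @[k --> \oo] --> \oo)
  (rho1 : R) (rho1_gt0 : 0 < rho1)
  (n_ratio : (n1 k)%:R / (n2 k)%:R @[k --> \oo] --> rho1)
  (* penalty *)
  (q : R) (q_gt1 : 1 < q)
  (lam : nat -> R) (lam_gt0 : forall k, 0 < lam k)
  (lam0 : R) (lam0_ge0 : 0 <= lam0)
  (lam_cvg : lam k / Num.sqrt (n1 k + n2 k)%:R @[k --> \oo] --> lam0)
  (* compact parameter set and finiteness of the integrals *)
  (Theta : set 'cV[R]_(1 + d)) (Theta_compact : compact Theta)
  (theta0_Theta : Theta° (param alpha0 beta0))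
  (A_finite : forall theta, Theta theta -> finite_A h rho1 g2 theta)
  (A_finite_dual : forall theta, Theta theta ->
     finite_A22_dual h rho1 g1 theta)
  (A_nonsing : Amx h rho1 g2 (param alpha0 beta0) \in unitmx) :
  let theta0 := param alpha0 beta0 in
  let lp (k : nat) (w : T) :=
    penalized_loglik h q (lam k) (n1 k) (n2 k)
      (fun j => X1 j w) (fun j => X2 j w) in
  let rootn (k : nat) : R := Num.sqrt (n1 k + n2 k)%:R in
  let S := Smx h rho1 g2 theta0 in
  let Sigma := Sigmamx h rho1 g2 theta0 in
  let b := penalty_grad q beta0 in
  exists thetahat : nat -> T -> 'cV[R]_(1 + d),
    [/\ forall k w, is_unique_maximizer (lp k w) (thetahat k w),
        cvg_in_law_normal P
          (fun k w => rootn k *: (thetahat k w - theta0) +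
                      lam0 *: (invmx S *m b))
          0 Sigma &
        lam0 = 0 ->
        cvg_in_law_normal P
          (fun k w => rootn k *: (thetahat k w - theta0)) 0 Sigma].
Proof.
move=> theta0 lp rootn S Sigma b.
pose X i : T -> R := match i with inl j => X1 j | inr j => X2 j end.
have mX i : measurable_fun setT (X i) by case: i => j; exact: measurable_funPT.
have indX : mutually_independent P X by exact: X_indep.
pose mu1 : probability R R := distribution P (X1 0%N).
pose mu2 : probability R R := distribution P (X2 0%N).
have [mg1 g10 _] := g1_density; have [mg2 g20 _] := g2_density.
have mu1E (B : set R) : measurable B ->
  mu1 B = (\int[lebesgue_measure]_(x in B) (g1 x)%:E)%E by exact: X1_density.
have mu2E (B : set R) : measurable B ->
  mu2 B = (\int[lebesgue_measure]_(x in B) (g2 x)%:E)%E by exact: X2_density.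
have X1mu j (B : set R) : measurable B -> P (X (inl j) @^-1` B) = mu1 B.
  by move=> mB; rewrite mu1E// -(X1_density j).
have X2mu j (B : set R) : measurable B -> P (X (inr j) @^-1` B) = mu2 B.
  by move=> mB; rewrite mu2E// -(X2_density j).
have md theta : measurable_fun setT (fun x => dotz h x theta).
  exact: measurable_dotz.
have mu12 (B : set R) : measurable B ->
    mu1 B = (\int[mu2]_(x in B) (expR (dotz h x theta0))%:E)%E.
  apply: (density_ratio mg2 g20 mu1E mu2E).
  - exact: measurableT_comp.
  - by move=> x; exact: expR_ge0.
  - by move=> x; rewrite ratio dotz_param.
have Ttheta0 : Theta theta0 by exact: interior_subset.
have I1 u : mu1.-integrable setT
    (EFin \o (fun x => (1 - logistic rho1 (dotz h x theta0)) * dotz h x u ^+ 2)).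
  exact: (integrable_logistic_compl_dotz_sqr h_meas mg1 g10 mu1E rho1_gt0 _ (A_finite_dual _ Ttheta0)).
have fA0 := A_finite _ Ttheta0.
have I2 u : mu2.-integrable setT
    (EFin \o (fun x => logistic rho1 (dotz h x theta0) * dotz h x u ^+ 2)).
  exact: (integrable_logistic_dotz_sqr h_meas mg2 g20 mu2E rho1_gt0 fA0).
have Tnear (u : 'cV[R]_(1 + d)) : exists2 e : R, 0 < e & Theta (theta0 + e *: u).
  have /nbhs_ballP[r /= r0 rT] : nbhs theta0 Theta by exact: theta0_Theta.
  have u1 : 0 < 1 + `|u| by rewrite ltr_wpDr.
  exists (r / 2 / (1 + `|u|)); first by rewrite !divr_gt0.
  apply: rT; rewrite -ball_normE /ball_/= opprD addNKr normrN normrZ gtr0_norm ?divr_gt0//.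
  rewrite mulrAC ltr_pdivrMr//.
  have := normr_ge0 u; move: (`|u|) u1 => v v1 v0; nra.
have rho11 : 0 < 1 + rho1 by rewrite addr_gt0.
have QE u := Rintegral_logistic_dotz_sqr h_meas mg2 g20 mu2E rho1_gt0 fA0 u.
have LE u := Rintegral_logistic_dotz h_meas mg2 g20 mu2E rho1_gt0 fA0 u.
have SE t : (t^T *m S *m t) 0 0 =
    (\int[mu2]_x (logistic rho1 (dotz h x theta0) * dotz h x t ^+ 2)) / (1 + rho1).
  by rewrite quad_scale QE mulrAC.
have VE t : (t^T *m Vmx h rho1 g2 theta0 *m t) 0 0 = score_var h mu2 theta0 rho1 t.
  by rewrite quad_Vmx /score_var QE LE; field; rewrite !gt_eqF.
have Ssym : S^T = S by rewrite /S /Smx linearZ/= Amx_sym.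
have Spsd (t : 'cV[R]_(1 + d)) : 0 <= (t^T *m S *m t) 0 0.
  rewrite SE divr_ge0 ?(ltW rho11)//; apply: Rintegral_ge0 => x _.
  by rewrite mulr_ge0 ?sqr_ge0//; exact/ltW/logistic_gt0.
have Sunit : S \in unitmx.
  by rewrite /S /Smx unitmxZ// unitfE gt_eqF// divr_gt0.
pose obj k w := objective h q (lam k) (n1 k) (n2 k) (fun j => X (inl j) w) (fun j => X (inr j) w).
have sobj k w : strict_support (obj k w).
  exact: (objective_strict_support h _ _ q_gt1 (lam_gt0 k) (n1_gt0 k) (n2_gt0 k)).
have mobj k theta : measurable_fun setT (fun w => obj k w theta).
  exact: (@measurable_objective _ _ _ _ h h_meas (fun j => X (inl j)) (fun j => X (inr j))).
have /choice[that thatP] : forall kw : nat * T, exists theta, forall y, obj kw.1 kw.2 theta <= obj kw.1 kw.2 y.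
  by move=> [k w]; exact: (objective_min_exists h _ _ q_gt1 (lam_gt0 k) (n1_gt0 k) (n2_gt0 k)).
pose thetahat k w := that (k, w).
have thetahat_min k w y : obj k w (thetahat k w) <= obj k w y by exact: (thatP (k, w)).
have mthetahat k : measurable_fun setT (thetahat k : T -> borelV R (1 + d)).
  apply: (@measurable_argmin _ _ _ _ (obj k)) => // w.
  by move=> v; apply: objective_continuous.
have r0 k : 0 < rootn k by exact: root_size_gt0.
have BE (u : 'cV[R]_(1 + d)) : (u^T *m (lam0 *: b)) 0 0 =
    lam0 * \sum_(i < d) powR_slope q (theta0 (rshift 1 i) 0) * u (rshift 1 i) 0.
  rewrite -scalemxAr mxE penalty_grad_dot; congr (_ * _); apply: eq_bigr => i _.
  by rewrite /theta0 /param col_mxEd.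
pose M k w u := obj k w (theta0 + (rootn k)^-1 *: u) - obj k w theta0.
have limit : cvg_in_law_normal P
    (fun k w => rootn k *: (thetahat k w - theta0) + invmx S *m (lam0 *: b)) 0 Sigma.
  apply: (@argmin_cvg_in_law _ _ _ P _ S (Vmx h rho1 g2 theta0) (lam0 *: b) M
    (score h X theta0 n1 n2) _ Ssym Spsd Sunit (Vmx_sym h rho1 g2 theta0)).
  - by move=> k x; apply: measurable_funB.
  - exact: measurable_score.
  - by move=> k; exact: measurable_rescale.
  - by move=> k w; exact: convex_cV_rescale (strict_support_convex (sobj k w)).
  - by move=> k w x; rewrite lerD2r rescaleK ?gt_eqF//; exact: thetahat_min.
  - exact: (tight_score h_meas mX indX X1mu X2mu rho1_gt0 mu12).
  - move=> u; have [e e0 Te] := Tnear u.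
    have E x : dotz h x (theta0 + e *: u) = dotz h x theta0 + e * dotz h x u.
      by rewrite dotzD dotzZ.
    have J1 : mu1.-integrable setT
        (EFin \o (fun x => (1 - logistic rho1 (dotz h x theta0 + e * dotz h x u)) * dotz h x u ^+ 2)).
      have := integrable_logistic_compl_dotz_sqr h_meas mg1 g10 mu1E rho1_gt0 u (A_finite_dual _ Te).
      by apply: eq_integrable => // x _ /=; rewrite E.
    have J2 : mu2.-integrable setT
        (EFin \o (fun x => logistic rho1 (dotz h x theta0 + e * dotz h x u) * dotz h x u ^+ 2)).
      have := integrable_logistic_dotz_sqr h_meas mg2 g20 mu2E rho1_gt0 (A_finite _ Te) u.
      by apply: eq_integrable => // x _ /=; rewrite E.
    have := objective_increment h_meas mX indX X1mu X2mu rho1_gt0 mu12 n1_gt0 n2_gt0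
      n_infty n_ratio e0 I1 I2 J1 J2 q_gt1 lam_cvg.
    congr cvg_prob0; apply/funext => k; apply/funext => w.
    by rewrite SE BE.
  - move=> t a; rewrite VE.
    exact: (score_cos h_meas mX indX X1mu X2mu rho1_gt0 mu12).
exists thetahat; split.
- move=> k w; split.
    by move=> y; rewrite -lerN2; exact: thetahat_min.
  move=> z zmax; apply: (strict_support_uniq (sobj k w)); last exact: thetahat_min.
  by move=> y; rewrite lerN2; exact: zmax.
- by under eq_fun do under eq_fun do rewrite scalemxAr.
- move=> lam00; move: limit; rewrite lam00 scale0r mulmx0.
  by under eq_fun do under eq_fun do rewrite addr0.
Qed.
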